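(* Suppose that $A$ is an $n\times n$ matrix with rational entries such that: (i) $A$ is strictly expansive with respect to the lattice $\Gamma=A\mathbb{Z}^n+\mathbb{Z}^n$; (ii) $n\le 2(p-q)$, where $p=|\Gamma/A\mathbb{Z}^n|$ and $q=|\Gamma/\mathbb{Z}^n|$. Then there exists an orthonormal wavelet $\Psi$ with respect to the dilation $A$ and the lattice $\mathbb{Z}^n$, which consists of $(p-q)$ functions in the Schwartz class. Moreover, the Fourier transform of each function in $\Psi$ is $C^\infty$ with compact support.
   Context: A real $n\times n$ matrix $A$ is expansive if all its eigenvalues $\lambda$ satisfy $|\lambda|>1$. The dual lattice of a full rank lattice $\Gamma\subset\mathbb{R}^n$ is $\Gamma^*=\{k\in\mathbb{R}^n:\langle k,\gamma\rangle\in\mathbb{Z}\text{ for all }\gamma\in\Gamma\}$. An expansive matrix $A$ is strictly expansive with respect to $\Gamma$ if there exists a compact set $K\subset\mathbb{R}^n$ such that $\sum_{k\in\Gamma^*}\mathbf 1_K(\xi+k)=1$ for a.e. $\xi\in\mathbb{R}^n$, and $K\subset BK^\circ$, where $B=A^\top$ and $K^\circ$ is the interior of $K$. Let $T_yf(x)=f(x-y)$, $D_Pf(x)=|\det P|^{1/2}f(Px)$, and $\widehat f(\xi)=\int_{\mathbb{R}^n} f(x)e^{-2\pi i\langle x,\xi\rangle}dx$. A finite collection $\Psi=\{\psi^1,\ldots,\psi^L\}\subset L^2(\mathbb{R}^n)$ is an orthonormal wavelet with respect to the dilation $A$ and the lattice $\mathbb{Z}^n$ if $\{D_{A^j}T_k\psi^l: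 j\in\mathbb{Z},\ k\in\mathbb{Z}^n,\ l=1,\ldots,L\}$ is an orthonormal basis of $L^2(\mathbb{R}^n)$. *)

(* Defs.v *)
From HB Require Import structures.
From mathcomp Require Import all_boot all_order all_algebra.
From mathcomp Require Import complex.
From mathcomp Require Import all_classical all_reals all_analysis.

Set Implicit Arguments.
Unset Strict Implicit.
Unset Printing Implicit Defensive.
Import Order.TTheory GRing.Theory Num.Theory.
Import numFieldNormedType.Exports.
Import Normc.
Local Open Scope classical_set_scope.
Local Open Scope ring_scope.
Local Open Scope complex_scope.

Definition cV_display : measure_display. Proof. exact. Qed.

Section measurable_cV.
Context {R : realType} (n : nat).

Let coord (i : 'I_n) (x : 'cV[R]_n) : R := x i 0.

Let cV_set0 : g_sigma_preimage coord set0.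
Proof. exact: sigma_algebra0. Qed.

Let cV_setC A : g_sigma_preimage coord A -> g_sigma_preimage coord (~` A).
Proof. exact: sigma_algebraC. Qed.

Let cV_bigcup (F : _^nat) : (forall i, g_sigma_preimage coord (F i)) ->
  g_sigma_preimage coord (\bigcup_i (F i)).
Proof. exact: sigma_algebra_bigcup. Qed.

(* The sigma-algebra generated by the coordinates, i.e. the Borel one; the
   library does the same for tuples. *)
HB.instance Definition _ := @isMeasurable.Build cV_display
  'cV[R]_n (g_sigma_preimage coord) cV_set0 cV_setC cV_bigcup.

Lemma measurable_cV_coord (i : 'I_n) :
  measurable_fun [set: 'cV[R]_n] (fun x : 'cV[R]_n => x i 0).
Proof.
move=> _ Y mY; rewrite setTI; apply: sub_sigma_algebra => /=.
rewrite -bigcup_seq/=; exists i => /=; first by rewrite mem_index_enum.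
by exists Y => //; rewrite setTI.
Qed.

Lemma measurable_fun_cVP d (T : measurableType d) (f : T -> 'cV[R]_n) :
  measurable_fun [set: T] f <->
  forall i, measurable_fun [set: T] (fun x => f x i 0).
Proof.
split=> [mf i|mf]; first exact: (measurableT_comp (measurable_cV_coord i) mf).
have sub : g_sigma_preimage (fun i x => f x i 0) `<=` @measurable _ T.
  apply: smallest_sub; first exact: sigma_algebra_measurable.
  rewrite -bigcup_seq; apply: bigcup_sub => i _ A [B mB <-]; exact: mf.
move=> _ A mA; rewrite setTI; apply: sub.
rewrite (_ : (fun i x => _) = (fun i => coord i \o f))//.
by rewrite g_sigma_preimage_comp; exists A => //; rewrite setTI.
Qed.

End measurable_cV.

Section lebesgue_cV.
Context {R : realType}.

Definition cV_cons n (p : measurableTypeR R * 'cV[R]_n) : 'cV[R]_n.+1 :=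
  \col_i oapp (fun j => p.2 j 0) p.1 (unlift ord0 i).

Definition cV_uncons n (x : 'cV[R]_n.+1) : measurableTypeR R * 'cV[R]_n :=
  (x ord0 0, \col_j x (lift ord0 j) 0).

Lemma cV_consK n : cancel (@cV_cons n) (@cV_uncons n).
Proof.
move=> [a v]; congr pair; rewrite /= ?mxE ?unlift_none//.
by apply/colP => j; rewrite !mxE liftK.
Qed.

Lemma measurable_cV_cons n : measurable_fun setT (@cV_cons n).
Proof.
apply/measurable_fun_cVP => i; rewrite /cV_cons.
under [X in measurable_fun _ X]eq_fun do rewrite mxE.
case: unliftP => [j _|_] /=; last exact: measurable_fst.
exact: (measurableT_comp (measurable_cV_coord j) measurable_snd).
Qed.

Lemma measurable_cV_uncons n : measurable_fun setT (@cV_uncons n).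
Proof.
apply/measurable_fun_pair => /=; first exact: measurable_cV_coord.
apply/measurable_fun_cVP => i.
under [X in measurable_fun _ X]eq_fun do rewrite mxE.
exact: measurable_cV_coord.
Qed.

Fixpoint lebesgue_cV n : set 'cV[R]_n -> \bar R :=
  match n with
  | 0 => dirac (0 : 'cV[R]_0)
  | n'.+1 => pushforward (lebesgue_measure \x @lebesgue_cV n')%E (@cV_cons n')
  end.

Let sigma_finite_pack d (T : measurableType d) (mu : {measure set T -> \bar R}) :
  sigma_finite setT mu ->
  exists m : {sigma_finite_measure set T -> \bar R}, mu = m :> (set T -> \bar R).
Proof.
move=> mu_sfin.
pose H1 := @isSFinite.Build _ _ _ _ (sfinite_measure_sigma_finite mu_sfin).
pose H2 := isSigmaFinite.Build _ _ _ _ mu_sfin.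
by exists (HB.pack_for (SigmaFiniteMeasure.type T R) (Measure.sort mu) H1 H2).
Qed.

Let lebesgue_cV_measure n :
  exists m : {sigma_finite_measure set 'cV[R]_n -> \bar R},
    @lebesgue_cV n = m.
Proof.
elim: n => [|n [m mE]]; first by exists (dirac (0 : 'cV[R]_0)).
rewrite /= {}mE.
pose lm : {measure set (measurableTypeR R * 'cV[R]_n)%type -> \bar R} :=
  (lebesgue_measure \x m)%E.
rewrite -/(lm : set _ -> _); set mu := pushforward _ _.
have mc : measurable_fun setT (@cV_cons n) := measurable_cV_cons (n := n).
pose mu_measure : {measure set 'cV[R]_n.+1 -> \bar R} :=
  measure_function_pushforward__canonical__measure_function_Measure lm mc.
have mu_sfin : sigma_finite setT mu.
  have /sigma_finiteP[F [TF ndF Foo]] := sigma_finiteT (@lebesgue_measure R).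
  have /sigma_finiteP[G [TG ndG Goo]] := sigma_finiteT m.
  exists (fun k => @cV_uncons n @^-1` (F k `*` G k)).
    rewrite -preimage_bigcup; apply/seteqP; split=> // x _ /=.
    have [k _ Fx] : (\bigcup_k F k) (cV_uncons x).1 by rewrite -TF.
    have [l _ Gx] : (\bigcup_k G k) (cV_uncons x).2 by rewrite -TG.
    exists (maxn k l) => //; split.
    - by move: Fx; exact/subsetPset/ndF/leq_maxl.
    - by move: Gx; exact/subsetPset/ndG/leq_maxr.
  move=> k; have [mF Fk] := Foo k; have [mG Gk] := Goo k; split.
    rewrite -[X in measurable X]setTI; apply: measurable_cV_uncons => //.
    exact: measurableX.
  rewrite /mu /pushforward -comp_preimage (_ : _ \o _ = id) ?preimage_id//.
    by rewrite /lm/= product_measure1E// lte_mul_pinfty// ge0_fin_numE.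
  by apply/funext => x /=; rewrite cV_consK.
have [m' m'E] := @sigma_finite_pack _ _ mu_measure mu_sfin.
by exists m'; rewrite -m'E.
Qed.

Section instances.
Variable n : nat.
Local Notation mu := (@lebesgue_cV n).

Let mu0 : mu set0 = 0%E.
Proof. by have [m ->] := lebesgue_cV_measure n; exact: measure0. Qed.

Let mu_ge0 A : (0 <= mu A)%E.
Proof. by have [m ->] := lebesgue_cV_measure n; exact: measure_ge0. Qed.

Let mu_sadd : semi_sigma_additive mu.
Proof.
by have [m ->] := lebesgue_cV_measure n; exact: measure_semi_sigma_additive.
Qed.

HB.instance Definition _ := isMeasure.Build _ _ _ mu mu0 mu_ge0 mu_sadd.

Let mu_sfinite : sigma_finite setT mu.
Proof. by have [m ->] := lebesgue_cV_measure n; exact: sigma_finiteT. Qed.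

HB.instance Definition _ := Measure_isSigmaFinite.Build _ _ _ mu mu_sfinite.
End instances.

End lebesgue_cV.

Lemma lebesgue_cV_box {R : realType} n (a b : 'cV[R]_n) :
  (forall i, a i 0 <= b i 0) ->
  lebesgue_cV [set x : 'cV[R]_n | forall i, a i 0 <= x i 0 <= b i 0] =
  (\prod_i (b i 0 - a i 0))%:E.
Proof.
elim: n a b => [|n IHn] a b ab.
  by rewrite big_ord0 /= diracE mem_set//= => -[].
rewrite big_ord_recl /= /pushforward.
pose lm : {sigma_finite_measure set 'cV[R]_n -> \bar R} := @lebesgue_cV R n.
pose ub := [set x : 'cV[R]_n | forall i,
  (\col_j a (lift ord0 j) 0) i 0 <= x i 0 <= (\col_j b (lift ord0 j) 0) i 0].
rewrite (_ : _ @^-1` _ = `[a ord0 0, b ord0 0]%classic `*` ub); last first.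
  apply/seteqP; split=> -[r v] /=.
    move=> H; split => /=.
      by have := H ord0; rewrite mxE unlift_none in_itv.
    by move=> i; have := H (lift ord0 i); rewrite !mxE liftK.
  move=> [/=]; rewrite in_itv/= => rab H i.
  rewrite mxE; case: unliftP => [j ->|->]//=.
  by have := H j; rewrite !mxE.
have mub : measurable ub.
  rewrite (_ : ub = \bigcap_(i in [set: 'I_n])
     ((fun x : 'cV[R]_n => x i 0) @^-1`
       `[(\col_j a (lift ord0 j) 0) i 0, (\col_j b (lift ord0 j) 0) i 0]%classic)).
    apply: fin_bigcap_measurable => //= i _.
    by rewrite -[X in measurable X]setTI; exact: measurable_cV_coord.
  apply/seteqP; split=> [x H i _ /=|x H i]; first by rewrite in_itv/= H.
  by have := H i Logic.I; rewrite /= in_itv.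
rewrite (product_measure1E lebesgue_measure lm)//.
transitivity ((b ord0 0 - a ord0 0)%:E * lm ub)%E.
  congr (_ * _)%E.
  rewrite [LHS](lebesgue_measure_itv `[a ord0 0, b ord0 0])/= lte_fin.
  case: ltP => [_|ba]; first by rewrite -EFinB.
  by rewrite (_ : b ord0 0 = a ord0 0) ?subrr//; apply/eqP; rewrite eq_le ba ab.
rewrite /lm /= IHn -?EFinM; last by move=> i; rewrite !mxE.
by congr (_ * _)%:E; apply: eq_bigr => i _; rewrite !mxE.
Qed.

Section lattices.
Context {R : realType} {n : nat}.
Local Notation V := 'cV[R]_n.

Definition dot (x y : V) : R := \sum_i x i 0 * y i 0.

Definition int_lattice : set V := [set x | forall i, x i 0 \is a Num.int].

Definition mx_image (P : 'M[R]_n) (X : set V) : set V := (mulmx P) @` X.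

Definition sumset (X Y : set V) : set V := [set x + y | x in X & y in Y].

Definition dual_lattice (G : set V) : set V :=
  [set k | forall g, G g -> dot k g \is a Num.int].

Definition quotient (G H : set V) : set (set V) :=
  [set sumset [set g] H | g in G].

(* [eigenvalue] refers to row eigenvectors; the spectrum is the same. *)
Definition expansive (A : 'M[R]_n) : Prop :=
  forall l : R[i], eigenvalue (map_mx (real_complex R) A) l -> 1 < normc l.

Definition strictly_expansive (A : 'M[R]_n) (G : set V) : Prop :=
  expansive A /\
  exists K : set V,
    [/\ compact K,
        {ae @lebesgue_cV R n, forall xi : V,
          \esum_(k in dual_lattice G) (\1_K (xi + k) : R)%:E = 1%E}
      & K `<=` mx_image A^T K°].

End lattices.

Section L2.
Context {R : realType} {n : nat}.
Local Notation V := 'cV[R]_n.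
Local Notation mu := (@lebesgue_cV R n).
Implicit Types f g : V -> R[i].

Definition cintegral f : R[i] :=
  (\int[mu]_x complex.Re (f x)) +i* (\int[mu]_x complex.Im (f x)).

Definition L2norm f : \bar R := Lnorm mu 2%:E (fun x => (normc (f x))%:E).

(* Elements of L^2 are handled through Borel representatives. *)
Definition L2 f : Prop :=
  [/\ measurable_fun setT (fun x => complex.Re (f x)),
      measurable_fun setT (fun x => complex.Im (f x))
    & (L2norm f < +oo)%E].

Definition inner f g : R[i] := cintegral (fun x => f x * conjc (g x)).

(* An orthonormal family whose finite linear combinations are dense in L^2. *)
Definition orthonormal_basis (I : eqType) (e : I -> V -> R[i]) : Prop :=
  [/\ forall i, L2 (e i),
      forall i j, inner (e i) (e j) = (i == j)%:R
    & forall f, L2 f -> forall eps : R, 0 < eps ->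
      exists (s : seq I) (c : I -> R[i]),
        (L2norm (fun x => f x - \sum_(i <- s) c i * e i x)%R < eps%:E)%E].

Definition translate (y : V) f : V -> R[i] := fun x => f (x - y).

Definition dilate (P : 'M[R]_n) f : V -> R[i] :=
  fun x => (Num.sqrt `|\det P|)%:C * f (P *m x).

Definition cis (t : R) : R[i] := cos t +i* sin t.

Definition fourier f : V -> R[i] :=
  fun xi => cintegral (fun x => f x * cis (- (2 * pi * dot x xi))).

End L2.

(* The dimension is written as a successor because the integer power A ^ j
   needs the unit ring structure, which only nontrivial matrices have; in
   dimension 0 the space L^2 is a line and the notion degenerates. *)
Definition orthonormal_wavelet {R : realType} {n L : nat} (A : 'M[R]_n.+1)
    (psi : 'I_L -> 'cV[R]_n.+1 -> R[i]) : Prop :=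
  (forall l, L2 (psi l)) /\
  orthonormal_basis (fun jkl : int * 'cV[int]_n.+1 * 'I_L =>
    dilate (A ^ jkl.1.1) (translate (map_mx intr jkl.1.2) (psi jkl.2))).

Section smooth.
Context {R : realType} {n : nat}.
Local Notation V := 'cV[R]_n.
Implicit Types f : V -> R[i].

Definition basis_vector (i : 'I_n) : V := delta_mx i 0.

(* Complex-valued functions are differentiated componentwise, R[i] being no
   normed module over R in the library. *)
Definition partial_derivable (i : 'I_n) f : Prop := forall x,
  derivable (fun y => complex.Re (f y)) x (basis_vector i) /\
  derivable (fun y => complex.Im (f y)) x (basis_vector i).

Definition partial (i : 'I_n) f : V -> R[i] := fun x =>
  'D_(basis_vector i) (fun y => complex.Re (f y)) x +i*
  'D_(basis_vector i) (fun y => complex.Im (f y)) x.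

(* A word of variables stands for a multi-index; every order of
   differentiation is covered. *)
Definition partials (s : seq 'I_n) f : V -> R[i] := foldr partial f s.

Definition smooth f : Prop := forall s : seq 'I_n,
  [/\ continuous (fun x => complex.Re (partials s f x)),
      continuous (fun x => complex.Im (partials s f x))
    & forall i, partial_derivable i (partials s f)].

Definition schwartz f : Prop :=
  smooth f /\
  forall (a : 'I_n -> nat) (s : seq 'I_n), exists M : R, forall x : V,
    `|\prod_i x i 0 ^+ a i| * normc (partials s f x) <= M.

Definition compactly_supported f : Prop :=
  compact (closure [set x | f x != 0]).

End smooth.

(* Main.v *)
(* This is Meyer's construction with theta, a smoothing of the indicator of K:
   theta has compact support, the sum of theta(x + k)^2 over k in Gamma^* is 1,
   and theta = 1 on B^-1 supp theta.  Multiplying theta by the exponentials with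
   frequencies representing Gamma/Z^n gives q functions, and multiplying
   theta(B^-1 x) by those representing A^-1 Gamma/Z^n gives p functions.  Both families are orthonormal under
   Z^n-periodization of products, and the first is the image of the second under
   a smooth Z^n-periodic q x p matrix with orthonormal rows.  When n <= 2(p - q)
   such a matrix has a smooth periodic completion to a unitary one: a
   Lipschitz map from [0, 1]^n misses a point of a sphere of dimension larger
   than n, so Householder reflections straighten the rows one after the other.
   The images of the p functions under the p - q new rows are the Fourier
   transforms of the wavelets.  By unitarity their autocorrelations are the
   difference of those of theta at two consecutive scales; these differences
   telescope over the dilations, which gives completeness. *)

Require Import Defs.
From mathcomp Require Import all_boot all_order all_algebra perm fingroup.
From mathcomp Require Import complex ring lra zify.
From mathcomp Require Import all_classical all_reals all_analysis measurable_realfun.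
Set Implicit Arguments.
Unset Strict Implicit.
Unset Printing Implicit Defensive.
Import Order.TTheory GRing.Theory Num.Theory.
Import numFieldNormedType.Exports.
Import Normc.
Local Open Scope classical_set_scope.
Local Open Scope ring_scope.

(** * Lebesgue measure and linear maps *)

Section boxes.
Context {R : realType}.
Local Notation V n := 'cV[R]_n.
Local Notation mu n := (@lebesgue_cV R n).

(** Estimates are made on test functions on the Fourier side, where lattice sums are locally finite
    and integrals converge absolutely; L^2 only enters at the end, through density. Room for
    smoothing comes from K lying in B K°: compactness turns this into a uniform margin, which also
    makes B^-1 contract and puts 0 inside the tile. The rule that th(x) <> 0 implies th(B^-1 x) = 1
    then carries the argument: it expresses the coarse family through the fine one, and it separates
    generators at least two scales apart. Two lattices of periods are in play, Z^n for the
    coefficients and the dual of Gamma, inside Z^n, for theta; the exponentials attached to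
    Gamma/Z^n are the characters of the quotient of the two and pass from one to the other. The
    bound n <= 2(p - q) is dictated by the last row to be straightened, a unit vector of C^(p-q+1),
    whose sphere has dimension 2(p - q) + 1; earlier rows live in larger spaces. Completeness
    requires no limit over scales: on functions vanishing near 0 and infinity the telescoping sum is
    finite and exact. *)

Definition cbox n (a b : V n) : set (V n) :=
  [set x | forall i, a i 0 <= x i 0 <= b i 0].

Definition cboxes n : set (set (V n)) :=
  [set A | exists a b, A = cbox a b].

Lemma cboxI n (a b c d : V n) :
  cbox a b `&` cbox c d =
  cbox (\col_i Num.max (a i 0) (c i 0)) (\col_i Num.min (b i 0) (d i 0)).
Proof.
apply/seteqP; split=> [x [H1 H2] i|x H].
  by rewrite !mxE ge_max le_min; move: (H1 i) (H2 i) => /andP[-> ->] /andP[-> ->].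
by split=> i; move: (H i); rewrite !mxE ge_max le_min => /andP[/andP[h1 h2] /andP[h3 h4]]; apply/andP.
Qed.

Lemma measurable_cbox n (a b : V n) : measurable (cbox a b).
Proof.
rewrite (_ : cbox a b = \bigcap_(i in [set: 'I_n])
   ((fun x : V n => x i 0) @^-1` `[a i 0, b i 0]%classic)).
  apply: fin_bigcap_measurable => //= i _.
  by rewrite -[X in measurable X]setTI; exact: measurable_cV_coord.
apply/seteqP; split=> [x H i _ /=|x H i]; first by rewrite in_itv/= H.
by have := H i Logic.I; rewrite /= in_itv.
Qed.

Lemma cboxes_cover n : \bigcup_k cbox (const_mx (- k%:R) : V n) (const_mx k%:R) = setT.
Proof.
apply/seteqP; split=> // x _.
exists (\sum_i Num.truncn `|x i 0%R|%R).+1 => // i.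
rewrite !mxE -ler_norml.
have h := truncnS_gt `|x i 0|.
apply: le_trans (ltW h) _; rewrite ler_nat ltnS.
by rewrite (bigD1 i)//= leq_addr.
Qed.

(** Closed boxes are stable under intersection and have an explicit measure, so this generating
    family is the one on which uniqueness of measures and Dynkin induction are run. For the other
    inclusion the half-spaces [c <= x i 0] suffice. *)
Lemma cV_measurableE n : @measurable _ (V n) = <<s @cboxes n >>.
Proof.
apply/seteqP; split; last first.
  apply: smallest_sub; first exact: sigma_algebra_measurable.
  by move=> A [a [b ->]]; exact: measurable_cbox.
apply: smallest_sub; first exact: smallest_sigma_algebra.
rewrite -bigcup_seq; apply: bigcup_sub => i _ A [B mB <-]; rewrite setTI.
pose G := <<s @cboxes n >>.
have sG : sigma_algebra setT G by exact: smallest_sigma_algebra.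
suff : (@measurable _ (measurableTypeR R)) `<=` [set B | G ((fun x : V n => x i 0) @^-1` B)] by exact.
rewrite RGenCInfty.measurableE.
apply: smallest_sub.
  split.
  - by rewrite /= preimage_set0; exact: sigma_algebra0.
  - move=> C /= GC; rewrite setTD preimage_setC -setTD.
    by case: sG => _ + _; exact.
  - move=> F GF /=; rewrite preimage_bigcup.
    by case: sG => _ _; exact.
move=> C [c ->] /=.
(* The half-space is exhausted by boxes whose side in direction [i] starts at [c], all other bounds
   going to infinity. *)
rewrite (_ : _ @^-1` _ = \bigcup_k
   cbox (\col_j (if j == i then c else - k%:R)) (const_mx k%:R : V n)); last first.
  apply/seteqP; split=> x /=.
    rewrite in_itv/= andbT => cx.
    have : (\bigcup_k cbox (const_mx (- k%:R) : V n) (const_mx k%:R)) x.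
      by rewrite cboxes_cover.
    move=> [k _ xk]; exists k => // j; rewrite !mxE; have := xk j; rewrite !mxE.
    by case: eqP => // -> /andP[_ ->]; rewrite andbT.
  move=> [k _ /(_ i)]; rewrite !mxE eqxx => /andP[cx _].
  by rewrite in_itv/= cx.
case: sG => _ _; apply => k; apply: sub_sigma_algebra.
by eexists; eexists.
Qed.

Lemma setI_closed_cboxes n : setI_closed (@cboxes n).
Proof. by move=> A B [a [b ->]] [c [d ->]]; rewrite cboxI; eexists; eexists. Qed.

Lemma lebesgue_cV_cbox_lty n (a b : V n) : (mu n (cbox a b) < +oo)%E.
Proof.
have [/forallP ab|/forallPn[i abi]] := boolP [forall i, a i 0 <= b i 0].
  by rewrite lebesgue_cV_box// ltry.
rewrite (_ : cbox _ _ = set0) ?measure0//.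
by apply/seteqP; split=> // x /(_ i) /andP[h1 h2]; rewrite (le_trans h1 h2) in abi.
Qed.

(** The factor [c] is there for maps that rescale volume: [m1] will be the image of the Lebesgue
    measure under such a map. *)
Lemma measure_cV_unique n (m1 : {measure set (V n) -> \bar R}) (c : R) :
  (0 <= c) ->
  (forall a b : V n, (forall i, a i 0 <= b i 0) ->
    (m1 (cbox a b) = c%:E * mu n (cbox a b))%E) ->
  forall A, measurable A -> (m1 A = c%:E * mu n A)%E.
Proof.
move=> c0 H A mA.
pose m2 := @mscale _ _ R (NngNum c0) (mu n).
change (m1 A = m2 A).
apply: (@measure_unique _ R (V n) (@cboxes n)
  (fun k => cbox (const_mx (- k%:R) : V n) (const_mx k%:R))) mA.
- exact: cV_measurableE.
- exact: setI_closed_cboxes.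
- by move=> i; eexists; eexists.
- exact: cboxes_cover.
- move=> B [a [b ->]].
  have [/forallP ab|/forallPn[i abi]] := boolP [forall i, a i 0 <= b i 0].
    exact: H.
  rewrite (_ : cbox _ _ = set0) ?measure0//.
  by apply/seteqP; split=> // x /(_ i) /andP[h1 h2]; rewrite (le_trans h1 h2) in abi.
- move=> k; rewrite H; last by move=> i; rewrite !mxE -subr_ge0 opprK addr_ge0.
  by rewrite lte_mul_pinfty// lebesgue_cV_cbox_lty.
Qed.

End boxes.

(** * Linear change of variables *)

Section change_of_variables.
Context {R : realType}.
Local Notation V n := 'cV[R]_n.
Local Notation mu n := (@lebesgue_cV R n).

(** [c] is the inverse of the Jacobian. Nonnegative integrands, rather than measures of sets, make
    the notion compose directly and combine with Tonelli's theorem. *)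
Definition scales_measure n (phi : V n -> V n) (c : R) := forall f : V n -> \bar R,
  measurable_fun setT f -> (forall x, 0 <= f x)%E ->
  (\int[mu n]_x f (phi x) = c%:E * \int[mu n]_x f x)%E.

Lemma scales_measure_cbox n (phi : V n -> V n) (c : R) : 0 <= c ->
  measurable_fun setT phi ->
  (forall a b : V n, (forall i, a i 0 <= b i 0) ->
    (mu n (phi @^-1` (cbox a b)) = c%:E * mu n (cbox a b))%E) ->
  scales_measure phi c.
Proof.
move=> c0 mphi H f mf f0.
pose m1 : {measure set (V n) -> \bar R} :=
  measure_function_pushforward__canonical__measure_function_Measure (mu n) mphi.
have E A : measurable A -> (m1 A = c%:E * mu n A)%E.
  by apply: measure_cV_unique => // a b ab; exact: H.
pose m2 := @mscale _ _ R (NngNum c0) (mu n).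
transitivity (\int[m1]_x f x)%E.
  by rewrite ge0_integral_pushforward.
transitivity (\int[m2]_x f x)%E.
  by apply: eq_measure_integral => A mA _; exact: E.
by rewrite ge0_integral_mscale.
Qed.

Lemma measurable_mulmx n (P : 'M[R]_n) : measurable_fun setT (fun x : V n => P *m x).
Proof.
apply/measurable_fun_cVP => i.
under eq_fun do rewrite mxE.
apply: measurable_sum => j.
by apply: measurable_funM => //; exact: measurable_cV_coord.
Qed.

Lemma measurable_addl n (v : V n) : measurable_fun setT (fun x : V n => v + x).
Proof.
apply/measurable_fun_cVP => i.
under eq_fun do rewrite mxE.
by apply: measurable_funD => //; exact: measurable_cV_coord.
Qed.

Lemma scales_measure_translate n (v : V n) : scales_measure (fun x => v + x) 1.
Proof.
apply: scales_measure_cbox => //; first exact: measurable_addl.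
move=> a b ab; rewrite mul1e.
rewrite (_ : _ @^-1` _ = cbox (a - v) (b - v)); last first.
  apply/seteqP; split=> x /= H i; have := H i; rewrite !mxE => /andP[h1 h2];
  apply/andP; split; lra.
rewrite !lebesgue_cV_box//; last by move=> i; rewrite !mxE lerD2r.
by congr EFin; apply: eq_bigr => i _; rewrite !mxE; lra.
Qed.

Lemma scales_measure_diag n (d : 'rV[R]_n) : (forall i, d 0 i != 0) ->
  scales_measure (fun x => diag_mx d *m x) (\prod_i `|d 0 i|)^-1.
Proof.
move=> d0; apply: scales_measure_cbox.
- by rewrite invr_ge0 prodr_ge0.
- exact: measurable_mulmx.
move=> a b ab.
pose s i := 0 < d 0 i.
(* A negative entry exchanges the two ends of the corresponding side. *)
pose a' : V n := \col_i (if s i then a i 0 / d 0 i else b i 0 / d 0 i).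
pose b' : V n := \col_i (if s i then b i 0 / d 0 i else a i 0 / d 0 i).
have dneg i : ~~ s i -> d 0 i < 0 by rewrite /s -leNgt lt_neqAle d0.
have ab' i : a' i 0 <= b' i 0.
  rewrite !mxE; case: ifPn => si; first by rewrite ler_pM2r ?invr_gt0.
  by rewrite ler_nM2r ?invr_lt0 ?dneg.
rewrite (_ : _ @^-1` _ = cbox a' b'); last first.
  apply/seteqP; split=> x /= H i; have := H i; rewrite mul_diag_mx !mxE;
    (case: ifPn => si; [rewrite ler_pdivrMr// ler_pdivlMr// | rewrite ler_ndivrMr ?dneg// ler_ndivlMr ?dneg//]);
    by rewrite ![x i 0 * _]mulrC// => /andP[-> ->].
rewrite !lebesgue_cV_box// -EFinM; congr EFin.
rewrite -prodfV -big_split/=; apply: eq_bigr => i _; rewrite !mxE.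
case: ifPn => si; first by rewrite gtr0_norm// -mulrBl mulrC.
by rewrite ltr0_norm ?dneg// -mulrBl invrN mulNr -mulrN opprB mulrC.
Qed.

Lemma scales_measure_perm n (s : 'S_n) :
  scales_measure (fun x : V n => perm_mx s *m x) 1.
Proof.
apply: scales_measure_cbox => //; first exact: measurable_mulmx.
move=> a b ab; rewrite mul1e.
have E (x : V n) i : (perm_mx s *m x) i 0 = x (s i) 0.
  by rewrite -row_permE mxE.
rewrite (_ : _ @^-1` _ = cbox (perm_mx s^-1 *m a) (perm_mx s^-1 *m b)); last first.
  have E' (x : V n) i : (perm_mx s^-1 *m x) i 0 = x ((s^-1)%g i) 0.
    by rewrite -row_permE mxE.
  apply/seteqP; split=> x /= H i.
    by have := H ((s^-1)%g i); rewrite !E !E' permKV.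
  by have := H (s i); rewrite !E !E' permK.
rewrite !lebesgue_cV_box//.
  congr EFin; rewrite (reindex_inj (@perm_inj _ s))/=; apply: eq_bigr => i _.
  by rewrite -!row_permE !mxE permK.
by move=> i; rewrite -!row_permE !mxE.
Qed.

Lemma scales_measure_comp n (f g : V n -> V n) c d :
  measurable_fun setT f -> 0 <= c -> 0 <= d ->
  scales_measure f c -> scales_measure g d ->
  scales_measure (fun x => f (g x)) (d * c).
Proof.
move=> mf c0 d0 Hf Hg h mh h0.
rewrite (Hg (fun x => h (f x)))//; last exact: (measurableT_comp mh).
by rewrite Hf// EFinM muleA.
Qed.

Lemma ge0_integral_cVS n (f : V n.+1 -> \bar R) :
  measurable_fun setT f -> (forall x, 0 <= f x)%E ->
  (\int[mu n.+1]_x f x =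
   \int[lebesgue_measure]_r \int[mu n]_v f (cV_cons (r, v)))%E.
Proof.
move=> mf f0.
pose lm : {measure set (measurableTypeR R * V n)%type -> \bar R} :=
  (lebesgue_measure \x (mu n : {sigma_finite_measure set (V n) -> \bar R}))%E.
have mc : measurable_fun setT (@cV_cons R n) := measurable_cV_cons (n := n).
transitivity (\int[pushforward lm (@cV_cons R n)]_x f x)%E; first by [].
rewrite ge0_integral_pushforward// preimage_setT fubini_tonelli1//.
  exact: (measurableT_comp mf).
by move=> x; exact: f0.
Qed.

Lemma fubini_tonelli_cV n (f : measurableTypeR R * V n -> \bar R) :
  measurable_fun setT f -> (forall x, 0 <= f x)%E ->
  (\int[lebesgue_measure]_r \int[mu n]_v f (r, v) =
   \int[mu n]_v \int[lebesgue_measure]_r f (r, v))%E.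
Proof.
move=> mf f0.
pose m1 : {sigma_finite_measure set (measurableTypeR R) -> \bar R} := lebesgue_measure.
pose m2 : {sigma_finite_measure set (V n) -> \bar R} := mu n.
have := @fubini_tonelli _ _ _ _ R m1 m2 f mf f0.
by rewrite /fubini_F /fubini_G.
Qed.

Lemma ge0_integral_cVS_swap n (f : V n.+1 -> \bar R) :
  measurable_fun setT f -> (forall x, 0 <= f x)%E ->
  (\int[mu n.+1]_x f x =
   \int[mu n]_v \int[lebesgue_measure]_r f (cV_cons (r, v)))%E.
Proof.
move=> mf f0; rewrite ge0_integral_cVS//.
apply: (fubini_tonelli_cV (f := fun z => f (cV_cons z))) => //.
exact: (measurableT_comp mf (measurable_cV_cons (n := n))).
Qed.

Lemma lebesgue_integral_shift (f : R -> \bar R) (c : R) :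
  measurable_fun setT f -> (forall x, 0 <= f x)%E ->
  (\int[lebesgue_measure]_r f (c + r)%R = \int[lebesgue_measure]_r f r)%E.
Proof.
move=> mf f0.
have mphi : measurable_fun setT (fun r : measurableTypeR R => c + r : measurableTypeR R).
  exact: measurable_funD.
pose m1 : {measure set (measurableTypeR R) -> \bar R} :=
  measure_function_pushforward__canonical__measure_function_Measure lebesgue_measure mphi.
transitivity (\int[m1]_x f x)%E; first by rewrite ge0_integral_pushforward.
apply: eq_measure_integral => A mA _; apply/esym.
apply: lebesgue_measure_unique => // X [[a b]] /= _ <-.
rewrite /pushforward (_ : _ @^-1` _ = `](a - c), (b - c)]%classic); last first.
  apply/seteqP; split=> x /=; rewrite !in_itv/= => /andP[h1 h2];
  apply/andP; split; lra.
have := lebesgue_measure_itv `](a - c), (b - c)].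
have := lebesgue_measure_itv `]a, b].
rewrite /= !lte_fin ltrD2r -!EFinD.
by rewrite (_ : b - c - (a - c) = b - a)//; [move=> -> -> | lra].
Qed.

Lemma mulmx_cV_cons n (P : 'M[R]_n.+1) (r : R) (v : V n) :
  P *m cV_cons (r, v) = cV_cons (P 0 0 * r + \sum_j P 0 (lift 0 j) * v j 0,
    r *: (\col_i P (lift 0 i) 0) + (\matrix_(i, j) P (lift 0 i) (lift 0 j)) *m v).
Proof.
apply/colP => i; rewrite !mxE big_ord_recl !mxE unlift_none/=.
under eq_bigr do rewrite !mxE liftK/=.
case: unliftP => [j ->|->]//=; rewrite !mxE mulrC; congr (_ + _).
by apply: eq_bigr => k _; rewrite !mxE.
Qed.

Lemma measurable_cV_cons2 n (r : R) : measurable_fun setT (fun v : V n => cV_cons (r, v)).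
Proof.
apply: (measurableT_comp (measurable_cV_cons (n := n))).
exact: measurable_fun_pair.
Qed.

Lemma measurable_cV_cons1 n (v : V n) :
  measurable_fun setT (fun r : measurableTypeR R => cV_cons (r, v)).
Proof.
apply: (measurableT_comp (measurable_cV_cons (n := n))).
exact: measurable_fun_pair.
Qed.

(** With the first coordinate frozen by Tonelli, the map acts on the others as a smaller matrix of
    the same kind followed by a translation. *)
Lemma scales_measure_lower n (P : 'M[R]_n) :
  (forall i j : 'I_n, (i <= j)%N -> P i j = (i == j)%:R) ->
  scales_measure (fun x => P *m x) 1.
Proof.
elim: n P => [|n IH] P HP f mf f0; rewrite mul1e.
  by apply: eq_integral => x _; rewrite flatmx0 [in RHS]flatmx0.
have mfP := measurableT_comp mf (measurable_mulmx P).
rewrite !ge0_integral_cVS//.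
apply: eq_integral => r _.
pose P' : 'M[R]_n := \matrix_(i, j) P (lift 0 i) (lift 0 j).
have P'L : forall i j : 'I_n, (i <= j)%N -> P' i j = (i == j)%:R.
  by move=> i j ij; rewrite mxE HP ?lift0 ?ltnS// (inj_eq lift_inj).
pose l : V n := r *: (\col_i P (lift 0 i) 0).
transitivity (\int[mu n]_v f (cV_cons (r, (l + P' *m v)%R)))%E.
  apply: eq_integral => v _; rewrite mulmx_cV_cons HP// eqxx mul1r.
  by rewrite big1 ?addr0// => j _; rewrite HP// mul0r.
rewrite (IH P' P'L (fun v => f (cV_cons (r, l + v))))//; last first.
  apply: (measurableT_comp mf); apply: (measurableT_comp (measurable_cV_cons2 r)).
  exact: measurable_addl.
rewrite mul1e (@scales_measure_translate _ l (fun v => f (cV_cons (r, v)))) ?mul1e//.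
by apply: (measurableT_comp mf); exact: measurable_cV_cons2.
Qed.

(** The order of integration is swapped: for a frozen tail the first coordinate undergoes a
    translation of the line, and the tail is left to the induction. *)
Lemma scales_measure_upper n (P : 'M[R]_n) :
  (forall i j : 'I_n, (j <= i)%N -> P i j = (i == j)%:R) ->
  scales_measure (fun x => P *m x) 1.
Proof.
elim: n P => [|n IH] P HP f mf f0; rewrite mul1e.
  by apply: eq_integral => x _; rewrite flatmx0 [in RHS]flatmx0.
have mfP := measurableT_comp mf (measurable_mulmx P).
rewrite ge0_integral_cVS_swap//.
pose P' : 'M[R]_n := \matrix_(i, j) P (lift 0 i) (lift 0 j).
have P'L : forall i j : 'I_n, (j <= i)%N -> P' i j = (i == j)%:R.
  by move=> i j ij; rewrite mxE HP ?lift0 ?ltnS// (inj_eq lift_inj).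
transitivity (\int[mu n]_v \int[lebesgue_measure]_r f (cV_cons (r, P' *m v)))%E.
  apply: eq_integral => v _.
  rewrite -[RHS](@lebesgue_integral_shift _ (\sum_j P 0 (lift 0 j) * v j 0))//; last first.
    by apply: (measurableT_comp mf); exact: measurable_cV_cons1.
  have c0 : \col_i P (lift 0 i) 0 = 0 :> V n.
    by apply/colP => i; rewrite !mxE HP.
  apply: eq_integral => r _; rewrite mulmx_cV_cons HP// eqxx mul1r addrC c0.
  by rewrite scaler0 add0r.
transitivity (\int[lebesgue_measure]_r \int[mu n]_v f (cV_cons (r, P' *m v)))%E.
  apply/esym; apply: (fubini_tonelli_cV (f := fun z => f (cV_cons (z.1, P' *m z.2)))) => //.
  apply: (measurableT_comp mf); apply: (measurableT_comp (measurable_cV_cons (n := n))).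
  apply: measurable_fun_pair => //=.
  exact: (measurableT_comp (measurable_mulmx P') measurable_snd).
rewrite ge0_integral_cVS//; apply: eq_integral => r _.
rewrite (IH P' P'L (fun v => f (cV_cons (r, v)))) ?mul1e//.
by apply: (measurableT_comp mf); exact: measurable_cV_cons2.
Qed.

(** The LUP decomposition reduces the Jacobian formula to permutations, diagonal matrices and the
    two kinds of unit triangular matrices. *)
Lemma scales_measure_mulmx n (P : 'M[R]_n.+1) : P \in unitmx ->
  scales_measure (fun x => P *m x) `|\det P|^-1.
Proof.
move=> uP.
have := cormen_lup_perm P; have := cormen_lup_correct P.
have := cormen_lup_lower P; have := cormen_lup_upper P; have := cormen_lup_detL P.
case: (cormen_lup P) => [[Q L] U] /= detL upU lowL E /is_perm_mxP[s QE].
have detU : \det U = \prod_i U i i.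
  rewrite -det_tr det_trig; first by apply: eq_bigr => i _; rewrite mxE.
  by apply/is_trig_mxP => i j ij; rewrite mxE upU.
have detE : `|\det P| = `|\prod_i U i i|.
  rewrite -detU -[\det U]mul1r -detL -det_mulmx -[L *m U]E det_mulmx QE det_perm normrM.
  by rewrite normrX normrN1 expr1n mul1r.
have Unz i : U i i != 0.
  have : \prod_i U i i != 0.
    by rewrite -normr_eq0 -detE normr_eq0 -unitfE -unitmxE.
  by move=> /prodf_neq0; apply.
pose d : 'rV[R]_n.+1 := \row_i U i i.
(* [W] is the unit upper triangular factor of [U] once its diagonal is split off. *)
pose W : 'M[R]_n.+1 := \matrix_(i, j) ((U i i)^-1 * U i j).
have UE : U = diag_mx d *m W.
  by apply/matrixP => i j; rewrite mul_diag_mx !mxE mulrA divff// mul1r.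
have PE : P = perm_mx s^-1 *m (L *m (diag_mx d *m W)).
  by rewrite -UE -[L *m U]E QE mulmxA -perm_mxM mulVg perm_mx1 mul1mx.
have -> : (fun x : V n.+1 => P *m x) =
    (fun x => perm_mx s^-1 *m (L *m (diag_mx d *m (W *m x)))).
  by apply/funext => x; rewrite {1}PE !mulmxA.
have -> : `|\det P|^-1 = 1 * (\prod_i `|d 0 i|)^-1 * 1 * 1.
  by rewrite mul1r !mulr1 detE normr_prod; congr (_^-1); apply: eq_bigr => i _; rewrite mxE.
have p0 : 0 <= (\prod_i `|d 0 i|)^-1 by rewrite invr_ge0 prodr_ge0.
apply: (scales_measure_comp (f := fun x => perm_mx s^-1 *m x)
   (g := fun x => L *m (diag_mx d *m (W *m x)))) => //.
- exact: measurable_mulmx.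
- by rewrite !mulr_ge0.
- exact: scales_measure_perm.
apply: (scales_measure_comp (f := fun x => L *m x)
   (g := fun x => diag_mx d *m (W *m x))) => //.
- exact: measurable_mulmx.
- by rewrite !mulr_ge0.
- exact: scales_measure_lower.
apply: (scales_measure_comp (f := fun x => diag_mx d *m x)
   (g := fun x => W *m x)) => //.
- exact: measurable_mulmx.
- by apply: scales_measure_diag => i; rewrite mxE.
apply: scales_measure_upper => i j; rewrite leq_eqVlt => /orP[/eqP/val_inj ->|ji].
  by rewrite mxE eqxx mulVf.
by rewrite mxE (upU _ _ ji) mulr0; case: eqP ji => // ->; rewrite ltnn.
Qed.

End change_of_variables.

(** * Complex-valued functions *)

Section cV_topology.
Context {R : realType}.
Local Notation V n := 'cV[R]_n.

Lemma ball_cVP n (x : V n) (e : R) (y : V n) : 0 < e ->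
  (forall i, `|x i 0 - y i 0| < e) -> ball x e y.
Proof. by move=> e0 H; split=> // i j; rewrite ord1; exact: H. Qed.

Lemma cV_norm_le n (x : V n) i : `|x i 0| <= `|x|.
Proof.
rewrite [leRHS]mx_normrE.
exact: (le_bigmax _ (fun ij => `|x ij.1 ij.2|) (i, 0)).
Qed.

Lemma cV_norm_leP n (x : V n) (r : R) : 0 <= r ->
  (forall i, `|x i 0| <= r) -> `|x| <= r.
Proof.
move=> r0 H; rewrite [leLHS]mx_normrE; apply/bigmax_leP; split => // -[i j] _ /=.
by rewrite ord1.
Qed.

(** Measurable sets are generated by the coordinates, not by the topology, so open sets have to be
    recovered: each is the countable union of the grid cells that it contains. *)
Lemma continuous_measurable n (f : V n -> R) : continuous f -> measurable_fun setT f.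
Proof.
move=> cf; apply: (measurability _ (RGenOInfty.measurableE R)) => //.
move=> _ [_ [c ->]] <-; rewrite setTI.
set U := _ @^-1` _.
have oU : open U by apply: open_comp => //; exact: itv_open.
(* [mk.1.+1] is the inverse of the mesh, [mk.2] holds the integer numerators of the lower corner of
   the cell. *)
pose Q (mk : nat * 'cV[int]_n) : set (V n) :=
  cbox (\col_i ((mk.2 i 0)%:~R / mk.1.+1%:R)) (\col_i (((mk.2 i 0)%:~R + 1) / mk.1.+1%:R)).
suff -> : U = \bigcup_(mk : nat * 'cV[int]_n) (if `[< Q mk `<=` U >] then Q mk else set0).
  apply: countable_bigcupT_measurable => [|mk]; first exact: countableP.
  case: ifP => _ //.
  exact: measurable_cbox.
apply/seteqP; split=> [x Ux|x [mk _]]; last by case: ifPn => // /asboolP h /h.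
have /nbhs_ballP[e /= e0 eU] : nbhs x U by exact: open_nbhs_nbhs.
have [m me] := ltr_add_invr e0.
exists (m, \col_i Num.floor (x i 0 * m.+1%:R)) => //.
rewrite add0r in me.
have m0 : 0 < m.+1%:R :> R by [].
have Qx : Q (m, \col_i Num.floor (x i 0 * m.+1%:R)) x.
  move=> i; rewrite !mxE /= ler_pdivrMr// ler_pdivlMr// floor_le/=.
  by rewrite ltW// -[1]/(1%:~R) -intrD floorD1_gt.
case: ifPn => // /asboolPn; apply: contra_notP => _; move=> y Qy; apply: eU.
apply: ball_cVP => // i; apply: le_lt_trans me.
have := Qx i; have := Qy i; rewrite !mxE/= => /andP[h1 h2] /andP[h3 h4].
move: h1 h2 h3 h4; rewrite [in X in _ -> X -> _]mulrDl [in X in _ -> _ -> _ -> X -> _]mulrDl mul1r.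
move: ((Num.floor (x i 0 * m.+1%:R))%:~R / m.+1%:R) => F.
move: (m.+1%:R^-1) (x i 0) (y i 0) => u s t h1 h2 h3 h4.
by rewrite ler_norml; apply/andP; split; lra.
Qed.

End cV_topology.

Section integral_lemmas.
Context {R : realType} {d : measure_display} {T : measurableType d}.
Variable mu : {measure set T -> \bar R}.

Lemma integrable_le (f g : T -> R) : measurable_fun setT f ->
  (forall x, `|f x| <= g x) -> mu.-integrable setT (EFin \o g) ->
  mu.-integrable setT (EFin \o f).
Proof.
move=> mf fg ig; apply: le_integrable ig => //.
  exact/measurable_EFinP.
by move=> x _ /=; rewrite lee_fin (le_trans (fg x))// ler_norm.
Qed.

Lemma Rintegral_dominated_cvg (f_ : nat -> T -> R) (f g : T -> R) :
  (forall n, measurable_fun setT (f_ n)) -> measurable_fun setT f ->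
  (forall x, f_ n x @[n --> \oo] --> f x) ->
  mu.-integrable setT (EFin \o g) ->
  (forall n x, `|f_ n x| <= g x) ->
  (\int[mu]_x f_ n x) @[n --> \oo] --> \int[mu]_x f x.
Proof.
move=> mf_ mf cf ig fg.
have [||||if_ _ H] := @dominated_convergence _ _ R mu setT measurableT
  (fun n => EFin \o f_ n) (EFin \o f) (EFin \o g) _ _ _ ig.
- by move=> n; exact/measurable_EFinP.
- exact/measurable_EFinP.
- by apply: aeW => x _; apply: cvg_EFin; [exact: nearW | exact: cf].
- by apply: aeW => x n _; rewrite /= lee_fin.
apply: fine_cvg.
rewrite fineK; first exact: H.
exact: integrable_fin_num.
Qed.

Lemma normr_Rintegral_le (f g : T -> R) : measurable_fun setT f ->
  (forall x, `|f x| <= g x) -> mu.-integrable setT (EFin \o g) ->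
  `|\int[mu]_x f x| <= \int[mu]_x g x.
Proof.
move=> mf fg ig.
have if_ := integrable_le mf fg ig.
apply: le_trans (le_normr_Rintegral _ if_) _ => //.
by apply: le_Rintegral => //; exact: integrable_norm.
Qed.

End integral_lemmas.

Section complex_functions.
Context {R : realType}.
Local Notation C := R[i].
Local Notation Re := (@complex.Re R).
Local Notation Im := (@complex.Im R).

Lemma cReD (z w : C) : Re (z + w) = Re z + Re w.
Proof. by case: z w => [a b] [c d]. Qed.
Lemma cImD (z w : C) : Im (z + w) = Im z + Im w.
Proof. by case: z w => [a b] [c d]. Qed.
Lemma cReN (z : C) : Re (- z) = - Re z. Proof. by case: z. Qed.
Lemma cImN (z : C) : Im (- z) = - Im z. Proof. by case: z. Qed.
Lemma cReM (z w : C) : Re (z * w) = Re z * Re w - Im z * Im w.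
Proof. by case: z w => [a b] [c d]. Qed.
Lemma cImM (z w : C) : Im (z * w) = Re z * Im w + Im z * Re w.
Proof. by case: z w => [a b] [c d]. Qed.
Lemma conjcM (a b : C) : conjc (a * b) = conjc a * conjc b.
Proof. exact: (rmorphM (@conjc R)). Qed.
Lemma cRe_conj (z : C) : Re (conjc z) = Re z. Proof. by case: z. Qed.
Lemma cIm_conj (z : C) : Im (conjc z) = - Im z. Proof. by case: z. Qed.
Lemma complex_ext (z w : C) : Re z = Re w -> Im z = Im w -> z = w.
Proof. by case: z w => [a b] [c d] /= -> ->. Qed.

Lemma normc_ge0 (z : C) : 0 <= normc z.
Proof. by case: z => a b /=; rewrite sqrtr_ge0. Qed.
Lemma normc_sqr (z : C) : normc z ^+ 2 = Re z ^+ 2 + Im z ^+ 2.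
Proof. by case: z => a b /=; rewrite sqr_sqrtr// addr_ge0// sqr_ge0. Qed.
Lemma normc_Re (z : C) : `|Re z| <= normc z.
Proof.
rewrite -(@ler_pXn2r _ 2) ?nnegrE ?normr_ge0 ?normc_ge0// normc_sqr real_normK ?num_real//.
by rewrite lerDl sqr_ge0.
Qed.
Lemma normc_Im (z : C) : `|Im z| <= normc z.
Proof.
rewrite -(@ler_pXn2r _ 2) ?nnegrE ?normr_ge0 ?normc_ge0// normc_sqr real_normK ?num_real//.
by rewrite lerDr sqr_ge0.
Qed.
Lemma normc_le (z : C) : normc z <= `|Re z| + `|Im z|.
Proof.
rewrite -(@ler_pXn2r _ 2) ?nnegrE ?addr_ge0 ?normr_ge0 ?normc_ge0// normc_sqr sqrrD.
rewrite !real_normK ?num_real// -addrA [X in _ <= _ + X]addrC addrA lerDl.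
by rewrite mulrn_wge0// mulr_ge0.
Qed.
Lemma normc_conj (z : C) : normc (conjc z) = normc z.
Proof. by case: z => a b /=; rewrite sqrrN. Qed.
Lemma normc_real (a : R) : normc (a%:C)%C = `|a|.
Proof. by rewrite /= expr0n/= addr0 sqrtr_sqr. Qed.
Lemma normc_mulconj (z : C) : z * conjc z = ((normc z ^+ 2)%:C)%C.
Proof.
by rewrite normc_sqr; apply: complex_ext; rewrite ?cReM ?cImM cRe_conj cIm_conj/=; lra.
Qed.

Lemma Re_cis (t : R) : Re (cis t) = cos t. Proof. by []. Qed.
Lemma cisD (s t : R) : cis (s + t) = cis s * cis t.
Proof. by apply: complex_ext; rewrite ?cReM ?cImM/= ?cosD ?sinD//; lra. Qed.
Lemma cis0 : cis (0 : R) = 1. Proof. by apply: complex_ext; rewrite /= ?cos0 ?sin0. Qed.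
Lemma cisN (t : R) : cis (- t) = conjc (cis t).
Proof. by apply: complex_ext; rewrite /= ?cosN ?sinN. Qed.
Lemma normc_cis (t : R) : normc (cis t) = 1.
Proof. by rewrite /= cos2Dsin2 sqrtr1. Qed.
Lemma cisM (n : int) (t : R) : cis (2 * pi * t * n%:~R) = cis (2 * pi * t) ^ n.
Proof.
have H (m : nat) : cis (2 * pi * t * m%:R) = cis (2 * pi * t) ^+ m.
  elim: m => [|m IH]; first by rewrite mulr0 cis0 expr0.
  by rewrite -[m.+1%:R]natr1 (mulrDr (2 * pi * t)) mulr1 cisD IH exprSr.
case: n => m; first exact: H.
rewrite NegzE mulrNz mulrN cisN H -exprnN.
have c1 : cis (2 * pi * t) * conjc (cis (2 * pi * t)) = 1.
  by rewrite normc_mulconj normc_cis expr1n.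
have /mulfI I0 : cis (2 * pi * t) ^+ m.+1 != 0.
  by rewrite expf_neq0//; apply/eqP => c0; rewrite c0 mul0r in c1; move/eqP: c1; rewrite eq_sym oner_eq0.
apply: I0; rewrite mulfV; last first.
  by rewrite expf_neq0//; apply/eqP => c0; rewrite c0 mul0r in c1; move/eqP: c1; rewrite eq_sym oner_eq0.
by rewrite normc_mulconj -H normc_cis expr1n.
Qed.
Lemma cis_int (k : R) : k \is a Num.int -> cis (2 * pi * k) = 1.
Proof.
move=> /intrP[n ->]; rewrite -[2 * pi]mulr1 cisM mulr1.
rewrite (_ : cis (2 * pi) = 1) ?exp1rz//.
by apply: complex_ext; rewrite /= mulrC mulr_natr ?cos2pi ?sin2pi.
Qed.

End complex_functions.

Section complex_integral.
Context {R : realType}.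
Local Notation C := R[i].
Local Notation Re := (@complex.Re R).
Local Notation Im := (@complex.Im R).

Section measurable.
Context {d : measure_display} {T : measurableType d}.
Implicit Types f g : T -> C.

Definition cmeasurable f :=
  measurable_fun setT (fun x => Re (f x)) /\ measurable_fun setT (fun x => Im (f x)).

Lemma cmeasurable_cst (c : C) : cmeasurable (fun=> c).
Proof. by split; exact: measurable_cst. Qed.

Lemma cmeasurableD f g : cmeasurable f -> cmeasurable g -> cmeasurable (fun x => f x + g x).
Proof.
move=> [f1 f2] [g1 g2]; split.
  by under eq_fun do rewrite cReD; exact: measurable_funD.
by under eq_fun do rewrite cImD; exact: measurable_funD.
Qed.

Lemma cmeasurableM f g : cmeasurable f -> cmeasurable g -> cmeasurable (fun x => f x * g x).
Proof.
move=> [f1 f2] [g1 g2]; split.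
  by under eq_fun do rewrite cReM; apply: measurable_funB; exact: measurable_funM.
by under eq_fun do rewrite cImM; apply: measurable_funD; exact: measurable_funM.
Qed.

Lemma cmeasurableN f : cmeasurable f -> cmeasurable (fun x => - f x).
Proof.
move=> mf; under eq_fun do rewrite -mulN1r.
by apply: cmeasurableM => //; exact: cmeasurable_cst.
Qed.

Lemma cmeasurable_conj f : cmeasurable f -> cmeasurable (fun x => conjc (f x)).
Proof.
move=> [f1 f2]; split.
  by under eq_fun do rewrite cRe_conj.
by under eq_fun do rewrite cIm_conj; exact: measurable_funN.
Qed.

Lemma cmeasurable_cis (f : T -> R) : measurable_fun setT f -> cmeasurable (fun x => cis (f x)).
Proof.
move=> mf; split => /=.
  by apply: (measurableT_comp _ mf); apply: continuous_measurable_fun; exact: continuous_cos.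
by apply: (measurableT_comp _ mf); apply: continuous_measurable_fun; exact: continuous_sin.
Qed.

Lemma cmeasurable_real (f : T -> R) : measurable_fun setT f -> cmeasurable (fun x => (f x)%:C)%C.
Proof. by move=> mf; split => //=; exact: measurable_cst. Qed.

Lemma cmeasurable_sum I (s : seq I) (F : I -> T -> C) :
  (forall i, cmeasurable (F i)) -> cmeasurable (fun x => \sum_(i <- s) F i x).
Proof.
move=> mF; elim: s => [|i s IH].
  by under eq_fun do rewrite big_nil; exact: cmeasurable_cst.
by under eq_fun do rewrite big_cons; exact: cmeasurableD.
Qed.

Lemma measurable_normc f : cmeasurable f -> measurable_fun setT (fun x => normc (f x)).
Proof.
move=> [f1 f2].
under eq_fun => x.
  rewrite (_ : normc (f x) = Num.sqrt (Re (f x) ^+ 2 + Im (f x) ^+ 2)); last by case: (f x).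
  over.
apply: (measurableT_comp (continuous_measurable_fun (@sqrt_continuous R))).
by apply: measurable_funD; exact: measurable_funX.
Qed.

End measurable.

Lemma cmeasurable_comp d d' (T : measurableType d) (U : measurableType d')
    (f : U -> C) (g : T -> U) :
  cmeasurable f -> measurable_fun setT g -> cmeasurable (fun x => f (g x)).
Proof. by move=> [f1 f2] mg; split; [exact: (measurableT_comp f1)|exact: (measurableT_comp f2)]. Qed.

Section integral.
Context {d : measure_display} {T : measurableType d}.
Variable mu : {measure set T -> \bar R}.
Implicit Types f g : T -> C.

(** [cintegral] over an arbitrary measure, for the line and for product spaces; over [lebesgue_cV]
    the two agree by conversion. *)
Definition cint f : C := Complex (\int[mu]_x Re (f x)) (\int[mu]_x Im (f x)).

Definition cintegrable f :=
  mu.-integrable setT (fun x => (Re (f x))%:E) /\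
  mu.-integrable setT (fun x => (Im (f x))%:E).

Lemma cintegrable_meas f : cintegrable f -> cmeasurable f.
Proof. by move=> [/measurable_int/measurable_EFinP h1 /measurable_int/measurable_EFinP h2]. Qed.

Lemma cintegrable_le f (g : T -> R) : cmeasurable f -> (forall x, normc (f x) <= g x) ->
  mu.-integrable setT (EFin \o g) -> cintegrable f.
Proof.
move=> [mf1 mf2] fg ig; split.
  by apply: (integrable_le mf1 _ ig) => x; exact: le_trans (normc_Re _) (fg x).
by apply: (integrable_le mf2 _ ig) => x; exact: le_trans (normc_Im _) (fg x).
Qed.

Lemma cintegrable_normc f : cintegrable f ->
  mu.-integrable setT (EFin \o (fun x => normc (f x))).
Proof.
move=> fi; have [i1 i2] := fi.
have mn := measurable_normc (cintegrable_meas fi).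
apply: (integrable_le mn (g := fun x => `|Re (f x)| + `|Im (f x)|)).
  by move=> x; rewrite ger0_norm ?normc_ge0// normc_le.
have -> : EFin \o (fun x => `|Re (f x)| + `|Im (f x)|) =
  (fun x => (`|Re (f x)|)%:E) \+ (fun x => (`|Im (f x)|)%:E)%E by apply/funext => x /=.
by apply: integrableD => //; exact: (@integrable_norm _ _ _ mu setT).
Qed.

(** The factor 2 comes from bounding real and imaginary parts separately; only the order of
    magnitude matters later. *)
Lemma normc_cint_le f (g : T -> R) : cmeasurable f -> (forall x, normc (f x) <= g x) ->
  mu.-integrable setT (EFin \o g) -> normc (cint f) <= 2 * \int[mu]_x g x.
Proof.
move=> [mf1 mf2] fg ig; apply: le_trans (normc_le _) _ => /=.
rewrite mulr_natl mulr2n; apply: lerD.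
  by apply: normr_Rintegral_le => // x; exact: le_trans (normc_Re _) (fg x).
by apply: normr_Rintegral_le => // x; exact: le_trans (normc_Im _) (fg x).
Qed.

Lemma cintD f g : cintegrable f -> cintegrable g ->
  cint (fun x => f x + g x) = cint f + cint g.
Proof.
move=> [f1 f2] [g1 g2]; apply: complex_ext; rewrite ?cReD ?cImD/=.
  by under eq_Rintegral do rewrite cReD; rewrite RintegralD.
by under eq_Rintegral do rewrite cImD; rewrite RintegralD.
Qed.

Lemma cintegrableD f g : cintegrable f -> cintegrable g ->
  cintegrable (fun x => f x + g x).
Proof.
move=> [f1 f2] [g1 g2]; split.
  under eq_fun do rewrite cReD EFinD.
  exact: (@integrableD _ _ _ mu setT _ (fun x => (Re (f x))%:E) (fun x => (Re (g x))%:E)).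
under eq_fun do rewrite cImD EFinD.
exact: (@integrableD _ _ _ mu setT _ (fun x => (Im (f x))%:E) (fun x => (Im (g x))%:E)).
Qed.

Lemma cintegrableZ (c : C) f : cintegrable f -> cintegrable (fun x => c * f x).
Proof.
move=> fi; apply: (cintegrable_le (g := fun x => normc c * normc (f x))).
- by apply: cmeasurableM; [exact: cmeasurable_cst|exact: cintegrable_meas].
- by move=> x; rewrite normcM.
have := integrableZl measurableT (normc c) (cintegrable_normc fi).
by under eq_fun do rewrite -EFinM.
Qed.

Lemma cintZ (c : C) f : cintegrable f -> cint (fun x => c * f x) = c * cint f.
Proof.
move=> [f1 f2].
have iZ (k : R) (g : T -> R) : mu.-integrable setT (EFin \o g) ->
    mu.-integrable setT (EFin \o (fun x => k * g x)).
  by move=> ig; have := integrableZl measurableT k ig; under eq_fun do rewrite -EFinM.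
apply: complex_ext; rewrite ?cReM ?cImM/=.
  under eq_Rintegral do rewrite cReM.
  rewrite RintegralB//; [|exact: iZ|exact: iZ].
  by rewrite !RintegralZl.
under eq_Rintegral do rewrite cImM.
rewrite RintegralD//; [|exact: iZ|exact: iZ].
by rewrite !RintegralZl.
Qed.

Lemma cintegrable0 : cintegrable (fun=> 0).
Proof. by split => /=; exact: integrable0. Qed.

Lemma cint0 : cint (fun=> 0) = 0.
Proof. by rewrite /cint/= /Rintegral integral0. Qed.

Lemma cintegrable_sum I (s : seq I) (F : I -> T -> C) :
  (forall i, cintegrable (F i)) -> cintegrable (fun x => \sum_(i <- s) F i x).
Proof.
move=> iF; elim: s => [|i s IH].
  by under eq_fun do rewrite big_nil; exact: cintegrable0.
by under eq_fun do rewrite big_cons; exact: cintegrableD.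
Qed.

Lemma cint_sum I (s : seq I) (F : I -> T -> C) : (forall i, cintegrable (F i)) ->
  cint (fun x => \sum_(i <- s) F i x) = \sum_(i <- s) cint (F i).
Proof.
move=> iF; elim: s => [|i s IH].
  by under eq_fun do rewrite big_nil; rewrite big_nil cint0.
under eq_fun do rewrite big_cons; rewrite big_cons cintD ?IH//.
exact: cintegrable_sum.
Qed.

Lemma cint_conj f : cintegrable f -> cint (fun x => conjc (f x)) = conjc (cint f).
Proof.
move=> [f1 f2]; apply: complex_ext; rewrite ?cRe_conj ?cIm_conj/=.
  by under eq_Rintegral do rewrite cRe_conj.
under eq_Rintegral do rewrite cIm_conj -mulN1r.
by rewrite RintegralZl// mulN1r.
Qed.

Lemma cintegrable_conj f : cintegrable f -> cintegrable (fun x => conjc (f x)).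
Proof.
move=> fi; apply: (cintegrable_le _ _ (cintegrable_normc fi)).
  by apply: cmeasurable_conj; exact: cintegrable_meas.
by move=> x; rewrite normc_conj.
Qed.

Lemma cintegrable_bounded f g (M : R) : cintegrable f -> cmeasurable g ->
  (forall x, normc (g x) <= M) -> cintegrable (fun x => f x * g x).
Proof.
move=> fi mg gM; apply: (cintegrable_le (g := fun x => M * normc (f x))).
- by apply: cmeasurableM => //; exact: cintegrable_meas.
- by move=> x; rewrite normcM mulrC ler_wpM2r ?normc_ge0.
have := integrableZl measurableT M (cintegrable_normc fi).
by under eq_fun do rewrite -EFinM.
Qed.

Definition ccvg (u : nat -> C) (l : C) :=
  Re (u n) @[n --> \oo] --> Re l /\ Im (u n) @[n --> \oo] --> Im l.

Lemma ccvg_unique u l l' : ccvg u l -> ccvg u l' -> l = l'.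
Proof.
move=> [a b] [c e]; apply: complex_ext; first by rewrite -(cvg_lim _ a)// (cvg_lim _ c).
by rewrite -(cvg_lim _ b)// (cvg_lim _ e).
Qed.

Lemma ccvgM u v l m : ccvg u l -> ccvg v m -> ccvg (fun n => u n * v n) (l * m).
Proof.
move=> [a b] [c e]; split.
  by under eq_fun do rewrite cReM; rewrite cReM; apply: cvgB; exact: cvgM.
by under eq_fun do rewrite cImM; rewrite cImM; apply: cvgD; exact: cvgM.
Qed.

Lemma ccvg_cst l : ccvg (fun=> l) l.
Proof. by split; exact: cvg_cst. Qed.

Lemma ccvg_real (u : nat -> R) (l : R) : u @ \oo --> l -> ccvg (fun n => (u n)%:C)%C (l%:C)%C.
Proof. by move=> h; split => //=; exact: cvg_cst. Qed.

Lemma cint_dominated_cvg (f_ : nat -> T -> C) f (g : T -> R) :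
  (forall n, cmeasurable (f_ n)) -> cmeasurable f ->
  (forall x, ccvg (f_ ^~ x) (f x)) ->
  mu.-integrable setT (EFin \o g) ->
  (forall n x, normc (f_ n x) <= g x) ->
  ccvg (fun n => cint (f_ n)) (cint f).
Proof.
move=> mf_ mf cf ig fg; split => /=.
  apply: Rintegral_dominated_cvg ig _.
  - by move=> n; case: (mf_ n).
  - by case: mf.
  - by move=> x; case: (cf x).
  - by move=> n x; exact: le_trans (normc_Re _) (fg n x).
apply: Rintegral_dominated_cvg ig _.
- by move=> n; case: (mf_ n).
- by case: mf.
- by move=> x; case: (cf x).
- by move=> n x; exact: le_trans (normc_Im _) (fg n x).
Qed.

End integral.

Section fubini.
Context {d1 d2 : measure_display} {T1 : measurableType d1} {T2 : measurableType d2}.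
Variables (m1 : {sigma_finite_measure set T1 -> \bar R})
          (m2 : {sigma_finite_measure set T2 -> \bar R}).

(** A real inner integral is [fine] of an extended one, which may be infinite on a null set and is
    then replaced by 0; the two agree almost everywhere, and that suffices. *)
Lemma Rintegral_fubini (f : T1 * T2 -> R) :
  (m1 \x m2)%E.-integrable setT (EFin \o f) ->
  \int[m1]_x \int[m2]_y f (x, y) = \int[m2]_y \int[m1]_x f (x, y).
Proof.
move=> fi.
have F1 := integrable_fubini_F fi.
have G1 := @Fubini _ _ _ _ _ m1 m2 _ fi.
rewrite /Rintegral; congr fine.
have iG : m2.-integrable setT (fubini_G m1 (EFin \o f)).
  apply/integrableP; split; first exact: measurable_fubini_G fi.
  have /integrableP[mf fo] := fi.
  have /(integrable21ltyP m1 m2 mf) := fi.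
  apply: le_lt_trans; apply: ge0_le_integral => //.
  - by apply: measurableT_comp => //; exact: measurable_fubini_G fi.
  - have mabs : measurable_fun setT (fun z => `|(EFin \o f) z|%E) by exact: measurableT_comp.
    have := measurable_fun_fubini_tonelli_G (m1 := m1) _ mabs.
    by rewrite /fubini_G; apply => z; exact: abse_ge0.
  - move=> y _; apply: le_abse_integral => //.
    by apply: (measurableT_comp mf); exact: measurable_fun_pair.
transitivity (\int[m1]_x fubini_F m2 (EFin \o f) x)%E.
  apply: ae_eq_integral => //.
  - apply: (measurableT_comp (f := EFin)) => //; apply: (measurableT_comp (@fine_measurable R setT measurableT)).
    by case/integrableP: F1.
  - by case/integrableP: F1.
  - have := integrable_ae measurableT F1.
    by apply: filterS => x H _ /=; rewrite fineK//; exact: H.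
rewrite /fubini_F G1.
apply: ae_eq_integral => //.
- exact: measurable_fubini_G fi.
- apply: (measurableT_comp (f := EFin)) => //; apply: (measurableT_comp (@fine_measurable R setT measurableT)).
  exact: measurable_fubini_G fi.
- have := integrable_ae measurableT iG.
  by apply: filterS => x H _ /=; rewrite fineK//; exact: H.
Qed.

End fubini.

End complex_integral.

Section cint_fubini.
Context {R : realType}.
Context {d1 d2 : measure_display} {T1 : measurableType d1} {T2 : measurableType d2}.
Variables (m1 : {sigma_finite_measure set T1 -> \bar R})
          (m2 : {sigma_finite_measure set T2 -> \bar R}).
Local Notation C := R[i].
Local Notation Re := (@complex.Re R).
Local Notation Im := (@complex.Im R).

Lemma cint_fubini (f : T1 * T2 -> C) : cintegrable (m1 \x m2)%E f ->
  cint m1 (fun x => cint m2 (fun y => f (x, y))) =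
  cint m2 (fun y => cint m1 (fun x => f (x, y))).
Proof.
move=> [f1 f2]; apply: complex_ext => /=.
  exact: (Rintegral_fubini (f := fun z => Re (f z))).
exact: (Rintegral_fubini (f := fun z => Im (f z))).
Qed.

Lemma integrable_tensor (u : T1 -> R) (v : T2 -> R) :
  m1.-integrable setT (EFin \o u) -> m2.-integrable setT (EFin \o v) ->
  (m1 \x m2)%E.-integrable setT (EFin \o (fun z => u z.1 * v z.2)).
Proof.
move=> iu iv.
have mu : measurable_fun setT u by move/measurable_int/measurable_EFinP: iu.
have mv : measurable_fun setT v by move/measurable_int/measurable_EFinP: iv.
have m : measurable_fun setT (fun z : T1 * T2 => u z.1 * v z.2).
  by apply: measurable_funM; [exact: (measurableT_comp mu)|exact: (measurableT_comp mv)].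
apply/(integrable12ltyP m1 m2); first exact/measurable_EFinP.
have mau : measurable_fun setT (fun x => `|(u x)%:E|%E).
  by apply/(@measurable_EFinP _ _ _ _ (fun x => `|u x|)); exact: (measurableT_comp (@normr_measurable R setT)).
have mav : measurable_fun setT (fun x => `|(v x)%:E|%E).
  by apply/(@measurable_EFinP _ _ _ _ (fun x => `|v x|)); exact: (measurableT_comp (@normr_measurable R setT)).
have E x : (\int[m2]_y `|(EFin \o (fun z => (u z.1 * v z.2)%R)) (x, y)| =
    `|u x|%:E * \int[m2]_y `|(v y)%:E|)%E.
  under eq_integral => y _ do rewrite /= normrM EFinM.
  by rewrite ge0_integralZl.
under eq_integral => x _ do rewrite E.
have /integrableP[_ uo] := iu; have /integrableP[_ vo] := iv.
rewrite ge0_integralZr//; last exact: integral_ge0.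
apply: lte_mul_pinfty => //; first exact: integral_ge0.
by rewrite ge0_fin_numE//; apply: integral_ge0.
Qed.

Lemma cintegrable_tensor (u : T1 -> C) (v : T2 -> C) (c : T1 * T2 -> C) :
  cintegrable m1 u -> cintegrable m2 v -> cmeasurable c ->
  (forall z, normc (c z) <= 1) ->
  cintegrable (m1 \x m2)%E (fun z => u z.1 * v z.2 * c z).
Proof.
move=> iu iv mc c1.
apply: (cintegrable_le (g := fun z => normc (u z.1) * normc (v z.2))).
- apply: cmeasurableM => //; apply: cmeasurableM.
    exact: (cmeasurable_comp (cintegrable_meas iu)).
  exact: (cmeasurable_comp (cintegrable_meas iv)).
- by move=> z; rewrite !normcM ler_piMr// mulr_ge0// normc_ge0.
by apply: (integrable_tensor (u := fun x => normc (u x)) (v := fun x => normc (v x)));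
  exact: cintegrable_normc.
Qed.

Lemma cint_tensor (u : T1 -> C) (v : T2 -> C) :
  cintegrable m1 u -> cintegrable m2 v ->
  cint (m1 \x m2)%E (fun z => u z.1 * v z.2) = cint m1 u * cint m2 v.
Proof.
move=> iu iv.
have R_tensor (f : T1 -> R) (g : T2 -> R) :
    m1.-integrable setT (EFin \o f) -> m2.-integrable setT (EFin \o g) ->
    \int[(m1 \x m2)%E]_z (f z.1 * g z.2) = (\int[m1]_x f x) * (\int[m2]_y g y).
  move=> i1 i2.
  have i12 := integrable_tensor i1 i2.
  rewrite /Rintegral -(integral12_prod_meas1 i12).
  pose Ig := \int[m2]_y g y.
  have IgE : (\int[m2]_y (g y)%:E)%E = Ig%:E.
    by rewrite /Ig /Rintegral fineK//; exact: (integrable_fin_num measurableT i2).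
  transitivity (fine (\int[m1]_x (Ig%:E * (f x)%:E))%E).
    congr fine; apply: eq_integral => x _; rewrite /fubini_F /=.
    under eq_integral => y _ do rewrite EFinM.
    by rewrite integralZl// IgE muleC.
  rewrite integralZl// fineM//; last exact: (integrable_fin_num measurableT i1).
  by rewrite mulrC.
have [u1 u2] := iu; have [v1 v2] := iv.
have i11 := integrable_tensor u1 v1; have i22 := integrable_tensor u2 v2.
have i12 := integrable_tensor u1 v2; have i21 := integrable_tensor u2 v1.
apply: complex_ext; rewrite ?cReM ?cImM.
  transitivity (\int[(m1 \x m2)%E]_z (Re (u z.1) * Re (v z.2) - Im (u z.1) * Im (v z.2))).
    by apply: eq_Rintegral => z _; rewrite cReM.
  by rewrite RintegralB// (R_tensor _ _ u1 v1) (R_tensor _ _ u2 v2).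
transitivity (\int[(m1 \x m2)%E]_z (Re (u z.1) * Im (v z.2) + Im (u z.1) * Re (v z.2))).
  by apply: eq_Rintegral => z _; rewrite cImM.
by rewrite RintegralD// (R_tensor _ _ u1 v2) (R_tensor _ _ u2 v1).
Qed.

End cint_fubini.

Section cint_change_of_variables.
Context {R : realType} {n : nat}.
Local Notation V := 'cV[R]_n.
Local Notation mu := (@lebesgue_cV R n).
Local Notation C := R[i].

Variables (phi : V -> V) (c : R).
Hypothesis mphi : measurable_fun setT phi.
Hypothesis c_gt0 : 0 < c.
Hypothesis sphi : scales_measure phi c.

(** If the positive or the negative part of [f] has infinite integral, [fine] returns 0 on both
    sides, so the identity holds for every measurable function. *)
Lemma Rintegral_scales (f : V -> R) : measurable_fun setT f ->
  \int[mu]_x f (phi x) = c * \int[mu]_x f x.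
Proof.
move=> mf.
have mEf : measurable_fun setT (EFin \o f) by exact/measurable_EFinP.
have key (a b : \bar R) : (0 <= a)%E -> (0 <= b)%E ->
    fine (c%:E * a - c%:E * b)%E = c * fine (a - b)%E.
  case: a => [a| |] //; case: b => [b| |] //= _ _.
  - by rewrite mulrBr.
  - by rewrite gt0_muley ?lte_fin//= mulr0.
  - by rewrite gt0_muley ?lte_fin//= mulr0.
  - by rewrite gt0_muley ?lte_fin//= mulr0.
have E1 : (\int[mu]_x (fun y => (f (phi y))%:E)^\+ x = c%:E * \int[mu]_x (EFin \o f)^\+ x)%E.
  rewrite -(sphi (measurable_funepos mEf)); last by move=> x; exact: funepos_ge0.
  by apply: eq_integral => x _; rewrite !funeposE.
have E2 : (\int[mu]_x (fun y => (f (phi y))%:E)^\- x = c%:E * \int[mu]_x (EFin \o f)^\- x)%E.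
  rewrite -(sphi (measurable_funeneg mEf)); last by move=> x; exact: funeneg_ge0.
  by apply: eq_integral => x _; rewrite !funenegE.
transitivity (fine (\int[mu]_x (fun y => (f (phi y))%:E)^\+ x - \int[mu]_x (fun y => (f (phi y))%:E)^\- x)%E).
  by rewrite /Rintegral integralE.
rewrite E1 E2 key; [|exact: integral_ge0|exact: integral_ge0].
by rewrite /Rintegral [in RHS]integralE.
Qed.

Lemma integrable_scales (f : V -> R) : mu.-integrable setT (EFin \o f) ->
  mu.-integrable setT (EFin \o (fun x => f (phi x))).
Proof.
move=> /integrableP[mf fo]; apply/integrableP; split.
  exact: (measurableT_comp mf mphi).
rewrite (sphi (f := fun x => `|(EFin \o f) x|%E)) ?lte_mul_pinfty// ?lee_fin ?ltW//.
exact: measurableT_comp.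
Qed.

Lemma cint_scales (f : V -> C) : cmeasurable f ->
  cint mu (fun x => f (phi x)) = (c%:C)%C * cint mu f.
Proof.
move=> [mf1 mf2]; apply: complex_ext; rewrite ?cReM ?cImM/= ?mul0r ?subr0 ?addr0.
  exact: (@Rintegral_scales (fun x => complex.Re (f x))).
exact: (@Rintegral_scales (fun x => complex.Im (f x))).
Qed.

Lemma cintegrable_scales (f : V -> C) : cintegrable mu f ->
  cintegrable mu (fun x => f (phi x)).
Proof.
move=> [f1 f2]; split.
  exact: (@integrable_scales (fun x => complex.Re (f x))).
exact: (@integrable_scales (fun x => complex.Im (f x))).
Qed.

End cint_change_of_variables.

Section bounded_support.
Context {R : realType}.
Local Notation V n := 'cV[R]_n.
Local Notation mu n := (@lebesgue_cV R n).
Lemma ball_le_cbox n (r : R) :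
  [set x : V n | `|x| <= r] `<=` cbox (const_mx (- r)) (const_mx r).
Proof. by move=> x /= xr i; rewrite !mxE -ler_norml (le_trans (cV_norm_le x i)). Qed.

Lemma integrable_bounded_support n (f : V n -> R) (r M : R) :
  measurable_fun setT f -> (forall x, `|f x| <= M) ->
  (forall x, r < `|x| -> f x = 0) ->
  (mu n).-integrable setT (EFin \o f).
Proof.
move=> mf fM f0.
pose B : set (V n) := cbox (const_mx (- r)) (const_mx r).
have mB : measurable B by exact: measurable_cbox.
have : (mu n).-integrable B (EFin \o f).
  apply: measurable_bounded_integrable => //.
  - exact: lebesgue_cV_cbox_lty.
  - exact: measurable_funTS.
  by exists M; split; rewrite ?num_real// => y My x _; exact: le_trans (fM x) (ltW My).
move=> /(integrable_mkcond _ mB); congr (_.-integrable _ _).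
apply/funext => x; rewrite patchE; case: ifPn => // xB.
rewrite /= f0// ltNge; apply: contra xB => xr; rewrite inE; exact: ball_le_cbox.
Qed.

End bounded_support.

(** * Smooth functions *)

Section Ck.
Context {R : realType}.
Implicit Types V W : normedModType R.

(* All directional derivatives are required, so that composition with affine
   maps needs no chain rule. *)
Fixpoint Ck V (m : nat) (f : V -> R) : Prop :=
  continuous f /\
  if m is m'.+1 then
    forall v : V, exists df : V -> R, (forall x, is_derive x v f (df x)) /\ Ck m' df
  else True.

Definition Cinf V (f : V -> R) := forall m, Ck m f.

Lemma Ck_continuous V m (f : V -> R) : Ck m f -> continuous f.
Proof. by case: m => [|m] []. Qed.

Lemma Cinf_continuous V (f : V -> R) : Cinf f -> continuous f.
Proof. by move=> /(_ 0%N) []. Qed.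

Lemma CkW V m (f : V -> R) : Ck m.+1 f -> Ck m f.
Proof.
elim: m f => [|m IH] f [cf Hf]; first by split.
by split=> // v; have [df [H1 H2]] := Hf v; exists df; split=> //; exact: IH.
Qed.

(** Restriction to a line turns directional derivatives on any normed space into derivatives on the
    reals, where the chain rule is available. *)
Lemma is_derive_line V (f : V -> R) x v d :
  is_derive (0 : R) 1 (fun t => f (t *: v + x)) d <-> is_derive x v f d.
Proof.
have E : (fun h : R => h^-1 *: ((f \o shift x) (h *: v) - f x)) =
    (fun h : R => h^-1 *: (((fun t => f (t *: v + x)) \o shift (0 : R)) (h *: (1 : R)) -
      f ((0 : R) *: v + x))).
  by apply/funext => h /=; rewrite addr0 scale0r add0r [h *: 1]mulr1.
split=> [[H1 H2]|[H1 H2]].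
  by split; rewrite /derivable /derive E.
by split; rewrite /derivable /derive -E.
Qed.

Lemma Cinf_derive V (f : V -> R) v : Cinf f ->
  (forall x, derivable f x v) /\ Cinf (fun x => 'D_v f x).
Proof.
move=> Hf; split=> [x|m].
  by have [_ /(_ v)[df [/(_ x)[]]]] := Hf 1%N.
have [_ /(_ v)[df [H1 H2]]] := Hf m.+1.
by rewrite (_ : (fun x => _) = df)//; apply/funext => x; have [_ ->] := H1 x.
Qed.

Lemma Ck_cst V m (c : R) : Ck m (fun _ : V => c).
Proof.
elim: m c => [|m IH] c; split=> //; try exact: cst_continuous.
move=> v; exists (fun=> 0); split=> // x; exact: is_derive_cst.
Qed.

Lemma CkD V m (f g : V -> R) : Ck m f -> Ck m g -> Ck m (fun x => f x + g x).
Proof.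
elim: m f g => [|m IH] f g [cf Hf] [cg Hg]; split=> //.
- by move=> x; apply: cvgD; [exact: cf|exact: cg].
- by move=> x; apply: cvgD; [exact: cf|exact: cg].
- move=> v; have [df [f1 f2]] := Hf v; have [dg [g1 g2]] := Hg v.
  exists (fun x => df x + dg x); split; last exact: IH.
  by move=> x; exact: is_deriveD.
Qed.

Lemma CkM V m (f g : V -> R) : Ck m f -> Ck m g -> Ck m (fun x => f x * g x).
Proof.
elim: m f g => [|m IH] f g Hf Hg; have cf := Ck_continuous Hf; have cg := Ck_continuous Hg.
  by split=> // x; apply: cvgM; [exact: cf|exact: cg].
split; first by move=> x; apply: cvgM; [exact: cf|exact: cg].
move=> v; have [df [f1 f2]] := Hf.2 v; have [dg [g1 g2]] := Hg.2 v.
exists (fun x => f x * dg x + g x * df x); split.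
  move=> x; have := f1 x; have := g1 x => G1 F1.
  exact: is_deriveM.
by apply: CkD; apply: IH => //; exact: CkW.
Qed.

Lemma CkN V m (f : V -> R) : Ck m f -> Ck m (fun x => - f x).
Proof.
move=> Hf; under eq_fun do rewrite -mulN1r; apply: CkM => //; exact: Ck_cst.
Qed.

Lemma CkB V m (f g : V -> R) : Ck m f -> Ck m g -> Ck m (fun x => f x - g x).
Proof. by move=> Hf Hg; apply: CkD => //; exact: CkN. Qed.

Lemma Ck_sum V m I (s : seq I) (F : I -> V -> R) :
  (forall i, Ck m (F i)) -> Ck m (fun x => \sum_(i <- s) F i x).
Proof.
move=> HF; elim: s => [|i s IH].
  by under eq_fun do rewrite big_nil; exact: Ck_cst.
by under eq_fun do rewrite big_cons; exact: CkD.
Qed.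

Lemma Ck_prod V m I (s : seq I) (F : I -> V -> R) :
  (forall i, Ck m (F i)) -> Ck m (fun x => \prod_(i <- s) F i x).
Proof.
move=> HF; elim: s => [|i s IH].
  by under eq_fun do rewrite big_nil; exact: Ck_cst.
by under eq_fun do rewrite big_cons; exact: CkM.
Qed.

Lemma Ck_affine V W m (L : V -> W) (f : W -> R) : continuous L ->
  (forall v, exists w, forall (t : R) x, L (t *: v + x) = t *: w + L x) ->
  Ck m f -> Ck m (f \o L).
Proof.
move=> cL HL; elim: m f => [|m IH] f [cf Hf]; split=> //;
  try by move=> x; apply: continuous_comp; [exact: cL|exact: cf].
move=> v; have [w Hw] := HL v; have [df [f1 f2]] := Hf w.
exists (df \o L); split; last exact: IH.
move=> x; apply/is_derive_line => /=.
under eq_fun do rewrite Hw.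
by apply/is_derive_line; exact: f1.
Qed.

Lemma Ck_comp V m (h : R -> R) (f : V -> R) : Ck m h -> Ck m f -> Ck m (h \o f).
Proof.
elim: m h f => [|m IH] h f Hh Hf; have ch := Ck_continuous Hh; have cf := Ck_continuous Hf;
  split=> //; try by move=> x; apply: continuous_comp; [exact: cf|exact: ch].
move=> v; have [dh [h1 h2]] := Hh.2 1; have [df [f1 f2]] := Hf.2 v.
exists (fun x => dh (f x) * df x); split.
  move=> x; apply/is_derive_line => /=.
  have H1 : is_derive (0 : R) 1 (fun t => f (t *: v + x)) (df x).
    by apply/is_derive_line.
  have H2 : is_derive (f ((0 : R) *: v + x)) 1 h (dh (f x)).
    by rewrite scale0r add0r.
  by have := @is_derive1_comp _ _ _ _ _ _ H2 H1.
by apply: CkM => //; apply: IH => //; exact: CkW.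
Qed.

Lemma Ck_inv V m (f : V -> R) : (forall x, f x != 0) -> Ck m f ->
  Ck m (fun x => (f x)^-1).
Proof.
move=> f0; elim: m => [|m IH] Hf; have cf := Ck_continuous Hf;
  split=> //; try by move=> x; apply: cvgV; [exact: f0|exact: cf].
move=> v; have [df [f1 f2]] := Hf.2 v.
have IH' := IH (CkW Hf).
exists (fun x => - ((f x)^-1 * (f x)^-1 * df x)); split.
  move=> x; have [d1 d2] := f1 x.
  split; first exact: derivableV.
  by rewrite deriveV// d2 scaleNr -exprVn expr2.
by apply: CkN; apply: CkM => //; apply: CkM.
Qed.

Lemma Ck_sqrt V m (f : V -> R) : (forall x, 0 < f x) -> Ck m f ->
  Ck m (fun x => Num.sqrt (f x)).
Proof.
move=> f0; elim: m => [|m IH] Hf; have cf := Ck_continuous Hf;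
  split=> //; try by move=> x; apply: (continuous_comp (cf x)); exact: sqrt_continuous.
move=> v; have [df [f1 f2]] := Hf.2 v.
have IH' := IH (CkW Hf).
exists (fun x => (2 * Num.sqrt (f x))^-1 * df x); split.
  move=> x; apply/is_derive_line => /=.
  have H1 : is_derive (0 : R) 1 (fun t => f (t *: v + x)) (df x).
    by apply/is_derive_line.
  have H2 : is_derive (f ((0 : R) *: v + x)) 1 (@Num.sqrt R) (2 * Num.sqrt (f x))^-1.
    by rewrite scale0r add0r; exact: is_derive1_sqrt.
  by have := @is_derive1_comp _ _ _ _ _ _ H2 H1.
apply: CkM => //; apply: Ck_inv.
  by move=> x; rewrite mulf_neq0 ?pnatr_eq0// gt_eqF// sqrtr_gt0.
by apply: CkM => //; exact: Ck_cst.
Qed.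

(** Smoothness is local: this is how lattice sums, finite near every point but by no single finite
    formula, become smooth. *)
Lemma Ck_near V m (f : V -> R) :
  (forall x : V, exists g, Ck m g /\ \forall y \near x, f y = g y) -> Ck m f.
Proof.
elim: m f => [|m IH] f Hf.
  split=> // x; have [g [[cg _] fg]] := Hf x.
  have gx : f x = g x by exact: nbhs_singleton fg.
  rewrite /continuous_at gx; apply: cvg_trans (cg x).
  by apply: near_eq_cvg; near=> y; apply/esym; near: y.
split.
  move=> x; have [g [[cg _] fg]] := Hf x.
  have gx : f x = g x by exact: nbhs_singleton fg.
  rewrite /continuous_at gx; apply: cvg_trans (cg x).
  by apply: near_eq_cvg; near=> y; apply/esym; near: y.
move=> v; exists (fun x => 'D_v f x).
have H x : exists dg, [/\ Ck m dg, derivable f x v & \forall y \near x, 'D_v f y = dg y].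
  have [g [[_ Hg] fg]] := Hf x; have [dg [g1 g2]] := Hg v.
  have [->|v0] := eqVneq v 0.
    exists (fun=> 0); split; [exact: Ck_cst|exact: derivable0|].
    by near=> y; rewrite derive0.
  exists dg; split => //.
    have [d1 _] := g1 x; apply: near_eq_derivable d1 => //.
    by near=> y; apply/esym; near: y.
  near=> y.
  have [_ <-] := g1 y.
  apply: near_eq_derive => //.
  by near: y; exact: near_join.
split=> [x|]; first by have [dg [_ d _]] := H x; exact: derivableP.
by apply: IH => x; have [dg [d1 _ d2]] := H x; exists dg.
Unshelve. all: by end_near.
Qed.

Lemma is_derive_scale (f : R -> R) (x v d : R) :
  is_derive x (1 : R) f d -> is_derive x v f (v * d).
Proof.
move=> H; apply/is_derive_line.
have H1 : is_derive (0 : R) 1 (fun t : R => t *: v + x) v.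
  by apply: is_derive_eq; rewrite addr0 scaler0 add0r [_ *: _]mulr1.
have H2 : is_derive ((0 : R) *: v + x) 1 f d by rewrite scale0r add0r.
by have := @is_derive1_comp _ f (fun t => t *: v + x) 0 d v H2 H1; rewrite mulrC.
Qed.

Lemma CkS_R m (f df : R -> R) : (forall x : R, is_derive x 1 f (df x)) -> Ck m df ->
  Ck m.+1 f.
Proof.
move=> H Hdf; split.
  move=> x; apply: differentiable_continuous; apply/derivable1_diffP.
  by have [] := H x.
move=> v; exists (fun x => v * df x); split; first by move=> x; exact: is_derive_scale.
by apply: CkM => //; exact: Ck_cst.
Qed.

Lemma Cinf_id : Cinf (@id R).
Proof.
case=> [|m]; first by split=> // x; exact: cvg_id.
by apply: (@CkS_R _ _ (fun=> 1)); exact: Ck_cst.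
Qed.

Lemma Cinf_sin_cos : Cinf (@sin R) /\ Cinf (@cos R).
Proof.
suff H m : Ck m (@sin R) /\ Ck m (@cos R) by split=> m; case: (H m).
elim: m => [|m [IH1 IH2]].
  by split; split=> //; [exact: continuous_sin|exact: continuous_cos].
split; first by apply: (@CkS_R _ _ (@cos R)).
by apply: (@CkS_R _ _ (fun x => - sin x)) => //; exact: CkN.
Qed.

(* The functions [t^-k exp(-1/t)], extended by [0] to [t <= 0], form a family
   closed under differentiation up to linear combinations. *)
Definition hexp (k : nat) (t : R) : R :=
  if 0 < t then t^-1 ^+ k * expR (- t^-1) else 0.

Lemma hexp_ge0 k t : 0 <= hexp k t.
Proof. by rewrite /hexp; case: ifPn => // t0; rewrite mulr_ge0 ?expR_ge0// exprn_ge0// invr_ge0 ltW. Qed.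

Lemma hexp_gt0 k t : 0 < t -> 0 < hexp k t.
Proof. by move=> t0; rewrite /hexp t0 mulr_gt0 ?expR_gt0// exprn_gt0// invr_gt0. Qed.

Lemma hexp_eq0 k t : t <= 0 -> hexp k t = 0.
Proof. by move=> t0; rewrite /hexp ltNge t0. Qed.

(** With s = 1/t, exp(s) is at least s^(k+1)/(k+1)!, hence the factorial. A linear bound at 0 is
    what differentiability there requires. *)
Lemma hexp_le k : exists M, forall t, hexp k t <= M * `|t|.
Proof.
exists (k.+1`!%:R) => t.
have [t0|t0] := ltP 0 t; last by rewrite hexp_eq0// mulr_ge0.
rewrite /hexp t0 gtr0_norm// expRN ler_pdivrMr ?expR_gt0// -mulrA mulrCA.
have s0 : 0 <= t^-1 by rewrite invr_ge0 ltW.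
have h : t^-1 ^+ k.+1 <= k.+1`!%:R * expR t^-1.
  rewrite mulrC -ler_pdivrMr ?ltr0n ?fact_gt0//.
  by apply: le_trans (expR_ge1Dxn k s0); rewrite lerDr.
have -> : t^-1 ^+ k = t * t^-1 ^+ k.+1 by rewrite exprS mulrA mulfV ?mul1r// gt_eqF.
by rewrite ler_pM2l.
Qed.

Lemma is_derive_hexp k (t : R) : is_derive t (1 : R) (hexp k) (hexp k.+2 t - k%:R * hexp k.+1 t).
Proof.
have [t0|t0|->] := ltgtP t 0.
- rewrite !hexp_eq0 ?ltW// mulr0 subr0.
  apply: near_eq_is_derive (is_derive_cst _ _ _); rewrite ?oner_neq0//.
  by near=> s; rewrite /cst hexp_eq0// ltW//; near: s; exact: lt_nbhsl.
- have tn : t != 0 by rewrite gt_eqF.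
  have H : is_derive t 1 (fun s : R => s^-1 ^+ k * expR (- s^-1))
      (hexp k.+2 t - k%:R * hexp k.+1 t).
    have iv : is_derive t 1 (fun s : R => s^-1) (- (t^-1 ^+ 2)).
      split; first exact: derivableV.
      by rewrite (@deriveV _ _ id)// derive_id scaleNr exprVn [_ *: _]mulr1.
    have ex : is_derive t 1 (fun s : R => expR (- s^-1)) (expR (- t^-1) * t^-1 ^+ 2).
      have in_ : is_derive t 1 (fun s : R => - s^-1) (t^-1 ^+ 2).
        by rewrite -[X in is_derive _ _ _ X]opprK; exact: is_deriveN.
      exact: (@is_derive1_comp _ _ _ _ _ _ (is_derive_expR _) in_).
    have pw : is_derive t 1 (fun s : R => s^-1 ^+ k) (k%:R * t^-1 ^+ k.-1 * - (t^-1 ^+ 2)).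
      have := @is_deriveX _ _ (fun s : R => s^-1) k t 1 _ iv.
      suff -> : (fun s : R => s^-1) ^+ k = (fun s : R => s^-1 ^+ k) by [].
      apply/funext => s; elim: (k) => // j IH; rewrite [RHS]exprS -IH.
      by rewrite [in LHS]exprS.
    have := @is_deriveM _ _ _ _ _ _ _ _ pw ex.
    move=> h; apply: is_derive_eq h _.
    rewrite /hexp t0 /GRing.scale/=; case: k {pw} => [|k]; rewrite ?exprS/=; ring.
  apply: near_eq_is_derive H; rewrite ?oner_neq0//.
  by near=> s; rewrite /hexp ifT//; near: s; exact: lt_nbhsr.
rewrite !hexp_eq0// mulr0 subr0.
have [M HM] := hexp_le k.+1.
suff H : (fun h : R => h^-1 *: ((hexp k \o shift 0) (h *: 1) - hexp k 0)) h @[h --> 0^'] --> (0 : R).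
  by split; [apply/cvg_ex; exists 0|exact/cvg_lim].
rewrite hexp_eq0//.
apply/cvgr0Pnorm_le => e e0.
near=> h.
rewrite /= addr0 subr0 [h *: 1]mulr1; change (`|h^-1 * hexp k h| <= e).
have h0 : h != 0 by near: h; exact: nbhs_dnbhs_neq.
(* The difference quotient at 0 is the next member of the family, to which the linear bound
   applies. *)
have -> : h^-1 * hexp k h = hexp k.+1 h.
  by rewrite /hexp; case: ifPn; rewrite ?mulr0// mulrA -exprS.
rewrite ger0_norm ?hexp_ge0// (le_trans (HM _))//.
have M1 : 0 < `|M| + 1 by rewrite ltr_wpDl.
apply: (@le_trans _ _ ((`|M| + 1) * `|h|)).
  by rewrite ler_wpM2r// (le_trans (ler_norm _))// lerDl.
rewrite mulrC -ler_pdivlMr//.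
near: h; apply: dnbhs0_le; exact: divr_gt0.
Unshelve. all: by end_near.
Qed.

Lemma Cinf_hexp k : Cinf (hexp k).
Proof.
move=> m; elim: m k => [|m IH] k.
  split=> // x; apply: differentiable_continuous; apply/derivable1_diffP.
  by have [] := is_derive_hexp k x.
apply: CkS_R (is_derive_hexp k) _.
by apply: CkB => //; apply: CkM => //; exact: Ck_cst.
Qed.

End Ck.

Lemma lipschitz_continuous {R : realType} (W : normedModType R) (g : W -> R) (L : R) :
  0 < L -> (forall x y, `|g x - g y| <= L * `|x - y|) -> continuous g.
Proof.
move=> L0 Hg x; apply/cvgrPdist_le => e e0.
have /cvgrPdist_le := @cvg_id W (nbhs x); move/(_ _ (divr_gt0 e0 L0)).
by apply: filterS => y; rewrite ler_pdivlMr// mulrC => h; exact: le_trans (Hg x y) h.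
Qed.

Section cV_calculus.
Context {R : realType}.
Local Notation V n := 'cV[R]_n.
Local Notation C := R[i].
Local Notation Re := (@complex.Re R).
Local Notation Im := (@complex.Im R).

Lemma cV_continuous (T : topologicalType) n (L : T -> V n) :
  (forall i, continuous (fun x => L x i 0)) -> continuous L.
Proof.
move=> H x; apply/cvgrPdist_le => e e0.
have : \forall y \near x, forall i, `|L x i 0 - L y i 0| <= e.
  apply: filter_forall => i; have /cvgrPdist_le := H i x; exact.
apply: filterS => y Hy; apply: cV_norm_leP; first exact: ltW.
by move=> i; rewrite !mxE; exact: Hy.
Qed.

Lemma continuous_coord n (i : 'I_n) : continuous (fun x : V n => x i 0).
Proof. by move=> x; exact: coord_continuous. Qed.

Lemma continuous_affine m n (P : 'M[R]_(m, n)) (b : V m) :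
  continuous (fun x : V n => P *m x + b).
Proof.
apply: cV_continuous => i x.
rewrite (_ : (fun x : V n => _) = (fun x : V n => \sum_j P i j * x j 0 + b i 0)); last first.
  by apply/funext => y; rewrite !mxE.
suff [] : Ck 0 (fun x : V n => \sum_j P i j * x j 0 + b i 0) by [].
apply: CkD; last exact: Ck_cst.
apply: Ck_sum => j; apply: CkM; first exact: Ck_cst.
by split=> //; exact: continuous_coord.
Qed.

Lemma Cinf_coord n (i : 'I_n) : Cinf (fun x : V n => x i 0).
Proof.
case=> [|m]; first by split=> //; exact: continuous_coord.
split; first exact: continuous_coord.
move=> v; exists (fun=> v i 0); split; last exact: Ck_cst.
move=> x; apply/is_derive_line.
under eq_fun do rewrite !mxE.
apply: is_derive_eq; by rewrite addr0 scaler0 add0r [_ *: _]mulr1.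
Qed.

Lemma Cinf_affine m n (P : 'M[R]_(m, n)) (b : V m) (f : V m -> R) : Cinf f ->
  Cinf (fun x => f (P *m x + b)).
Proof.
move=> Hf k; apply: (@Ck_affine _ _ _ k (fun x => P *m x + b) f (@continuous_affine _ _ P b)) => //.
by move=> v; exists (P *m v) => t x; rewrite mulmxDr -scalemxAr addrA.
Qed.

Lemma Cinf_dot n (a : V n) : Cinf (fun x : V n => dot a x).
Proof.
move=> m; apply: Ck_sum => i; apply: CkM; [exact: Ck_cst|exact: Cinf_coord].
Qed.

Lemma dotC n (x y : V n) : dot x y = dot y x.
Proof. by apply: eq_bigr => i _; rewrite mulrC. Qed.
Lemma dotDl n (x y z : V n) : dot (x + y) z = dot x z + dot y z.
Proof. by rewrite /dot -big_split/=; apply: eq_bigr => i _; rewrite mxE mulrDl. Qed.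
Lemma dotDr n (x y z : V n) : dot x (y + z) = dot x y + dot x z.
Proof. by rewrite dotC dotDl !(dotC _ x). Qed.
Lemma dotZl n (a : R) (x y : V n) : dot (a *: x) y = a * dot x y.
Proof. by rewrite /dot mulr_sumr; apply: eq_bigr => i _; rewrite mxE mulrA. Qed.
Lemma dotZr n (a : R) (x y : V n) : dot x (a *: y) = a * dot x y.
Proof. by rewrite dotC dotZl dotC. Qed.
Lemma dotNl n (x y : V n) : dot (- x) y = - dot x y.
Proof. by rewrite -scaleN1r dotZl mulN1r. Qed.
Lemma dotNr n (x y : V n) : dot x (- y) = - dot x y.
Proof. by rewrite dotC dotNl dotC. Qed.
Lemma dot0l n (y : V n) : dot 0 y = 0.
Proof. by rewrite /dot big1// => i _; rewrite mxE mul0r. Qed.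
Lemma dotBl n (x y z : V n) : dot (x - y) z = dot x z - dot y z.
Proof. by rewrite dotDl dotNl. Qed.
Lemma dotBr n (x y z : V n) : dot x (y - z) = dot x y - dot x z.
Proof. by rewrite dotDr dotNr. Qed.
Lemma dot_mulmx n (P : 'M[R]_n) (x y : V n) : dot (P *m x) y = dot x (P^T *m y).
Proof.
rewrite /dot; under eq_bigr do rewrite mxE mulr_suml.
under [RHS]eq_bigr do rewrite mxE mulr_sumr.
rewrite exchange_big/=; apply: eq_bigr => i _; apply: eq_bigr => j _.
by rewrite mxE mulrCA mulrA.
Qed.

Definition csmooth n (f : V n -> C) :=
  Cinf (fun x => Re (f x)) /\ Cinf (fun x => Im (f x)).

Section csmooth.
Context {n : nat}.
Implicit Types f g : V n -> C.

Lemma csmooth_cst (c : C) : csmooth (fun _ : V n => c).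
Proof. by split=> m; exact: Ck_cst. Qed.

Lemma csmoothD f g : csmooth f -> csmooth g -> csmooth (fun x => f x + g x).
Proof.
move=> [f1 f2] [g1 g2]; split=> m.
  by under eq_fun do rewrite cReD; exact: CkD.
by under eq_fun do rewrite cImD; exact: CkD.
Qed.

Lemma csmoothM f g : csmooth f -> csmooth g -> csmooth (fun x => f x * g x).
Proof.
move=> [f1 f2] [g1 g2]; split=> m.
  by under eq_fun do rewrite cReM; apply: CkB; exact: CkM.
by under eq_fun do rewrite cImM; apply: CkD; exact: CkM.
Qed.

Lemma csmoothN f : csmooth f -> csmooth (fun x => - f x).
Proof.
move=> [f1 f2]; split=> m.
  by under eq_fun do rewrite cReN; exact: CkN.
by under eq_fun do rewrite cImN; exact: CkN.
Qed.

Lemma csmoothB f g : csmooth f -> csmooth g -> csmooth (fun x => f x - g x).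
Proof. by move=> Hf Hg; apply: csmoothD => //; exact: csmoothN. Qed.

Lemma csmooth_conj f : csmooth f -> csmooth (fun x => conjc (f x)).
Proof.
move=> [f1 f2]; split=> m.
  by under eq_fun do rewrite cRe_conj; exact: f1.
by under eq_fun do rewrite cIm_conj; exact: CkN.
Qed.

Lemma csmooth_sum I (s : seq I) (F : I -> V n -> C) :
  (forall i, csmooth (F i)) -> csmooth (fun x => \sum_(i <- s) F i x).
Proof.
move=> HF; elim: s => [|i s IH].
  by under eq_fun do rewrite big_nil; exact: csmooth_cst.
by under eq_fun do rewrite big_cons; exact: csmoothD.
Qed.

Lemma csmooth_real (f : V n -> R) : Cinf f -> csmooth (fun x => (f x)%:C%C).
Proof. by move=> Hf; split=> //= m; exact: Ck_cst. Qed.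

Lemma csmooth_cis (f : V n -> R) : Cinf f -> csmooth (fun x => cis (f x)).
Proof.
move=> Hf; have [s c] := @Cinf_sin_cos R.
by split=> m /=; [exact: (Ck_comp (c m) (Hf m))|exact: (Ck_comp (s m) (Hf m))].
Qed.

Lemma csmooth_affine (P : 'M[R]_n) (b : V n) f : csmooth f ->
  csmooth (fun x => f (P *m x + b)).
Proof.
move=> [f1 f2]; split.
  exact: (@Cinf_affine _ _ P b (fun x => Re (f x))).
exact: (@Cinf_affine _ _ P b (fun x => Im (f x))).
Qed.

Lemma csmooth_mulmx (P : 'M[R]_n) f : csmooth f -> csmooth (fun x => f (P *m x)).
Proof.
by move=> /(csmooth_affine P 0); under eq_fun do rewrite addr0.
Qed.

Lemma csmooth_translate (b : V n) f : csmooth f -> csmooth (fun x => f (x + b)).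
Proof.
by move=> /(csmooth_affine 1%:M b); under eq_fun do rewrite mul1mx.
Qed.

Lemma csmooth_near f :
  (forall x : V n, exists g, csmooth g /\ \forall y \near x, f y = g y) -> csmooth f.
Proof.
move=> H; split=> m; apply: Ck_near => x; have [g [[g1 g2] gf]] := H x.
  exists (fun x => Re (g x)); split; first exact: g1.
  by apply: filterS gf => y ->.
exists (fun x => Im (g x)); split; first exact: g2.
by apply: filterS gf => y ->.
Qed.

Lemma csmooth_partial i f : csmooth f -> csmooth (partial i f).
Proof.
move=> [f1 f2]; split=> /=.
  by have [_] := Cinf_derive (basis_vector i) f1.
by have [_] := Cinf_derive (basis_vector i) f2.
Qed.

Lemma csmooth_partials (s : seq 'I_n) f : csmooth f -> csmooth (partials s f).
Proof. by move=> Hf; elim: s => // i s IH; exact: csmooth_partial. Qed.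

Lemma csmooth_smooth f : csmooth f -> smooth f.
Proof.
move=> Hf s; have [f1 f2] := csmooth_partials s Hf; split.
- exact: Cinf_continuous.
- exact: Cinf_continuous.
- move=> i x; split.
    by have [+ _] := Cinf_derive (basis_vector i) f1; apply.
  by have [+ _] := Cinf_derive (basis_vector i) f2; apply.
Qed.

Lemma csmooth_measurable f : csmooth f -> cmeasurable f.
Proof.
by move=> [f1 f2]; split; apply: continuous_measurable; exact: Cinf_continuous.
Qed.

End csmooth.

(** Support in a ball rather than a compact closed support: the radius is what makes lattice sums
    finite. With it, [testfun] is the space of smooth compactly supported functions. *)
Definition bsupp (T : nmodType) n (f : V n -> T) :=
  exists r, forall x, r < `|x| -> f x = 0.

Definition testfun n (f : V n -> C) := csmooth f /\ bsupp f.

Lemma bsupp_ge0 (T : nmodType) n (f : V n -> T) : bsupp f ->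
  exists2 r, 0 < r & forall x, r < `|x| -> f x = 0.
Proof.
move=> [r H]; exists (Num.max r 1); first by rewrite lt_max ltr01 orbT.
by move=> x; rewrite gt_max => /andP[h _]; exact: H.
Qed.

(** Heine-Borel for row vectors, transported by transposition. *)
Lemma cV_bounded_closed_compact n (A : set (V n)) : bounded_set A -> closed A -> compact A.
Proof.
move=> bA cA.
pose tr : 'rV[R]_n -> V n := fun x => x^T.
have ctr : continuous tr.
  apply: cV_continuous => i x; rewrite /tr; under eq_fun do rewrite mxE.
  exact: coord_continuous.
have -> : A = tr @` (tr @^-1` A).
  apply/seteqP; split=> [x Ax|_ [x Ax <-]] //.
  by exists x^T; rewrite /tr/= trmxK.
apply: continuous_compact; first exact: continuous_subspaceT.
apply: bounded_closed_compact.
  case: bA => M [Mr HM]; exists M; split=> // y My x /= Ax.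
  have h : `|x^T| <= y := HM y My _ Ax.
  apply: le_trans h; rewrite [leLHS]mx_normrE; apply/bigmax_leP; split=> // -[i j] _ /=.
  by rewrite (ord1 i); have := cV_norm_le x^T j; rewrite mxE.
exact: (proj1 (continuous_closedP _) ctr).
Qed.

Lemma cV_cball_compact n (r : R) : compact [set x : V n | `|x| <= r].
Proof.
apply: cV_bounded_closed_compact.
  by exists r; split; rewrite ?num_real// => y ry x /= xr; exact: le_trans xr (ltW ry).
apply: (@closed_comp _ _ _ [set y : R | y <= r]).
  by move=> x _; exact: norm_continuous.
exact: closed_le.
Qed.

Lemma continuous_bsupp_bounded n (f : V n -> R) : continuous f -> bsupp f ->
  exists2 M, 0 < M & forall x, `|f x| <= M.
Proof.
move=> cf /bsupp_ge0[r r0 Hr].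
have [M [_ HM]] : bounded_set (f @` [set x : V n | `|x| <= r]).
  apply: compact_bounded; apply: continuous_compact; last exact: cV_cball_compact.
  exact: continuous_subspaceT.
exists (Num.max (M + 1) 1); first by rewrite lt_max ltr01 orbT.
move=> x; have [xr|xr] := leP `|x| r.
  by rewrite le_max; apply/orP; left; apply: (HM (M + 1)); [rewrite ltrDl|exists x].
by rewrite Hr// normr0 le_max ler01 orbT.
Qed.

Lemma testfun_bounded n (f : V n -> C) : testfun f -> exists2 M, 0 < M & forall x, normc (f x) <= M.
Proof.
move=> [[f1 f2] [r fr]].
have b1 : bsupp (fun x => Re (f x)) by exists r => x /fr ->.
have b2 : bsupp (fun x => Im (f x)) by exists r => x /fr ->.
have [M1 M10 H1] := continuous_bsupp_bounded (Cinf_continuous f1) b1.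
have [M2 M20 H2] := continuous_bsupp_bounded (Cinf_continuous f2) b2.
exists (M1 + M2); first exact: addr_gt0.
by move=> x; apply: le_trans (normc_le _) _; apply: lerD.
Qed.

Lemma testfun_integrable n (f : V n -> C) : testfun f -> cintegrable (@lebesgue_cV R n) f.
Proof.
move=> tf; have [M M0 HM] := testfun_bounded tf.
have [sf [r fr]] := tf; have [m1 m2] := csmooth_measurable sf.
split.
  apply: (integrable_bounded_support m1 (r := r) (M := M)) => [x|x /fr -> //].
  exact: le_trans (normc_Re _) (HM x).
apply: (integrable_bounded_support m2 (r := r) (M := M)) => [x|x /fr -> //].
exact: le_trans (normc_Im _) (HM x).
Qed.

Section testfun.
Context {n : nat}.
Implicit Types f g : V n -> C.

Lemma testfun0 : testfun (fun _ : V n => 0 : C).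
Proof. by split; [exact: csmooth_cst|exists 0]. Qed.

Lemma testfunD f g : testfun f -> testfun g -> testfun (fun x => f x + g x).
Proof.
move=> [f1 [r fr]] [g1 [s gs]]; split; first exact: csmoothD.
by exists (Num.max r s) => x; rewrite gt_max => /andP[/fr -> /gs ->]; rewrite addr0.
Qed.

Lemma testfunMl f g : csmooth f -> testfun g -> testfun (fun x => f x * g x).
Proof.
move=> f1 [g1 [s gs]]; split; first exact: csmoothM.
by exists s => x /gs ->; rewrite mulr0.
Qed.

Lemma testfunMr f g : testfun f -> csmooth g -> testfun (fun x => f x * g x).
Proof. by move=> Hf Hg; under eq_fun do rewrite mulrC; exact: testfunMl. Qed.

Lemma testfunN f : testfun f -> testfun (fun x => - f x).
Proof. by move=> [f1 [r fr]]; split; [exact: csmoothN|exists r => x /fr ->; rewrite oppr0]. Qed.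

Lemma testfunB f g : testfun f -> testfun g -> testfun (fun x => f x - g x).
Proof. by move=> Hf Hg; apply: testfunD => //; exact: testfunN. Qed.

Lemma testfun_conj f : testfun f -> testfun (fun x => conjc (f x)).
Proof.
by move=> [f1 [r fr]]; split; [exact: csmooth_conj|exists r => x /fr ->; exact: conjc0].
Qed.

Lemma testfun_sum I (s : seq I) (F : I -> V n -> C) :
  (forall i, testfun (F i)) -> testfun (fun x => \sum_(i <- s) F i x).
Proof.
move=> HF; elim: s => [|i s IH].
  by under eq_fun do rewrite big_nil; exact: testfun0.
by under eq_fun do rewrite big_cons; exact: testfunD.
Qed.

Lemma mulmx_norm_le (P : 'M[R]_n) : exists2 c, 0 < c & forall x : V n, `|P *m x| <= c * `|x|.
Proof.
exists (1 + \sum_i \sum_j `|P i j|).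
  by rewrite ltr_pwDl// sumr_ge0// => i _; rewrite sumr_ge0.
move=> x; have S0 : 0 <= \sum_i \sum_j `|P i j| by rewrite sumr_ge0// => i _; rewrite sumr_ge0.
apply: cV_norm_leP; first by rewrite mulr_ge0// addr_ge0.
move=> i; rewrite mxE; apply: le_trans (ler_norm_sum _ _ _) _.
apply: (@le_trans _ _ (\sum_j `|P i j| * `|x|)).
  by apply: ler_sum => j _; rewrite normrM ler_wpM2l// cV_norm_le.
rewrite -mulr_suml ler_wpM2r//.
rewrite [X in _ <= _ + X](bigD1 i)//= addrCA lerDl addr_ge0// sumr_ge0// => k _; exact: sumr_ge0.
Qed.

Lemma testfun_affine (P : 'M[R]_n) (b : V n) f : P \in unitmx -> testfun f ->
  testfun (fun x => f (P *m x + b)).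
Proof.
move=> uP [f1 /bsupp_ge0[r r0 fr]]; split; first exact: csmooth_affine.
have [c c0 Hc] := mulmx_norm_le (invmx P).
exists (c * (r + `|b|)) => x Hx; apply: fr.
have xE : x = invmx P *m (P *m x) by rewrite mulKmx.
have : `|x| <= c * `|P *m x| by rewrite {1}xE.
move=> h; have : r + `|b| < `|P *m x| by rewrite -(ltr_pM2l c0); exact: lt_le_trans Hx h.
rewrite -ltrBrDr => /lt_le_trans; apply.
by rewrite lerBlDr -{1}[P *m x](addrK b); exact: ler_normB.
Qed.

Lemma testfun_partial i f : testfun f -> testfun (partial i f).
Proof.
move=> [f1 [r fr]]; split; first exact: csmooth_partial.
exists r => x rx.
have H : \forall y \near x, f y = 0.
  have : \forall y \near x, r < `|y|.
    by have /cvgr_gt := @norm_continuous R (V n) x; apply.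
  by apply: filterS => y /fr.
rewrite /partial; apply: complex_ext => /=.
  rewrite (near_eq_derive (g := cst 0)) ?derive_cst//.
  by apply: filterS H => y ->.
rewrite (near_eq_derive (g := cst 0)) ?derive_cst//.
by apply: filterS H => y ->.
Qed.

End testfun.

Lemma bounded_coord_is_derive (g dg : R -> R) (B : R) :
  (forall t : R, is_derive t (1 : R) g (dg t)) -> (forall t, `|dg t| <= B) ->
  forall s t, `|g s - g t| <= B * `|s - t|.
Proof.
move=> Hg HB s t; wlog st : s t / t <= s.
  move=> W; have [/W //|/ltW/W] := leP t s.
  by rewrite distrC [X in _ -> _ <= _ * X]distrC.
have cg : {within `[t, s], continuous g}.
  apply: continuous_subspaceT => x; apply: differentiable_continuous.
  by apply/derivable1_diffP; have [] := Hg x.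
have [c _ ->] := MVT_segment st (fun x _ => Hg x) cg.
by rewrite normrM ler_wpM2r.
Qed.

(** The path from [y] to [x] changes one coordinate at a time, [z k] having the first [k]
    coordinates of [x]; each leg is a mean value estimate in one variable. *)
Lemma lipschitz_of_bounded_partials n (f : V n -> R) (B : R) : Cinf f ->
  (forall i x, `|'D_(basis_vector i) f x| <= B) -> 0 <= B ->
  forall x y, `|f x - f y| <= B * n%:R * `|x - y|.
Proof.
move=> sf HB B0 x y.
pose z k : V n := \col_i (if (i < k)%N then x i 0 else y i 0).
have z0 : z 0%N = y by apply/colP => i; rewrite mxE.
have zn : z n = x by apply/colP => i; rewrite mxE ltn_ord.
suff H k : (k <= n)%N -> `|f (z k) - f y| <= B * k%:R * `|x - y|.
  by have := H n (leqnn n); rewrite zn.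
elim: k => [|k IH] kn; first by rewrite z0 subrr normr0 mulr0 mul0r.
have step : `|f (z k.+1) - f (z k)| <= B * `|x - y|.
  pose i := Ordinal kn.
  pose g t := f (t *: basis_vector i + (z k - y i 0 *: basis_vector i)).
  have dg (t : R) : is_derive t (1 : R) g ('D_(basis_vector i) f (t *: basis_vector i + (z k - y i 0 *: basis_vector i))).
    apply/is_derive_line => /=.
    rewrite /g.
    have := Cinf_derive (basis_vector i) sf => -[D _].
    have /derivableP/is_derive_line := D (t *: basis_vector i + (z k - y i 0 *: basis_vector i)).
    congr (is_derive _ _ _ _); apply/funext => h; congr f.
    by rewrite [h *: 1]mulr1 scalerDl addrA.
  have E1 : f (z k.+1) = g (x i 0).
    congr f; apply/colP => j; rewrite !mxE !andbT.
    have [->|ji] := eqVneq j i; first by rewrite /= ltnSn ltnn; lra.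
    have -> : (j < k.+1)%N = (j < k)%N.
      by rewrite ltnS leq_eqVlt; have -> : (j == k :> nat) = false by apply: contra_neqF ji => /eqP h; exact: val_inj.
    by rewrite /= !mulr0 oppr0 addr0 add0r.
  have E2 : f (z k) = g (y i 0).
    by congr f; rewrite addrCA subrr addr0.
  rewrite E1 E2; apply: le_trans (bounded_coord_is_derive dg _ _ _) _.
    by move=> t; exact: HB.
  by rewrite ler_wpM2l//; have := cV_norm_le (x - y) i; rewrite !mxE.
rewrite -[f (z k.+1)](subrK (f (z k))) -addrA; apply: le_trans (ler_normD _ _) _.
rewrite -natr1 mulrDr mulr1 mulrDl [leRHS]addrC; apply: lerD => //.
exact: IH (ltnW kn).
Qed.

End cV_calculus.

(** * Lattice sums *)

Section lattice_sums.
Context {R : realType} {n : nat}.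
Local Notation V := 'cV[R]_n.
Local Notation C := R[i].
Local Notation Z := 'cV[int]_n.

Definition zvec (k : Z) : V := map_mx intr k.

Lemma zvecD (k l : Z) : zvec (k + l) = zvec k + zvec l.
Proof. by apply/colP => i; rewrite !mxE intrD. Qed.
Lemma zvecN (k : Z) : zvec (- k) = - zvec k.
Proof. by apply/colP => i; rewrite !mxE intrN. Qed.
Lemma zvec0 : zvec 0 = 0.
Proof. by apply/colP => i; rewrite !mxE. Qed.
Lemma zvecB (k l : Z) : zvec (k - l) = zvec k - zvec l.
Proof. by rewrite zvecD zvecN. Qed.
Lemma zvec_inj : injective zvec.
Proof. by move=> k l /colP H; apply/colP => i; have := H i; rewrite !mxE => /intr_inj. Qed.

Lemma int_latticeP (x : V) : int_lattice x <-> exists k, x = zvec k.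
Proof.
split=> [H|[k ->] i]; last by rewrite mxE intr_int.
exists (\col_i Num.floor (x i 0)); apply/colP => i; rewrite !mxE.
by apply/esym/eqP; rewrite -intrEfloor; exact: H.
Qed.

Lemma finite_int_ball (M : nat) : finite_set [set k : Z | forall i, (`|k i 0%R| <= M)%N].
Proof.
pose g (f : {ffun 'I_n -> 'I_(M + M).+1}) : Z := \col_i ((f i)%:Z - M%:Z).
apply: (@sub_finite_set _ _ (g @` setT)); last exact: finite_image.
move=> k Hk; exists [ffun i => inord `|(k i 0%R + M%:Z)%R|%N] => //.
apply/colP => i; rewrite mxE ffunE.
have := Hk i => h; rewrite inordK; lia.
Qed.

(** One finite set [s] serves every function supported in the ball of radius [r], every [x] near
    [x0] and every index set [S]. This uniformity lets smoothness, linearity and interchange of sums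
    be proved on finite sums. *)
Lemma lattice_sum_local (r : R) (x0 : V) : exists2 s : seq Z, uniq s &
  forall (T : nmodType) (F : V -> T), (forall x, r < `|x| -> F x = 0) ->
  forall x, `|x - x0| <= 1 -> forall S : set Z,
  \sum_(k \in S) F (x + zvec k) = \sum_(k <- s | k \in S) F (x + zvec k).
Proof.
pose M := (Num.truncn (`|r| + `|x0| + 1)).+1.
have MM : `|r| + `|x0| + 1 < M%:R by exact: truncnS_gt.
have fM := finite_int_ball M.
exists (finmap.enum_fset (fset_set [set k : Z | forall i, (`|k i 0%R| <= M)%N])); first exact: finmap.fset_uniq.
move=> T F Fr x xx0 S.
rewrite [RHS]bigfs ?finmap.fset_uniq//=; last first.
  move=> k _; rewrite in_fset_set// => /negP; rewrite inE => /existsNP[i /negP].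
  rewrite -ltnNge => Mk; apply: Fr.
  have h1 : M%:R <= `|zvec k|.
    apply: le_trans (cV_norm_le _ i); rewrite mxE -intr_norm -abszE.
    by rewrite -[X in _ <= X]/((`|k i 0%R|%N)%:R) ler_nat ltnW.
  have h2 : `|x| <= `|x0| + 1.
    by rewrite -[x](subrK x0) addrC (le_trans (ler_normD _ _))// lerD2l.
  have h3 : `|zvec k| <= `|x + zvec k| + `|x|.
    by rewrite -{1}(addKr x (zvec k)) addrC (le_trans (ler_normD _ _))// normrN.
  have h4 : r <= `|r| := ler_norm r.
  lra.
by apply: eq_fsbigl; apply/seteqP; split=> k /=; rewrite inE.
Qed.

(** The lattices of periods that occur, Z^n and the duals of lattices containing it, all lie in Z^n,
    hence the integer indices. A sum with infinitely many nonzero terms takes the default value 0,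
    so finiteness has to come from [bsupp]. *)
Definition psum (T : nmodType) (S : set Z) (F : V -> T) (x : V) : T :=
  \sum_(k \in S) F (x + zvec k).

Lemma psum_shift (T : nmodType) (S : set Z) (F : V -> T) (x : V) (h : Z) :
  (forall k, S k <-> S (k + h)) -> psum S F (x + zvec h) = psum S F x.
Proof.
move=> Sh; rewrite /psum [RHS](reindex_fsbig (fun k : Z => k + h) S S).
  by apply: eq_fsbigr => k _; rewrite zvecD (addrC (zvec k)) addrA.
split; first by move=> k /Sh.
  by move=> k l _ _ /addIr.
by move=> k Sk; exists (k - h); rewrite ?subrK//; apply/Sh; rewrite subrK.
Qed.

Lemma psum_local (T : nmodType) (S : set Z) (F : V -> T) (x0 : V) : bsupp F ->
  exists s : seq Z, uniq s /\ forall x, `|x - x0| <= 1 ->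
    psum S F x = \sum_(k <- s | k \in S) F (x + zvec k).
Proof.
by move=> [r Fr]; have [s us H] := lattice_sum_local r x0; exists s; split=> // x xx0; exact: H.
Qed.

Lemma near_ball1 (x0 : V) : \forall x \near x0, `|x - x0| <= 1.
Proof.
have /cvgrPdist_le := @cvg_id _ (nbhs x0); move/(_ _ ltr01).
by apply: filterS => x; rewrite distrC.
Qed.

Lemma csmooth_psum (S : set Z) (F : V -> C) : testfun F -> csmooth (psum S F).
Proof.
move=> [sF bF]; apply: csmooth_near => x0.
have [s [_ H]] := psum_local S x0 bF.
exists (fun x => \sum_(k <- s) (if k \in S then F (x + zvec k) else 0)); split.
  apply: csmooth_sum => k; case: (k \in S); first exact: csmooth_translate.
  exact: csmooth_cst.
by apply: filterS (near_ball1 x0) => x /H ->; rewrite big_mkcond.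
Qed.

Lemma Cinf_psum (S : set Z) (F : V -> R) : Cinf F -> bsupp F -> Cinf (psum S F).
Proof.
move=> sF bF m; apply: Ck_near => x0.
have [s [_ H]] := psum_local S x0 bF.
exists (fun x => \sum_(k <- s) (if k \in S then F (x + zvec k) else 0)); split.
  apply: Ck_sum => k; case: (k \in S); last exact: Ck_cst.
  have := Cinf_affine 1%:M (zvec k) sF m.
  by under eq_fun do rewrite mul1mx.
by apply: filterS (near_ball1 x0) => x /H ->; rewrite big_mkcond.
Qed.

Definition zperiodic (T : Type) (F : V -> T) := forall x k, F (x + zvec k) = F x.

Lemma zperiodic_reduce (x : V) : exists k : Z, `|x + zvec k| <= 1.
Proof.
exists (\col_i - Num.floor (x i 0)).
apply: cV_norm_leP => // i; rewrite !mxE intrN.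
have h1 := floor_le (x i 0); have h2 := floorD1_gt (x i 0).
by rewrite intrD in h2; rewrite ger0_norm; lra.
Qed.

Lemma zperiodic_bounded (f : V -> R) : continuous f -> zperiodic f ->
  exists2 M, 0 < M & forall x, `|f x| <= M.
Proof.
move=> cf pf.
have [M [_ HM]] : bounded_set (f @` [set x : V | `|x| <= 1]).
  apply: compact_bounded; apply: continuous_compact; last exact: cV_cball_compact.
  exact: continuous_subspaceT.
exists (Num.max (M + 1) 1); first by rewrite lt_max ltr01 orbT.
move=> x; have [k xk] := zperiodic_reduce x.
rewrite -(pf x k) le_max; apply/orP; left; apply: (HM (M + 1)); first by rewrite ltrDl.
by exists (x + zvec k).
Qed.

Lemma zperiodic_lipschitz (f : V -> R) : Cinf f -> zperiodic f ->
  exists2 L, 0 < L & forall x y, `|f x - f y| <= L * `|x - y|.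
Proof.
move=> sf pf.
have H (i : 'I_n) : exists2 M, 0 < M & forall x, `|'D_(basis_vector i) f x| <= M.
  have [_ s1] := Cinf_derive (basis_vector i) sf.
  apply: zperiodic_bounded; first exact: Cinf_continuous s1.
  move=> x k; rewrite /derive (_ : (fun h => _) =
    (fun h : R => h^-1 *: ((f \o shift x) (h *: basis_vector i) - f x)))//.
  by apply/funext => h /=; rewrite addrA !pf.
have /choice[M HM] : forall i : 'I_n, exists M : R, 0 < M /\ forall x, `|'D_(basis_vector i) f x| <= M.
  by move=> i; have [M] := H i; exists M.
pose B := 1 + \sum_i M i.
have sM0 : 0 <= \sum_i M i by apply: sumr_ge0 => i _; exact: ltW (HM i).1.
exists (B * n%:R + 1); first by rewrite ltr_wpDl// mulr_ge0// addr_ge0.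
move=> x y; apply: le_trans (lipschitz_of_bounded_partials (B := B) sf _ _ x y) _.
- move=> i z; apply: le_trans ((HM i).2 z) _.
  rewrite /B (bigD1 i)//= addrCA lerDl addr_ge0// sumr_ge0// => j _; exact: ltW (HM j).1.
- by rewrite addr_ge0.
- by rewrite ler_wpM2r// lerDl.
Qed.

End lattice_sums.

(** * The Fourier transform *)

Section fourier.
Context {R : realType} {n : nat}.
Local Notation V := 'cV[R]_n.
Local Notation C := R[i].
Local Notation mu := (@lebesgue_cV R n).
Local Notation Re := (@complex.Re R).
Local Notation Im := (@complex.Im R).
Implicit Types f g : V -> C.

Lemma fourierE (f : V -> C) xi :
  fourier f xi = cint mu (fun x => f x * cis (- (2 * pi * dot x xi))).
Proof. by []. Qed.

Lemma Cinf_phase (xi : V) : Cinf (fun x : V => - (2 * pi * dot x xi)).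
Proof.
move=> m; apply: CkN; apply: CkM; first exact: Ck_cst.
by under eq_fun do rewrite dotC; exact: Cinf_dot.
Qed.

Lemma csmooth_phase (xi : V) : csmooth (fun x : V => cis (- (2 * pi * dot x xi))).
Proof. by apply: csmooth_cis; exact: Cinf_phase. Qed.

Lemma cmeasurable_phase (xi : V) : cmeasurable (fun x : V => cis (- (2 * pi * dot x xi))).
Proof. by apply: csmooth_measurable; exact: csmooth_phase. Qed.

Lemma cintegrable_phase (f : V -> C) xi : cintegrable mu f ->
  cintegrable mu (fun x => f x * cis (- (2 * pi * dot x xi))).
Proof.
move=> fi; apply: (cintegrable_bounded (M := 1)) => //; first exact: cmeasurable_phase.
by move=> x; rewrite normc_cis.
Qed.

Lemma fourier_bound (f : V -> C) : cintegrable mu f ->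
  exists2 M, 0 <= M & forall xi, normc (fourier f xi) <= M.
Proof.
move=> fi; exists (2 * \int[mu]_x normc (f x)).
  by rewrite mulr_ge0// Rintegral_ge0// => x _; exact: normc_ge0.
move=> xi; rewrite fourierE; apply: normc_cint_le (cintegrable_normc fi).
- by apply: cintegrable_meas; exact: cintegrable_phase.
- by move=> x; rewrite normcM normc_cis mulr1.
Qed.

Lemma cis_lipschitz (s t : R) : normc (cis s - cis t) <= 2 * `|s - t|.
Proof.
apply: le_trans (normc_le _) _; rewrite cReD cImD cReN cImN /=.
have h1 : `|cos s - cos t| <= 1 * `|s - t|.
  apply: (bounded_coord_is_derive (fun u => is_derive_cos u)) => u.
  by rewrite normrN sin_max.
have h2 : `|sin s - sin t| <= 1 * `|s - t|.
  by apply: (bounded_coord_is_derive (fun u => is_derive_sin u)) => u; rewrite cos_max.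
lra.
Qed.

Lemma dot_le (x y : V) : `|dot x y| <= n%:R * (`|x| * `|y|).
Proof.
rewrite /dot; apply: le_trans (ler_norm_sum _ _ _) _.
rewrite mulr_natl -[X in _ *+ X]card_ord -sumr_const; apply: ler_sum => i _.
by rewrite normrM ler_pM// cV_norm_le.
Qed.

Lemma fourier_lipschitz (f : V -> C) : testfun f -> exists2 L, 0 < L &
  forall x y, normc (fourier f x - fourier f y) <= L * `|x - y|.
Proof.
move=> tf; have fi := testfun_integrable tf.
have [_ /bsupp_ge0[r r0 fr]] := tf.
pose I := \int[mu]_x normc (f x).
have I0 : 0 <= I by apply: Rintegral_ge0 => x _; exact: normc_ge0.
have pi0 : 0 <= pi :> R by exact: pi_ge0.
exists (2 * (2 * (2 * pi * (n%:R * r)) * I) + 1).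
  by rewrite ltr_wpDl// !mulr_ge0// ltW.
move=> x y.
have i1 := cintegrable_phase x fi; have i2 := cintegrable_phase y fi.
have -> : fourier f x - fourier f y = cint mu (fun z =>
    f z * (cis (- (2 * pi * dot z x)) - cis (- (2 * pi * dot z y)))).
  rewrite !fourierE -[- cint _ _]mulN1r -cintZ// -cintD//; last exact: cintegrableZ.
  by congr cint; apply/funext => z; rewrite mulN1r mulrBr.
pose K := 2 * (2 * pi * (n%:R * r * `|x - y|)).
apply: (@le_trans _ _ (2 * \int[mu]_z (K * normc (f z)))).
  apply: normc_cint_le.
  - apply: cmeasurableM; first exact: (cintegrable_meas fi).
    by apply: cmeasurableD; [|apply: cmeasurableN]; exact: cmeasurable_phase.
  - move=> z; rewrite normcM mulrC.
    have [zr|zr] := leP `|z| r; last by rewrite fr// normc0 !mulr0.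
    rewrite ler_wpM2r ?normc_ge0//; apply: le_trans (cis_lipschitz _ _) _.
    have -> : - (2 * pi * dot z x) - - (2 * pi * dot z y) = 2 * pi * dot z (y - x).
      by rewrite dotBr; ring.
    rewrite /K normrM distrC (@ger0_norm _ (2 * pi)) ?mulr_ge0// ler_wpM2l// ler_wpM2l ?mulr_ge0//.
    by apply: le_trans (dot_le _ _) _; rewrite -mulrA ler_wpM2l// ler_wpM2r.
  - have := integrableZl measurableT K (cintegrable_normc fi).
    by under eq_fun do rewrite -EFinM.
rewrite RintegralZl//; last exact: cintegrable_normc.
rewrite -/I /K [leRHS]mulrDl mul1r -[leLHS]addr0; apply: lerD => //.
by rewrite le_eqVlt; apply/orP; left; apply/eqP; ring.
Qed.

Lemma integrable_opp (f : V -> R) : mu.-integrable setT (EFin \o f) ->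
  mu.-integrable setT (EFin \o (fun x => - f x)).
Proof.
move=> fi; apply: (@integrable_le _ _ _ mu _ (fun x => `|f x|)).
- by apply: measurable_funN; move/measurable_int/measurable_EFinP: fi.
- by move=> x; rewrite normrN.
- exact: (@integrable_norm _ _ _ mu setT).
Qed.

(** Along a line the phase is affine in the parameter [h], and the real and imaginary parts of a
    Fourier integral both have this form. The derivative is dominated by |s a| + |s b| uniformly in
    [h]. *)
Lemma trig_integral_derive (a b u s : V -> R) :
  mu.-integrable setT (EFin \o a) -> mu.-integrable setT (EFin \o b) ->
  mu.-integrable setT (EFin \o (fun y => s y * a y)) ->
  mu.-integrable setT (EFin \o (fun y => s y * b y)) ->
  measurable_fun setT u -> measurable_fun setT s ->
  is_derive (0 : R) (1 : R)
    (fun h => \int[mu]_y (a y * cos (h * s y + u y) + b y * sin (h * s y + u y)))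
    (\int[mu]_y (s y * (b y * cos (u y) - a y * sin (u y)))).
Proof.
move=> ia ib isa isb mU ms.
have ma : measurable_fun setT a by move/measurable_int/measurable_EFinP: ia.
have mb : measurable_fun setT b by move/measurable_int/measurable_EFinP: ib.
pose f h y := a y * cos (h * s y + u y) + b y * sin (h * s y + u y).
pose df h y := s y * (b y * cos (h * s y + u y) - a y * sin (h * s y + u y)).
have mph h : measurable_fun setT (fun y => h * s y + u y).
  by apply: measurable_funD => //; exact: measurable_funM.
have mcos h : measurable_fun setT (fun y => cos (h * s y + u y)).
  by apply: (measurableT_comp _ (mph h)); apply: continuous_measurable_fun; exact: continuous_cos.
have msin h : measurable_fun setT (fun y => sin (h * s y + u y)).
  by apply: (measurableT_comp _ (mph h)); apply: continuous_measurable_fun; exact: continuous_sin.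
have Df y (h : R) : is_derive h (1 : R) (f^~ y) (df h y).
  have d1 : is_derive h (1 : R) (fun h => h * s y + u y) (s y).
    have : is_derive h (1 : R) (fun h : R => h *: (s y : R) + u y) (s y) by
      apply: is_derive_eq; rewrite addr0 scaler0 add0r [_ *: _]mulr1.
    by [].
  have d2 := @is_derive1_comp _ cos (fun h => h * s y + u y) h _ _ (is_derive_cos _) d1.
  have d3 := @is_derive1_comp _ sin (fun h => h * s y + u y) h _ _ (is_derive_sin _) d1.
  have d4 := @is_deriveZ _ _ _ _ (a y) _ _ _ d2.
  have d5 := @is_deriveZ _ _ _ _ (b y) _ _ _ d3.
  have := is_deriveD d4 d5.
  rewrite (_ : _ *: _ + _ *: _ = df h y)//.
  by rewrite /df /GRing.scale/=; ring.
have := @cvg_differentiation_under_integral R _ _ mu f setT measurableT 0 (-1) 1 _ _ _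
  (fun y => `|s y * a y| + `|s y * b y|).
have -> : (fun y => partial1of2 f 0 y) = (fun y => s y * (b y * cos (u y) - a y * sin (u y))).
  by apply/funext => y; rewrite partial1of2E; have [_ ->] := Df y 0; rewrite /df mul0r add0r.
move=> H.
have H' := H _ _ _ _ _ _.
suff K : h^-1 *: ((fun x' => \int[mu]_y f x' y) (h + 0) -
   (fun x' => \int[mu]_y f x' y) 0) @[h --> 0^'] -->
   \int[mu]_y (s y * (b y * cos (u y) - a y * sin (u y))).
  have K' : (fun h : R => h^-1 *: (((fun x' => \int[mu]_y f x' y) \o shift 0) (h *: (1:R)) -
     (fun x' => \int[mu]_y f x' y) 0)) h @[h --> 0^'] -->
     \int[mu]_y (s y * (b y * cos (u y) - a y * sin (u y))).
    apply: cvg_trans K; apply: near_eq_cvg; near=> h.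
    by rewrite /= [h *: 1]mulr1.
  by split; [apply/cvg_ex; eexists; exact: K'|exact/cvg_lim].
apply: H.
- by rewrite /= in_itv/= ltrN10 ltr01.
- move=> h _; apply: (@integrable_le _ _ _ _ _ (fun y => `|a y| + `|b y|)).
  + by apply: measurable_funD; exact: measurable_funM.
  + move=> y; apply: le_trans (ler_normD _ _) _; apply: lerD; rewrite normrM ler_piMr ?cos_max ?sin_max//.
  + have -> : EFin \o (fun y => `|a y| + `|b y|) = (fun y => (`|a y|)%:E) \+ (fun y => (`|b y|)%:E)%E by apply/funext => y.
    by apply: integrableD => //; exact: (@integrable_norm _ _ _ mu setT).
- by move=> h y _ _; have [] := Df y h.
- by move=> y; rewrite addr_ge0.
- have -> : EFin \o (fun y => `|s y * a y| + `|s y * b y|) =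
     (fun y => (`|s y * a y|)%:E) \+ (fun y => (`|s y * b y|)%:E)%E by apply/funext => y.
  by apply: integrableD => //; apply: (@integrable_norm _ _ _ mu setT (fun y => s y * _)).
- move=> h y _ _; rewrite partial1of2E; have [_ ->] := Df y h.
  rewrite /df mulrBr addrC; apply: le_trans (ler_normD _ _) _; rewrite normrN.
  by apply: lerD; rewrite mulrA normrM ler_piMr ?cos_max ?sin_max//.
Unshelve. all: by end_near.
Qed.

(** Multiplication by -2 pi i <x, v>, to which the derivative of the transform along [v]
    corresponds. *)
Definition freq_mul (v : V) (f : V -> C) : V -> C :=
  fun x => Complex 0 (- (2 * pi * dot x v)) * f x.

Lemma testfun_freq_mul v f : testfun f -> testfun (freq_mul v f).
Proof.
move=> tf; apply: testfunMl => //; split; last exact: Cinf_phase.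
by move=> m; exact: Ck_cst.
Qed.

Lemma dot_basis (x : V) i : dot x (basis_vector i) = x i 0.
Proof.
rewrite /dot (bigD1 i)//= !mxE !eqxx mulr1 big1 ?addr0// => j ji.
by rewrite !mxE (negbTE ji) mulr0.
Qed.

Lemma fourier_is_derive v f xi : testfun f ->
  is_derive xi v (fun y => Re (fourier f y)) (Re (fourier (freq_mul v f) xi)) /\
  is_derive xi v (fun y => Im (fourier f y)) (Im (fourier (freq_mul v f) xi)).
Proof.
move=> tf; have [f1 f2] := testfun_integrable tf.
pose s (y : V) := - (2 * pi * dot y v); pose u (y : V) := - (2 * pi * dot y xi).
have mu_ : measurable_fun setT u by apply: continuous_measurable; apply: Cinf_continuous; exact: Cinf_phase.
have ms : measurable_fun setT s.
  by apply: continuous_measurable; apply: Cinf_continuous; exact: Cinf_phase.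
have [g1 g2] := testfun_integrable (testfun_freq_mul v tf).
have sIm : mu.-integrable setT (EFin \o (fun y => s y * Im (f y))).
  rewrite (_ : (fun y => s y * Im (f y)) = (fun y => - Re (freq_mul v f y))).
    exact: integrable_opp g1.
  by apply/funext => y; rewrite /freq_mul cReM/= mul0r sub0r opprK.
have sRe : mu.-integrable setT (EFin \o (fun y => s y * Re (f y))).
  rewrite (_ : (fun y => s y * Re (f y)) = (fun y => Im (freq_mul v f y)))//.
  by apply/funext => y; rewrite /freq_mul cImM/= mul0r add0r.
have ph (y : V) (h : R) : - (2 * pi * dot y (h *: v + xi)) = h * s y + u y.
  by rewrite dotDr dotZr /u /s; ring.
have NIm : mu.-integrable setT (EFin \o (fun y => - Im (f y))) by exact: (@integrable_opp (fun y => Im (f y))).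
have sNIm : mu.-integrable setT (EFin \o (fun y => s y * - Im (f y))).
  by under eq_fun do rewrite mulrN; exact: (@integrable_opp (fun y => s y * Im (f y))).
split; apply/is_derive_line.
  rewrite (_ : Re (fourier (freq_mul v f) xi) = \int[mu]_y (s y * (- Im (f y) * cos (u y) - Re (f y) * sin (u y)))).
    rewrite (_ : (fun t => _) = (fun h => \int[mu]_y (Re (f y) * cos (h * s y + u y) + - Im (f y) * sin (h * s y + u y)))).
      exact: (trig_integral_derive f1 NIm sRe sNIm mu_ ms).
    apply/funext => h; rewrite fourierE /=; apply: eq_Rintegral => y _.
    by rewrite ph cReM/= mulNr.
  rewrite fourierE /=; apply: eq_Rintegral => y _.
  by rewrite /freq_mul !cReM !cImM /= -/(s y) -/(u y); ring.
rewrite (_ : Im (fourier (freq_mul v f) xi) = \int[mu]_y (s y * (Re (f y) * cos (u y) - Im (f y) * sin (u y)))).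
  rewrite (_ : (fun t => _) = (fun h => \int[mu]_y (Im (f y) * cos (h * s y + u y) + Re (f y) * sin (h * s y + u y)))).
    exact: (trig_integral_derive f2 f1 sIm sRe mu_ ms).
  apply/funext => h; rewrite fourierE /=; apply: eq_Rintegral => y _.
  by rewrite ph cImM/= addrC.
rewrite fourierE /=; apply: eq_Rintegral => y _.
by rewrite cImM /freq_mul cReM cImM /= -/(s y) -/(u y); ring.
Qed.

Lemma partial_fourier i f : testfun f ->
  partial i (fourier f) = fourier (freq_mul (basis_vector i) f).
Proof.
move=> tf; apply/funext => x.
have [[_ d1] [_ d2]] := fourier_is_derive (basis_vector i) x tf.
by rewrite /partial d1 d2; case: (fourier _ _).
Qed.

Lemma continuous_fourier f : testfun f ->
  continuous (fun x => Re (fourier f x)) /\ continuous (fun x => Im (fourier f x)).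
Proof.
move=> tf; have [L L0 HL] := fourier_lipschitz tf.
split; apply: (lipschitz_continuous L0) => x y; apply: le_trans (HL x y).
  by rewrite -cReN -cReD; exact: normc_Re.
by rewrite -cImN -cImD; exact: normc_Im.
Qed.

Lemma csmooth_fourier f : testfun f -> csmooth (fourier f).
Proof.
move=> tf; split=> m.
  elim: m f tf => [|m IH] f tf; split=> //; try exact: (continuous_fourier tf).1.
  move=> v; exists (fun y => Re (fourier (freq_mul v f) y)).
  by split; [move=> x; exact: (fourier_is_derive v x tf).1|apply: IH; exact: testfun_freq_mul].
elim: m f tf => [|m IH] f tf; split=> //; try exact: (continuous_fourier tf).2.
move=> v; exists (fun y => Im (fourier (freq_mul v f) y)).
by split; [move=> x; exact: (fourier_is_derive v x tf).2|apply: IH; exact: testfun_freq_mul].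
Qed.

Lemma partials_fourier f (w : seq 'I_n) : testfun f ->
  exists2 g, testfun g & partials w (fourier f) = fourier g.
Proof.
move=> tf; elim: w => [|i w [g tg gE]]; first by exists f.
exists (freq_mul (basis_vector i) g); first exact: testfun_freq_mul.
by rewrite -partial_fourier// -gE.
Qed.

Lemma smooth_fourier f : testfun f -> smooth (fourier f).
Proof. by move=> tf; apply: csmooth_smooth; exact: csmooth_fourier. Qed.

(** The integral of the translate of [g] by [h *: e] does not depend on [h]; the claim follows by
    differentiating it at [h = 0] under the integral sign. *)
Lemma Rintegral_partial_eq0 i (g : V -> R) : Cinf g -> bsupp g ->
  \int[mu]_x ('D_(basis_vector i) g x) = 0.
Proof.
move=> sg bg; set e := basis_vector i.
have [Dg sDg] := Cinf_derive e sg.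
have [r r0 gr] := bsupp_ge0 bg.
have bDg : forall x, r < `|x| -> 'D_e g x = 0.
  move=> x rx; rewrite (near_eq_derive (g := cst 0)) ?derive_cst//.
  have : \forall y \near x, r < `|y|.
    by have /cvgr_gt := @norm_continuous R V x; apply.
  by apply: filterS => y /gr.
have [M M0 HM] : exists2 M, 0 < M & forall x, `|'D_e g x| <= M.
  by apply: continuous_bsupp_bounded; [exact: Cinf_continuous|exists r].
have ig := integrable_bounded_support (continuous_measurable (Cinf_continuous sg)).
have igh (v : V) : mu.-integrable setT (EFin \o (fun y => g (v + y))).
  have [M' _ HM'] := continuous_bsupp_bounded (Cinf_continuous sg) bg.
  have := integrable_scales (measurable_addl v) ltr01 (@scales_measure_translate _ _ v) (ig _ _ HM' gr).
  by apply.
have e1 : `|e| <= 1.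
  apply: cV_norm_leP => // j; rewrite !mxE eqxx andbT.
  by case: (j == i); rewrite ?normr1 ?normr0.
pose f (h : R) (y : V) := g (h *: e + y).
have Df y (h : R) : is_derive h (1 : R) (f^~ y) ('D_e g (h *: e + y)).
  apply/is_derive_line; rewrite /f.
  have /derivableP/is_derive_line := Dg (h *: e + y).
  congr (is_derive _ _ _ _); apply/funext => t; congr g.
  by rewrite [t *: 1]mulr1 scalerDl addrA.
(* For |h| < 1 the translates of the derivative all live in the ball of radius [r + 1], which gives
   an integrable bound. *)
pose G (y : V) := if `|y| <= r + 1 then M else 0.
have iG : mu.-integrable setT (EFin \o G).
  apply: (@integrable_bounded_support _ _ _ (r + 1) M).
  - apply: measurable_fun_if => //.
    + by apply: measurable_fun_ler => //; apply: continuous_measurable; exact: norm_continuous.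
  - by move=> x; rewrite /G; case: ifP => _; rewrite ?normr0 ?gtr0_norm// ltW.
  - by move=> x rx; rewrite /G leNgt rx.
have := @cvg_differentiation_under_integral R _ _ mu f setT measurableT 0 (-1) 1.
have -> : (fun y => partial1of2 f 0 y) = (fun y => 'D_e g y).
  by apply/funext => y; rewrite partial1of2E; have [_ ->] := Df y 0; rewrite scale0r add0r.
move=> /(_ _ _ _ G) H.
have {}H : h^-1 *: ((fun x' => \int[mu]_y f x' y) (h + 0) -
   (fun x' => \int[mu]_y f x' y) 0) @[h --> 0^'] --> \int[mu]_y 'D_e g y.
  apply: H => //.
  - by rewrite /= in_itv/= ltrN10 ltr01.
  - by move=> h _; exact: igh.
  - by move=> y; rewrite /G; case: ifP => // _; exact: ltW.
  - move=> h y /=; rewrite in_itv/= => /andP[h1 h2] _.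
    rewrite partial1of2E; have [_ ->] := Df y h; rewrite /G; case: ifPn => // yr.
    rewrite bDg ?normr0//; rewrite -ltNge in yr.
    have h3 : `|h *: e| <= 1.
      by rewrite normrZ mulr_ile1// ler_norml !ltW.
    have h4 : `|y| <= `|h *: e + y| + `|h *: e|.
      by rewrite -{1}(addKr (h *: e) y) addrC (le_trans (ler_normD _ _))// normrN.
    lra.
have F0 (h : R) : \int[mu]_y f h y = \int[mu]_y g y.
  have := Rintegral_scales (phi := fun x => h *: e + x) (c := 1) ltr01 (@scales_measure_translate _ _ _) (continuous_measurable (Cinf_continuous sg)).
  by rewrite mul1r.
have : (fun h : R => h^-1 *: ((fun x' => \int[mu]_y f x' y) (h + 0) -
   (fun x' => \int[mu]_y f x' y) 0)) = (fun=> 0).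
  by apply/funext => h; rewrite !F0 subrr scaler0.
move=> E; rewrite E in H.
by rewrite -(cvg_lim _ H)//; apply: lim_cst.
Qed.

Lemma cint_partial_eq0 i f : testfun f -> cint mu (partial i f) = 0.
Proof.
move=> [[f1 f2] [r fr]]; apply: complex_ext => /=.
  by apply: Rintegral_partial_eq0 => //; exists r => x /fr ->.
by apply: Rintegral_partial_eq0 => //; exists r => x /fr ->.
Qed.

Lemma partialM i f g : csmooth f -> csmooth g ->
  partial i (fun x => f x * g x) = (fun x => partial i f x * g x + f x * partial i g x).
Proof.
move=> [f1 f2] [g1 g2]; apply/funext => x.
have [F1 _] := Cinf_derive (basis_vector i) f1; have [F2 _] := Cinf_derive (basis_vector i) f2.
have [G1 _] := Cinf_derive (basis_vector i) g1; have [G2 _] := Cinf_derive (basis_vector i) g2.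
apply: complex_ext; rewrite /partial ?cReD ?cImD !(cReM, cImM)/=.
  rewrite (_ : (fun y => Re (f y * g y)) = (fun y => Re (f y) * Re (g y)) - (fun y => Im (f y) * Im (g y))); last first.
    by apply/funext => y; rewrite cReM.
  rewrite deriveB; [|exact: derivableM|exact: derivableM].
  rewrite !deriveM// /GRing.scale/=.
  move: ('D_ _ _ x) ('D_ _ _ x) ('D_ _ _ x) ('D_ _ _ x) => d1 d2 d3 d4.
  by move: (Re (f x)) (Im (f x)) (Re (g x)) (Im (g x)) => a1 a2 a3 a4; ring.
rewrite (_ : (fun y => Im (f y * g y)) = (fun y => Re (f y) * Im (g y)) + (fun y => Im (f y) * Re (g y))); last first.
  by apply/funext => y; rewrite cImM.
rewrite deriveD; [|exact: derivableM|exact: derivableM].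
rewrite !deriveM// /GRing.scale/=.
move: ('D_ _ _ x) ('D_ _ _ x) ('D_ _ _ x) ('D_ _ _ x) => d1 d2 d3 d4.
by move: (Re (f x)) (Im (f x)) (Re (g x)) (Im (g x)) => a1 a2 a3 a4; ring.
Qed.

Lemma partial_phase i (xi : V) : partial i (fun x : V => cis (- (2 * pi * dot x xi))) =
  (fun x => Complex 0 (- (2 * pi * xi i 0)) * cis (- (2 * pi * dot x xi))).
Proof.
apply/funext => x.
have d1 : is_derive (0 : R) (1 : R) (fun t => - (2 * pi * dot (t *: basis_vector i + x) xi)) (- (2 * pi * xi i 0)).
  rewrite (_ : (fun t => _) = (fun t : R => t *: (- (2 * pi * xi i 0)) + - (2 * pi * dot x xi))).
    by apply: is_derive_eq; rewrite ?addr0 ?subr0 scaler0 add0r [_ *: _]mulr1.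
  by apply/funext => t; rewrite dotDl dotZl dotC dot_basis /GRing.scale/=; ring.
have E0 : - (2 * pi * dot ((0 : R) *: basis_vector i + x) xi) = - (2 * pi * dot x xi).
  by rewrite scale0r add0r.
rewrite /partial; apply: complex_ext; rewrite ?cReM ?cImM /=.
  have H := @is_derive1_comp _ cos (fun t => - (2 * pi * dot (t *: basis_vector i + x) xi)) 0 _ _ (is_derive_cos _) d1.
  have [_ ->] := proj1 (is_derive_line (fun y : V => cos (- (2 * pi * dot y xi))) x (basis_vector i) _) H.
  by rewrite E0; ring.
have H := @is_derive1_comp _ sin (fun t => - (2 * pi * dot (t *: basis_vector i + x) xi)) 0 _ _ (is_derive_sin _) d1.
have [_ ->] := proj1 (is_derive_line (fun y : V => sin (- (2 * pi * dot y xi))) x (basis_vector i) _) H.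
by rewrite E0; ring.
Qed.

(** Integration by parts: the derivative of [f] times the phase has integral 0. *)
Lemma fourier_partial i f xi : testfun f ->
  fourier (partial i f) xi = Complex 0 (2 * pi * xi i 0) * fourier f xi.
Proof.
move=> tf; have sf := tf.1.
have tpf := testfun_partial i tf.
have := cint_partial_eq0 i (testfunMr tf (csmooth_phase xi)).
rewrite partialM//; last exact: csmooth_phase.
have i1 := cintegrable_phase xi (testfun_integrable tpf).
have i2 := cintegrable_phase xi (testfun_integrable tf).
rewrite partial_phase.
under [X in cint _ X]eq_fun do rewrite mulrCA.
rewrite cintD//; last exact: cintegrableZ.
rewrite cintZ// -!fourierE => /eqP; rewrite addr_eq0 => /eqP ->.
by apply: complex_ext; rewrite ?cReN ?cImN ?cReM ?cImM/=; ring.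
Qed.

Lemma fourier_mul_bounded f (w : seq 'I_n) : testfun f ->
  exists M, forall x : V, (\prod_(i <- w) `|x i 0|) * normc (fourier f x) <= M.
Proof.
elim: w f => [|i w IH] f tf.
  have [M _ HM] := fourier_bound (testfun_integrable tf).
  by exists M => x; rewrite big_nil mul1r.
have [M HM] := IH _ (testfun_partial i tf).
have pi2 : 0 < 2 * pi :> R by rewrite mulr_gt0// pi_gt0.
exists ((2 * pi)^-1 * M) => x; rewrite big_cons.
have := HM x; rewrite fourier_partial// normcM (_ : normc (Complex 0 _) = 2 * pi * `|x i 0|); last first.
  by rewrite /= expr0n/= add0r sqrtr_sqr normrM (gtr0_norm pi2).
move=> h; rewrite ler_pdivlMl//.
by apply: le_trans h; rewrite le_eqVlt; apply/orP; left; apply/eqP; ring.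
Qed.

(** Each weight 1 + x_i^2 costs two derivatives in direction i. The resulting bound is a product of
    Cauchy functions of one variable, integrable by Fubini, so transforms of test functions are
    integrable. *)
Lemma fourier_decay f : testfun f -> exists M, forall x : V,
  normc (fourier f x) <= M * \prod_i (1 + x i 0 ^+ 2)^-1.
Proof.
suff H (w : seq 'I_n) : forall g, testfun g -> exists M, forall x : V,
    (\prod_(i <- w) (1 + x i 0 ^+ 2)) * normc (fourier g x) <= M.
  move=> tf; have [M HM] := H (index_enum 'I_n) f tf; exists M => x.
  rewrite prodfV ler_pdivlMr; first by rewrite mulrC.
  by apply: prodr_gt0 => i _; rewrite ltr_pwDl// sqr_ge0.
elim: w => [|i w IH] g tg.
  have [M _ HM] := fourier_bound (testfun_integrable tg).
  by exists M => x; rewrite big_nil mul1r.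
have tp := testfun_partial i tg; have tpp := testfun_partial i tp.
have [M1 HM1] := IH _ tg; have [M2 HM2] := IH _ tpp.
have pi2 : 0 < (2 * pi) ^+ 2 :> R by rewrite exprn_gt0// mulr_gt0// pi_gt0.
exists (M1 + ((2 * pi) ^+ 2)^-1 * M2) => x.
have := HM1 x; have := HM2 x; rewrite !fourier_partial// !normcM.
rewrite (_ : normc (Complex 0 _) = `|2 * pi * x i 0|); last by rewrite /= expr0n/= add0r sqrtr_sqr.
rewrite big_cons; move: (\prod_(_ <- w) _) (normc _) => P N h1 h2.
have E : `|2 * pi * x i 0| * (`|2 * pi * x i 0| * N) = (2 * pi) ^+ 2 * (x i 0 ^+ 2 * N).
  by rewrite mulrA -expr2 real_normK ?num_real// exprMn mulrA.
rewrite E in h1.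
have h3 : P * (x i 0 ^+ 2 * N) <= ((2 * pi) ^+ 2)^-1 * M2.
  by rewrite ler_pdivlMl// mulrCA.
rewrite mulrDl mul1r mulrDl; apply: lerD => //.
suff <- : P * (x i 0 ^+ 2 * N) = x i 0 ^+ 2 * P * N by [].
by ring.
Qed.

Lemma fourier_schwartz f : testfun f -> schwartz (fourier f).
Proof.
move=> tf; split; first exact: smooth_fourier.
move=> a w; have [g tg ->] := partials_fourier w tf.
(* The monomial is spelled as a word in which [i] occurs [a i] times. *)
have [M HM] := fourier_mul_bounded (flatten [seq nseq (a i) i | i <- index_enum 'I_n]) tg.
exists M => x; apply: le_trans (HM x); rewrite le_eqVlt; apply/orP; left; apply/eqP.
congr (_ * _); rewrite normr_prod; elim: (index_enum 'I_n) => [|i s IH].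
  by rewrite !big_nil.
rewrite big_cons IH /= big_cat/=; congr (_ * _).
by rewrite big_nseq normrX; elim: (a i) => //= m IHm; rewrite exprS IHm.
Qed.

End fourier.

(** * One-dimensional Poisson and Cauchy integrals *)

Section poisson_kernel.
Context {R : realType}.
Local Notation C := R[i].
Local Notation leb := (@lebesgue_measure R).

Lemma lebesgue_integral_opp (f : R -> \bar R) :
  measurable_fun setT f -> (forall x, 0 <= f x)%E ->
  (\int[leb]_r f (- r)%R = \int[leb]_r f r)%E.
Proof.
move=> mf f0.
have mphi : measurable_fun setT (fun r : measurableTypeR R => - r : measurableTypeR R).
  exact: oppr_measurable.
pose m1 : {measure set (measurableTypeR R) -> \bar R} :=
  measure_function_pushforward__canonical__measure_function_Measure leb mphi.
transitivity (\int[m1]_x f x)%E; first by rewrite ge0_integral_pushforward.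
apply: eq_measure_integral => A mA _; apply/esym.
apply: lebesgue_measure_unique => // X [[a b]] /= _ <-.
rewrite /pushforward (_ : _ @^-1` _ = `[(- b), (- a)[%classic); last first.
  apply/seteqP; split=> x /=; rewrite !in_itv/= => /andP[h1 h2];
  apply/andP; split; lra.
have := lebesgue_measure_itv `[(- b), (- a)[.
have := lebesgue_measure_itv `]a, b].
rewrite /= !lte_fin ltrN2 -!EFinD.
by rewrite (_ : - a - - b = b - a)//; [move=> -> -> | lra].
Qed.

Lemma Rintegral_odd (f : R -> R) : leb.-integrable setT (EFin \o f) ->
  (forall x, f (- x) = - f x) -> \int[leb]_x f x = 0.
Proof.
move=> fi fodd.
have mf : measurable_fun setT (EFin \o f) by exact: measurable_int fi.
have E : (\int[leb]_x (EFin \o f)^\- x = \int[leb]_x (EFin \o f)^\+ x)%E.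
  rewrite -lebesgue_integral_opp; last 2 first.
  - exact: measurable_funeneg.
  - by move=> x; exact: funeneg_ge0.
  apply: eq_integral => x _; rewrite funenegE funeposE /= fodd.
  by rewrite opprK.
rewrite /Rintegral integralE E subee//.
exact: integrable_pos_fin_num.
Qed.

Lemma continuous_exp_abs (a : R) : continuous (fun x : R => expR (- (a * `|x|))).
Proof.
move=> x; apply: (@continuous_comp _ _ _ (fun x : R => - (a * `|x|)) expR); last exact: continuous_expR.
by apply: cvgN; apply: cvgM; [exact: cvg_cst|exact: norm_continuous].
Qed.

Section exp_abs.
Variables (a b : R).
Hypothesis a_gt0 : 0 < a.

Let D := a ^+ 2 + b ^+ 2.
Let D_gt0 : 0 < D. Proof. by rewrite ltr_pwDl ?sqr_ge0// exprn_gt0. Qed.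

(** Adding 1 to the cosine keeps the integrand [f] nonnegative, so the fundamental theorem applies
    on the half-line without prior integrability; [F] is the primitive of [f] that vanishes at
    infinity. *)
Let F (x : R) := expR (- (a * x)) * ((b * sin (b * x) - a * cos (b * x)) / D - a^-1).
Let f (x : R) := expR (- (a * x)) * (1 + cos (b * x)).

Let dlin (c x : R) : is_derive x (1 : R) (fun t : R => c * t) c.
Proof.
have -> : (fun t : R => c * t) = (fun t : R => t *: (c : R) + 0).
  by apply/funext => t; rewrite addr0 mulrC.
by apply: is_derive_eq; rewrite addr0 scaler0 add0r [_ *: _]mulr1.
Qed.

Let dF (x : R) : is_derive x (1 : R) F (f x).
Proof.
have d1 : is_derive x (1 : R) (fun t => expR (- (a * t))) (expR (- (a * x)) * - a).
  have dN : is_derive x (1 : R) (fun t => - (a * t)) (- a).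
    by have := dlin (- a) x; under eq_fun do rewrite mulNr.
  exact: (@is_derive1_comp _ expR (fun t => - (a * t)) x _ _ (is_derive_expR _) dN).
have d2 := @is_derive1_comp _ sin (fun t => b * t) x _ _ (is_derive_sin _) (dlin b x).
have d3 := @is_derive1_comp _ cos (fun t => b * t) x _ _ (is_derive_cos _) (dlin b x).
have d4 : is_derive x (1 : R) (fun t => (b * sin (b * t) - a * cos (b * t)) / D - a^-1)
   ((b * (cos (b * x) * b) - a * (- sin (b * x) * b)) / D).
  have -> : (fun t => (b * sin (b * t) - a * cos (b * t)) / D - a^-1) =
     ((b / D) \*: (sin \o (fun t => b * t))) + ((- (a / D)) \*: (cos \o (fun t => b * t)) + cst (- a^-1)).
    apply/funext => t.
    change ((b * sin (b * t) - a * cos (b * t)) / D - a^-1 =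
      b / D * sin (b * t) + (- (a / D) * cos (b * t) + - a^-1)).
    by rewrite mulrBl; ring.
  have := is_deriveD (is_deriveZ (b / D) d2) (is_deriveD (is_deriveZ (- (a / D)) d3) (is_derive_cst (- a^-1) x (1 : R))).
  rewrite (_ : _ + (_ + 0) = (b * (cos (b * x) * b) - a * (- sin (b * x) * b)) / D)//.
  by rewrite /GRing.scale/=; field; rewrite gt_eqF.
have := is_deriveM d1 d4.
rewrite (_ : _ *: _ + _ *: _ = f x)//.
rewrite /f /GRing.scale/=.
move: (expR _) (sin _) (cos _) => e s c.
have Dn : a ^+ 2 + b ^+ 2 != 0 by rewrite gt_eqF.
by rewrite /D; field; rewrite Dn gt_eqF.
Qed.

Let cf : continuous f.
Proof.
suff [] : Ck 0 f by [].
have H (c : R) : Cinf (fun x => c * x) by move=> m; apply: CkM; [exact: Ck_cst|exact: Cinf_id].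
apply: CkM.
  split=> // x; apply: continuous_comp; last exact: continuous_expR.
  by apply: cvgN; apply: (Cinf_continuous (H a)).
apply: CkD; first exact: Ck_cst.
exact: (Ck_comp (proj2 (@Cinf_sin_cos R) 0%N) (H b 0%N)).
Qed.

Let Fy : F x @[x --> +oo] --> (0 : R).
Proof.
apply/cvgr0Pnorm_le => e e0.
pose M := (`|b| + a) / D + a^-1.
have M0 : 0 < M.
  apply: ltr_wpDl; last by rewrite invr_gt0.
  by apply: divr_ge0; [apply: addr_ge0 => //|]; exact: ltW.
near=> x.
have x0 : 0 < x by near: x; exact: nbhs_pinfty_gt.
rewrite /F normrM ger0_norm ?expR_ge0//.
have h1 : `|(b * sin (b * x) - a * cos (b * x)) / D - a^-1| <= M.
  apply: le_trans (ler_normB _ _) _.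
  rewrite /M [`|a^-1|]gtr0_norm ?invr_gt0// lerD2r normrM [`|D^-1|]gtr0_norm ?invr_gt0//.
  rewrite ler_pM2r ?invr_gt0//; apply: le_trans (ler_normB _ _) _.
  rewrite !normrM (gtr0_norm a_gt0); apply: lerD; rewrite ler_piMr ?sin_max ?cos_max// ltW//.
have h2 : expR (- (a * x)) <= (1 + a * x)^-1.
  by rewrite expRN lef_pV2 ?posrE ?expR_gt0 ?expR_ge1Dx// ltr_pwDl// ltW// mulr_gt0.
apply: le_trans (ler_pM _ _ h2 h1) _; rewrite ?expR_ge0//.
rewrite mulrC ler_pdivrMr; last by rewrite ltr_pwDl// ltW// mulr_gt0.
have : M / (e * a) <= x by near: x; apply: nbhs_pinfty_ge; exact: num_real.
by rewrite ler_pdivrMr ?mulr_gt0//; lra.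
Unshelve. all: by end_near.
Qed.

Lemma integral_exp_abs_cos1 :
  (\int[leb]_x (expR (- (a * `|x|)) * (1 + cos (b * x)))%:E =
   (2 * (a^-1 + a / D))%:E)%E.
Proof.
have H : (\int[leb]_(x in `[0%R, +oo[) (f x)%:E = (a^-1 + a / D)%:E)%E.
  rewrite (@ge0_continuous_FTC2y R f F 0 0).
  - rewrite /F !mulr0 oppr0 expR0 sin0 cos0 -EFinD; congr EFin; lra.
  - move=> x _; apply: mulr_ge0; first exact: expR_ge0.
    by have := cos_geN1 (b * x); lra.
  - exact: continuous_subspaceT.
  - exact: Fy.
  - by move=> x _; have [] := dF x.
  - apply: cvg_at_right_filter.
    have : differentiable F 0 by apply/derivable1_diffP; have [] := dF 0.
    exact: differentiable_continuous.
  - by move=> x _; rewrite derive1E; have [_ ->] := dF x.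
rewrite ge0_symfun_integralT.
- rewrite EFinM -H; congr (_ * _)%E.
  rewrite (_ : [set x | _] = `[0, +oo[%classic); last first.
    by apply/seteqP; split => x/=; rewrite in_itv/= andbT.
  apply: eq_integral => x; rewrite inE/= in_itv/= andbT => x0.
  by rewrite ger0_norm.
- move=> x; apply: mulr_ge0; first exact: expR_ge0.
  by have := cos_geN1 (b * x); lra.
- suff [] : Ck 0 (fun x : R => expR (- (a * `|x|)) * (1 + cos (b * x))) by [].
  apply: CkM; first by split=> //; exact: continuous_exp_abs.
  apply: CkD; first exact: Ck_cst.
  apply: (Ck_comp (proj2 (@Cinf_sin_cos R) 0%N)).
  by apply: CkM; [exact: Ck_cst|exact: Cinf_id].
- by move=> x /=; rewrite normrN mulrN cosN.
Qed.

End exp_abs.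

Section exp_abs_cis.
Variables (a b : R).
Hypothesis a_gt0 : 0 < a.

Let e (x : R) := expR (- (a * `|x|)).

Let ce : continuous e.
Proof. exact: continuous_exp_abs. Qed.

Let me : measurable_fun setT e.
Proof. exact: continuous_measurable_fun ce. Qed.

Let int_e : (\int[leb]_x (e x)%:E = (2 / a)%:E)%E.
Proof.
have := integral_exp_abs_cos1 0 a_gt0.
under eq_integral => x _ do rewrite mul0r cos0 (_ : 1 + 1 = 2)// mulrC EFinM.
rewrite ge0_integralZl//; last exact: (proj2 (measurable_EFinP _ _) me).
move=> H.
rewrite -[LHS]mul1e (_ : 1 = 2^-1 * 2)%R; last by rewrite mulVf.
rewrite EFinM -muleA H -EFinM; congr EFin.
by field; rewrite gt_eqF.
Qed.

Lemma integrable_exp_abs : leb.-integrable setT (EFin \o e).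
Proof.
apply/integrableP; split; first exact: (proj2 (measurable_EFinP _ _) me).
under eq_integral => x _ do rewrite /= ger0_norm ?expR_ge0//.
by rewrite int_e ltry.
Qed.

Lemma cintegrable_exp_abs_cis :
  cintegrable leb (fun x => (e x)%:C%C * cis (b * x)).
Proof.
apply: (cintegrable_le _ _ integrable_exp_abs).
  apply: cmeasurableM; first exact: (cmeasurable_real me).
  apply: cmeasurable_cis; exact: measurable_funM.
by move=> x; rewrite normcM normc_cis mulr1 normc_real ger0_norm ?expR_ge0.
Qed.

(** The case b = 0 of [integral_exp_abs_cos1] gives the integral of [e] alone, which is subtracted
    to isolate the cosine; the sine part is odd. *)
Lemma cint_exp_abs_cis :
  cint leb (fun x => (e x)%:C%C * cis (b * x)) = (2 * a / (a ^+ 2 + b ^+ 2))%:C%C.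
Proof.
have [i1 i2] := cintegrable_exp_abs_cis.
have E1 x : complex.Re ((e x)%:C%C * cis (b * x)) = e x * (1 + cos (b * x)) - e x.
  by rewrite cReM/= mul0r subr0; lra.
have E2 x : complex.Im ((e x)%:C%C * cis (b * x)) = e x * sin (b * x).
  by rewrite cImM/= mul0r addr0.
apply: complex_ext.
  change (\int[leb]_x complex.Re ((e x)%:C%C * cis (b * x)) = 2 * a / (a ^+ 2 + b ^+ 2)).
  under eq_Rintegral do rewrite E1.
  have ie1 : leb.-integrable setT (EFin \o (fun x => e x * (1 + cos (b * x)))).
    apply: (@integrable_le _ _ _ leb (fun x => e x * (1 + cos (b * x))) (fun x => 2 * e x)).
    - apply: measurable_funM => //; apply: measurable_funD => //.
      apply: (measurableT_comp (continuous_measurable_fun (@continuous_cos R))).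
      exact: measurable_funM.
    - move=> x; rewrite normrM ger0_norm ?expR_ge0// mulrC ler_wpM2r ?expR_ge0//.
      by have := cos_geN1 (b * x); have := cos_le1 (b * x); rewrite ler_norml; lra.
    - have := integrableZl measurableT 2 integrable_exp_abs.
      by under eq_fun do rewrite -EFinM.
  rewrite RintegralB//; last exact: integrable_exp_abs.
  rewrite /Rintegral int_e integral_exp_abs_cos1//=.
  have Dn : a ^+ 2 + b ^+ 2 != 0 by rewrite gt_eqF// ltr_pwDl ?sqr_ge0// exprn_gt0.
  by field; rewrite Dn gt_eqF.
change (\int[leb]_x complex.Im ((e x)%:C%C * cis (b * x)) = 0).
under eq_Rintegral do rewrite E2.
apply: Rintegral_odd.
  by move: i2; under eq_fun do rewrite E2.
by move=> x; rewrite /e normrN mulrN sinN mulrN.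
Qed.

End exp_abs_cis.

Lemma cintegrable_cauchy : cintegrable leb (fun x => ((1 + x ^+ 2)^-1)%:C%C) /\
  cint leb (fun x => ((1 + x ^+ 2)^-1)%:C%C) = (pi%:C)%C.
Proof.
have H : (\int[leb]_x ((1 + x ^+ 2)^-1)%:E = pi%:E)%E.
  rewrite ge0_symfun_integralT.
  - rewrite (_ : [set x | _] = `[0, +oo[%classic); last first.
      by apply/seteqP; split => x/=; rewrite in_itv/= andbT.
    rewrite (_ : pi = 2 * (pi / 2)); last by rewrite mulrC divfK.
    by rewrite EFinM; congr (_ * _)%E; rewrite -integral0y_oneDsqr.
  - by move=> x; rewrite invr_ge0 addr_ge0// sqr_ge0.
  - exact: continuous_oneDsqrV.
  - by move=> x /=; rewrite sqrrN.
have m : measurable_fun setT (fun x : R => (1 + x ^+ 2)^-1).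
  by apply: continuous_measurable_fun; exact: continuous_oneDsqrV.
have ci : cintegrable leb (fun x => ((1 + x ^+ 2)^-1)%:C%C).
  split => /=; last exact: integrable0.
  apply/integrableP; split; first exact/measurable_EFinP.
  under eq_integral => x _ do rewrite /= ger0_norm ?invr_ge0 ?addr_ge0 ?sqr_ge0//.
  by rewrite H ltry.
split=> //; apply: complex_ext => /=; first by rewrite /Rintegral H.
by rewrite /Rintegral integral0.
Qed.

End poisson_kernel.

Section product_integral.
Context {R : realType}.
Local Notation C := R[i].
Local Notation leb := (@lebesgue_measure R).
Local Notation V n := 'cV[R]_n.
Local Notation mu n := (@lebesgue_cV R n).

Lemma cint_cVS n (f : V n.+1 -> C) : cmeasurable f ->
  cintegrable (leb \x (mu n : {sigma_finite_measure set (V n) -> \bar R}))%E (fun z => f (cV_cons z)) ->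
  cintegrable (mu n.+1) f /\
  cint (mu n.+1) f = cint (leb \x (mu n : {sigma_finite_measure set (V n) -> \bar R}))%E (fun z => f (cV_cons z)).
Proof.
move=> [mf1 mf2] [i1 i2].
pose lm : {measure set (measurableTypeR R * V n)%type -> \bar R} :=
  (leb \x (mu n : {sigma_finite_measure set (V n) -> \bar R}))%E.
have mc : measurable_fun setT (@cV_cons R n) := measurable_cV_cons (n := n).
have K (g : V n.+1 -> R) : measurable_fun setT g ->
    lm.-integrable setT (fun z => (g (cV_cons z))%:E) ->
    (mu n.+1).-integrable setT (fun x => (g x)%:E) /\
    \int[mu n.+1]_x g x = \int[lm]_z g (cV_cons z).
  move=> mg ig; have mEg : measurable_fun setT (fun x => (g x)%:E) by exact/measurable_EFinP.
  split.
    have := integrable_pushforward mc mEg (mu := lm) (D := setT) ig measurableT.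
    by [].
  rewrite /Rintegral; congr fine.
  exact: (integral_pushforward mc (mu := lm) (D := setT) mEg ig measurableT).
have [j1 e1] := K _ mf1 i1; have [j2 e2] := K _ mf2 i2.
by split=> //; rewrite /cint e1 e2.
Qed.

(** The Poisson and Cauchy kernels and the unit cube all factor over the coordinates. In dimension 0
    the measure is a unit mass, which matches the empty product. *)
Lemma cint_prod n (f : 'I_n -> R -> C) : (forall i, cintegrable leb (f i)) ->
  cintegrable (mu n) (fun x => \prod_i f i (x i 0)) /\
  cint (mu n) (fun x => \prod_i f i (x i 0)) = \prod_i cint leb (f i).
Proof.
elim: n f => [|n IH] f fi.
  have n0 (x : V 0) : `|x| = 0 by rewrite (flatmx0 x) normr0.
  have muT : mu 0 setT = 1%E.
    have := @lebesgue_cV_box R 0 0 0 (fun i => lexx _); rewrite big_ord0 => <-.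
    by congr (mu 0 _); apply/seteqP; split=> // x _ [].
  have ci : cintegrable (mu 0) (fun _ : V 0 => 1 : C).
    apply: (cintegrable_le (g := fun=> 1)); first exact: cmeasurable_cst.
      by move=> x; rewrite normc1.
    apply: (@integrable_bounded_support _ _ _ 1 1); first exact: measurable_cst.
      by move=> x; rewrite normr1.
    by move=> x; rewrite n0 ltr10.
  under eq_fun do rewrite big_ord0; rewrite big_ord0; split=> //.
  apply: complex_ext.
    by change (\int[mu 0]_x (1 : R) = 1); rewrite Rintegral_cst// mul1r; exact: (congr1 fine muT).
  by change (\int[mu 0]_x (0 : R) = 0); rewrite Rintegral_cst// mul0r.
have [IH1 IH2] := IH (fun j => f (lift ord0 j)) (fun j => fi _).
have E (z : measurableTypeR R * V n) : \prod_i f i (cV_cons z i 0) =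
    f ord0 z.1 * \prod_j f (lift ord0 j) (z.2 j 0).
  rewrite big_ord_recl mxE unlift_none/=; congr (_ * _).
  by apply: eq_bigr => j _; rewrite mxE liftK.
have iE : cintegrable (leb \x (mu n : {sigma_finite_measure set (V n) -> \bar R}))%E
    (fun z => \prod_i f i (cV_cons z i 0)).
  under eq_fun do rewrite E -[_ * _]mulr1.
  apply: (cintegrable_tensor (fi ord0) IH1); first exact: cmeasurable_cst.
  by move=> z; rewrite normc1.
have mP : cmeasurable (fun x : V n.+1 => \prod_i f i (x i 0)).
  elim: (index_enum _) => [|i s IHs].
    by under eq_fun do rewrite big_nil; exact: cmeasurable_cst.
  under eq_fun do rewrite big_cons; apply: cmeasurableM => //.
  exact: (cmeasurable_comp (cintegrable_meas (fi i)) (measurable_cV_coord i)).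
have [h1 h2] := cint_cVS mP iE; split=> //.
rewrite h2; under [X in cint _ X]eq_fun do rewrite E.
by rewrite (cint_tensor (fi ord0) IH1) IH2 big_ord_recl.
Qed.

End product_integral.

(** * Fourier inversion and Parseval's identity on test functions *)

Section inversion.
Context {R : realType} {n : nat}.
Local Notation C := R[i].
Local Notation leb := (@lebesgue_measure R).
Local Notation V := 'cV[R]_n.+1.
Local Notation mu := (@lebesgue_cV R n.+1).

Lemma scales_measure_scale (a : R) : a != 0 ->
  scales_measure (fun x : V => a *: x) (`|a| ^+ n.+1)^-1.
Proof.
move=> a0 f mf f0; rewrite -normrX -det_scalar.
under eq_integral do rewrite -mul_scalar_mx.
by apply: scales_measure_mulmx => //; rewrite unitmxE det_scalar unitfE expf_neq0.
Qed.

Lemma measurable_scale (a : R) : measurable_fun setT (fun x : V => a *: x).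
Proof.
apply: (eq_measurable_fun (fun x : V => a%:M *m x)); last exact: measurable_mulmx.
by move=> x _; rewrite mul_scalar_mx.
Qed.

Lemma scales_measure_opp : scales_measure (fun x : V => - x) 1.
Proof.
have h : (-1 : R) != 0 by rewrite oppr_eq0 oner_eq0.
move=> f mf f0; have := scales_measure_scale h mf f0.
by rewrite normrN1 expr1n invr1; under eq_integral do rewrite scaleN1r.
Qed.

Lemma measurable_oppmx : measurable_fun setT (fun x : V => - x).
Proof. by have := measurable_scale (-1); under eq_fun do rewrite scaleN1r. Qed.

Lemma cint_opp (f : V -> C) : cmeasurable f -> cint mu (fun x => f (- x)) = cint mu f.
Proof. by move=> mf; rewrite (cint_scales ltr01 scales_measure_opp mf) mul1r. Qed.

Lemma cmeasurable_joint_phase :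
  cmeasurable (fun z : V * V => cis (- (2 * pi * dot z.2 z.1))).
Proof.
apply: cmeasurable_cis; apply: measurable_funN.
apply: measurable_funM => //; rewrite /dot; apply: measurable_sum => i.
by apply: measurable_funM;
  [apply: (measurableT_comp (measurable_cV_coord i)); exact: measurable_snd
  |apply: (measurableT_comp (measurable_cV_coord i)); exact: measurable_fst].
Qed.

(** The kernel exp(-2 pi i <x, y>) is symmetric, so Fubini moves the transform from one factor to
    the other. Inversion, Parseval and Plancherel are all read off this formula. *)
Lemma fourier_multiplication (u v : V -> C) : cintegrable mu u -> cintegrable mu v ->
  cint mu (fun x => u x * fourier v x) = cint mu (fun x => fourier u x * v x).
Proof.
move=> iu iv.
have := cint_fubini (cintegrable_tensor iu iv cmeasurable_joint_phase
  (fun z => eq_ind_r (fun t => t <= 1) (lexx _) (normc_cis _))).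
rewrite (_ : (fun x => cint mu _) = (fun x => u x * fourier v x)); last first.
  apply/funext => x; rewrite fourierE -cintZ; last exact: cintegrable_phase.
  by congr cint; apply/funext => y /=; rewrite mulrA.
move=> ->; congr cint; apply/funext => y; rewrite [RHS]mulrC fourierE -cintZ.
  by congr cint; apply/funext => x /=; rewrite dotC; ring.
exact: cintegrable_phase.
Qed.

Lemma cis_sum I (s : seq I) (F : I -> R) :
  cis (\sum_(i <- s) F i) = \prod_(i <- s) cis (F i).
Proof.
by elim/big_rec2: _ => [|i y z _ <-]; rewrite ?cis0// cisD.
Qed.

Lemma expR_sum I (s : seq I) (F : I -> R) :
  expR (\sum_(i <- s) F i) = \prod_(i <- s) expR (F i).
Proof.
by elim/big_rec2: _ => [|i y z _ <-]; rewrite ?expR0// expRD.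
Qed.

Lemma rprod_complex I (s : seq I) (F : I -> R) :
  (\prod_(i <- s) F i)%:C%C = \prod_(i <- s) (F i)%:C%C.
Proof. exact: (rmorph_prod (@real_complex R)). Qed.

Let poisson (e : R) (xi : V) (x : V) : C :=
  (expR (- (2 * pi * e * \sum_i `|x i 0|)))%:C%C * cis (2 * pi * dot x xi).

Let factor (e s : R) (t : R) : C :=
  (expR (- (2 * pi * e * `|t|)))%:C%C * cis (2 * pi * s * t).

Let poisson_prod e xi (x z : V) :
  poisson e xi x * cis (- (2 * pi * dot x z)) = \prod_i factor e (xi i 0 - z i 0) (x i 0).
Proof.
rewrite /poisson -mulrA -cisD -mulrBr -dotBr mulr_sumr -sumrN expR_sum rprod_complex.
rewrite /dot mulr_sumr cis_sum -big_split/=; apply: eq_bigr => i _.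
by rewrite !mxE; congr (_ * cis _); ring.
Qed.

Let pi_gt0 : 0 < (pi : R). Proof. exact: pi_gt0. Qed.

Let factor_int e s : 0 < e -> cintegrable leb (factor e s) /\
  cint leb (factor e s) = (pi^-1 * (e / (e ^+ 2 + s ^+ 2)))%:C%C.
Proof.
move=> e0; have a0 : 0 < 2 * pi * e by rewrite !mulr_gt0.
split; first exact: cintegrable_exp_abs_cis.
rewrite /factor cint_exp_abs_cis//; congr (_%:C)%C.
have D : e ^+ 2 + s ^+ 2 != 0 by rewrite gt_eqF// ltr_pwDl ?sqr_ge0// exprn_gt0.
have -> : (2 * pi * e) ^+ 2 + (2 * pi * s) ^+ 2 = (2 * pi) ^+ 2 * (e ^+ 2 + s ^+ 2) by ring.
have p0 : (pi : R) != 0 by rewrite gt_eqF.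
by move: D p0; move: (e ^+ 2 + s ^+ 2) (pi : R) => d c d0 c0; field; rewrite d0 c0.
Qed.

Let poisson_fourier e xi z : 0 < e ->
  fourier (poisson e xi) z =
  (\prod_i (pi^-1 * (e / (e ^+ 2 + (xi i 0 - z i 0) ^+ 2))))%:C%C.
Proof.
move=> e0; rewrite fourierE; under [X in cint _ X]eq_fun do rewrite poisson_prod.
have [_ ->] := cint_prod (fun i => (factor_int (xi i 0 - z i 0) e0).1).
by rewrite rprod_complex; apply: eq_bigr => i _; rewrite (factor_int _ e0).2.
Qed.

Let poisson_integrable e xi : 0 < e -> cintegrable mu (poisson e xi).
Proof.
move=> e0; have [h _] := cint_prod (fun i => (factor_int (xi i 0 - (0 : V) i 0) e0).1).
rewrite (_ : poisson e xi = fun x => \prod_i factor e (xi i 0 - (0 : V) i 0) (x i 0))//.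
by apply/funext => x; rewrite -poisson_prod dotC dot0l mulr0 oppr0 cis0 mulr1.
Qed.

Let cauchy (x : V) : C := \prod_i (((1 + x i 0 ^+ 2)^-1)%:C%C).

Let cauchy_int : cintegrable mu cauchy /\ cint mu cauchy = (pi ^+ n.+1)%:C%C.
Proof.
have [h1 h2] := @cintegrable_cauchy R.
have [h3 h4] := cint_prod (fun i : 'I_n.+1 => h1); split=> //.
rewrite /cauchy h4 -[X in _ ^+ X]card_ord -prodr_const rprod_complex.
by apply: eq_bigr => i _; rewrite h2.
Qed.

Let cauchy_real : mu.-integrable setT (EFin \o (fun x : V => \prod_i (1 + x i 0 ^+ 2)^-1)).
Proof.
have [[h _] _] := cauchy_int; move: h.
by under eq_fun do rewrite /cauchy -rprod_complex.
Qed.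

Lemma cintegrable_fourier (G : V -> C) : testfun G -> cintegrable mu (fourier G).
Proof.
move=> tG; have [M HM] := fourier_decay tG.
apply: (cintegrable_le _ HM).
  by have [c1 c2] := continuous_fourier tG; split; exact: continuous_measurable.
have := integrableZl measurableT M cauchy_real.
by under eq_fun do rewrite -EFinM.
Qed.

Lemma cmeasurable_fourier (G : V -> C) : testfun G -> cmeasurable (fourier G).
Proof. by move=> tG; apply: cintegrable_meas; exact: cintegrable_fourier. Qed.

Let ep (k : nat) : R := k.+1%:R^-1.
Let ep_gt0 k : 0 < ep k. Proof. by rewrite invr_gt0. Qed.
Let ep_cvg : ep k @[k --> \oo] --> (0 : R).
Proof. exact: cvg_harmonic. Qed.

Definition ifourier (G : V -> C) (x : V) : C := fourier G (- x).

(* Abel summation with exp(-2 pi e sum |x_i|), whose transform is a product of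
   one-dimensional Poisson kernels. *)
Lemma fourier_ifourier (G : V -> C) : testfun G -> fourier (ifourier G) = G.
Proof.
move=> tG; apply/funext => xi.
have iG := cintegrable_fourier tG; have mG := cintegrable_meas iG.
have [sG1 sG2] := tG.1.
have [M HM] := fourier_decay tG; have [B B0 HB] := testfun_bounded tG.
have mph : cmeasurable (fun x : V => cis (2 * pi * dot x xi)).
  apply: csmooth_measurable.
  by have := csmooth_phase (- xi); under eq_fun do rewrite dotNr mulrN opprK.
have -> : fourier (ifourier G) xi = cint mu (fun x => cis (2 * pi * dot x xi) * fourier G x).
  rewrite fourierE /ifourier -[RHS]cint_opp; last exact: cmeasurableM.
  by congr cint; apply/funext => x; rewrite dotNl mulrN mulrC.
(* Two limits of one sequence: letting [ep k] tend to 0 under the integral removes the Abel factor,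
   while after the multiplication formula the same integrals converge to [G xi]. *)
apply: (@ccvg_unique _ (fun k => cint mu (fun x => poisson (ep k) xi x * fourier G x))).
  apply: (@cint_dominated_cvg _ _ _ mu _ _ (fun x => M * \prod_i (1 + x i 0 ^+ 2)^-1)).
  - by move=> k; apply: cmeasurableM => //; exact: (cintegrable_meas (poisson_integrable _ _)).
  - exact: cmeasurableM.
  - move=> x; apply: ccvgM; last exact: ccvg_cst.
    rewrite -[X in ccvg _ X]mul1r; apply: ccvgM; last exact: ccvg_cst.
    apply: (@ccvg_real _ _ 1); rewrite -[X in _ --> X]expR0.
    apply: continuous_cvg; first exact: continuous_expR.
    rewrite -[X in _ --> X]oppr0; apply: cvgN.
    rewrite -[X in _ --> X](mul0r (\sum_i `|x i 0|)); apply: cvgMl.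
    by rewrite -[X in _ --> X](mulr0 (2 * pi)); apply: cvgMr.
  - have := integrableZl measurableT M cauchy_real.
    by under eq_fun do rewrite -EFinM.
  - move=> k x; apply: le_trans _ (HM x).
    rewrite !normcM normc_cis mulr1 normc_real ger0_norm ?expR_ge0//.
    rewrite ler_piMl ?normc_ge0// -expR0 ler_expR oppr_le0.
    by rewrite mulr_ge0 ?sumr_ge0// !mulr_ge0// ltW.
(* The substitution x = xi + ep k y turns the Poisson average of [G] at scale [ep k] into an average
   against one fixed Cauchy density. *)
pose H (k : nat) (y : V) : C := (pi ^- n.+1)%:C%C * cauchy y * G (xi + ep k *: y).
have mG' : cmeasurable G by exact: csmooth_measurable tG.1.
have mGk k : cmeasurable (fun y : V => G (xi + ep k *: y)).
  apply: (cmeasurable_comp mG'); apply: (measurableT_comp (measurable_addl xi)).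
  exact: measurable_scale.
have mH k : cmeasurable (H k).
  apply: cmeasurableM; first apply: cmeasurableM; [exact: cmeasurable_cst|exact: (cintegrable_meas cauchy_int.1)|exact: mGk].
have iH k : cintegrable mu (H k).
  by apply: (cintegrable_bounded (M := B) (cintegrableZ _ cauchy_int.1) (mGk k)) => x; exact: HB.
have E k : cint mu (fun x => poisson (ep k) xi x * fourier G x) = cint mu (H k).
  have e0 := ep_gt0 k; have en0 : ep k != 0 by rewrite gt_eqF.
  rewrite fourier_multiplication; [|exact: poisson_integrable|exact: testfun_integrable].
  have me : measurable_fun setT (fun x : V => (ep k)^-1 *: (- xi + x)).
    by apply: (measurableT_comp (measurable_scale _)); exact: measurable_addl.
  have s1 : scales_measure (fun x : V => - xi + x) 1 := @scales_measure_translate R n.+1 (- xi).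
  have s2 := scales_measure_scale (invr_neq0 en0).
  have c0 : 0 < (`|(ep k)^-1| ^+ n.+1)^-1 by rewrite invr_gt0 exprn_gt0// normr_gt0 invr_neq0.
  have s3 := scales_measure_comp (measurable_scale (ep k)^-1) (ltW c0) ler01 s2 s1.
  have c1 : 0 < 1 * (`|(ep k)^-1| ^+ n.+1)^-1 by rewrite mul1r.
  have := cint_scales c1 s3 (mH k).
  rewrite mul1r gtr0_norm ?invr_gt0// exprVn invrK => h.
  have ek0 : ep k ^+ n.+1 != 0 by rewrite expf_neq0.
  rewrite -[RHS]mul1r -[X in X * _](_ : (ep k ^- n.+1)%:C%C * (ep k ^+ n.+1)%:C%C = 1); last first.
    by rewrite -rmorphM/= mulVf// rmorph1.
  rewrite -mulrA -{}h -cintZ; last exact: (cintegrable_scales me c1 s3 (iH k)).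
  congr cint; apply/funext => x.
  rewrite /H scalerA mulfV// scale1r addrA subrr add0r.
  rewrite mulrA; congr (_ * _).
  rewrite poisson_fourier// /cauchy -rprod_complex -!rmorphM/=; congr (_%:C)%C.
  rewrite -[X in _ ^- X]card_ord -[X in pi ^- X]card_ord -!prodr_const -!prodfV -!big_split/=.
  apply: eq_bigr => i _; rewrite !mxE.
  have D : ep k ^+ 2 + (x i 0 - xi i 0) ^+ 2 != 0 by rewrite gt_eqF// ltr_pwDl ?sqr_ge0// exprn_gt0.
  have p0 : (pi : R) != 0 by rewrite gt_eqF.
  rewrite -[_ - x i 0]opprB sqrrN [- xi i 0 + _]addrC.
  have K (t s c : R) : t != 0 -> c != 0 -> t ^+ 2 + s ^+ 2 != 0 ->
      c^-1 * (t / (t ^+ 2 + s ^+ 2)) = t^-1 * (c^-1 * (1 + (t^-1 * s) ^+ 2)^-1).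
    move=> t0 c0' ts0.
    have -> : 1 + (t^-1 * s) ^+ 2 = (t ^+ 2 + s ^+ 2) / t ^+ 2 by field.
    by rewrite invf_div; field; rewrite ts0 t0 c0'.
  exact: K.
under eq_fun do rewrite E.
have pn0 : (pi : R) ^+ n.+1 != 0 by rewrite expf_neq0// gt_eqF.
have -> : G xi = cint mu (fun y => (pi ^- n.+1)%:C%C * cauchy y * G xi).
  under [X in cint _ X]eq_fun do rewrite [_ * cauchy _]mulrC -mulrA mulrC.
  rewrite cintZ; last exact: cauchy_int.1.
  by rewrite cauchy_int.2 mulrAC -rmorphM/= mulVf// rmorph1 mul1r.
apply: (@cint_dominated_cvg _ _ _ mu _ _ (fun x => B * (pi ^- n.+1 * \prod_i (1 + x i 0 ^+ 2)^-1))).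
- by [].
- apply: cmeasurableM; last exact: cmeasurable_cst.
  by apply: cmeasurableM; [exact: cmeasurable_cst|exact: (cintegrable_meas cauchy_int.1)].
- move=> x; apply: ccvgM; first exact: ccvg_cst.
  have cv : xi + ep k *: x @[k --> \oo] --> xi.
    rewrite -[X in _ --> X]addr0; apply: cvgD; first exact: cvg_cst.
    by rewrite -[X in _ --> X](scale0r x); apply: cvgZl.
  split.
    exact: (cvg_comp _ _ cv (Cinf_continuous sG1 (x := xi))).
  exact: (cvg_comp _ _ cv (Cinf_continuous sG2 (x := xi))).
- have := integrableZl measurableT (B * pi ^- n.+1) cauchy_real.
  by under eq_fun do rewrite -EFinM -mulrA.
- move=> k x; rewrite /H mulrC normcM ler_pM ?normc_ge0//.
  rewrite normcM /cauchy -rprod_complex !normc_real ger0_norm ?invr_ge0 ?exprn_ge0 ?(ltW pi_gt0)//.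
  rewrite ger0_norm//; apply: prodr_ge0 => i _.
  by rewrite invr_ge0 addr_ge0// sqr_ge0.
Qed.

Lemma fourier_conj (f : V -> C) x : cintegrable mu f ->
  conjc (fourier f x) = ifourier (fun y => conjc (f y)) x.
Proof.
move=> fi; rewrite /ifourier !fourierE -cint_conj; last exact: (cintegrable_phase _ fi).
congr cint; apply/funext => y; rewrite dotNr mulrN [in RHS]cisN.
exact: conjcM.
Qed.

Lemma cintegrable_ifourier (G : V -> C) : testfun G -> cintegrable mu (ifourier G).
Proof.
by move=> tG; exact: (cintegrable_scales measurable_oppmx ltr01 scales_measure_opp (cintegrable_fourier tG)).
Qed.

Lemma parseval (G H : V -> C) : testfun G -> testfun H ->
  inner (ifourier G) (ifourier H) = cint mu (fun x => G x * conjc (H x)).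
Proof.
move=> tG tH; rewrite /inner -[cintegral _]/(cint mu _) /ifourier.
rewrite (cint_opp (f := fun x => fourier G x * conjc (fourier H x))); last first.
  by apply: cmeasurableM; [|apply: cmeasurable_conj]; exact: cmeasurable_fourier.
have Hi := testfun_integrable tH; under eq_fun do rewrite fourier_conj// mulrC.
rewrite fourier_multiplication; [|exact: (cintegrable_ifourier (testfun_conj tH))|exact: testfun_integrable].
by rewrite fourier_ifourier; [congr cint; apply/funext => x; rewrite mulrC|exact: testfun_conj].
Qed.

End inversion.

(** * The smoothed tile *)

Section lattice_sums_real.
Context {R : realType} {n : nat}.
Local Notation V := 'cV[R]_n.
Local Notation Z := 'cV[int]_n.
Local Notation zvec := (@zvec R n).

Lemma lattice_finite (r : R) (x0 : V) : exists s : seq Z,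
  forall k x, `|x - x0| <= 1 -> `|x + zvec k| <= r -> k \in s.
Proof.
have [s us H] := lattice_sum_local r x0; exists s => k x xx0 xr.
(* The indicator of the ball, summed over a single lattice point, detects membership in the finite
   set. *)
pose F (y : V) : nat := (`|y| <= r)%R.
have Fr : forall y, r < `|y| -> F y = 0 by move=> y yr; rewrite /F leNgt yr.
have := H _ F Fr x xx0 [set k]; rewrite fsbig_set1 {1}/F xr => h.
apply/negPn/negP => ks; move: h; rewrite big1_seq// => l /andP[]; rewrite inE => -> kins.
by rewrite kins in ks.
Qed.

Lemma psum_le (S : set Z) (F : V -> R) k x : bsupp F -> (forall y, 0 <= F y) -> S k ->
  F (x + zvec k) <= psum S F x.
Proof.
move=> /bsupp_ge0[r r0 Fr] F0 Sk; have [s us H] := lattice_sum_local r x.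
have xx : `|x - x| <= 1 by rewrite subrr normr0.
have := H _ F Fr x xx [set k]; rewrite fsbig_set1 => ->.
rewrite /psum (H _ F Fr x xx) big_mkcond [leRHS]big_mkcond; apply: ler_sum => l _.
case: ifPn; last by case: ifP.
by rewrite inE => ->; rewrite mem_set.
Qed.

Lemma psum_single (T : nmodType) (S : set Z) (F : V -> T) x : S 0 ->
  (forall k, S k -> k != 0 -> F (x + zvec k) = 0) -> psum S F x = F x.
Proof.
move=> S0 H; transitivity (\sum_(k \in [set (0 : Z)]) F (x + zvec k)); last by rewrite fsbig_set1 zvec0 addr0.
apply/esym/fsbig_widen; first by move=> k ->.
by move=> k [Sk /eqP k0]; exact: H.
Qed.

Lemma psum_eq1 (T : nmodType) (S : set Z) (F : V -> T) x k0 : S k0 ->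
  (forall k, S k -> k != k0 -> F (x + zvec k) = 0) -> psum S F x = F (x + zvec k0).
Proof.
move=> S0 H; transitivity (\sum_(k \in [set k0]) F (x + zvec k)); last by rewrite fsbig_set1.
apply/esym/fsbig_widen; first by move=> k ->.
by move=> k [Sk /eqP k0']; exact: H.
Qed.

End lattice_sums_real.

Section bumps.
Context {R : realType} {n : nat}.
Local Notation V := 'cV[R]_n.

Definition bump (e : R) (c x : V) : R :=
  \prod_i (hexp 0 (e - (x i 0 - c i 0)) * hexp 0 (e + (x i 0 - c i 0))).

Lemma bump_ge0 e c x : 0 <= bump e c x.
Proof. by apply: prodr_ge0 => i _; rewrite mulr_ge0// hexp_ge0. Qed.

Lemma bump_gt0 e c x : `|x - c| < e -> 0 < bump e c x.
Proof.
move=> xc; apply: prodr_gt0 => i _.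
have := le_lt_trans (cV_norm_le (x - c) i) xc; rewrite !mxE ltr_norml => /andP[h1 h2].
by rewrite mulr_gt0// hexp_gt0//; lra.
Qed.

Lemma bump_eq0 e c x : 0 < e -> bump e c x != 0 -> `|x - c| <= e.
Proof.
move=> e0; apply: contraNT => xc.
have [i xi] : exists i, e <= `|x i 0 - c i 0|.
  apply/not_existsP => H; move: xc; rewrite -ltNge ltNge => /negP; apply.
  apply: cV_norm_leP; first exact: ltW.
  by move=> i; rewrite !mxE; have /negP := H i; rewrite -ltNge => /ltW.
rewrite /bump (bigD1 i)//=; move: xi; rewrite ler_normr => /orP[h|h].
  by rewrite hexp_eq0 ?mul0r//; lra.
by rewrite (@hexp_eq0 _ _ (e + (x i 0 - c i 0))) ?mulr0 ?mul0r//; lra.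
Qed.

Lemma Cinf_bump e c : Cinf (bump e c).
Proof.
move=> m; apply: Ck_prod => i; apply: CkM; apply: (Ck_comp (Cinf_hexp 0 m)).
  apply: CkB; first exact: Ck_cst.
  by apply: CkB; [exact: Cinf_coord|exact: Ck_cst].
apply: CkD; first exact: Ck_cst.
by apply: CkB; [exact: Cinf_coord|exact: Ck_cst].
Qed.

(** By compactness finitely many bumps centred in [K] suffice; their sum replaces a mollification of
    the indicator of [K]. *)
Lemma bump_cover (K : set V) (e : R) : compact K -> 0 < e ->
  exists g : V -> R, [/\ Cinf g, forall x, 0 <= g x, forall x, K x -> 0 < g x
    & forall x, g x != 0 -> exists2 y, K y & `|x - y| <= e].
Proof.
move=> cK e0.
have : cover_compact K by rewrite -compact_cover.
move=> /(_ _ K (fun y => ball y e)).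
case => [y _||D DK cov].
- exact: ball_open.
- by move=> y Ky; exists y => //; exact: ballxx.
pose s := finmap.enum_fset D.
exists (fun x => \sum_(y <- s) bump e y x); split.
- by move=> m; apply: Ck_sum => y; exact: Cinf_bump.
- by move=> x; apply: sumr_ge0 => y _; exact: bump_ge0.
- move=> x /cov[y /= yD]; rewrite -ball_normE /= distrC => xy.
  rewrite (big_rem y)//=; apply: ltr_pwDl; first exact: bump_gt0.
  by apply: sumr_ge0 => z _; exact: bump_ge0.
- move=> x; apply: contraNP => H; apply/eqP; apply: big1_seq => y /= ys.
  apply/eqP; apply/negPn/negP => /(bump_eq0 e0) xy; apply: H; exists y => //.
  by have := DK _ ys; rewrite inE.
Qed.

End bumps.

Section tile.
Context {R : realType} {n : nat}.
Local Notation V := 'cV[R]_n.+1.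
Local Notation Z := 'cV[int]_n.+1.
Local Notation mu := (@lebesgue_cV R n.+1).
Local Notation zvec := (@zvec R n.+1).

Definition cube (x : V) (e : R) : set V := [set y | `|y - x| <= e].

Lemma cube_cbox x e : 0 < e -> cube x e = cbox (x - const_mx e) (x + const_mx e).
Proof.
move=> e0; apply/seteqP; split=> y /=.
  move=> h i; have := le_trans (cV_norm_le (y - x) i) h; rewrite !mxE ler_norml; lra.
move=> h; apply: cV_norm_leP; first exact: ltW.
by move=> i; have := h i; rewrite !mxE ler_norml; lra.
Qed.

Lemma cube_not_negligible x e : 0 < e -> ~ mu.-negligible (cube x e).
Proof.
move=> e0; rewrite cube_cbox// => /(negligibleP _ (measurable_cbox _ _)).
rewrite [LHS]lebesgue_cV_box => [|i]; last by rewrite !mxE; lra.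
move=> /eqP; rewrite eqe; apply/negP; rewrite gt_eqF// prodr_gt0// => i _.
by rewrite !mxE; lra.
Qed.

Lemma negligible_translate (N : set V) v : mu.-negligible N ->
  mu.-negligible [set x | N (v + x)].
Proof.
move=> [M [mM M0 NM]]; exists [set x | M (v + x)]; split; last by move=> x /= /NM.
  by rewrite -[X in measurable X]setTI; exact: measurable_addl.
have := @scales_measure_translate R n.+1 v (fun x => (\1_M x)%:E).
have mvM : measurable [set x | M (v + x)].
  by rewrite -[X in measurable X]setTI; exact: measurable_addl.
have M0' : (\int[mu]_x (\1_M x)%:E = 0)%E by rewrite integral_indic// setIT.
rewrite M0' mule0 => <-.
- by rewrite -[LHS]/(mu ([set x | M (v + x)])) -[in LHS](setIT [set x | M (v + x)]) -integral_indic.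
- by apply/measurable_EFinP; exact: measurable_indic.
- by move=> x; rewrite lee_fin.
Qed.

Variables (D : set V) (B : 'M[R]_n.+1) (K : set V).
Hypothesis D0 : D 0.
Hypothesis DB : forall x y, D x -> D y -> D (x - y).
Hypothesis DZ : D `<=` int_lattice.
Hypothesis B_unit : B \in unitmx.
Hypothesis cK : compact K.
Hypothesis tileK : {ae mu, forall xi : V, \esum_(k in D) (\1_K (xi + k) : R)%:E = 1%E}.
Hypothesis KB : K `<=` mx_image B K°.

Let S : set Z := [set k | D (zvec k)].
Let S0 : S 0. Proof. by rewrite /S/= zvec0. Qed.
Let DN x : D x -> D (- x). Proof. by move=> Dx; rewrite -sub0r; exact: DB. Qed.
Let DD x y : D x -> D y -> D (x + y).
Proof. by move=> Dx Dy; rewrite -[y]opprK; apply: DB => //; exact: DN. Qed.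

(* K tiles only up to null sets; its measure-theoretic support K' is closed,
   and its translates cover, with disjoint interiors, without exception. *)
Let K' : set V := [set x | forall e, 0 < e -> ~ mu.-negligible (K `&` cube x e)].

Let K'K : K' `<=` K.
Proof.
move=> x Kx; have clK : closed K by apply: compact_closed => //; exact: norm_hausdorff.
apply: clK => U /nbhs_ballP[e /= e0 eU]; apply/set0P/negP => /eqP KU.
have e20 : 0 < e / 2 by rewrite divr_gt0.
apply: (Kx _ e20); apply: negligibleS (negligible_set0 mu).
rewrite -KU => y [Ky]; rewrite /cube /= => yx; split=> //; apply: eU.
by rewrite -ball_normE /= distrC (le_lt_trans yx)// ltr_pdivrMr// ltr_pMr// ltr1n.
Qed.

Let cubeS x e e' : e <= e' -> cube x e `<=` cube x e'.
Proof. by move=> ee y /= /le_trans; apply. Qed.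

Let KoK' : K° `<=` K'.
Proof.
move=> x /nbhs_ballP[e /= e0 eK] d d0.
pose m := Num.min (e / 2) d.
have m0 : 0 < m by rewrite lt_min d0 divr_gt0.
move=> H; apply: (@cube_not_negligible x m m0); apply: negligibleS H => y ym; split.
  apply: eK; rewrite -ball_normE /= distrC (le_lt_trans ym)//.
  by rewrite gt_min ltr_pdivrMr// ltr_pMr// ltr1n.
by apply: cubeS ym; rewrite ge_min lexx orbT.
Qed.

Let closedK' : closed K'.
Proof.
move=> x cx e e0 H.
have e20 : 0 < e / 2 by rewrite divr_gt0.
have [y [Ky]] := cx _ (nbhsx_ballx x _ e20).
rewrite -ball_normE /= => xy; apply: (Ky _ e20); apply: negligibleS H.
apply: setIS => z; rewrite /cube/= => zy.
rewrite -(subrK y z) -addrA (le_trans (ler_normD _ _))// (splitr e) lerD// ltW// distrC//.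
Qed.

Let cK' : compact K'.
Proof. exact: subclosed_compact closedK' cK K'K. Qed.

Let K'bound : exists2 r, 0 < r & forall x, K x -> `|x| <= r.
Proof.
have [M [_ HM]] := compact_bounded cK.
exists (Num.max (M + 1) 1); first by rewrite lt_max ltr01 orbT.
by move=> x Kx; rewrite le_max; apply/orP; left; apply: (HM (M + 1)) => //; rewrite ltrDl.
Qed.

(** Only finitely many translates come near [y]. If all of them missed [K'], a small cube about [y]
    would, up to a null set, be met by no translate of [K], against the tiling. *)
Let K'cover y : exists2 k, S k & K' (y + zvec k).
Proof.
apply: contrapT => H.
have [r r0 Kr] := K'bound.
have [s Hs] := lattice_finite r y.
have [e e0 He] : exists2 e, 0 < e & forall k, k \in s -> S k ->
    mu.-negligible (K `&` cube (y + zvec k) e).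
  elim: s {Hs} => [|k s [e e0 He]]; first by exists 1.
  have [Sk|nSk] := pselect (S k); last first.
    by exists e => // l; rewrite inE => /orP[/eqP -> //|]; exact: He.
  have /existsNP[d /not_implyP[d0 /contrapT Hd]] : ~ K' (y + zvec k) by move=> Hk; apply: H; exists k.
  exists (Num.min d e); first by rewrite lt_min d0.
  move=> l; rewrite inE => /orP[/eqP -> _|ls Sl].
    by apply: negligibleS Hd; apply: setIS; apply: cubeS; rewrite ge_min lexx.
  by apply: negligibleS (He l ls Sl); apply: setIS; apply: cubeS; rewrite ge_min lexx orbT.
pose m := Num.min e 1.
have m0 : 0 < m by rewrite lt_min e0 ltr01.
apply: (@cube_not_negligible y m m0).
(* Translating back by [k] gathers the finitely many negligible pieces into a single null set around
   [y]. *)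
have nU : mu.-negligible (\big[setU/set0]_(k <- s)
    [set x | (if k \in S then K `&` cube (y + zvec k) e else set0) (zvec k + x)]).
  rewrite big_seq; elim/big_rec: _ => [|k X ks nX]; first exact: negligible_set0.
  apply: negligibleU => //.
  apply: (@negligible_translate (if k \in S then K `&` cube (y + zvec k) e else set0)).
  case: ifPn => [|_]; last exact: negligible_set0.
  by rewrite inE => Sk; exact: He.
apply: negligibleS (negligibleU tileK nU) => x xm.
have [xT|] := pselect (\esum_(k in D) (\1_K (x + k) : R)%:E = 1%E); last by left.
right.
have [k Sk Kk] : exists2 k, S k & K (x + zvec k).
  apply: contrapT => nk; move: xT; rewrite esum1; first by move=> /eqP; rewrite eqe eq_sym oner_eq0.
  move=> d Dd; have /int_latticeP[k kE] := DZ Dd.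
  rewrite indicE memNset// => Kd; apply: nk; exists k; last by rewrite -kE.
  by rewrite /S/= -kE.
have ks : k \in s.
  apply: (Hs _ x); last exact: Kr.
  by apply: le_trans xm _; rewrite ge_min lexx orbT.
rewrite -bigcup_seq; exists k => //=; rewrite mem_set// [zvec k + x]addrC; split=> //.
by rewrite /cube/= opprD addrACA subrr addr0 (le_trans xm)// ge_min lexx.
Qed.

(** Otherwise, near [y], a non-null set of points [z] of [K] would also have [z + zvec k] in [K],
    and the tiling sum would be at least 2 there. *)
Let K'disj x y k : K'° x -> K' y -> S k -> x = y + zvec k -> k = 0.
Proof.
move=> /nbhs_ballP[e /= e0 eK] Ky Sk xE; apply: contrapT => k0.
have e20 : 0 < e / 2 by rewrite divr_gt0.
apply: (Ky _ e20); apply: negligibleS tileK => z [Kz zy] zT.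
have zk0 : zvec k != 0 by apply/eqP => h; apply: k0; apply: (@zvec_inj R); rewrite h zvec0.
have Kzk : K (z + zvec k).
  apply: K'K; apply: eK; rewrite -ball_normE /= xE opprD addrACA subrr addr0 distrC.
  by rewrite (le_lt_trans zy)// ltr_pdivrMr// ltr_pMr// ltr1n.
have : (2%:E <= \esum_(k in D) (\1_K (z + k) : R)%:E)%E.
  apply: esum_ge; exists [set 0; zvec k].
    by split; [exact: finite_set2|move=> d [->|->]].
  rewrite fsbigU/=; [|by []|by []|].
    by rewrite !fsbig_set1 addr0 !indicE !mem_set.
  by move=> d [-> h]; rewrite -h eqxx in zk0.
by rewrite zT lee_fin -[X in _ <= X]/(1%:R) ler_nat.
Qed.

Let Bi : 'M[R]_n.+1 := invmx B.

Let BK' x : K' x -> K'° (Bi *m x).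
Proof.
move=> /K'K/KB[y Ky <-]; rewrite mulmxA mulVmx// mul1mx.
by apply: filterS KoK' _; exact: (open_nbhs_nbhs (conj (@open_interior _ K) Ky)).
Qed.

(** The inclusion of [K] in B K° made quantitative: compactness of [K'] gives one radius [e] for all
    its points. *)
Let margin : exists2 e, 0 < e & forall x u, K' x -> `|u| <= e -> K'° (Bi *m x + u).
Proof.
have /compact_near_coveringP nc := cK'.
have : \forall u \near (0 : V), K' `<=` (fun x => K'° (Bi *m x + u)).
  apply: (nc V (nbhs (0 : V)) (fun u x => K'° (Bi *m x + u)) (nbhs_filter _)) => x Kx.
  have cadd : (fun z : V * V => Bi *m z.1 + z.2) @ (x, 0 : V) --> Bi *m x + 0.
    apply: cvgD; last exact: cvg_snd.
    apply: (@cvg_comp _ _ _ fst (fun z : V => Bi *m z)); first exact: cvg_fst.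
    by move: (@continuous_affine _ _ _ Bi 0 x); rewrite /continuous_at addr0; under eq_fun do rewrite addr0.
  rewrite addr0 in cadd.
  have := cadd _ (open_nbhs_nbhs (conj (@open_interior _ K') (BK' Kx))).
  by [].
move=> /nbhs_ballP[e /= e0 eH]; exists (e / 2); first by rewrite divr_gt0.
  move=> x u Kx ue; apply: (eH u) => //.
  by rewrite -ball_normE /= sub0r normrN (le_lt_trans ue)// ltr_pdivrMr// ltr_pMr// ltr1n.
Qed.

Let bernoulli (d : R) (j : nat) : 0 <= d -> 1 + j%:R * d <= (1 + d) ^+ j.
Proof.
move=> d0; elim: j => [|j IH]; first by rewrite mul0r addr0 expr0.
rewrite exprS; apply: le_trans (ler_wpM2l _ IH); last by rewrite addr_ge0.
have := mulr_ge0 (ler0n R j) (mulr_ge0 d0 d0).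
by rewrite -[j.+1%:R]natr1; nra.
Qed.

(** By the margin, [K'] is stable under (1 + q) B^-1 for some q > 0. Since [K'] is bounded and has
    an interior point, differences from that point decay like (1 + q)^-j under B^-j, and linearity
    extends this to all vectors. *)
Lemma tile_contraction (r d : R) : 0 < d ->
  exists J : nat, forall j (x : V), (J <= j)%N -> `|x| <= r -> `|Bi ^+ j *m x| <= d.
Proof.
move=> d0; have [e e0 He] := margin; have [rK rK0 HrK] := K'bound.
have [c c0 Hc] := mulmx_norm_le Bi.
(* Given |B^-1 x| <= c rK on [K'], this [q] keeps the extra displacement q B^-1 x within the
   margin. *)
pose q := e / (c * rK); have q0 : 0 < q by rewrite divr_gt0// mulr_gt0.
have step x : K' x -> K' ((1 + q) *: (Bi *m x)).
  move=> Kx; rewrite scalerDl scale1r; apply: interior_subset; apply: He => //.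
  have h : `|Bi *m x| <= c * rK.
    by apply: le_trans (Hc _) _; rewrite ler_pM2l//; apply: HrK; exact: K'K.
  rewrite normrZ gtr0_norm//; apply: le_trans (ler_wpM2l (ltW q0) h) _.
  by rewrite divfK// gt_eqF// mulr_gt0.
have iter j x : K' x -> K' ((1 + q) ^+ j *: (Bi ^+ j *m x)).
  elim: j x => [|j IH] x Kx; first by rewrite !expr0 scale1r mul1mx.
  have := IH _ (step _ Kx).
  by rewrite -scalemxAr scalerA -exprSr mulmxA [Bi ^+ j.+1]exprSr.
have [k _ Kk] := K'cover 0.
have /nbhs_ballP[p /= p0 Hp] := BK' Kk; set x0 := Bi *m _ in Hp.
have Kx0 : K' x0 by apply: Hp; exact: ballxx.
have small j (u : V) : `|u| < p -> (1 + q) ^+ j * `|Bi ^+ j *m u| <= 2 * rK.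
  move=> up; have Kx : K' (x0 + u).
    by apply: Hp; rewrite -ball_normE /= opprD addNKr normrN.
  have q1 : 0 <= (1 + q) ^+ j by rewrite exprn_ge0// addr_ge0// ltW.
  rewrite -{1}(ger0_norm q1) -normrZ.
  rewrite (_ : _ *: _ = (1 + q) ^+ j *: (Bi ^+ j *m (x0 + u)) - (1 + q) ^+ j *: (Bi ^+ j *m x0)).
    rewrite mulr_natl mulr2n (le_trans (ler_normB _ _))//.
    by apply: lerD; apply: HrK; apply: K'K; exact: iter.
  by rewrite -scalerBr -mulmxBr [x0 + u]addrC addrK.
pose r1 := Num.max r 1; have r10 : 0 < r1 by rewrite lt_max ltr01 orbT.
pose M := 2 * rK * (2 * r1 / p).
have M0 : 0 < M by rewrite !mulr_gt0// invr_gt0.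
pose J := (Num.truncn (M / d / q)).+1.
exists J => j x Jj xr.
have hJ : M / d / q < j%:R by apply: lt_le_trans (truncnS_gt _) _; rewrite ler_nat.
have hq : M / d <= (1 + q) ^+ j.
  apply: le_trans (bernoulli j (ltW q0)); apply: ler_wpDl => //.
  by rewrite -ler_pdivrMr// ltW.
(* Scaling by [a] brings [x] into the ball of radius [p], where [small] applies. *)
pose a := p / (2 * r1); have a0 : 0 < a by rewrite divr_gt0// mulr_gt0.
have := small j (a *: x).
rewrite normrZ gtr0_norm// -scalemxAr normrZ gtr0_norm// => /(_ _) h.
have {}h : (1 + q) ^+ j * (a * `|Bi ^+ j *m x|) <= 2 * rK.
  apply: h; apply: (@le_lt_trans _ _ (a * r1)).
    by rewrite ler_pM2l// (le_trans xr)// le_max lexx.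
  by rewrite /a mulrAC -mulf_div divff ?gt_eqF// mulr1 ltr_pdivrMr// ltr_pMr// ltr1n.
have h2 : M / d * (a * `|Bi ^+ j *m x|) <= 2 * rK.
  by apply: le_trans h; rewrite ler_wpM2r// mulr_ge0// ltW.
have E : M / d * (a * `|Bi ^+ j *m x|) = 2 * rK * (`|Bi ^+ j *m x| / d).
  by rewrite /M /a; field; rewrite !gt_eqF.
by move: h2; rewrite E ger_pMr ?mulr_gt0// ler_pdivrMr// mul1r.
Qed.

(** The iterates B^-j x of a point of [K'] stay in the closed set [K'] and tend to 0, so 0 belongs
    to [K']; one more application of B^-1 makes it interior. *)
Let K'0 : K'° 0.
Proof.
have [k _ Kk] := K'cover 0; set x := _ + _ in Kk.
have it j : K' (Bi ^+ j *m x).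
  elim: j => [|j IH]; first by rewrite expr0 mul1mx.
  by rewrite exprS -[_ * _]/(_ *m _) -mulmxA; apply: interior_subset; exact: BK'.
suff : K' 0 by move=> /BK'; rewrite mulmx0.
apply: closedK' => U /nbhs_ballP[e /= e0 eU].
have e20 : 0 < e / 2 by rewrite divr_gt0.
have [J HJ] := @tile_contraction `|x| (e / 2) e20.
exists (Bi ^+ J *m x); split=> //; apply: eU.
rewrite -ball_normE /= sub0r normrN (le_lt_trans (HJ J x (leqnn _) (lexx _)))//.
by rewrite ltr_pdivrMr// ltr_pMr// ltr1n.
Qed.

(** [th] is a smooth bump around [K'] divided by the square root of the periodization of its square.
    It equals 1 wherever a single translate of the bump is active, and the margin places the image
    under B^-1 of its support among such points. *)
Lemma tile_partition : exists th : V -> R,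
  [/\ Cinf th, bsupp th, forall x, psum S (fun y => th y ^+ 2) x = 1,
      forall x, th x != 0 -> th (Bi *m x) = 1
    & exists2 d, 0 < d & forall x, `|x| <= d -> th x = 1].
Proof.
have [e e0 He] := margin; have [rK rK0 HrK] := K'bound.
have [c c0 Hc] := mulmx_norm_le Bi.
(* Of the margin, c e' absorbs the image under B^-1 of the enlargement of [K'], and e' the reach of
   a neighbouring bump. *)
pose e' := e / (c + 1); have e'0 : 0 < e' by rewrite divr_gt0// ltr_wpDl// ltW.
have ce' : c * e' + e' = e.
  by rewrite -{2}[e']mul1r -mulrDl mulrC divfK// gt_eqF// ltr_wpDl// ltW.
have [g [sg g0 gpos gsupp]] := bump_cover cK' e'0.
pose g2 (x : V) := g x ^+ 2; pose P := psum S g2.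
have sg2 : Cinf g2.
  move=> m; rewrite (_ : g2 = fun x => g x * g x); last by apply/funext => x; rewrite -expr2.
  by apply: CkM; exact: sg.
have bg : bsupp g.
  exists (rK + e') => x; apply: contraTeq => /gsupp[y Ky xy]; rewrite -leNgt.
  by rewrite -(subrK y x) addrC (le_trans (ler_normD _ _))// lerD//; apply: HrK; exact: K'K.
have bg2 : bsupp g2 by case: bg => r Hr; exists r => x /Hr h; rewrite /g2 h expr0n.
have Ppos x : 0 < P x.
  have [k Sk /gpos Kk] := K'cover x.
  apply: lt_le_trans (psum_le x bg2 _ Sk); first by rewrite /g2 exprn_gt0.
  by move=> y; exact: sqr_ge0.
have sP : Cinf P by exact: Cinf_psum.
have Pper x k : S k -> P (x + zvec k) = P x.
  move=> Sk; apply: psum_shift => l; split => Sl.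
    by rewrite /S/= zvecD; exact: DD.
  by rewrite -[l](addrK k) /S/= zvecB; exact: DB.
pose th x := g x * (Num.sqrt (P x))^-1.
have thne x : g x != 0 -> th x != 0.
  by move=> gx; rewrite mulf_neq0// invr_eq0 gt_eqF// sqrtr_gt0.
have th1 x : th x != 0 -> th (Bi *m x) = 1.
  rewrite mulf_eq0 negb_or => /andP[/gsupp[y Ky xy] _].
  set w := Bi *m x; have wE : w = Bi *m y + Bi *m (x - y) by rewrite -mulmxDr addrC subrK.
  have bw : `|Bi *m (x - y)| <= c * e' by apply: le_trans (Hc _) _; rewrite ler_pM2l.
  have Kw u : `|u| <= e' -> K'° (w + u).
    move=> ue; rewrite wE -addrA; apply: He => //.
    by rewrite -ce' (le_trans (ler_normD _ _))// lerD.
  have gw : 0 < g w.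
    by apply: gpos; apply: interior_subset; rewrite -(addr0 w); apply: Kw; rewrite normr0 ltW.
  have PE : P w = g2 w.
    (* A second active translate would put a point of [K'], moved by -k, in the interior of [K'],
       which [K'disj] excludes. *)
    apply: psum_single => // k Sk k0; rewrite /g2 -[RHS](expr0n R 2); congr (_ ^+ _).
    apply/eqP; apply/negPn/negP => /gsupp[z Kz wz]; move/eqP: k0; apply.
    apply: oppr_inj; rewrite oppr0.
    apply: (@K'disj (w + (z - (w + zvec k))) z); last by rewrite zvecN opprD addrCA addNKr.
    - by apply: Kw; rewrite distrC.
    - by [].
    - by rewrite /S/= zvecN; exact: DN.
  by rewrite /th PE /g2 sqrtr_sqr gtr0_norm// divff// gt_eqF.
exists th; split.
- move=> m; apply: CkM; first exact: sg.
  apply: Ck_inv; last by apply: Ck_sqrt; [exact: Ppos|exact: sP].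
  by move=> x; rewrite gt_eqF// sqrtr_gt0.
- by case: bg => r Hr; exists r => x /Hr h; rewrite /th h mul0r.
- move=> x; transitivity (psum S g2 x / P x); last by rewrite divff// gt_eqF.
  have [r Hr] := bg; have [s _ H] := lattice_sum_local r x.
  have xx : `|x - x| <= 1 by rewrite subrr normr0.
  rewrite /psum (H _ g2 _ x xx); last by move=> y /Hr h; rewrite /g2 h expr0n.
  rewrite (H _ (fun y => th y ^+ 2) _ x xx); last by move=> y /Hr h; rewrite /th h mul0r expr0n.
  rewrite mulr_suml; apply: eq_bigr => k; rewrite inE => Sk.
  by rewrite /th exprMn Pper// exprVn sqr_sqrtr// ltW.
- exact: th1.
have /nbhs_ballP[p /= p0 Hp] := K'0.
have [b b0 Hb] := mulmx_norm_le B.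
exists (p / (2 * b)); first by rewrite divr_gt0// mulr_gt0.
(* For small x, B x lies in [K'], where [th] is nonzero, and x = B^-1 (B x). *)
move=> x xp; rewrite -[x]mul1mx -(mulVmx B_unit) -mulmxA; apply: th1; apply: thne.
rewrite gt_eqF//; apply: gpos; apply: Hp; rewrite -ball_normE /= sub0r normrN.
apply: le_lt_trans (Hb _) _; rewrite mulrC; apply: le_lt_trans (ler_wpM2r (ltW b0) xp) _.
rewrite (_ : p / (2 * b) * b = p / 2); last by field; rewrite gt_eqF.
by rewrite ltr_pdivrMr// ltr_pMr// ltr1n.
Qed.

End tile.

(** * Characters of a finite quotient *)

Section char_aux.
Context {R : realType}.
Local Notation C := R[i].

Lemma cis_eq1 (t : R) : cis (2 * pi * t) = 1 -> t \is a Num.int.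
Proof.
pose k := Num.floor t; pose u := t - k%:~R.
have u0 : 0 <= u by rewrite subr_ge0 floor_le.
have u1 : u < 1 by have := floorD1_gt t; rewrite intrD -/k /u; lra.
have -> : cis (2 * pi * t) = cis (2 * pi * u).
  by rewrite -{1}(subrK k%:~R t) -/u mulrDr cisD [X in _ * X]cis_int ?mulr1// intr_int.
move=> h; have : u = 0.
  apply/eqP; apply/negPn/negP => un0.
  have : 0 < sin (pi * u).
    have u0' : 0 < u by rewrite lt_def un0.
    by apply: sin_gt0_pi; rewrite ?mulr_gt0 ?gtr_pMr ?pi_gt0.
  have : cos (2 * pi * u) = 1 by rewrite -Re_cis h.
  rewrite (_ : 2 * pi * u = pi * u + pi * u); last by ring.
  by rewrite cosD -!expr2 cos2sin2; nra.
by move/eqP; rewrite subr_eq0 => /eqP ->; exact: intr_int.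
Qed.

(** The classical proof that a nontrivial character sums to 0, the translation of the group being
    replaced by a permutation of representatives. *)
Lemma sum_shift_eq0 (I : finType) (F : I -> C) (sigma : I -> I) (c : C) :
  injective sigma -> c != 1 -> (forall i, F (sigma i) = c * F i) -> \sum_i F i = 0.
Proof.
move=> inj c1 H; have E : \sum_i F i = c * \sum_i F i.
  by rewrite {1}(reindex_inj inj)/= mulr_sumr; apply: eq_bigr => i _.
apply/eqP; have : (1 - c) * \sum_i F i == 0 by rewrite mulrBl mul1r -E subrr.
by rewrite mulf_eq0 subr_eq0 eq_sym (negbTE c1).
Qed.

Lemma normc_sqr_cis (t : R) : cis t * conjc (cis t) = 1.
Proof. by rewrite normc_mulconj normc_cis expr1n. Qed.

Lemma conjc_sum I (s : seq I) (P : pred I) (F : I -> C) :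
  conjc (\sum_(i <- s | P i) F i) = \sum_(i <- s | P i) conjc (F i).
Proof. exact: (raddf_sum (@conjc R)). Qed.

End char_aux.

Section characters.
Context {R : realType} {n : nat}.
Local Notation C := R[i].
Local Notation V := 'cV[R]_n.
Local Notation Z := 'cV[int]_n.
Local Notation zvec := (@zvec R n).

Lemma psum_translate (T : nmodType) (S : set Z) (F : V -> T) (x : V) (h : Z) :
  psum S F (x + zvec h) = psum [set k | S (k - h)] F x.
Proof.
rewrite /psum [RHS](reindex_fsbig (fun k : Z => k + h) S).
  by apply: eq_fsbigr => k _; rewrite zvecD (addrC (zvec k)) addrA.
split; first by move=> k /= Sk; rewrite addrK.
  by move=> k l _ _ /addIr.
by move=> k Sk; exists (k - h) => //; rewrite subrK.
Qed.

Lemma psumZ (S : set Z) (F : V -> C) (c : C) (x : V) : bsupp F ->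
  psum S (fun y => c * F y) x = c * psum S F x.
Proof.
move=> [r Fr]; have [s us H] := lattice_sum_local r x.
have xx : `|x - x| <= 1 by rewrite subrr normr0.
rewrite /psum (H _ F Fr x xx) (H _ (fun y => c * F y) _ x xx) ?mulr_sumr//.
by move=> y /Fr ->; rewrite mulr0.
Qed.

Lemma psumD (T : nmodType) (S : set Z) (F H : V -> T) (x : V) : bsupp F -> bsupp H ->
  psum S (fun y => F y + H y) x = psum S F x + psum S H x.
Proof.
move=> [r1 Fr] [r2 Hr]; have [t _ loc] := lattice_sum_local (Num.max r1 r2) x.
have xx : `|x - x| <= 1 by rewrite subrr normr0.
rewrite /psum (loc _ F _ x xx); last by move=> y; rewrite gt_max => /andP[/Fr].
rewrite (loc _ H _ x xx); last by move=> y; rewrite gt_max => /andP[_ /Hr].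
rewrite (loc _ (fun y => F y + H y) _ x xx) ?big_split// => y.
by rewrite gt_max => /andP[/Fr -> /Hr ->]; rewrite addr0.
Qed.

Lemma bsuppD (T : nmodType) (F H : V -> T) : bsupp F -> bsupp H ->
  bsupp (fun y => F y + H y).
Proof.
move=> [r1 Fr] [r2 Hr]; exists (Num.max r1 r2) => y.
by rewrite gt_max => /andP[/Fr -> /Hr ->]; rewrite addr0.
Qed.

Lemma psum_sum (S : set Z) I (s : seq I) (F : I -> V -> C) (x : V) :
  (forall i, bsupp (F i)) ->
  psum S (fun y => \sum_(i <- s) F i y) x = \sum_(i <- s) psum S (F i) x.
Proof.
move=> Fb; elim: s => [|i s IH].
  by rewrite big_nil /psum; apply: fsbig1 => k _; rewrite big_nil.
rewrite big_cons -IH -psumD//.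
  by apply: eq_fsbigr => k _; rewrite big_cons.
elim: s {IH} => [|j s IH]; first by exists 0 => y _; rewrite big_nil.
by under eq_fun do rewrite big_cons; exact: bsuppD.
Qed.

Variables (L : set V) (s : nat) (a : 'I_s -> V) (tau : V -> R).
Hypothesis L0 : L 0.
Hypothesis LB : forall x y, L x -> L y -> L (x - y).
Hypothesis ZL : int_lattice `<=` L.
Hypothesis La : forall i, L (a i).
Hypothesis a_surj : forall x, L x -> exists i, int_lattice (x - a i).
Hypothesis a_inj : forall i j, int_lattice (a i - a j) -> i = j.

Definition dualZ : set Z := [set k | dual_lattice L (zvec k)].
Hypothesis tau_b : bsupp tau.
Hypothesis tau1 : forall x, psum dualZ (fun y => tau y ^+ 2) x = 1.

(** For representatives a_i of L/Z^n, the maps k |-> exp(2 pi i <k, a_i>) are the characters of Z^n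
    modulo the dual of L; the factor s^(-1/2) normalizes the family. *)
Definition fiber (i : 'I_s) (x : V) : C :=
  ((Num.sqrt s%:R)^-1 * tau x)%:C%C * cis (2 * pi * dot x (a i)).

Let ch (k : Z) (x : V) : C := cis (2 * pi * dot (zvec k) x).

Let chD k l x : ch (k + l) x = ch k x * ch l x.
Proof. by rewrite /ch zvecD dotDl mulrDr cisD. Qed.

Let chDr k x y : ch k (x + y) = ch k x * ch k y.
Proof. by rewrite /ch dotDr mulrDr cisD. Qed.

Let dot_zz k x : int_lattice x -> dot (zvec k) x \is a Num.int.
Proof.
move=> Hx; rewrite /dot rpred_sum// => i _; rewrite mxE rpredM//; first exact: intr_int.
Qed.

Let ch_int k x : int_lattice x -> ch k x = 1.
Proof. by move=> Zx; rewrite /ch cis_int//; exact: dot_zz. Qed.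

Let ch_dual k x : dualZ k -> L x -> ch k x = 1.
Proof. by move=> Sk Lx; rewrite /ch cis_int//; exact: Sk. Qed.

Let intB x y : int_lattice x -> int_lattice y -> int_lattice (x - y : V).
Proof. by move=> Zx Zy i; rewrite !mxE rpredB. Qed.

Let LD x y : L x -> L y -> L (x + y).
Proof. by move=> Lx Ly; rewrite -[y]opprK; apply: LB => //; rewrite -sub0r; exact: LB. Qed.

Let s_gt0 : (0 < s)%N.
Proof. by have [[m Hm] _] := a_surj L0; exact: leq_ltn_trans Hm. Qed.

Let sum_ch (k : Z) : \sum_i ch k (a i) = if k \in dualZ then s%:R else 0.
Proof.
case: ifPn => [|/negP]; rewrite inE => Sk.
  rewrite (eq_bigr (fun=> 1)) ?sumr_const ?card_ord// => i _.
  exact: ch_dual.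
have /existsNP[g /not_implyP[Lg kg]] := Sk.
have /choice[sg Hsg] i := a_surj (LD (La i) Lg).
apply: (@sum_shift_eq0 _ _ _ sg (ch k g)).
- move=> i j sij; apply: a_inj.
  rewrite (_ : a i - a j = (a i + g - a (sg i)) - (a j + g - a (sg j))).
    exact: intB.
  by rewrite sij; apply/colP => c; rewrite !mxE; lra.
- by apply/eqP => /cis_eq1.
- move=> i; rewrite -chDr addrC.
  by rewrite -(subrK (a (sg i)) (a i + g)) [in RHS]chDr (ch_int _ (Hsg i)) mul1r.
Qed.

Let cis_zD (x y : V) k : cis (2 * pi * dot (x + zvec k) y) = cis (2 * pi * dot x y) * ch k y.
Proof. by rewrite dotDl mulrDr cisD. Qed.

Let s_sqrt : ((Num.sqrt s%:R)^-1 : R) ^+ 2 = s%:R^-1.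
Proof. by rewrite exprVn sqr_sqrtr. Qed.

(** Orthogonality of the characters leaves only shifts by the dual lattice. The representatives
    disappear from the kernel, which is why it can telescope over the scales. *)
Lemma fiber_kernel (x : V) (k : Z) :
  \sum_i fiber i x * conjc (fiber i (x + zvec k)) =
  (tau x * tau (x + zvec k))%:C%C * (k \in dualZ)%:R.
Proof.
have E i : fiber i x * conjc (fiber i (x + zvec k)) =
    (s%:R^-1 * (tau x * tau (x + zvec k)))%:C%C * conjc (ch k (a i)).
  rewrite /fiber cis_zD !conjcM conjc_real -s_sqrt.
  transitivity (((Num.sqrt s%:R)^-1 ^+ 2 * (tau x * tau (x + zvec k)))%:C%C *
     (cis (2 * pi * dot x (a i)) * conjc (cis (2 * pi * dot x (a i)))) * conjc (ch k (a i))); last first.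
    by rewrite normc_sqr_cis mulr1.
  rewrite expr2 !rmorphM/=; ring.
under eq_bigr do rewrite E.
rewrite -mulr_sumr -conjc_sum sum_ch; case: ifPn => _; last by rewrite conjc0 !mulr0.
rewrite conjc_nat mulr1 -[X in _ * X](rmorph_nat (@real_complex R)) -rmorphM/= mulrC mulVKf//.
by rewrite pnatr_eq0 -lt0n.
Qed.

Let dualB k l : dualZ k -> dualZ l -> dualZ (k - l).
Proof. by move=> Sk Sl g Lg; rewrite zvecB dotBl rpredB; [|exact: Sk|exact: Sl]. Qed.

Let dual0 : dualZ 0.
Proof. by move=> g _; rewrite zvec0 dot0l. Qed.

Let dualN k : dualZ k -> dualZ (- k).
Proof. by move=> Sk; rewrite -sub0r; exact: dualB. Qed.

Let separated t (k : 'I_t -> Z) := forall j j', dualZ (k j - k j') -> j = j'.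

Let nat_unit : (s%:R : C) != 0.
Proof. by rewrite pnatr_eq0 -lt0n. Qed.

(** Orthogonality factors the identity of size t through dimension s, and the rank bounds t. *)
Let separated_le t (k : 'I_t -> Z) : separated k -> (t <= s)%N.
Proof.
move=> sk; pose X := \matrix_(j < t, i < s) (s%:R^-1 * ch (- k j) (a i) : C).
pose Y := \matrix_(i < s, j < t) ch (k j) (a i).
apply: (@mulmx1_min _ _ _ X Y); apply/matrixP => j j'; rewrite !mxE.
under eq_bigr do rewrite !mxE -mulrA -chD.
rewrite -mulr_sumr sum_ch; case: ifPn => [|/negP]; rewrite inE => H.
  by rewrite mulVf// (sk j' j) ?eqxx// addrC.
rewrite mulr0; case: eqP => // jj; exfalso; apply: H.
by rewrite jj addNr.
Qed.

(** Z^n modulo the dual lattice has exactly s classes: a separated family of maximal size is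
    complete, which gives the second orthogonality relation, and the rank argument with the roles
    exchanged yields s <= t. *)
Let max_family : exists k : 'I_s -> Z, [/\ separated k, forall l, exists j, dualZ (l - k j) &
  forall x, L x -> ~ int_lattice x -> \sum_j ch (k j) x = 0].
Proof.
pose P := [pred t | `[< exists k : 'I_t -> Z, separated k >]].
have P0 : exists t, P t.
  by exists 0%N; apply/asboolP; exists (fun=> 0) => -[].
have Pb t : P t -> (t <= s)%N by move=> /asboolP[k /separated_le].
case: (ex_maxnP P0 Pb) => t /asboolP[k sk] tmax.
have cov l : exists j, dualZ (l - k j).
  apply: contrapT => nl; have : P t.+1; last by move=> /tmax; rewrite ltnn.
  apply/asboolP; exists (fun j => oapp k l (unlift ord0 j)) => i j.
  case: unliftP => [i'|] ->; case: unliftP => [j'|] -> //=.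
  - by move=> /sk ->.
  - by move=> H; exfalso; apply: nl; exists i'; rewrite -opprB; exact: dualN.
  - by move=> H; exfalso; apply: nl; exists j'.
have sum0 x : L x -> ~ int_lattice x -> \sum_j ch (k j) x = 0.
  move=> Lx /existsNP[c xc]; pose e : Z := delta_mx c 0.
  have de : dot (zvec e) x = x c 0.
    rewrite /dot (bigD1 c)//= !mxE !eqxx mul1r big1 ?addr0// => i ic.
    by rewrite !mxE (negbTE ic) mul0r.
  have /choice[sg Hsg] j := cov (k j + e).
  apply: (@sum_shift_eq0 _ _ _ sg (ch e x)).
  - move=> i j sij; apply: sk.
    rewrite (_ : k i - k j = (k i + e - k (sg i)) - (k j + e - k (sg j))); first exact: dualB.
    by rewrite sij; apply/colP => ?; rewrite !mxE; ring.
  - by apply/eqP => /cis_eq1; rewrite de.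
  - move=> i; rewrite -chD addrC.
    by rewrite -(subrK (k (sg i)) (k i + e)) [in RHS]chD (ch_dual (Hsg i) Lx) mul1r.
have t0 : (t%:R : C) != 0.
  rewrite pnatr_eq0 -lt0n; have [[m Hm] _] := cov 0; exact: leq_ltn_trans Hm.
suff st : t = s by move: k sk cov sum0; rewrite st => k sk cov sum0; exists k.
apply/eqP; rewrite eqn_leq (separated_le sk)/=.
pose X := \matrix_(i < s, j < t) (t%:R^-1 * ch (k j) (a i) : C).
pose Y := \matrix_(j < t, i < s) ch (k j) (- a i).
apply: (@mulmx1_min _ _ _ X Y); apply/matrixP => i j; rewrite !mxE.
under eq_bigr do rewrite !mxE -mulrA -chDr.
rewrite -mulr_sumr; have [ij|/eqP ij] := eqVneq i j.
  rewrite (eq_bigr (fun=> 1)) ?sumr_const ?card_ord ?mulVf// => l _.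
  by rewrite ij subrr ch_int// => c; rewrite mxE.
by rewrite sum0 ?mulr0//; [exact: LB|move=> /a_inj].
Qed.

Lemma psum_real (S : set Z) (F : V -> R) x : bsupp F ->
  psum S (fun y => (F y)%:C%C) x = (psum S F x)%:C%C.
Proof.
move=> [r Fr]; have [t _ H] := lattice_sum_local r x.
have xx : `|x - x| <= 1 by rewrite subrr normr0.
rewrite /psum (H _ F Fr x xx) (H _ (fun y => (F y)%:C%C) _ x xx) ?rmorph_sum//.
by move=> y /Fr ->.
Qed.

Let psum_split (k : 'I_s -> Z) (T : nmodType) (F : V -> T) x : separated k ->
  (forall l, exists j, dualZ (l - k j)) -> bsupp F ->
  psum setT F x = \sum_m psum dualZ F (x + zvec (k m)).
Proof.
move=> sk cov [r Fr]; have [t _ H] := lattice_sum_local r x.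
have xx : `|x - x| <= 1 by rewrite subrr normr0.
under eq_bigr do rewrite psum_translate /psum (H _ F Fr x xx) big_mkcond.
rewrite exchange_big /psum (H _ F Fr x xx) big_mkcond/=; apply: eq_bigr => l _.
rewrite mem_set//; have [j Hj] := cov l.
rewrite (bigD1 j)//= mem_set// big1 ?addr0// => i ij.
rewrite memNset// => /= Hi; move/eqP: ij; apply; apply: sk.
by rewrite (_ : k i - k j = (l - k j) - (l - k i)); [exact: dualB|rewrite opprB [RHS]addrC addrA subrK].
Qed.

(** Z^n is split into s classes modulo the dual lattice. On each class the exponentials leave the
    sum and the squares of [tau] add up to 1; the sum over the classes is then an orthogonality
    relation. *)
Lemma fiber_gram (i j : 'I_s) (x : V) :
  psum setT (fun y => fiber i y * conjc (fiber j y)) x = (i == j)%:R.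
Proof.
have [k [sk cov sum0]] := max_family.
have b2 : bsupp (fun y => tau y ^+ 2) by case: tau_b => r Hr; exists r => y /Hr ->; rewrite expr0n.
pose F y : C := (s%:R^-1 * tau y ^+ 2)%:C%C * cis (2 * pi * dot y (a i - a j)).
have FE y : fiber i y * conjc (fiber j y) = F y.
  rewrite /F /fiber conjcM conjc_real -s_sqrt dotBr mulrBr cisD cisN expr2 !rmorphM/=; ring.
under eq_fun do rewrite FE.
rewrite (psum_split _ sk cov); last first.
  by case: b2 => r Hr; exists r => y /Hr h; rewrite /F h mulr0 mul0r.
have E m : psum dualZ F (x + zvec (k m)) =
   s%:R^-1 * cis (2 * pi * dot x (a i - a j)) * ch (k m) (a i - a j).
  transitivity (psum dualZ (fun y => (s%:R^-1 * cis (2 * pi * dot x (a i - a j)) * ch (k m) (a i - a j)) * ((tau y ^+ 2)%:C)%C) (x + zvec (k m))).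
    apply: eq_fsbigr => l; rewrite inE => Sl.
    rewrite /F !cis_zD (ch_dual Sl) ?mulr1; last exact: LB.
    rewrite rmorphM/= fmorphV rmorph_nat; ring.
  rewrite psumZ; last by case: b2 => r Hr; exists r => y /Hr ->.
  by rewrite psum_real// tau1 mulr1.
under eq_bigr do rewrite E.
rewrite -mulr_sumr; have [ij|/eqP ij] := eqVneq i j.
  rewrite ij subrr dotC dot0l mulr0 cis0 mulr1.
  rewrite (eq_bigr (fun=> 1)) ?sumr_const ?card_ord ?mulVf// => l _.
  by rewrite ch_int// => c; rewrite mxE.
by rewrite sum0 ?mulr0//; [exact: LB|move=> /a_inj].
Qed.

End characters.

(** * Orthonormal completion of periodic frames *)

Section conjugate_transpose.
Context {R : realType}.
Local Notation C := R[i].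

Definition hconj m k (M : 'M[C]_(m, k)) : 'M[C]_(k, m) := map_mx (@conjc R) M^T.

Lemma cconjD (a b : C) : conjc (a + b) = conjc a + conjc b.
Proof. exact: (raddfD (@conjc R)). Qed.

Lemma hconjK m k (M : 'M[C]_(m, k)) : hconj (hconj M) = M.
Proof. by apply/matrixP => i j; rewrite !mxE conjcK. Qed.

Lemma hconjM m k l (M : 'M[C]_(m, k)) (N : 'M[C]_(k, l)) :
  hconj (M *m N) = hconj N *m hconj M.
Proof. by rewrite /hconj trmx_mul map_mxM. Qed.

Lemma hconj1 m : hconj 1%:M = 1%:M :> 'M[C]_m.
Proof. by rewrite /hconj trmx1 map_mx1. Qed.

Lemma hconj_row m k l (M : 'M[C]_(m, k)) (N : 'M[C]_(m, l)) :
  hconj (row_mx M N) = col_mx (hconj M) (hconj N).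
Proof. by rewrite /hconj tr_row_mx map_col_mx. Qed.

Lemma hconj_col m k l (M : 'M[C]_(m, k)) (N : 'M[C]_(l, k)) :
  hconj (col_mx M N) = row_mx (hconj M) (hconj N).
Proof. by rewrite /hconj tr_col_mx map_row_mx. Qed.

Lemma hconj0 m k : hconj (0 : 'M[C]_(m, k)) = 0.
Proof. by rewrite /hconj trmx0 map_mx0. Qed.

Definition normsq k (x : 'rV[C]_k) : R := \sum_j normc (x 0 j) ^+ 2.

Lemma normsqE k (x : 'rV[C]_k) : x *m hconj x = ((normsq x)%:C%C)%:M.
Proof.
apply/matrixP => i j; rewrite !ord1 !mxE eqxx mulr1n rmorph_sum; apply: eq_bigr => l _.
by rewrite !mxE normc_mulconj.
Qed.

Lemma normsq_ge0 k (x : 'rV[C]_k) : 0 <= normsq x.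
Proof. by apply: sumr_ge0 => j _; exact: sqr_ge0. Qed.

Lemma normsq_eq0 k (x : 'rV[C]_k) : normsq x = 0 -> x = 0.
Proof.
move=> /eqP; rewrite psumr_eq0 => [/allP H|j _]; last exact: sqr_ge0.
apply/rowP => j; rewrite mxE; have := H j (mem_index_enum _).
by rewrite /= sqrf_eq0 => /eqP/eq0_normc.
Qed.

Section householder.
Variables (k : nat) (v w : 'rV[C]_k).
Hypotheses (v1 : v *m hconj v = 1%:M) (w1 : w *m hconj w = 1%:M) (vw : v != w).

Let z : C := (w *m hconj v) 0 0 - 1.
Let d := v - w.

(* The complex constant z lets this reflection-like matrix send w to v without
   first adjusting their phases, hence smoothly in v. *)
Definition householder : 'M[C]_k := 1%:M + z^-1 *: (hconj d *m d).

Let hconjB (x y : 'rV[C]_k) : hconj (x - y) = hconj x - hconj y.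
Proof. by rewrite /hconj raddfB /= map_mxB. Qed.

Let scal (x y : 'rV[C]_k) : x *m hconj y = ((x *m hconj y) 0 0)%:M.
Proof. exact: mx11_scalar. Qed.

Let wd : w *m hconj d = z%:M.
Proof. by rewrite hconjB mulmxBr w1 scal -raddfB. Qed.

Let vwc : (v *m hconj w) 0 0 = conjc (z + 1).
Proof. by rewrite /z subrK -[v *m _]hconjK hconjM hconjK !mxE. Qed.

Let dd : d *m hconj d = (- (z + conjc z))%:M.
Proof.
rewrite mulmxBl wd hconjB mulmxBr v1 [v *m hconj w]scal vwc cconjD conjc1.
by rewrite -!raddfB/=; congr (_%:M); ring.
Qed.

(** |v - w|^2 = -(z + conj z), so z = 0 would force v = w. *)
Lemma householder_neq0 : z != 0.
Proof.
apply/eqP => z0; move/eqP: vw; apply; apply/eqP; rewrite -subr_eq0; apply/eqP.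
apply: normsq_eq0; have := normsqE d; rewrite -/d dd z0 conjc0 addr0 oppr0.
by move=> /matrixP/(_ 0 0); rewrite !mxE eqxx !mulr1n => -[<-].
Qed.

Lemma householder_map : w *m householder = v.
Proof.
rewrite mulmxDr mulmx1 -scalemxAr mulmxA wd mul_scalar_mx scalerA.
by rewrite mulVf ?householder_neq0// scale1r addrC subrK.
Qed.

Lemma householder_unitary : householder *m hconj householder = 1%:M.
Proof.
have z0 := householder_neq0.
have cz0 : conjc z != 0 by rewrite conjc_eq0.
have -> : hconj householder = 1%:M + (conjc z)^-1 *: (hconj d *m d).
  rewrite /householder /hconj raddfD/= map_mxD -/(hconj _) hconj1; congr (_ + _).
  rewrite linearZ/= -conjc_inv -[RHS](_ : map_mx (@conjc R) (z^-1 *: (hconj d *m d)^T) = _)//.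
  by rewrite map_mxZ -/(hconj _) hconjM hconjK.
have : (hconj d *m d) *m (hconj d *m d) = - (z + conjc z) *: (hconj d *m d).
  by rewrite -mulmxA [d *m (_ *m _)]mulmxA dd mul_scalar_mx scalemxAr.
rewrite /householder; move: (hconj d *m d) => A AA.
rewrite mulmxDl mul1mx mulmxDr mulmx1 -scalemxAl -scalemxAr AA !scalerA.
rewrite -addrA -!scalerDl -[RHS]addr0; congr (_ + _).
rewrite -[RHS](scale0r A); congr (_ *: _).
by field; rewrite z0 cz0.
Qed.

End householder.
End conjugate_transpose.

(** * A direction missed by a smooth periodic map into a sphere *)

Section missing_direction.
Context {R : realType} {n : nat}.
Local Notation C := R[i].
Local Notation V := 'cV[R]_n.
Local Notation Z := 'cV[int]_n.
Local Notation zvec := (@zvec R n).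

Lemma zperiodic_reduce01 (x : V) : exists k : Z, forall i, 0 <= (x + zvec k) i 0 < 1.
Proof.
exists (\col_i - Num.floor (x i 0)) => i; rewrite !mxE intrN.
have h1 := floor_le (x i 0); have h2 := floorD1_gt (x i 0).
by rewrite intrD in h2; apply/andP; split; lra.
Qed.

Definition digit (K : nat) (x : R) : 'I_K.+1 := inord (Num.truncn (x * K.+1%:R)).

Lemma digit_close K (x y : R) : 0 <= x < 1 -> 0 <= y < 1 -> digit K x = digit K y ->
  `|x - y| <= K.+1%:R^-1.
Proof.
move=> /andP[x0 x1] /andP[y0 y1].
have K0 : 0 < K.+1%:R :> R by [].
have tl (t : R) : 0 <= t -> t < 1 -> (Num.truncn (t * K.+1%:R) < K.+1)%N.
  move=> t0 t1; rewrite -(ltr_nat R); apply: le_lt_trans (_ : t * K.+1%:R < _).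
    by have /andP[] := truncn_itv (mulr_ge0 t0 (ltW K0)).
  by rewrite gtr_pMl.
move=> /(congr1 val); rewrite /= !inordK ?tl// => E.
have hx := truncn_itv (mulr_ge0 x0 (ltW K0)); have hy := truncn_itv (mulr_ge0 y0 (ltW K0)).
rewrite E in hx; move/andP: hx => [hx1 hx2]; move/andP: hy => [hy1 hy2].
rewrite -[_^-1]mul1r ler_pdivlMr// -[X in _ * X <= _](gtr0_norm K0) -normrM mulrBl ler_norml.
move: hx2 hy2; rewrite -[(Num.truncn _).+1%:R]natr1 => hx2 hy2.
by apply/andP; split; lra.
Qed.

(* Pigeonhole: if v hits every direction, then (x, s) |-> s v(x) is a Lipschitz
   map from [0, 1]^(n+1) onto a neighbourhood of 0 in dimension 2(p+1), and a
   fine grid has more points there than there are cubes in the source. *)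
Lemma missing_direction p (v : V -> 'rV[C]_p.+1) :
  (forall j, csmooth (fun x => v x 0 j)) -> zperiodic v ->
  (forall x, normsq (v x) = 1) -> (n.+1 < 2 * p.+1)%N -> exists2 w : 'rV[C]_p.+1, normsq w = 1 & forall x, v x != w.
Proof.
move=> sv pv v1 np; apply: contrapT => H.
have {}H w : normsq w = 1 -> exists x, v x = w.
  move=> w1; apply: contrapT => Hw; apply: H; exists w => // x.
  by apply/eqP => vx; apply: Hw; exists x.
have [L L0 HL] : exists2 L, 0 < L & forall j x y,
    normc (v x 0 j - v y 0 j) <= L * `|x - y|.
  have /choice[l Hl] j : exists l, 0 < l /\ forall x y, normc (v x 0 j - v y 0 j) <= l * `|x - y|.
    have [s1 s2] := sv j.
    have [l1 l10 Hl1] := zperiodic_lipschitz s1 (fun x k => congr1 (fun M : 'rV_p.+1 => complex.Re (M 0 j)) (pv x k)).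
    have [l2 l20 Hl2] := zperiodic_lipschitz s2 (fun x k => congr1 (fun M : 'rV_p.+1 => complex.Im (M 0 j)) (pv x k)).
    exists (l1 + l2); split; first exact: addr_gt0.
    move=> x y; apply: le_trans (normc_le _) _.
    by rewrite cReD cImD cReN cImN mulrDl lerD.
  exists (\sum_j l j + 1).
    by rewrite ltr_wpDl// sumr_ge0// => j _; exact: ltW (Hl j).1.
  move=> j x y; apply: le_trans ((Hl j).2 x y) _; apply: ler_wpM2r => //.
  rewrite (bigD1 j)//= -addrA lerDl addr_ge0// sumr_ge0// => i _; exact: ltW (Hl i).1.
(* [q] exceeds the norm of every vector whose p + 1 coordinates have modulus at most 2, since q^2 >
   4 (p + 1). *)
pose q : R := (2 * p.+1)%:R + 1; have q0 : 0 < q by rewrite ltr_wpDl.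
have hit (y : 'rV[C]_p.+1) : (forall j, normc (y 0 j) <= 2) ->
    exists (x : V) (s : R), [/\ forall i, 0 <= x i 0 < 1, 0 <= s < 1 & forall j, y 0 j = (s * q)%:C%C * v x 0 j].
  move=> y2; pose t := Num.sqrt (normsq y).
  have t0 : 0 <= t by exact: sqrtr_ge0.
  have tq : t < q.
    rewrite /t -[q]gtr0_norm// -sqrtr_sqr ltr_sqrt ?exprn_gt0//.
    apply: (@le_lt_trans _ _ (\sum_(j < p.+1) 4)).
      apply: ler_sum => j _; rewrite (_ : 4 = 2 ^+ 2 :> R); last by ring.
      by rewrite lerXn2r ?nnegrE ?normc_ge0.
    rewrite sumr_const card_ord -[_ *+ p.+1]mulr_natr /q natrM.
    have : 1 <= p.+1%:R :> R by rewrite ler1n.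
    by move: (p.+1%:R : R) => P P1; nra.
  have sq : 0 <= t / q < 1 by rewrite divr_ge0 ?(ltW q0)//= ltr_pdivrMr// mul1r.
  have tE : t / q * q = t by rewrite divfK// gt_eqF.
  have [x [Hx yE]] : exists x : V, (forall i, 0 <= x i 0 < 1) /\ forall j, y 0 j = t%:C%C * v x 0 j.
    have [y0|yn0] := eqVneq (normsq y) 0.
      have [k Hk] := zperiodic_reduce01 0; exists (0 + zvec k); split=> // j.
      by rewrite /t y0 sqrtr0 mul0r (normsq_eq0 y0) mxE.
    have tn0 : 0 < t by rewrite sqrtr_gt0 lt_def yn0 normsq_ge0.
    have [|x vx] := H ((t^-1)%:C%C *: y).
      rewrite /normsq; under eq_bigr do rewrite mxE normcM normc_real exprMn.
      rewrite -mulr_sumr -/(normsq y) ger0_norm ?invr_ge0// exprVn /t sqr_sqrtr ?normsq_ge0//.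
      by rewrite mulVf.
    have [k Hk] := zperiodic_reduce01 x; exists (x + zvec k); split=> // j.
    by rewrite pv vx mxE mulrA -rmorphM/= divff ?gt_eqF// rmorph1 mul1r.
  by exists x, (t / q); rewrite tE.
(* k0 > q (1 + L), e = 2 (p + 1) - 1 >= n + 1 and M > k0^e. With K + 1 = k0 M cells per side, two
   points of one cell have images closer than 1/M, and the number of cells is (k0 M)^(n+1) <= (k0
   M)^e < M^(e+1), below the number of grid points. *)
pose k0 := (Num.truncn (q * (1 + L))).+1.
pose e := (2 * p.+1).-1; pose M := (k0 ^ e).+1.
pose K := (k0 * M).-1.
have KE : K.+1 = (k0 * M)%N by rewrite prednK.
(* Each complex coordinate contributes M^2 values; distinct grid points differ by at least 1/M in
   some real or imaginary part. *)
pose y (g : {ffun 'I_p.+1 -> 'I_M * 'I_M}) : 'rV[C]_p.+1 :=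
  \row_j Complex ((g j).1%:R / M%:R) ((g j).2%:R / M%:R).
have M0 : 0 < M%:R :> R by [].
have dig (d : 'I_M) : `|(d%:R / M%:R : R)| <= 1.
  by rewrite ger0_norm ?divr_ge0// ler_pdivrMr// mul1r ler_nat ltnW.
have /choice[xs Hxs] g : exists xs : V * R, [/\ forall i, 0 <= xs.1 i 0 < 1, 0 <= xs.2 < 1 &
    forall j, y g 0 j = (xs.2 * q)%:C%C * v xs.1 0 j].
  have [|x [s Hs]] := hit (y g); last by exists (x, s).
  by move=> j; rewrite mxE (le_trans (normc_le _))//= -[leRHS]/(1 + 1) lerD.
pose F g := ([ffun i => digit K ((xs g).1 i 0)], digit K (xs g).2).
have injF : injective F.
  move=> g h [/ffunP Fx Fs].
  have [gx gs gy] := Hxs g; have [hx hs hy] := Hxs h.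
  have Dx : `|(xs g).1 - (xs h).1| <= K.+1%:R^-1.
    apply: cV_norm_leP => // i; rewrite !mxE; apply: digit_close => //.
    by have := Fx i; rewrite !ffunE.
  have Ds := digit_close gs hs Fs.
  have vle x j : normc (v x 0 j) <= 1.
    rewrite -(@ler_pXn2r _ 2) ?nnegrE ?normc_ge0// expr1n -(v1 x).
    by rewrite /normsq (bigD1 j)//= lerDl sumr_ge0// => i _; exact: sqr_ge0.
  have Dy j : normc (y g 0 j - y h 0 j) < M%:R^-1.
    rewrite gy hy.
    rewrite (_ : _ - _ = (((xs g).2 - (xs h).2) * q)%:C%C * v (xs g).1 0 j +
       ((xs h).2 * q)%:C%C * (v (xs g).1 0 j - v (xs h).1 0 j)); last first.
      by rewrite !rmorphM rmorphB/=; ring.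
    apply: le_lt_trans (le_normcD _ _) _; rewrite !normcM !normc_real.
    apply: (@le_lt_trans _ _ (K.+1%:R^-1 * q * 1 + q * (L * K.+1%:R^-1))).
      apply: lerD; apply: ler_pM; rewrite ?normc_ge0 ?vle//.
      - by rewrite normrM [`|q|]gtr0_norm// ler_pM2r.
      - case/andP: hs => hs0 hs1.
        by rewrite ger0_norm ?mulr_ge0 ?(ltW q0)// ler_piMl ?(ltW q0)// ltW.
      - by apply: le_trans (HL _ _ _) _; rewrite ler_pM2l.
    rewrite (_ : _ + _ = q * (1 + L) / K.+1%:R); last by ring.
    rewrite KE natrM invfM mulrA gtr_pMl ?invr_gt0// ltr_pdivrMr// mul1r.
    exact: truncnS_gt.
  have nat_eq (d d' : 'I_M) : `|(d%:R / M%:R - d'%:R / M%:R : R)| < M%:R^-1 -> d = d'.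
    rewrite -mulrBl normrM [`|M%:R^-1|]gtr0_norm ?invr_gt0// gtr_pMl ?invr_gt0// => h1.
    apply/val_inj/eqP => /=; rewrite eqn_leq; move: h1; rewrite ltr_norml => /andP[h1 h2].
    by apply/andP; split; rewrite -ltnS -(ltr_nat R) -natr1; lra.
  apply/ffunP => j; have := Dy j; rewrite !mxE => Dj.
  rewrite [g j]surjective_pairing [h j]surjective_pairing; congr pair; apply: nat_eq.
    by apply: le_lt_trans (normc_Re _) Dj.
  by apply: le_lt_trans (normc_Im _) Dj.
have := leq_card F injF.
rewrite card_prod !card_ffun card_prod !card_ord KE -expnSr mulnn -expnM.
apply/negP; rewrite -ltnNge.
have h1 : ((k0 * M) ^ n.+1 <= (k0 * M) ^ e)%N by rewrite leq_pexp2l// /e -ltnS prednK.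
apply: leq_ltn_trans h1 _; rewrite expnMn.
rewrite (_ : (2 * p.+1)%N = e.+1) ?prednK// expnS ltn_pmul2r// expn_gt0//.
Qed.

End missing_direction.

(** * Smooth periodic completion to a unitary matrix *)

Section frame_completion.
Context {R : realType} {n : nat}.
Local Notation C := R[i].
Local Notation V := 'cV[R]_n.

Lemma csmooth_inv (f : V -> C) : csmooth f -> (forall x, f x != 0) ->
  csmooth (fun x => (f x)^-1).
Proof.
move=> sf f0; have [sf1 sf2] := sf.
pose N x := complex.Re (f x) ^+ 2 + complex.Im (f x) ^+ 2.
have N0 x : N x != 0.
  by rewrite /N -normc_sqr expf_neq0//; apply: contra (f0 x) => /eqP/eq0_normc ->.
have sN : Cinf N.
  move=> m; rewrite (_ : N = fun x => complex.Re (f x) * complex.Re (f x) + complex.Im (f x) * complex.Im (f x)).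
    by apply: CkD; apply: CkM; [exact: sf1|exact: sf1|exact: sf2|exact: sf2].
  by apply/funext => x; rewrite /N !expr2.
rewrite (_ : (fun x => _) = (fun x => conjc (f x) * ((N x)^-1)%:C%C)).
  apply: csmoothM; first exact: csmooth_conj.
  by apply: csmooth_real => m; apply: Ck_inv.
apply/funext => x; apply: (mulfI (f0 x)); rewrite mulfV// mulrA normc_mulconj.
by rewrite normc_sqr -/(N x) -rmorphM/= mulfV.
Qed.

Definition smooth_periodic m k (M : V -> 'M[C]_(m, k)) :=
  (forall i j, csmooth (fun x => M x i j)) /\ zperiodic M.

Lemma smooth_periodic_cst m k (M : 'M[C]_(m, k)) : smooth_periodic (fun=> M).
Proof. by split=> // i j; exact: csmooth_cst. Qed.

Lemma smooth_periodicM m k l (M : V -> 'M[C]_(m, k)) (N : V -> 'M[C]_(k, l)) :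
  smooth_periodic M -> smooth_periodic N -> smooth_periodic (fun x => M x *m N x).
Proof.
move=> [sM pM] [sN pN]; split; last by move=> x h; rewrite pM pN.
move=> i j; under eq_fun do rewrite mxE; apply: csmooth_sum => c.
exact: csmoothM.
Qed.

Lemma smooth_periodic_hconj m k (M : V -> 'M[C]_(m, k)) :
  smooth_periodic M -> smooth_periodic (fun x => hconj (M x)).
Proof.
move=> [sM pM]; split; last by move=> x h; rewrite pM.
by move=> i j; under eq_fun do rewrite !mxE; exact: csmooth_conj.
Qed.

Lemma smooth_periodic_row0 m k l (M : V -> 'M[C]_(m, k)) : smooth_periodic M ->
  smooth_periodic (fun x => row_mx (0 : 'M[C]_(m, l)) (M x)).
Proof.
move=> [sM pM]; split; last by move=> x h; rewrite pM.
move=> i j; rewrite -(fintype.splitK j); case: (fintype.split j) => c /=.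
  by under eq_fun do rewrite row_mxEl mxE; exact: csmooth_cst.
by under eq_fun do rewrite row_mxEr; exact: sM.
Qed.

Lemma smooth_periodic_householder k (v : V -> 'rV[C]_k) (w : 'rV[C]_k) :
  smooth_periodic v -> (forall x, v x *m hconj (v x) = 1%:M) -> w *m hconj w = 1%:M ->
  (forall x, v x != w) -> smooth_periodic (fun x => householder (v x) w).
Proof.
move=> pv v1 w1 vw.
have [sz _] := smooth_periodicM (smooth_periodic_cst w) (smooth_periodic_hconj pv).
split; last by move=> x h; rewrite pv.2.
move=> i j; have E x : householder (v x) w i j = (1%:M : 'M[C]_k) i j +
    ((w *m hconj (v x)) 0 0 - 1)^-1 * (hconj (v x - w) *m (v x - w)) i j.
  by rewrite [LHS]mxE [X in _ + X]mxE.
under eq_fun do rewrite E.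
apply: csmoothD; first exact: csmooth_cst.
apply: csmoothM.
  apply: csmooth_inv; last by move=> x; exact: householder_neq0.
  by apply: csmoothB; [exact: sz|exact: csmooth_cst].
under eq_fun do rewrite mxE; apply: csmooth_sum => c.
apply: csmoothM.
  under eq_fun do rewrite !mxE; apply: csmooth_conj.
  by apply: csmoothB; [exact: pv.1|exact: csmooth_cst].
under eq_fun do rewrite !mxE.
by apply: csmoothB; [exact: pv.1|exact: csmooth_cst].
Qed.

(* Away from one missing direction w0, a Householder matrix carries the first
   vector to the constant w0, hence the problem to the orthogonal of w0. *)
Lemma frame_completion q r p (v : V -> 'M[C]_(q, p)) : (q + r)%N = p -> (n <= 2 * r)%N ->
  smooth_periodic v -> (forall x, v x *m hconj (v x) = 1%:M) ->
  exists w : V -> 'M[C]_(r, p), [/\ smooth_periodic w,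
    forall x, w x *m hconj (w x) = 1%:M, forall x, v x *m hconj (w x) = 0 &
    forall x, hconj (v x) *m v x + hconj (w x) *m w x = 1%:M].
Proof.
elim: q p v => [|q IH] p v.
  move=> rp nr; have {}rp : r = p := rp; subst p => pv v1; exists (fun=> 1%:M); split.
  - exact: smooth_periodic_cst.
  - by move=> x; rewrite hconj1 mulmx1.
  - by move=> x; apply/matrixP => -[].
  - move=> x; rewrite hconj1 mulmx1 [X in X + _](_ : _ = 0) ?add0r//.
    by apply/matrixP => i j; rewrite !mxE big_ord0.
case: p v => // p v [qrp] nr pv v1.
have {}qrp : (q + r)%N = p by [].
pose v0 x : 'rV[C]_(1 + p) := usubmx (v x : 'M[C]_(1 + q, 1 + p)).
pose v' x : 'M[C]_(q, 1 + p) := dsubmx (v x : 'M[C]_(1 + q, 1 + p)).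
have vE x : v x = col_mx (v0 x) (v' x) by rewrite vsubmxK.
have [v00 v0' v'0 v''] : [/\ forall x, v0 x *m hconj (v0 x) = 1%:M,
   forall x, v0 x *m hconj (v' x) = 0, forall x, v' x *m hconj (v0 x) = 0
   & forall x, v' x *m hconj (v' x) = 1%:M].
  have H x := v1 x; have {}H x : block_mx (v0 x *m hconj (v0 x)) (v0 x *m hconj (v' x))
    (v' x *m hconj (v0 x)) (v' x *m hconj (v' x)) = block_mx 1%:M 0 0 1%:M.
    by rewrite -scalar_mx_block -mul_col_row -hconj_col -vE H.
  by split=> x; have [] := eq_block_mx (H x).
have sv0 : smooth_periodic v0.
  split; last by move=> x h; rewrite /v0 pv.2.
  by move=> i j; rewrite /v0; under eq_fun do rewrite mxE; exact: pv.1.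
have sv' : smooth_periodic v'.
  split; last by move=> x h; rewrite /v' pv.2.
  by move=> i j; rewrite /v'; under eq_fun do rewrite mxE; exact: pv.1.
have nsq x : normsq (v0 x) = 1.
  by have := normsqE (v0 x); rewrite v00 => /matrixP/(_ 0 0); rewrite !mxE => -[].
have [w0 w01 w0m] : exists2 w : 'rV[C]_p.+1, normsq w = 1 & forall x, v0 x != w.
  apply: missing_direction => //.
  - by move=> j; exact: sv0.1.
  - exact: sv0.2.
  (* The ambient dimension is p + 1 = q + r + 1 at this stage, so n <= 2 r is enough for every q. *)
  - by rewrite -qrp; lia.
have w0u : w0 *m hconj w0 = 1%:M by rewrite normsqE w01.
pose e0 : 'rV[C]_(1 + p) := row_mx 1%:M 0.
have e0u : e0 *m hconj e0 = 1%:M.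
  by rewrite hconj_row mul_row_col hconj0 mulmx0 addr0 hconj1 mulmx1.
(* A constant unitary matrix taking the first basis vector [e0] to [w0]; followed by the Householder
   matrix it gives [H x] with [e0 *m H x = v0 x]. *)
have [Q Qu Q0] : exists2 Q : 'M[C]_(1 + p), Q *m hconj Q = 1%:M & e0 *m Q = w0.
  have [we|we] := eqVneq w0 e0.
    by exists 1%:M; rewrite ?hconj1 ?mulmx1.
  exists (householder w0 e0); first exact: householder_unitary.
  exact: householder_map.
pose H x : 'M[C]_(1 + p) := Q *m householder (v0 x) w0.
have sH : smooth_periodic H.
  by apply: smooth_periodicM; [exact: smooth_periodic_cst|exact: smooth_periodic_householder].
have Hu x : H x *m hconj (H x) = 1%:M.
  rewrite /H hconjM mulmxA -[_ *m hconj (householder _ _)]mulmxA householder_unitary//.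
  by rewrite mulmx1.
have Hu' x : hconj (H x) *m H x = 1%:M by exact: mulmx1C.
have H0 x : e0 *m H x = v0 x by rewrite /H mulmxA Q0 householder_map.
move: H sH Hu Hu' H0 => H sH Hu Hu' H0.
(* In the frame given by [H x] the remaining rows are orthogonal to [e0], so their first column
   vanishes and the induction takes place in dimension p. *)
pose u x : 'M[C]_(q, 1 + p) := v' x *m hconj (H x).
pose u' x : 'M[C]_(q, p) := rsubmx (u x).
have uE x : u x = row_mx 0 (u' x).
  rewrite -[LHS]hsubmxK; congr row_mx.
  have : u x *m hconj e0 = 0.
    by rewrite /u -mulmxA -hconjM H0 v'0.
  by rewrite -{1}[u x]hsubmxK hconj_row mul_row_col hconj0 mulmx0 addr0 hconj1 mulmx1.
have uu x : u x *m hconj (u x) = 1%:M.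
  by rewrite /u hconjM hconjK mulmxA -[_ *m H x]mulmxA Hu' mulmx1 v''.
have [||w' [sw' w'w' u'w' sumw']] := IH p u' qrp nr.
- have su : smooth_periodic u.
    exact: (smooth_periodicM sv' (smooth_periodic_hconj sH)).
  split; last by move=> x h; rewrite /u' su.2.
  by move=> i j; rewrite /u'; under eq_fun do rewrite mxE; exact: su.1.
- by move=> x; have := uu x; rewrite uE hconj_row mul_row_col mul0mx add0r.
have v'E x : v' x = row_mx 0 (u' x) *m H x.
  by rewrite -uE /u -mulmxA Hu' mulmx1.
exists (fun x => row_mx 0 (w' x) *m H x); split.
- exact: (smooth_periodicM (smooth_periodic_row0 _ sw') sH).
- move=> x; rewrite hconjM mulmxA -[_ *m hconj (H x)]mulmxA Hu mulmx1.
  by rewrite hconj_row mul_row_col mul0mx add0r w'w'.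
- move=> x; set W := _ *m H x.
  transitivity (col_mx (v0 x *m hconj W) (v' x *m hconj W)).
    by rewrite vE; exact: (mul_col_mx (v0 x) (v' x)).
  rewrite -H0 v'E /W hconjM !mulmxA -[e0 *m _ *m _]mulmxA -[_ *m H x *m _]mulmxA Hu !mulmx1.
  by rewrite hconj_row !mul_row_col hconj0 !mulmx0 !mul0mx !add0r u'w' col_mx0.
- move=> x; have -> : hconj (v x) *m v x = hconj (v0 x) *m v0 x + hconj (v' x) *m v' x.
    by rewrite vE (hconj_col (v0 x) (v' x)); exact: (mul_row_col (hconj (v0 x)) (hconj (v' x)) (v0 x) (v' x)).
  have K m (y : 'M[C]_(m, 1 + p)) :
      hconj (y *m H x) *m (y *m H x) = hconj (H x) *m (hconj y *m y) *m H x.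
    by rewrite hconjM !mulmxA.
  rewrite -H0 v'E !K -!mulmxDl -!mulmxDr.
  rewrite (_ : _ + _ + _ = 1%:M) ?mulmx1//.
  rewrite /e0 !hconj_row !mul_col_row !hconj0 !mul0mx !mulmx0 hconj1 mulmx1.
  by rewrite !add_block_mx !addr0 !add0r sumw' -scalar_mx_block.
Qed.

End frame_completion.

(** * The generators *)

Section generators.
Context {R : realType} {n : nat}.
Local Notation C := R[i].
Local Notation V := 'cV[R]_n.+1.
Local Notation Z := 'cV[int]_n.+1.
Local Notation zvec := (@zvec R n.+1).

Lemma psum_le2 (S : set Z) (F : V -> R) k l x : bsupp F -> (forall y, 0 <= F y) ->
  S k -> S l -> k != l -> F (x + zvec k) + F (x + zvec l) <= psum S F x.
Proof.
move=> Fb F0 Sk Sl kl.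
have [r Fr] := Fb; have [s us H] := lattice_sum_local r x.
have xx : `|x - x| <= 1 by rewrite subrr normr0.
have := H _ F Fr x xx [set k]; rewrite fsbig_set1 => ->.
have := H _ F Fr x xx [set l]; rewrite fsbig_set1 => ->.
rewrite /psum (H _ F Fr x xx) big_mkcond [X in _ + X <= _]big_mkcond -big_split/=.
rewrite [leRHS]big_mkcond; apply: ler_sum => m _.
have [mk|mk] := eqVneq m k.
  by rewrite mk (@mem_set _ [set k] k)// (@mem_set _ S k)// (@memNset _ [set l] k) ?addr0//; apply/eqP.
rewrite (@memNset _ [set k] m) ?add0r; last by apply/eqP.
case: ifPn; last by case: ifP.
by rewrite inE => ->; rewrite mem_set.
Qed.

(** The squares are nonnegative and add up to 1, so a term equal to 1 leaves nothing to the
    others. *)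
Lemma psum_sqr_unique (S : set Z) (th : V -> R) y l : bsupp th ->
  (forall x, psum S (fun z => th z ^+ 2) x = 1) -> S 0 -> S l -> th y = 1 -> l != 0 ->
  th (y + zvec l) = 0.
Proof.
move=> [r Hr] th_sum S0 Sl ty l0.
have b2 : bsupp (fun z => th z ^+ 2) by exists r => x /Hr ->; rewrite expr0n.
have := psum_le2 y b2 (fun z => sqr_ge0 (th z)) S0 Sl; rewrite eq_sym => /(_ l0).
rewrite zvec0 addr0 ty th_sum expr1n gerDl => h.
by apply/eqP; rewrite -sqrf_eq0 eq_le h sqr_ge0.
Qed.

Lemma dual_int (L : set V) x : int_lattice `<=` L -> dual_lattice L x -> int_lattice x.
Proof.
move=> ZL Dx i; rewrite -(dot_basis x i); apply: Dx; apply: ZL => j.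
by rewrite mxE; case: (_ && _).
Qed.

Lemma dual_mulmx_int (B : 'M[R]_n.+1) (L : set V) (y : V) :
  int_lattice `<=` [set x | L (B^T *m x)] -> dual_lattice L y -> int_lattice (B *m y).
Proof.
move=> ZL Dy i; rewrite -(dot_basis (B *m y) i) dot_mulmx; apply: Dy.
by apply: (ZL (basis_vector i)) => j; rewrite mxE; case: (_ && _).
Qed.

Lemma psum_mulmx (T : nmodType) (B : 'M[R]_n.+1) (S S1 : set Z) (F : V -> T) x :
  B \in unitmx -> (forall l, S l -> exists2 k, S1 k & zvec k = B *m zvec l) ->
  (forall k, S1 k -> exists2 l, S l & zvec k = B *m zvec l) ->
  psum S1 F x = psum S (fun y => F (B *m y)) (invmx B *m x).
Proof.
move=> uB H1 H2.
have /choice[f Hf] (l : Z) : exists k : Z, S l -> S1 k /\ zvec k = B *m zvec l.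
  have [/H1[k]|] := pselect (S l); last by exists 0.
  by exists k.
have cancel_B (y : V) : invmx B *m (B *m y) = y by rewrite mulmxA mulVmx// mul1mx.
rewrite /psum [LHS](reindex_fsbig f S).
  apply: eq_fsbigr => l; rewrite inE => Sl.
  by rewrite mulmxDr mulmxA mulmxV// mul1mx (Hf l Sl).2.
split; first by move=> l /Hf[].
  move=> l l'; rewrite !inE => Sl Sl' ff; apply: (@zvec_inj R).
  by rewrite -[zvec l]cancel_B -[zvec l']cancel_B -(Hf l Sl).2 -(Hf l' Sl').2 ff.
move=> k /H2[l Sl kE]; exists l => //; apply: (@zvec_inj R).
by rewrite (Hf l Sl).2.
Qed.

Variables (B : 'M[R]_n.+1) (G : set V) (th : V -> R).
Variables (p q : nat) (a : 'I_p -> V) (g : 'I_q -> V).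
Hypothesis B_unit : B \in unitmx.
Let Bi := invmx B.
(** For B = A^T and G = Gamma this is A^-1 Gamma; its dual is the image under B of the dual of
    Gamma. *)
Let G1 : set V := [set x | G (B^T *m x)].
Hypothesis GB : forall x y, G x -> G y -> G (x - y).
Hypothesis ZG : int_lattice `<=` G.
Hypothesis ZG1 : int_lattice `<=` G1.
Hypothesis Ga : forall i, G1 (a i).
Hypothesis a_surj : forall x, G1 x -> exists i, int_lattice (x - a i).
Hypothesis a_inj : forall i j, int_lattice (a i - a j) -> i = j.
Hypothesis Gg : forall i, G (g i).
Hypothesis g_surj : forall x, G x -> exists i, int_lattice (x - g i).
Hypothesis g_inj : forall i j, int_lattice (g i - g j) -> i = j.
Hypothesis th_smooth : Cinf th.
Hypothesis th_bsupp : bsupp th.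
Hypothesis th_sum : forall x, psum (dualZ G) (fun y => th y ^+ 2) x = 1.
Hypothesis th_step : forall x, th x != 0 -> th (Bi *m x) = 1.

Let G0 : G 0. Proof. by apply: ZG => i; rewrite mxE. Qed.
Let G10 : G1 0. Proof. by apply: ZG1 => i; rewrite mxE. Qed.
Let G1B x y : G1 x -> G1 y -> G1 (x - y).
Proof. by move=> h1 h2; rewrite /G1/= mulmxBr; exact: GB. Qed.

Let BiK (x : V) : B *m (Bi *m x) = x. Proof. by rewrite mulmxA mulmxV// mul1mx. Qed.
Let BKi (x : V) : Bi *m (B *m x) = x. Proof. by rewrite mulmxA mulVmx// mul1mx. Qed.

Let dual1P x : dual_lattice G1 x <-> dual_lattice G (Bi *m x).
Proof.
split=> H y Gy.
  rewrite dot_mulmx; apply: H; rewrite /G1/= mulmxA -trmx_mul mulVmx// trmx1 mul1mx.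
  exact: Gy.
rewrite -[x]BiK dot_mulmx; exact: H.
Qed.

Let th_unique y l : th y = 1 -> dualZ G l -> l != 0 -> th (y + zvec l) = 0.
Proof.
move=> ty Sl l0; apply: (psum_sqr_unique th_bsupp th_sum _ Sl) => //.
by move=> z _; rewrite zvec0 dot0l.
Qed.

Let tau x := th (Bi *m x).

Let tau_bsupp : bsupp tau.
Proof.
have [r r0 Hr] := bsupp_ge0 th_bsupp; have [c c0 Hc] := mulmx_norm_le B.
exists (c * r) => x xr; apply: Hr.
by rewrite -(ltr_pM2l c0); apply: lt_le_trans xr _; rewrite -{1}[x]BiK; exact: Hc.
Qed.

Let tau_sum x : psum (dualZ G1) (fun y => tau y ^+ 2) x = 1.
Proof.
rewrite -(th_sum (Bi *m x)) (psum_mulmx (S := dualZ G) _ _ B_unit).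
- by apply: eq_fsbigr => l _; rewrite /tau BKi.
- move=> l Sl; have Dl : dual_lattice G1 (B *m zvec l) by apply/dual1P; rewrite BKi.
  have /int_latticeP[k kE] := dual_int ZG1 Dl.
  by exists k => //; rewrite /dualZ/= -kE.
- move=> k /dual1P Dk; have /int_latticeP[l lE] := dual_int ZG Dk.
  by exists l; rewrite -?lE// /dualZ/= -lE.
Qed.

Let ta := fiber a tau.
Let si := fiber g th.

Let ta_kernel x k := fiber_kernel tau G10 G1B Ga a_surj a_inj x k.
Let ta_gram i j x : psum setT (fun y => ta i y * conjc (ta j y)) x = (i == j)%:R := fiber_gram G10 G1B Ga a_surj a_inj tau_bsupp tau_sum i j x.
Let si_kernel x k := fiber_kernel th G0 GB Gg g_surj g_inj x k.
Let si_gram i j x : psum setT (fun y => si i y * conjc (si j y)) x = (i == j)%:R := fiber_gram G0 GB Gg g_surj g_inj th_bsupp th_sum i j x.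

Let th_test : testfun (fun x => (th x)%:C%C).
Proof.
split; first exact: csmooth_real.
by case: th_bsupp => r Hr; exists r => x /Hr ->.
Qed.

Let testfun_fiber s (b : 'I_s -> V) (f : V -> R) i :
  testfun (fun x => (f x)%:C%C) -> testfun (fiber b f i).
Proof.
move=> tf; rewrite /fiber.
rewrite (_ : (fun x => _) = (fun x => ((Num.sqrt s%:R)^-1)%:C%C * (f x)%:C%C * cis (2 * pi * dot x (b i)))).
  apply: testfunMr; first by apply: testfunMl => //; exact: csmooth_cst.
  by have := csmooth_phase (- b i); under eq_fun do rewrite dotNr mulrN opprK.
by apply/funext => x; rewrite rmorphM.
Qed.

Let ta_test i : testfun (ta i).
Proof.
apply: testfun_fiber.
have := testfun_affine 0 (_ : Bi \in unitmx) th_test; rewrite unitmx_inv => /(_ B_unit).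
by under eq_fun do rewrite addr0.
Qed.

Let si_test i : testfun (si i). Proof. exact: testfun_fiber. Qed.

(** The periodized inner products of the two families; they turn out to be the coefficients of [si]
    on [ta], a matrix-valued low-pass filter. *)
Let v (x : V) : 'M[C]_(q, p) :=
  \matrix_(i, j) psum setT (fun y => conjc (ta j y) * si i y) x.

Let psum_zperiodic (F : V -> C) : zperiodic (psum setT F).
Proof. by move=> x h; exact: psum_shift. Qed.

Let v_sp : smooth_periodic v.
Proof.
split; last by move=> x h; apply/matrixP => i j; rewrite !mxE psum_zperiodic.
move=> i j; rewrite /v; under eq_fun do rewrite mxE; apply: csmooth_psum.
by apply: testfunMr => //; [exact: testfun_conj|exact: (si_test i).1].
Qed.

(** The refinement relation. The kernel of [ta] reduces the right side to shifts k in the dual of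
    [G1]; where si(x + k) is nonzero, tau(x + k) = 1, which forces tau(x) = 0 unless k = 0. *)
Let si_eq x i : si i x = \sum_j v x i j * ta j x.
Proof.
have tb j : bsupp (fun y => conjc (ta j y) * si i y).
  by have [] := testfunMr (testfun_conj (ta_test j)) (si_test i).1.
transitivity (psum setT (fun y => \sum_j ta j x * (conjc (ta j y) * si i y)) x); last first.
  rewrite psum_sum => [|j]; last by case: (tb j) => r Hr; exists r => y /Hr ->; rewrite mulr0.
  by apply: eq_bigr => j _; rewrite psumZ// mxE mulrC.
have E k : \sum_j ta j x * (conjc (ta j (x + zvec k)) * si i (x + zvec k)) =
   (tau x * tau (x + zvec k))%:C%C * (k \in dualZ G1)%:R * si i (x + zvec k).
  by rewrite -ta_kernel mulr_suml; apply: eq_bigr => j _; rewrite mulrA.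
have sne y : si i y != 0 -> tau y = 1.
  rewrite mulf_eq0 negb_or => /andP[+ _]; rewrite fmorph_eq0 mulf_eq0 negb_or => /andP[_].
  exact: th_step.
rewrite psum_single//.
  have := E 0; rewrite zvec0 addr0 => ->.
  rewrite mem_set; last by move=> y _; rewrite zvec0 dot0l.
  by have [->|/sne ->] := eqVneq (si i x) 0; rewrite ?mulr0// mulr1 rmorph1 mulr1 mul1r.
move=> k _ k0; rewrite E; have [->|/sne t1] := eqVneq (si i (x + zvec k)) 0; first by rewrite mulr0.
have [|_] := boolP (k \in dualZ G1); last by rewrite mulr0 mul0r.
rewrite inE => /dual1P Dk.
have /int_latticeP[l lE] : int_lattice (Bi *m zvec k) by exact: (dual_int ZG).
suff -> : tau x = 0 by rewrite mul0r rmorph0 !mul0r.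
have := @th_unique (Bi *m (x + zvec k)) (- l) t1; rewrite zvecN -lE mulmxDr addrK; apply.
  by rewrite /dualZ/= zvecN -lE => y Gy; rewrite dotNl rpredN; exact: Dk.
rewrite oppr_eq0; apply: contraNneq k0 => l0; apply/eqP; apply: (@zvec_inj R).
by rewrite zvec0 -[LHS]BiK lE l0 zvec0 mulmx0.
Qed.

Let T x : 'cV[C]_p := \col_j ta j x.

(** As the Gram matrix of [ta] is the identity, Gram matrices of combinations with periodic
    coefficients are products of the coefficient matrices. *)
Let gram m k (u : V -> 'M[C]_(m, p)) (u' : V -> 'M[C]_(k, p)) i j x :
  zperiodic u -> zperiodic u' ->
  psum setT (fun y => (u y *m T y) i 0 * conjc ((u' y *m T y) j 0)) x =
  (u x *m hconj (u' x)) i j.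
Proof.
move=> pu pu'.
have bT c d : bsupp (fun y => ta c y * conjc (ta d y)).
  by have [] := testfunMr (ta_test c) (testfun_conj (ta_test d)).1.
transitivity (psum setT (fun y => \sum_c \sum_d (u x i c * conjc (u' x j d)) * (ta c y * conjc (ta d y))) x).
  apply: eq_fsbigr => l _; rewrite pu pu' !mxE mulr_suml; apply: eq_bigr => c _.
  rewrite conjc_sum mulr_sumr; apply: eq_bigr => d _.
  by rewrite !mxE conjcM; ring.
rewrite psum_sum => [|c]; last first.
  suff [] : testfun (fun y => \sum_d u x i c * conjc (u' x j d) * (ta c y * conjc (ta d y))) by [].
  apply: testfun_sum => d; apply: testfunMl; first exact: csmooth_cst.
  by apply: testfunMr => //; exact: (testfun_conj (ta_test d)).1.
rewrite !mxE; apply: eq_bigr => c _; rewrite psum_sum => [|d]; last first.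
  by case: (bT c d) => r Hr; exists r => y /Hr ->; rewrite mulr0.
have E d : psum setT (fun y => u x i c * conjc (u' x j d) * (ta c y * conjc (ta d y))) x =
    u x i c * conjc (u' x j d) * (c == d)%:R by rewrite (psumZ _ _ _ (bT c d)) ta_gram.
under eq_bigr do rewrite E.
rewrite (bigD1 c)//= eqxx mulr1 big1 ?addr0 ?mxE// => d dc.
by rewrite eq_sym (negbTE dc) mulr0.
Qed.

Let vT x i : (v x *m T x) i 0 = si i x.
Proof. by rewrite si_eq mxE; apply: eq_bigr => j _; rewrite !mxE. Qed.

Let v_unit x : v x *m hconj (v x) = 1%:M.
Proof.
apply/matrixP => i j; rewrite -gram ?v_sp.2//; last 2 first.
- exact: v_sp.2.
- exact: v_sp.2.
by under eq_fun do rewrite !vT; rewrite si_gram mxE.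
Qed.

(** The kernel, a difference of two scales, serves completeness; the Gram identity serves
    orthonormality within one scale. Neighbouring scales need the last two clauses: orthogonality to
    [th] over the dual lattice, and a factorization whose multiplier is periodic under that lattice
    after composition with B. *)
Lemma generators_exist r : (q + r)%N = p -> (n.+1 <= 2 * r)%N ->
  exists Gl : 'I_r -> V -> C, [/\ forall l, testfun (Gl l),
   forall x k, \sum_l Gl l x * conjc (Gl l (x + zvec k)) =
     (th (Bi *m x) * th (Bi *m (x + zvec k)))%:C%C * (`[< dual_lattice G (Bi *m zvec k) >])%:R -
     (th x * th (x + zvec k))%:C%C * (`[< dual_lattice G (zvec k) >])%:R,
   forall l l' x, psum setT (fun y => Gl l y * conjc (Gl l' y)) x = (l == l')%:R,
   forall l x, (th x)%:C%C * psum (dualZ G) (fun y => (th y)%:C%C * Gl l y) x = 0 &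
   forall l, exists M : V -> C, (forall x, Gl l x = M x * (th (Bi *m x))%:C%C) /\
     forall x y, dual_lattice G y -> M (B *m (x + y)) = M (B *m x) ].
Proof.
move=> qrp nr; have [w [w_sp w_unit vw vvww]] := frame_completion qrp nr v_sp v_unit.
exists (fun l x => (w x *m T x) l 0); split.
- move=> l; under eq_fun do rewrite mxE; apply: testfun_sum => j.
  by under eq_fun do rewrite mxE; apply: testfunMl => //; exact: w_sp.1.
- move=> x k; have -> : \sum_l (w x *m T x) l 0 * conjc ((w (x + zvec k) *m T (x + zvec k)) l 0) =
      (hconj (w (x + zvec k) *m T (x + zvec k)) *m (w x *m T x)) 0 0.
    by rewrite mxE; apply: eq_bigr => l _; rewrite !mxE mulrC.
  rewrite hconjM w_sp.2 mulmxA -[_ *m _ *m w x]mulmxA.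
  (* Unitarity of the completed matrix turns the kernel of the new rows into that of [ta] minus that
     of [si]. *)
  have -> : hconj (w x) *m w x = 1%:M - hconj (v x) *m v x by rewrite -(vvww x) [X in X - _]addrC addrK.
  rewrite mulmxBr mulmx1 mulmxBl mxE; congr (_ + _).
    rewrite -[in RHS](asbool_equiv_eq (dual1P (zvec k))) -[`[< _ >]]/(k \in dualZ G1) -ta_kernel mxE.
    by apply: eq_bigr => j _; rewrite !mxE mulrC.
  rewrite mxE; congr (- _).
  rewrite -[`[< _ >]]/(k \in dualZ G) -si_kernel.
  rewrite !mulmxA -hconjM -mulmxA -{1}(v_sp.2 x k) mxE; apply: eq_bigr => i _.
  have hc (M : 'cV[C]_q) : hconj M 0 i = conjc (M i 0) by rewrite !mxE.
  by rewrite hc !vT mulrC.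
- move=> l l' x; rewrite gram ?w_unit ?mxE//; exact: w_sp.2.
- move=> l x.
  have bF i : bsupp (fun y => conjc (si i y) * (w y *m T y) l 0).
    by case: (si_test i).2 => r' Hr; exists r' => y /Hr ->; rewrite conjc0 mul0r.
  transitivity (\sum_i si i x * psum setT (fun y => conjc (si i y) * (w y *m T y) l 0) x); last first.
    apply: big1 => i _; rewrite (_ : psum _ _ _ = 0) ?mulr0//.
    have := gram l i x w_sp.2 v_sp.2.
    rewrite (_ : w x *m hconj (v x) = 0) ?mxE; last by rewrite -[LHS]hconjK hconjM hconjK vw hconj0.
    by move=> <-; congr psum; apply/funext => y; rewrite vT mulrC.
  transitivity (psum setT (fun y => \sum_i si i x * (conjc (si i y) * (w y *m T y) l 0)) x); last first.
    rewrite psum_sum => [|i]; last by case: (bF i) => r' Hr; exists r' => y /Hr ->; rewrite mulr0.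
    by apply: eq_bigr => i _; rewrite psumZ.
  rewrite -psumZ; last by case: th_bsupp => r' Hr; exists r' => y /Hr ->; rewrite mul0r.
  rewrite /psum [LHS]fsbig_mkcond; apply: eq_fsbigr => k _; rewrite /patch.
  have -> : \sum_i si i x * (conjc (si i (x + zvec k)) * (w (x + zvec k) *m T (x + zvec k)) l 0) =
     (th x * th (x + zvec k))%:C%C * (k \in dualZ G)%:R * (w (x + zvec k) *m T (x + zvec k)) l 0.
    by rewrite -si_kernel mulr_suml; apply: eq_bigr => i _; rewrite mulrA.
  by case: ifP => _; rewrite ?mulr0 ?mul0r// mulr1 rmorphM/= mulrA.
- move=> l; exists (fun x => \sum_j w x l j * (((Num.sqrt p%:R)^-1)%:C%C * cis (2 * pi * dot x (a j)))).
  split.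
    move=> x; rewrite mxE mulr_suml; apply: eq_bigr => j _.
    by rewrite mxE /ta /fiber /tau rmorphM/=; ring.
  move=> x y Dy; apply: eq_bigr => j _.
  have /int_latticeP[k kE] : int_lattice (B *m y).
    by apply: (dual_int ZG1); apply/dual1P; rewrite BKi.
  rewrite mulmxDr kE w_sp.2; congr (_ * (_ * _)).
  rewrite dotDl mulrDr cisD [X in _ * X]cis_int ?mulr1//.
  by rewrite -kE dot_mulmx; apply: Dy; exact: Ga.
Qed.

End generators.

(** * Orthonormality *)

Section periodization.
Context {R : realType} {n : nat}.
Local Notation C := R[i].
Local Notation V := 'cV[R]_n.
Local Notation Z := 'cV[int]_n.
Local Notation zvec := (@zvec R n).
Local Notation mu := (@lebesgue_cV R n).

Definition bounded_meas (f : V -> C) :=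
  [/\ cmeasurable f, exists M, forall x, normc (f x) <= M & bsupp f].

Lemma bounded_meas_integrable f : bounded_meas f -> cintegrable mu f.
Proof.
move=> [[mf1 mf2] [M HM] [r Hr]]; split.
  apply: (@integrable_bounded_support _ _ (fun x => complex.Re (f x)) r M) => //.
    by move=> x; apply: le_trans (normc_Re _) (HM x).
  by move=> x /Hr ->.
apply: (@integrable_bounded_support _ _ (fun x => complex.Im (f x)) r M) => //.
  by move=> x; apply: le_trans (normc_Im _) (HM x).
by move=> x /Hr ->.
Qed.

Lemma testfun_bounded_meas f : testfun f -> bounded_meas f.
Proof.
move=> tf; split; [exact: csmooth_measurable tf.1| |exact: tf.2].
by have [M _ HM] := testfun_bounded tf; exists M.
Qed.

Lemma bounded_measM f g : bounded_meas f -> cmeasurable g ->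
  (exists M, forall x, normc (g x) <= M) -> bounded_meas (fun x => f x * g x).
Proof.
move=> [mf [M HM] [r Hr]] mg [M' HM']; split.
- exact: cmeasurableM.
- by exists (M * M') => x; rewrite normcM ler_pM ?normc_ge0.
- by exists r => x /Hr ->; rewrite mul0r.
Qed.

Lemma bounded_meas_translate f v : bounded_meas f -> bounded_meas (fun x => f (v + x)).
Proof.
move=> [mf [M HM] [r Hr]]; split.
- exact: (cmeasurable_comp mf (measurable_addl v)).
- by exists M.
- exists (r + `|v|) => x xr; apply: Hr.
  have : `|x| <= `|v + x| + `|v| by rewrite -{1}(addKr v x) addrC (le_trans (ler_normD _ _))// normrN.
  lra.
Qed.

Lemma psum_seq (T : nmodType) (S : set Z) (F : V -> T) x (s : seq Z) : uniq s ->
  (forall k, S k -> k \notin s -> F (x + zvec k) = 0) ->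
  psum S F x = \sum_(k <- s | k \in S) F (x + zvec k).
Proof.
move=> us H; rewrite /psum [RHS](_ : _ = \sum_(k <- s) if k \in S then F (x + zvec k) else 0).
  rewrite [LHS]fsbig_mkcond [RHS]bigfs//.
    by apply: eq_fsbigl; apply/seteqP; split.
  move=> k _ ks; case: ifPn => //; rewrite inE => Sk; exact: H.
by rewrite big_mkcond.
Qed.

(** Unfolding with a partition of unity [chi] in place of a fundamental domain: the same lemma
    serves Z^n with the unit cube and the dual lattice with the square of [th]. *)
Lemma cint_periodize (S : set Z) (chi F : V -> C) : (forall k, S k -> S (- k)) ->
  bounded_meas chi -> bounded_meas F -> (forall x, psum S chi x = 1) ->
  cint mu F = cint mu (fun x => chi x * psum S F x).
Proof.
move=> SN bchi bF chi1.
have [mchi [Mc HMc] /bsupp_ge0[rc rc0 Hrc]] := bchi.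
have [mF [MF HMF] /bsupp_ge0[rF rF0 HrF]] := bF.
(* Beyond this radius of [zvec k], chi(x + k) and F(x) are never both nonzero. *)
have [s0 Hs0] := lattice_finite (rc + rF) (0 : V).
pose s := undup s0; have us : uniq s by exact: undup_uniq.
have Hs k : `|zvec k| <= rc + rF -> k \in s.
  move=> kr; rewrite mem_undup; apply: (Hs0 k 0); first by rewrite subrr normr0.
  by rewrite add0r.
have E1 x : F x = \sum_(k <- s | k \in S) chi (x + zvec k) * F x.
  have [Fx|Fx] := eqVneq (F x) 0; first by rewrite big1// => k _; rewrite Fx mulr0.
  rewrite -mulr_suml -[LHS]mul1r -(chi1 x); congr (_ * _).
  apply: psum_seq => // k Sk ks; apply: Hrc; rewrite ltNge; apply: contra ks => h; apply: Hs.
  rewrite -{1}(addKr x (zvec k)) addrC (le_trans (ler_normD _ _))// normrN lerD//.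
  by rewrite leNgt; apply: contra Fx => /HrF ->.
have E2 x : chi x * psum S F x = \sum_(k <- s | k \in S) chi x * F (- zvec k + x).
  rewrite -mulr_sumr; have [cx|cx] := eqVneq (chi x) 0; first by rewrite cx !mul0r.
  congr (_ * _); rewrite (psum_seq (s := map -%R s)).
  - rewrite big_map; apply: eq_big => k; last by rewrite zvecN addrC.
    by apply/idP/idP; rewrite !inE => /SN; rewrite ?opprK.
  - by rewrite map_inj_uniq//; exact: oppr_inj.
  - move=> k Sk ks; apply: HrF; rewrite ltNge; apply: contra ks => h.
    apply/mapP; exists (- k); last by rewrite opprK.
    apply: Hs; rewrite zvecN normrN.
    rewrite -{1}(addKr x (zvec k)) addrC (le_trans (ler_normD _ _))// normrN addrC lerD//.
    by rewrite leNgt; apply: contra cx => /Hrc ->.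
transitivity (cint mu (fun x => \sum_(k <- s | k \in S) chi (x + zvec k) * F x)).
  by congr cint; apply/funext.
rewrite [RHS](_ : _ = cint mu (fun x => \sum_(k <- s | k \in S) chi x * F (- zvec k + x))); last first.
  by congr cint; apply/funext.
have mk (G : Z -> V -> C) : (fun x => \sum_(k <- s | k \in S) G k x) =
    (fun x => \sum_(k <- s) if k \in S then G k x else 0).
  by apply/funext => x; rewrite big_mkcond.
rewrite !mk.
have i1 k : bounded_meas (fun x => chi (x + zvec k) * F x).
  have := bounded_meas_translate (zvec k) bchi; under eq_fun do rewrite addrC.
  by move=> b; apply: bounded_measM => //; exists MF.
have i2 k : bounded_meas (fun x => chi x * F (- zvec k + x)).
  have [m2 ? _] := bounded_meas_translate (- zvec k) bF.
  by apply: bounded_measM.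
rewrite !cint_sum; last 2 first.
- by move=> k; case: (k \in S); [exact: bounded_meas_integrable|exact: cintegrable0].
- by move=> k; case: (k \in S); [exact: bounded_meas_integrable|exact: cintegrable0].
apply: eq_bigr => k _; case: (k \in S) => //.
have [m2 _ _] := i2 k.
have := cint_scales ltr01 (@scales_measure_translate R n (zvec k)) m2; rewrite mul1r => <-.
by congr cint; apply/funext => x; rewrite addKr addrC.
Qed.

Definition unit_cube (x : V) : C := \prod_i ((0 <= x i 0) && (x i 0 < 1))%:R.

Let unit1 (t : R) : C := ((0 <= t) && (t < 1))%:R.

Let unit1E t : unit1 t = (\1_(`[0, 1[%classic) t)%:C%C.
Proof. by rewrite /unit1 indicE mem_setE in_itv/=; case: (_ && _). Qed.

Let unit1_int : cintegrable (@lebesgue_measure R) unit1 /\ cint (@lebesgue_measure R) unit1 = 1.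
Proof.
have Ei : (@lebesgue_measure R).-integrable setT (EFin \o \1_(`[0, 1[%classic : set R)).
  apply/integrableP; split.
    by apply/measurable_EFinP; exact: measurable_indic.
  under eq_integral => x _ do rewrite /= ger0_norm//.
  rewrite integral_indic// setIT -[X in (X < _)%E]/(lebesgue_measure `[0, 1[%classic).
  by rewrite lebesgue_measure_itv/= lte_fin ltr01 -EFinD ltry.
have -> : unit1 = (fun t => (\1_(`[0, 1[%classic) t)%:C%C) by apply/funext => t; exact: unit1E.
split; first by split => //; exact: integrable0.
apply: complex_ext.
  change (\int[@lebesgue_measure R]_t (\1_(`[0, 1[%classic) t : R) = 1).
  rewrite /Rintegral integral_indic// setIT -[X in fine X]/(lebesgue_measure `[0, 1[%classic).
  by rewrite lebesgue_measure_itv/= lte_fin ltr01 -EFinD/= subr0.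
by change (\int[@lebesgue_measure R]_t (0 : R) = 0); rewrite /Rintegral integral0.
Qed.

Lemma unit_cubeE x : unit_cube x = (`[< forall i, 0 <= x i 0 < 1 >])%:R.
Proof.
rewrite /unit_cube; case: asboolP => H.
  by apply: big1 => i _; rewrite (H i).
have [i Hi] : exists i, ~ (0 <= x i 0 < 1) by apply/existsNP.
by rewrite (bigD1 i)//= (negbTE (introN idP Hi)) mul0r.
Qed.

Lemma unit_cube_bounded_meas : bounded_meas unit_cube.
Proof.
split.
- exact: (cintegrable_meas (cint_prod (fun i => unit1_int.1)).1).
- by exists 1 => x; rewrite unit_cubeE; case: asbool; rewrite ?normc1 ?normc0.
- exists 1 => x x1; rewrite unit_cubeE asboolF// => H.
  move: x1; rewrite ltNge => /negP; apply; apply: cV_norm_leP => // i.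
  by have /andP[h1 h2] := H i; rewrite ger0_norm// ltW.
Qed.

Lemma cint_unit_cube : cint mu unit_cube = 1.
Proof.
have [_ ->] := cint_prod (fun i : 'I_n => unit1_int.1).
by apply: big1 => i _; exact: unit1_int.2.
Qed.

Lemma psum_unit_cube v x : psum setT (fun y => unit_cube (v + y)) x = 1.
Proof.
have [k Hk] := zperiodic_reduce01 (v + x).
rewrite (psum_eq1 (k0 := k))//.
  by rewrite unit_cubeE asboolT// addrA.
move=> l _ lk; rewrite unit_cubeE asboolF// => Hl; move/eqP: lk; apply.
apply/colP => i; have := Hl i; have := Hk i; rewrite !mxE => /andP[h1 h2] /andP[h3 h4].
apply/eqP; rewrite eq_le -!ltzD1; apply/andP; split.
  by rewrite -(ltr_int R) intrD; lra.
by rewrite -(ltr_int R) intrD; lra.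
Qed.

(** A translation by [v] multiplies the character by e(v) and preserves the integral over a period,
    which therefore vanishes once e(v) differs from 1. *)
Lemma cint_unit_cube_character (k : Z) :
  cint mu (fun x => unit_cube x * cis (2 * pi * dot (zvec k) x)) = (k == 0)%:R.
Proof.
have [->|k0] := eqVneq k 0.
  under eq_fun do rewrite zvec0 dot0l mulr0 cis0 mulr1.
  exact: cint_unit_cube.
have /existsP[i ki] : [exists i, k i 0 != 0].
  apply: contraR k0 => /existsPn H; apply/eqP/colP => i; rewrite mxE; apply/eqP.
  by have := H i; rewrite negbK.
pose e (x : V) : C := cis (2 * pi * dot (zvec k) x).
(* The pairing of [k] with [v] is 1/2, so e(v) = -1. *)
pose v : V := ((k i 0)%:~R * 2)^-1 *: delta_mx i 0.
have ev : cis (2 * pi * dot (zvec k) v) != 1.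
  have -> : dot (zvec k) v = 2^-1.
    rewrite dotZr /dot (bigD1 i)//= !mxE !eqxx mulr1 big1 ?addr0.
      by rewrite invfM mulrC mulrA mulfV ?mul1r// intr_eq0.
    by move=> j ji; rewrite !mxE (negbTE ji) mulr0.
  rewrite mulrAC divff ?mul1r; last by rewrite pnatr_eq0.
  apply/eqP => /(congr1 (@complex.Re R)); rewrite /= cospi => h; lra.
have me : cmeasurable e.
  by have := csmooth_measurable (csmooth_phase (- zvec k)); rewrite /e; under eq_fun do rewrite dotNr mulrN opprK dotC.
have be : exists M, forall x, normc (e x) <= M by exists 1 => x; rewrite normc_cis.
have be_ x (l : Z) : e (x + zvec l) = e x.
  rewrite /e dotDr mulrDr cisD [X in _ * X]cis_int ?mulr1//.
  by rewrite /dot rpred_sum// => j _; rewrite !mxE rpredM// intr_int.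
have bc := unit_cube_bounded_meas.
have bcv := bounded_meas_translate (- v) bc.
have bF := bounded_measM bcv me be.
have H1 := cint_periodize (S := setT) (fun _ _ => Logic.I) bc bF (fun x => _).
have cu x : psum setT unit_cube x = 1.
  by have := psum_unit_cube 0 x; under eq_fun do rewrite add0r.
have {}H1 := H1 cu.
have E x : psum setT (fun y => unit_cube (- v + y) * e y) x = e x.
  rewrite -[RHS]mulr1 -[X in _ * X](psum_unit_cube (- v) x) -psumZ; last by have [] := bcv.
  by apply: eq_fsbigr => l _; rewrite be_ mulrC.
have mF : cmeasurable (fun y => unit_cube (- v + y) * e y) by have [] := bF.
have H2 := cint_scales ltr01 (@scales_measure_translate R n v) mF; rewrite mul1r in H2.
rewrite H1 in H2.
have iF := bounded_meas_integrable (bounded_measM bc me be).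
have H3 : cint mu (fun x => e v * (unit_cube x * e x)) = cint mu (fun x => unit_cube x * e x).
  rewrite -[RHS](_ : cint mu (fun x => unit_cube x * psum setT (fun y => unit_cube (- v + y) * e y) x) = _).
    rewrite -H2; congr cint; apply/funext => x.
    by rewrite addKr /e dotDr (mulrDr (2 * pi)) cisD; ring.
  by congr cint; apply/funext => x; rewrite E.
rewrite cintZ// in H3.
apply/eqP; have : (e v - 1) * cint mu (fun x => unit_cube x * e x) == 0.
  by rewrite mulrBl mul1r H3 subrr.
by rewrite mulf_eq0 subr_eq0 (negbTE ev).
Qed.

End periodization.

(** * Orthogonality of the waves within and across scales *)

Section waves.
Context {R : realType} {n : nat}.
Local Notation C := R[i].
Local Notation V := 'cV[R]_n.+1.
Local Notation Z := 'cV[int]_n.+1.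
Local Notation zvec := (@zvec R n.+1).
Local Notation mu := (@lebesgue_cV R n.+1).

Definition char (k : Z) (x : V) : C := cis (- (2 * pi * dot (zvec k) x)).

Lemma charD k x y : char k (x + y) = char k x * char k y.
Proof. by rewrite /char dotDr (mulrDr (2 * pi)) opprD cisD. Qed.

Lemma char_int k x : int_lattice x -> char k x = 1.
Proof.
move=> Zx; rewrite /char cisN cis_int ?conjc1// /dot rpred_sum// => i _.
by rewrite mxE rpredM// intr_int.
Qed.

Lemma csmooth_char k : csmooth (char k).
Proof. by have := csmooth_phase (zvec k); under eq_fun do rewrite dotC. Qed.

Lemma char_conj k k' x : char k x * conjc (char k' x) = cis (2 * pi * dot (zvec (k' - k)) x).
Proof.
rewrite /char -cisN -cisD zvecB dotBl (mulrBr (2 * pi)) opprK addrC; congr cis; ring.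
Qed.

(** The Fourier transform of D_P T_k f, where Q = P^T and [G] is the transform of f. *)
Definition wave (Q : 'M[R]_n.+1) (G : V -> C) (k : Z) : V -> C := fun xi =>
  ((Num.sqrt `|\det Q|)^-1)%:C%C * (G (invmx Q *m xi) * char k (invmx Q *m xi)).

Lemma testfun_mulmx (P : 'M[R]_n.+1) (G : V -> C) : P \in unitmx -> testfun G ->
  testfun (fun x => G (P *m x)).
Proof. by move=> uP /(testfun_affine 0 uP); under eq_fun do rewrite addr0. Qed.

Lemma testfun_wave Q G k : Q \in unitmx -> testfun G -> testfun (wave Q G k).
Proof.
move=> uQ tG; apply: testfunMl; first exact: csmooth_cst.
apply: testfunMr; first by apply: testfun_mulmx => //; rewrite unitmx_inv.
exact: csmooth_mulmx (csmooth_char k).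
Qed.

Lemma cint_mulmx (P : 'M[R]_n.+1) (f : V -> C) : P \in unitmx -> cmeasurable f ->
  cint mu (fun x => f (P *m x)) = (`|\det P|^-1)%:C%C * cint mu f.
Proof.
move=> uP mf; apply: (cint_scales _ (scales_measure_mulmx uP) mf).
by rewrite invr_gt0 normr_gt0 -unitfE -unitmxE.
Qed.

Lemma dilate_translate_ifourier (P : 'M[R]_n.+1) (G : V -> C) k : P \in unitmx -> testfun G ->
  dilate P (translate (zvec k) (ifourier G)) = ifourier (wave P^T G k).
Proof.
move=> uP tG; apply/funext => x; rewrite /dilate /translate /ifourier !fourierE.
have uT : P^T \in unitmx by rewrite unitmx_tr.
have uTi : invmx P^T \in unitmx by rewrite unitmx_inv.
set c := Num.sqrt _.
have c0 : 0 < c by rewrite sqrtr_gt0 normr_gt0 -unitfE -unitmxE.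
pose H (y : V) : C := (c^-1)%:C%C * (G y * cis (- (2 * pi * dot y (- (P *m x - zvec k))))).
have iG := cintegrable_phase (- (P *m x - zvec k)) (testfun_integrable tG).
have mH : cmeasurable H.
  by apply: cmeasurableM; [exact: cmeasurable_cst|exact: cintegrable_meas iG].
transitivity (cint mu (fun y => H (invmx P^T *m y))); last first.
  congr cint; apply/funext => y; rewrite /H /wave det_tr -/c -!mulrA; congr (_ * (_ * _)).
  rewrite /char -cisD; congr cis; rewrite opprB dotBr [dot (invmx _ *m y) (P *m x)]dotC dot_mulmx.
  rewrite mulmxA mulmxV// mul1mx dotNr [dot x y]dotC [dot (zvec k) _]dotC; ring.
rewrite cint_mulmx// det_inv det_tr normfV invrK /H cintZ// mulrA -rmorphM/=.
congr (_%:C%C * _); rewrite -[`|\det P|](sqr_sqrtr (normr_ge0 _)) -/c expr2 mulfK// gt_eqF//.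
Qed.

(** The substitution x = Q y leaves only the relative scale of the two waves. *)
Lemma cint_wave (Q Q' : 'M[R]_n.+1) (G G' : V -> C) k k' : Q \in unitmx -> Q' \in unitmx ->
  testfun G -> testfun G' ->
  cint mu (fun x => wave Q G k x * conjc (wave Q' G' k' x)) =
  (Num.sqrt `|\det Q| / Num.sqrt `|\det Q'|)%:C%C *
  cint mu (fun x => G x * char k x * conjc (G' ((invmx Q' *m Q) *m x) * char k' ((invmx Q' *m Q) *m x))).
Proof.
move=> uQ uQ' tG tG'; set c := Num.sqrt _; set c' := Num.sqrt `|\det Q'|.
have tW := testfun_wave k uQ tG; have tW' := testfun_wave k' uQ' tG'.
have d0 : `|\det Q| != 0 by rewrite normr_eq0 -unitfE -unitmxE.
have c0 : c != 0 by rewrite gt_eqF// sqrtr_gt0 lt_def d0 normr_ge0.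
have := cint_mulmx uQ (csmooth_measurable (testfunMr tW (csmooth_conj tW'.1)).1).
have dC : ((`|\det Q|)%:C%C : C) != 0 by rewrite eq_complex/= eqxx andbT.
move=> h; apply: (mulfI (_ : ((`|\det Q|^-1)%:C%C : C) != 0)).
  by rewrite eq_complex/= eqxx andbT invr_eq0.
rewrite -{}h mulrA -rmorphM/=.
have -> : `|\det Q|^-1 * (c / c') = c^-1 * c'^-1.
  by rewrite -[`|\det Q|](sqr_sqrtr (normr_ge0 _)) -/c expr2 invfM -mulrA mulKf.
rewrite -cintZ.
  congr cint; apply/funext => x; rewrite /wave -/c -/c' mulmxA mulVmx// mul1mx -mulmxA.
  by rewrite !conjcM conjc_real rmorphM/=; ring.
have uD : invmx Q' *m Q \in unitmx by rewrite unitmx_mul unitmx_inv uQ'.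
have tt : testfun (fun x => G x * char k x * conjc (G' ((invmx Q' *m Q) *m x) * char k' ((invmx Q' *m Q) *m x))).
  apply: testfunMr; first exact: testfunMr tG (csmooth_char k).
  apply: csmooth_conj; apply: csmoothM; first exact: csmooth_mulmx tG'.1.
  exact: csmooth_mulmx (csmooth_char k').
exact: testfun_integrable tt.
Qed.

Lemma psum_conj (S : set Z) (F : V -> C) x : bsupp F ->
  psum S (fun y => conjc (F y)) x = conjc (psum S F x).
Proof.
move=> [r Fr]; have [t _ H] := lattice_sum_local r x.
have xx : `|x - x| <= 1 by rewrite subrr normr0.
rewrite /psum (H _ F Fr x xx) (H _ (fun y => conjc (F y)) _ x xx) ?conjc_sum//.
by move=> y /Fr ->; rewrite conjc0.
Qed.

Variables (B : 'M[R]_n.+1) (G : set V) (th : V -> R) (r : nat) (Gl : 'I_r -> V -> C).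
Hypothesis B_unit : B \in unitmx.
Let Bi := invmx B.
Hypothesis ZG : int_lattice `<=` G.
Hypothesis ZG1 : int_lattice `<=` [set x | G (B^T *m x)].
Hypothesis th_smooth : Cinf th.
Hypothesis th_bsupp : bsupp th.
Hypothesis th_sum : forall x, psum (dualZ G) (fun y => th y ^+ 2) x = 1.
Hypothesis th_step : forall x, th x != 0 -> th (Bi *m x) = 1.
Hypothesis Gl_test : forall l, testfun (Gl l).
Hypothesis Gl_kernel : forall x k, \sum_l Gl l x * conjc (Gl l (x + zvec k)) =
  (th (Bi *m x) * th (Bi *m (x + zvec k)))%:C%C * (`[< dual_lattice G (Bi *m zvec k) >])%:R -
  (th x * th (x + zvec k))%:C%C * (`[< dual_lattice G (zvec k) >])%:R.
Hypothesis Gl_gram : forall l l' x, psum setT (fun y => Gl l y * conjc (Gl l' y)) x = (l == l')%:R.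
Hypothesis Gl_perp : forall l x, (th x)%:C%C * psum (dualZ G) (fun y => (th y)%:C%C * Gl l y) x = 0.
Hypothesis Gl_factor : forall l, exists M : V -> C, (forall x, Gl l x = M x * (th (Bi *m x))%:C%C) /\
     forall x y, dual_lattice G y -> M (B *m (x + y)) = M (B *m x).

Let BKi (x : V) : Bi *m (B *m x) = x. Proof. by rewrite mulmxA mulVmx// mul1mx. Qed.

Let dual_B_int (y : V) : dual_lattice G y -> int_lattice (B *m y).
Proof. exact: dual_mulmx_int. Qed.

Let same_scale l l' k k' :
  cint mu (fun x => Gl l x * char k x * conjc (Gl l' x * char k' x)) = ((l == l') && (k == k'))%:R.
Proof.
have tF : testfun (fun x => Gl l x * char k x * conjc (Gl l' x * char k' x)).
  apply: testfunMr; first exact: testfunMr (Gl_test l) (csmooth_char k).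
  by apply: csmooth_conj; apply: csmoothM; [exact: (Gl_test l').1|exact: csmooth_char].
rewrite (cint_periodize (S := setT) (fun _ _ => Logic.I) unit_cube_bounded_meas (testfun_bounded_meas tF)); last first.
  by move=> x; have := psum_unit_cube 0 x; under eq_fun do rewrite add0r.
rewrite [X in cint _ X](_ : _ = (fun x => (l == l')%:R * (unit_cube x * cis (2 * pi * dot (zvec (k' - k)) x)))).
  rewrite cintZ.
    rewrite cint_unit_cube_character subr_eq0 (eq_sym k').
    by case: (l == l') => /=; rewrite ?mul1r ?mul0r.
  apply: bounded_meas_integrable; apply: bounded_measM; first exact: unit_cube_bounded_meas.
    by under eq_fun do rewrite -char_conj; apply: cmeasurableM;
      [|apply: cmeasurable_conj]; apply: csmooth_measurable; exact: csmooth_char.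
  by exists 1 => x; rewrite normc_cis.
apply/funext => x; rewrite mulrCA; congr (_ * _).
rewrite -(Gl_gram l l' x) mulrC -psumZ; last first.
  by case: (Gl_test l).2 => t Ht; exists t => y /Ht ->; rewrite mul0r.
apply: eq_fsbigr => h _; rewrite -char_conj conjcM.
have ch kk : char kk x = char kk (x + zvec h) by rewrite charD [X in _ * X]char_int ?mulr1// => j; rewrite mxE intr_int.
by rewrite (ch k) (ch k'); ring.
Qed.

(** After x = B y the integrand is periodized over the dual lattice. [Gl_factor] splits off a
    periodic multiplier, and what remains is the conjugate of the sum of [th] times [Gl l'], which
    [th] annihilates by [Gl_perp]. *)
Let next_scale l l' k k' :
  cint mu (fun x => Gl l x * char k x * conjc (Gl l' (Bi *m x) * char k' (Bi *m x))) = 0.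
Proof.
have tG' := testfun_mulmx (_ : Bi \in unitmx) (Gl_test l').
have tF : testfun (fun x => Gl l x * char k x * conjc (Gl l' (Bi *m x) * char k' (Bi *m x))).
  apply: testfunMr; first exact: testfunMr (Gl_test l) (csmooth_char k).
  by apply: csmooth_conj; apply: csmoothM; apply: csmooth_mulmx; [exact: (Gl_test l').1|exact: csmooth_char].
have d0 : `|\det B| != 0 by rewrite normr_eq0 -unitfE -unitmxE.
apply: (mulfI (_ : ((`|\det B|^-1)%:C%C : C) != 0)); first by rewrite eq_complex/= eqxx andbT invr_eq0.
rewrite mulr0 -cint_mulmx//; last exact: csmooth_measurable tF.1.
have bF := testfun_bounded_meas (testfun_mulmx B_unit tF).
have SN h : dualZ G h -> dualZ G (- h) by move=> Dh y Gy; rewrite zvecN dotNl rpredN; exact: Dh.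
have b2 : bsupp (fun x => th x ^+ 2) by case: th_bsupp => t Ht; exists t => x /Ht ->; rewrite expr0n.
have t2 : testfun (fun x => (th x ^+ 2)%:C%C).
  split; last by case: b2 => t Ht; exists t => x /Ht ->.
  by apply: csmooth_real => m; under eq_fun do rewrite expr2; apply: CkM; exact: th_smooth.
(* The partition of unity is th^2: one of its two factors is the [th] that [Gl_perp] requires. *)
rewrite (cint_periodize SN (testfun_bounded_meas t2) bF); last first.
  by move=> x; rewrite psum_real// th_sum.
rewrite [X in cint _ X](_ : _ = fun=> 0) ?cint0//.
apply/funext => x; have [M [HM pM]] := Gl_factor l.
pose P (y : V) := M (B *m y) * char k (B *m y) * conjc (char k' y).
have FE y : Gl l (B *m y) * char k (B *m y) * conjc (Gl l' (Bi *m (B *m y)) * char k' (Bi *m (B *m y))) =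
    P y * conjc ((th y)%:C%C * Gl l' y).
  by rewrite HM BKi !conjcM conjc_real /P; ring.
have bt : bsupp (fun y => (th y)%:C%C * Gl l' y).
  by case: th_bsupp => t Ht; exists t => y /Ht ->; rewrite mul0r.
have PE : psum (dualZ G) (fun y => Gl l (B *m y) * char k (B *m y) * conjc (Gl l' (Bi *m (B *m y)) * char k' (Bi *m (B *m y)))) x =
   P x * conjc (psum (dualZ G) (fun y => (th y)%:C%C * Gl l' y) x).
  rewrite -psum_conj// -psumZ; last by case: bt => t Ht; exists t => y /Ht ->; rewrite conjc0.
  apply: eq_fsbigr => h; rewrite inE => Dh; rewrite FE; congr (_ * _).
  rewrite /P pM// mulmxDr !charD [char k (B *m zvec h)]char_int ?mulr1; last exact: dual_B_int.
  by rewrite [char k' (zvec h)]char_int ?mulr1// => j; rewrite mxE intr_int.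
rewrite PE -[RHS](mulr0 ((th x)%:C%C * P x)) -[X in _ = _ * X]conjc0 -(Gl_perp l' x).
by rewrite conjcM conjc_real rmorphXn/= expr2; ring.
Qed.

(** On the diagonal the kernel is th(B^-1 x)^2 - th(x)^2, and both squares are 1. *)
Lemma generator_eq0 l x : th x = 1 -> Gl l x = 0.
Proof.
move=> tx; have t1 : th (Bi *m x) = 1 by apply: th_step; rewrite tx oner_neq0.
have := Gl_kernel x 0; rewrite zvec0 addr0 mulmx0 tx t1 subrr.
rewrite (eq_bigr (fun l => (normc (Gl l x) ^+ 2)%:C%C)) => [|i _]; last by rewrite normc_mulconj.
rewrite -rmorph_sum/= => /(congr1 (@complex.Re R))/= /eqP.
rewrite psumr_eq0 => [/allP/(_ l (mem_index_enum _))|i _]; last exact: sqr_ge0.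
by rewrite /= sqrf_eq0 => /eqP/eq0_normc.
Qed.

(** [Gl l] lives where th(B^-1 x) is nonzero; there [th] equals 1 at B^-j x for all j >= 2, and
    generators vanish where [th] equals 1. *)
Let far_scale l l' m x : Gl l x * Gl l' (Bi ^+ m.+2 *m x) = 0.
Proof.
have [->|Gx] := eqVneq (Gl l x) 0; first by rewrite mul0r.
have [M [HM _]] := Gl_factor l.
have tx : th (Bi *m x) != 0.
  by apply: contraNneq Gx => t0; rewrite HM t0 mulr0.
have it j : th (Bi ^+ j.+2 *m x) = 1.
  elim: j => [|j IH]; first by rewrite expr2 -mulmxA; exact: th_step.
  rewrite exprS -[_ * _]/(_ *m _) -mulmxA; apply: th_step.
  by rewrite IH oner_neq0.
by rewrite (generator_eq0 _ (it m)) mulr0.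
Qed.

Lemma wave_orthonormal (A : 'M[R]_n.+1) (j j' : int) k k' l l' : B = A^T ->
  cint mu (fun x => wave (A ^ j)^T (Gl l) k x * conjc (wave (A ^ j')^T (Gl l') k' x)) =
  ((j == j') && (k == k') && (l == l'))%:R.
Proof.
move=> BA; have uA : A \is a GRing.unit by rewrite -[_ \is a _]/(_ \in unitmx) -unitmx_tr -BA.
have uj (i : int) : (A ^ i)^T \in unitmx by rewrite unitmx_tr; exact: unitrXz.
have nz (i : int) : Num.sqrt `|\det (A ^ i)^T| != 0.
  by rewrite gt_eqF// sqrtr_gt0 normr_gt0 -unitfE -unitmxE.
have trX m : (A ^+ m)^T = B ^+ m.
  elim: m => [|m IH]; first by rewrite !expr0 trmx1.
  by rewrite exprS exprSr -[_ * _]/(_ *m _) trmx_mul IH BA.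
have diffscale (i : int) (m : nat) l1 l2 k1 k2 :
    cint mu (fun x => wave (A ^ i)^T (Gl l1) k1 x * conjc (wave (A ^ (i + m.+1))^T (Gl l2) k2 x)) = 0.
  rewrite cint_wave//.
  have -> : invmx (A ^ (i + m.+1))^T *m (A ^ i)^T = Bi ^+ m.+1.
    have uBm : B ^+ m.+1 \in unitmx by exact: unitrX.
    have E : (A ^ (i + m.+1))^T = (A ^ i)^T *m B ^+ m.+1.
      by rewrite addrC exprzDr// -exprnP -[_ * _]/(_ *m _) trmx_mul trX.
    apply: (can_inj (mulKmx (uj (i + m.+1)))).
    rewrite mulKVmx// E -mulmxA /Bi.
    have -> : B ^+ m.+1 *m (invmx B) ^+ m.+1 = 1%:M.
      have -> : (invmx B) ^+ m.+1 = (B ^+ m.+1)^-1 by rewrite -exprVn.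
      exact: mulmxV.
    by rewrite mulmx1.
  case: m => [|m]; first by rewrite expr1 next_scale mulr0.
  rewrite [X in cint _ X](_ : _ = fun=> 0) ?cint0 ?mulr0//.
  apply/funext => x; rewrite conjcM.
  have [->|G0] := eqVneq (Gl l1 x) 0; first by rewrite !mul0r.
  have /eqP := far_scale l1 l2 m x; rewrite mulf_eq0 (negbTE G0)/= => /eqP ->.
  by rewrite conjc0 mul0r mulr0.
have tW i l1 k1 := testfun_wave k1 (uj i) (Gl_test l1).
have [->|jj] := eqVneq j j'.
  by rewrite cint_wave// mulVmx// mulfV// mul1r; under eq_fun do rewrite mul1mx; rewrite same_scale andbC.
case: (ltrgtP j j') jj => // jlt _.
  rewrite (_ : j' = j + (`|j' - j|%N.-1.+1 : int)) ?diffscale//.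
  lia.
(* Conjugation exchanges the two scales and reduces to the case already treated. *)
rewrite -[LHS]conjcK -cint_conj; last first.
  exact: testfun_integrable (testfunMr (tW _ _ _) (csmooth_conj (tW _ _ _).1)).
under eq_fun do rewrite conjcM conjcK mulrC.
rewrite [in X in conjc X](_ : j = j' + (`|j - j'|%N.-1.+1 : int)) ?diffscale ?conjc0//.
lia.
Qed.

End waves.

(** * Completeness *)

Section raised_cosine.
Context {R : realType}.
Local Notation C := R[i].

(** Equal to cos(pi t)^2; its powers peak at the integers and play the part of an approximate
    identity. *)
Definition rcos (t : R) : R := (1 + cos (2 * pi * t)) / 2.

Lemma normc_sum I (s : seq I) (F : I -> C) :
  normc (\sum_(i <- s) F i) <= \sum_(i <- s) normc (F i).
Proof.
elim/big_rec2: _ => [|i u v _ h]; first by rewrite normc0.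
by apply: le_trans (le_normcD _ _) _; rewrite lerD2l.
Qed.

Lemma rcos_ge0 t : 0 <= rcos t.
Proof. by rewrite divr_ge0//; have := cos_geN1 (2 * pi * t); lra. Qed.

Lemma rcos_le1 t : rcos t <= 1.
Proof. by rewrite ler_pdivrMr// mul1r; have := cos_le1 (2 * pi * t); lra. Qed.

(** The mean of [rcos ^+ m] over a period. Consecutive values have ratio (2m + 1)/(2m + 2), whence
    [aS]. *)
Let a (m : nat) : R := 'C(2 * m, m)%:R / 4 ^+ m.

Let a_gt0 m : 0 < a m.
Proof. by rewrite divr_gt0 ?exprn_gt0// ltr0n bin_gt0; lia. Qed.

Let aS m : a m - a m.+1 = a m / (2 * m.+1%:R).
Proof.
have h1 := mul_bin_diag (2 * m).+2 m; have h2 := mul_bin_down (2 * m).+1 m.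
have E : ((m.+1 * 'C(2 * m.+1, m.+1)) = 2 * (2 * m).+1 * 'C(2 * m, m))%N.
  have : ((2 * m).+1 - m = m.+1)%N by lia.
  move: h1 h2; rewrite /= (_ : (2 * m.+1 = (2 * m).+2)%N); last by lia.
  move=> h1 h2 h3; rewrite h3 in h2; rewrite -h1.
  rewrite -[RHS]mulnA h2 [RHS]mulnA; congr muln; lia.
have {}E : m.+1%:R * 'C(2 * m.+1, m.+1)%:R = 2 * (2 * m.+1%:R - 1) * 'C(2 * m, m)%:R :> R.
  have := congr1 (fun k => k%:R : R) E; rewrite !natrM => ->; congr (_ * _ * _).
  by rewrite -[(2 * m).+1%:R]natr1 natrM -[m.+1%:R]natr1; ring.
have m0 : m.+1%:R != 0 :> R by rewrite pnatr_eq0.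
apply: (mulfI (_ : 2 * m.+1%:R != 0)); first by rewrite mulf_neq0// pnatr_eq0.
rewrite /a mulrBr mulrCA mulrA [2 * m.+1%:R * ('C(2 * m.+1, _)%:R / _)]mulrA -[2 * m.+1%:R * _]mulrA E exprS.
have f0 : (4 : R) ^+ m != 0 by rewrite expf_neq0// pnatr_eq0.
move: (m.+1%:R) (4 ^+ m) m0 f0 ('C(2 * m, m)%:R) => u f u0 f0 c.
by field; rewrite f0 u0.
Qed.

Let rcos_expand m t : (rcos t ^+ m)%:C%C =
  (4 ^- m)%:C%C * \sum_(i < (2 * m).+1) ('C(2 * m, i))%:R * cis (2 * pi * t * (m%:~R - i%:~R)).
Proof.
have E : (rcos t)%:C%C = (4^-1)%:C%C * (cis (pi * t) + cis (- (pi * t))) ^+ 2.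
  apply: complex_ext.
    rewrite expr2 !(cReM, cImM, cReD, cImD) /= cosN sinN /rcos.
    rewrite (_ : 2 * pi * t = pi * t + pi * t); last by ring.
    rewrite cosD; have := cos2Dsin2 (pi * t); rewrite !expr2.
    move: (cos _) (sin _) => c s cs.
    rewrite (_ : 1 + (c * c - s * s) = c * c + s * s + c * c - s * s); last by rewrite cs; ring.
    by field.
  by rewrite expr2 !(cReM, cImM, cReD, cImD) /= cosN sinN; ring.
rewrite rmorphXn/= E exprMn -exprM -rmorphXn/= exprVn; congr (_ * _).
rewrite exprDn; apply: eq_bigr => i _; rewrite -mulr_natl; congr (_ * _).
have cisX (s : R) k : cis s ^+ k = cis (s * k%:R).
  elim: k => [|k IH]; first by rewrite expr0 mulr0 cis0.
  by rewrite exprS IH -cisD -natr1 mulrDr mulr1 addrC.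
rewrite !cisX -cisD; congr cis.
have i2 : (i <= 2 * m)%N by rewrite -ltnS.
rewrite natrB// natrM -![_%:~R]/(_%:R); ring.
Qed.

(** A cyclic step of the node multiplies every term by exp(-2 pi i d/M), which differs from 1 for 0
    < |d| < M. *)
Let grid_sum (M : nat) (d : int) (t : R) : (0 < M)%N -> (`|d|%N < M)%N -> d != 0 ->
  \sum_(j < M) cis (2 * pi * (t - j%:R / M%:R) * d%:~R) = 0.
Proof.
case: M => // M _ dM d0; have M0 : M.+1%:R != 0 :> R by rewrite pnatr_eq0.
apply: (@sum_shift_eq0 _ _ _ (@ordS M.+1) (cis (2 * pi * (- (d%:~R / M.+1%:R))))).
- exact: ordS_inj.
- apply/eqP => /cis_eq1; rewrite rpredN => /intrP[k /eqP].
  rewrite eq_sym -(can_eq (mulfK M0)) divfK// -[M.+1%:R]/((M.+1%:Z)%:~R) -intrM eqr_int => /eqP kd.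
  move: dM d0; rewrite -kd abszM /=.
  have [->|k0] := eqVneq k 0; first by rewrite mul0r eqxx.
  have : (0 < `|k|)%N by rewrite absz_gt0.
  by move=> h1 h2; nia.
- move=> j; rewrite -cisD.
  have [jM|jM] := ltnP j.+1 M.+1.
    rewrite (_ : nat_of_ord (ordS j) = j.+1); last by rewrite /= modn_small.
    by congr cis; rewrite -[j.+1%:R]natr1; ring.
  have -> : nat_of_ord (ordS j) = 0%N.
    by rewrite /= (_ : j.+1 = M.+1) ?modnn//; apply/eqP; rewrite eqn_leq jM ltn_ord.
  have jE : j%:R = M.+1%:R - 1 :> R.
    have : (nat_of_ord j = M)%N by apply/eqP; rewrite eqn_leq -ltnS ltn_ord.
    by move=> ->; rewrite -[M.+1%:R]natr1 addrK.
  rewrite jE mul0r subr0.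
  rewrite (_ : 2 * pi * _ + _ = 2 * pi * t * d%:~R - 2 * pi * d%:~R); last by field.
  rewrite cisD cisN cis_int ?conjc1 ?mulr1//; exact: intr_int.
Qed.

Let rcos_sum m (M : nat) (t : R) : (m < M)%N ->
  \sum_(j < M) rcos (t - j%:R / M%:R) ^+ m = M%:R * a m.
Proof.
move=> mM; apply: (fmorph_inj (real_complex R)); rewrite rmorph_sum/=.
under eq_bigr do rewrite rcos_expand.
rewrite -mulr_sumr exchange_big/=.
have mm : (m < (2 * m).+1)%N by lia.
rewrite (bigD1 (Ordinal mm))//= [X in _ + X]big1 => [|i im].
  rewrite addr0; under eq_bigr do rewrite subrr mulr0 cis0 mulr1.
  rewrite sumr_const card_ord /a -[_ *+ M]mulr_natl.
  rewrite -[X in (_ * (X * _))](rmorph_nat (@real_complex R)) -[X in (_ * (_ * X))](rmorph_nat (@real_complex R)).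
  by rewrite -!rmorphM/=; congr (_%:C)%C; ring.
rewrite -mulr_sumr; under eq_bigr do rewrite -intrB.
rewrite grid_sum ?mulr0//; first by lia.
  by have := ltn_ord i; lia.
by apply: contra im => /eqP h; apply/eqP/val_inj => /=; lia.
Qed.

(** The second sum is governed by [a m - a m.+1], the mean of 1 - rcos under the kernel; it involves
    degree m + 1, hence the bound on [M]. *)
Lemma rcos_mean m : exists2 c : nat -> R, (forall M, (m < M)%N -> 0 < c M) &
  forall (M : nat) t, (m.+1 < M)%N ->
    \sum_(j < M) rcos (t - j%:R / M%:R) ^+ m = c M /\
    \sum_(j < M) rcos (t - j%:R / M%:R) ^+ m * (1 - rcos (t - j%:R / M%:R)) = c M / (2 * m.+1%:R).
Proof.
exists (fun M => M%:R * a m).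
  by move=> M mM; rewrite mulr_gt0// ltr0n; exact: leq_ltn_trans mM.
move=> M t mM; split; first by rewrite rcos_sum// ltnW.
under eq_bigr do rewrite mulrBr mulr1 -exprSr.
by rewrite sumrB !rcos_sum ?(ltnW mM)// -mulrBr aS mulrA.
Qed.

End raised_cosine.

(** * Uniform approximation by trigonometric polynomials *)

Section trigonometric_approximation.
Context {R : realType} {n : nat}.
Local Notation C := R[i].
Local Notation V := 'cV[R]_n.+1.
Local Notation Z := 'cV[int]_n.+1.
Local Notation zvec := (@zvec R n.+1).

Definition trig_poly (f : V -> C) :=
  exists s : seq (Z * C), forall x, f x = \sum_(t <- s) t.2 * char t.1 x.

Lemma trig_poly_cst (c : C) : trig_poly (fun=> c).
Proof.
exists [:: (0, c)] => x; rewrite big_seq1 /char zvec0 dot0l mulr0 oppr0 cis0.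
by rewrite mulr1.
Qed.

Lemma trig_polyD f g : trig_poly f -> trig_poly g -> trig_poly (fun x => f x + g x).
Proof. by move=> [s fs] [t gt]; exists (s ++ t) => x; rewrite big_cat fs gt. Qed.

Lemma trig_poly_sum I (s : seq I) (F : I -> V -> C) : (forall i, trig_poly (F i)) ->
  trig_poly (fun x => \sum_(i <- s) F i x).
Proof.
move=> HF; elim: s => [|i s IH].
  by under eq_fun do rewrite big_nil; exact: trig_poly_cst.
by under eq_fun do rewrite big_cons; exact: trig_polyD.
Qed.

Let char_addk k l (x : V) : char (k + l) x = char k x * char l x :> C.
Proof. by rewrite /char zvecD dotDl (mulrDr (2 * pi)) opprD cisD. Qed.

Lemma trig_polyM f g : trig_poly f -> trig_poly g -> trig_poly (fun x => f x * g x).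
Proof.
move=> [s fs] [t gt].
exists [seq (u.1 + v.1, u.2 * v.2) | u <- s, v <- t] => x.
rewrite big_allpairs_dep/= fs gt mulr_suml; apply: eq_bigr => u _.
rewrite mulr_sumr; apply: eq_bigr => v _; rewrite char_addk; ring.
Qed.

Lemma trig_poly_prod I (s : seq I) (F : I -> V -> C) : (forall i, trig_poly (F i)) ->
  trig_poly (fun x => \prod_(i <- s) F i x).
Proof.
move=> HF; elim: s => [|i s IH].
  by under eq_fun do rewrite big_nil; exact: trig_poly_cst.
by under eq_fun do rewrite big_cons; exact: trig_polyM.
Qed.

Lemma trig_poly_exp f m : trig_poly f -> trig_poly (fun x => f x ^+ m).
Proof.
move=> tf; elim: m => [|m IH].
  by under eq_fun do rewrite expr0; exact: trig_poly_cst.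
by under eq_fun do rewrite exprS; exact: trig_polyM.
Qed.

Lemma trig_poly_rcos i (y : R) : trig_poly (fun x => (rcos (x i 0 - y))%:C%C).
Proof.
pose e : Z := delta_mx i 0.
have de x : dot (zvec e) x = x i 0.
  rewrite /dot (bigD1 i)//= !mxE !eqxx mul1r big1 ?addr0// => j ji.
  by rewrite !mxE (negbTE ji) mul0r.
exists [:: (0, (2^-1)%:C%C); (- e, (4^-1)%:C%C * cis (- (2 * pi * y))); (e, (4^-1)%:C%C * cis (2 * pi * y))] => x.
rewrite !big_cons big_nil /= addr0 {1}/char zvec0 dot0l mulr0 oppr0 cis0 mulr1.
rewrite /char zvecN dotNl de mulrN opprK.
rewrite -[X in _ + (X + _)]mulrA -[X in _ + (_ + X)]mulrA -!cisD.
have -> : - (2 * pi * y) + 2 * pi * x i 0 = 2 * pi * (x i 0 - y) by ring.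
have -> : 2 * pi * y - 2 * pi * x i 0 = - (2 * pi * (x i 0 - y)) by ring.
apply: complex_ext; rewrite !(cReD, cImD, cReM, cImM) /= /rcos ?cosN ?sinN.
  by move: (cos _) (sin _) => c s; field.
by move: (cos _) (sin _) => c s; ring.
Qed.

Lemma rcos_lt1 (e : R) : 0 < e -> exists2 k, 0 < k & forall t, (forall m : int, e < `|t - m%:~R|) ->
  k <= 1 - rcos t.
Proof.
(* The cap at 1/2 keeps 2 pi h in [0, pi], where the cosine decreases. *)
move=> e0; pose h := Num.min e (2^-1).
have h0 : 0 < h by rewrite lt_min e0 invr_gt0/=.
have h2 : h <= 2^-1 by rewrite ge_min lexx orbT.
have pi0 := pi_gt0 R.
have hI : 2 * pi * h \in `[0, pi].
  rewrite in_itv/= !mulr_ge0 ?(ltW pi0) ?(ltW h0)//= mulrAC ger_pMl//.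
  by rewrite -ler_pdivlMl// mulr1.
exists (1 - rcos h).
  rewrite subr_gt0 /rcos ltr_pdivrMr// mul1r.
  have : cos (2 * pi * h) < cos 0.
    by rewrite ltr_cos ?in_itv/= ?lexx ?(ltW pi0)// !mulr_gt0.
  by rewrite cos0; lra.
move=> t Ht; rewrite lerD2l lerN2 /rcos ler_pM2r ?invr_gt0// lerD2l.
pose m := Num.floor (t + 2^-1); pose u := `|t - m%:~R|.
have ut : cos (2 * pi * t) = cos (2 * pi * u).
  have -> : cos (2 * pi * u) = cos (2 * pi * (t - m%:~R)).
    rewrite /u; case: (ler0P (t - m%:~R)) => // _; by rewrite mulrN cosN.
  rewrite -!Re_cis mulrBr cisD cisN [X in _ * conjc X]cis_int ?intr_int//.
  by rewrite conjc1 mulr1.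
have u1 : u <= 2^-1.
  rewrite ler_norml; have f1 := floor_le (t + 2^-1); have f2 := floorD1_gt (t + 2^-1).
  by rewrite intrD -/m in f2; rewrite -/m in f1; apply/andP; split; lra.
have hu : h < u by rewrite gt_min (Ht m).
have uI : 2 * pi * u \in `[0, pi].
  rewrite in_itv/= !mulr_ge0 ?(ltW pi0) ?normr_ge0//= mulrAC ger_pMl//.
  by rewrite -ler_pdivlMl// mulr1.
by rewrite ut ltW// ltr_cos// ltr_pM2l// mulr_gt0.
Qed.

(** The modulus of continuity is expressed through 1 - rcos, whose average against the kernel is
    known exactly. For points close modulo Z^n the Lipschitz bound gives [e]; otherwise some 1 -
    rcos is bounded below and absorbs the sup norm. *)
Lemma periodic_modulus (f : V -> C) (e : R) : csmooth f -> zperiodic f -> 0 < e ->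
  exists2 K, 0 <= K & forall x y : V, normc (f x - f y) <= e + K * \sum_i (1 - rcos (x i 0 - y i 0)).
Proof.
move=> [s1 s2] pf e0.
have [l1 l10 Hl1] := zperiodic_lipschitz s1 (fun x k => congr1 (@complex.Re R) (pf x k)).
have [l2 l20 Hl2] := zperiodic_lipschitz s2 (fun x k => congr1 (@complex.Im R) (pf x k)).
have [b1 b10 Hb1] := zperiodic_bounded (Cinf_continuous s1) (fun x k => congr1 (@complex.Re R) (pf x k)).
have [b2 b20 Hb2] := zperiodic_bounded (Cinf_continuous s2) (fun x k => congr1 (@complex.Im R) (pf x k)).
have L0 : 0 < l1 + l2 by exact: addr_gt0.
have HL x y : normc (f x - f y) <= (l1 + l2) * `|x - y|.
  apply: le_trans (normc_le _) _.
  by rewrite cReD cImD cReN cImN mulrDl lerD.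
have Hb x y : normc (f x - f y) <= 2 * (b1 + b2).
  apply: le_trans (normc_le _) _; rewrite cReD cImD cReN cImN.
  have h1 := ler_normB (complex.Re (f x)) (complex.Re (f y)).
  have h2 := ler_normB (complex.Im (f x)) (complex.Im (f y)).
  have := Hb1 x; have := Hb1 y; have := Hb2 x; have := Hb2 y; lra.
have eL : 0 < e / (l1 + l2) by rewrite divr_gt0.
have [k k0 Hk] := rcos_lt1 eL.
have K0 : 0 <= 2 * (b1 + b2) / k by rewrite divr_ge0 ?(ltW k0)// mulr_ge0// addr_ge0// ltW.
exists (2 * (b1 + b2) / k) => // x y.
have S0 i : 0 <= 1 - rcos (x i 0 - y i 0) by rewrite subr_ge0 rcos_le1.
have [[i Hi]|H] := pselect (exists i, forall m : int, e / (l1 + l2) < `|x i 0 - y i 0 - m%:~R|).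
  apply: le_trans (Hb x y) _; apply: ler_wpDl; first exact: ltW.
  rewrite -{1}[2 * (b1 + b2)](divfK (lt0r_neq0 k0)) ler_wpM2l//.
  apply: le_trans (Hk _ Hi) _; rewrite (bigD1 i)//= lerDl sumr_ge0//.
have {}H i : exists m : int, `|x i 0 - y i 0 - m%:~R| <= e / (l1 + l2).
  apply: contrapT => Hi; apply: H; exists i => m; rewrite ltNge; apply/negP => h.
  by apply: Hi; exists m.
have /choice[m Hm] := H.
pose kk : Z := \col_i m i.
rewrite -(pf y kk); apply: le_trans (HL _ _) _; apply: ler_wpDr.
  by rewrite mulr_ge0// sumr_ge0.
rewrite mulrC -ler_pdivlMr//; apply: cV_norm_leP; first exact: ltW.
by move=> i; rewrite !mxE opprD addrA.
Qed.

(* A Bernstein-type operator: a sum over M > m + 1 equidistant nodes integrates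
   exactly the kernel rcos^m and its first moment. *)
Lemma trig_poly_dense (f : V -> C) (e : R) : csmooth f -> zperiodic f -> 0 < e ->
  exists2 p : V -> C, trig_poly p & forall x, normc (f x - p x) <= e.
Proof.
move=> sf pf e0; have e20 : 0 < e / 2 by rewrite divr_gt0.
have [K K0 HK] := periodic_modulus sf pf e20.
(* Chosen so that the averaged error K (n + 1)/(2 (m + 1)) is at most e/2. *)
pose m := Num.truncn (K * n.+1%:R / e).
have [c c0 Hc] := @rcos_mean R m.
pose M := m.+2; have cM : 0 < c M by apply: c0.
pose y (j : {ffun 'I_n.+1 -> 'I_M}) : V := \col_i ((j i)%:R / M%:R).
pose W (j : {ffun 'I_n.+1 -> 'I_M}) (x : V) : R := \prod_i rcos (x i 0 - y j i 0) ^+ m.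
have yE j i : y j i 0 = (j i)%:R / M%:R by rewrite mxE.
have W0 j x : 0 <= W j x by apply: prodr_ge0 => i _; rewrite exprn_ge0 ?rcos_ge0.
have sumW x : \sum_j W j x = c M ^+ n.+1.
  transitivity (\prod_(i < n.+1) \sum_(j < M) rcos (x i 0 - j%:R / M%:R) ^+ m).
    rewrite bigA_distr_bigA/=; apply: eq_bigr => j _; apply: eq_bigr => i _.
    by rewrite yE.
  under eq_bigr => i _ do rewrite (Hc M _ _).1//.
  by rewrite prodr_const card_ord.
have sumW1 x i : \sum_j W j x * (1 - rcos (x i 0 - y j i 0)) = c M ^+ n.+1 / (2 * m.+1%:R).
  transitivity (\prod_(i' < n.+1) \sum_(j < M) (rcos (x i' 0 - j%:R / M%:R) ^+ m *
      (if i' == i then 1 - rcos (x i' 0 - j%:R / M%:R) else 1))).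
    rewrite bigA_distr_bigA/=; apply: eq_bigr => j _; rewrite big_split/=; congr (_ * _).
      by apply: eq_bigr => i' _; rewrite yE.
    rewrite (bigD1 i)//= eqxx yE big1 ?mulr1// => i' /negbTE ->//.
  transitivity (\prod_(i' < n.+1) (c M * (if i' == i then (2 * m.+1%:R)^-1 else 1))).
    apply: eq_bigr => i' _; case: ifPn => _; first by rewrite (Hc M _ _).2.
    by rewrite mulr1 -(Hc M (x i' 0) _).1//; apply: eq_bigr => j _; rewrite mulr1.
  rewrite big_split/= prodr_const card_ord; congr (_ * _).
  by rewrite (bigD1 i)//= eqxx big1 ?mulr1// => i' /negbTE ->.
have cN0 : 0 < c M ^+ n.+1 by rewrite exprn_gt0.
exists (fun x => \sum_j f (y j) * ((c M ^- n.+1) * W j x)%:C%C).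
  apply: trig_poly_sum => j; apply: trig_polyM; first exact: trig_poly_cst.
  rewrite (_ : (fun x => _) = (fun x : V => (c M ^- n.+1)%:C%C * \prod_i (rcos (x i 0 - y j i 0))%:C%C ^+ m)).
    apply: trig_polyM; first exact: trig_poly_cst.
    by apply: trig_poly_prod => i; apply: trig_poly_exp; exact: trig_poly_rcos.
  apply/funext => x; rewrite rmorphM/= rprod_complex; congr (_ * _).
  by apply: eq_bigr => i _; rewrite rmorphXn.
move=> x.
have -> : f x - \sum_j f (y j) * ((c M ^- n.+1) * W j x)%:C%C =
    \sum_j (f x - f (y j)) * ((c M ^- n.+1) * W j x)%:C%C.
  under [RHS]eq_bigr do rewrite mulrBl.
  rewrite sumrB -mulr_sumr -rmorph_sum/= -mulr_sumr sumW mulVf ?gt_eqF//.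
  by rewrite mulr1.
apply: le_trans (normc_sum _ _) _.
apply: (@le_trans _ _ (\sum_j (e / 2 + K * \sum_i (1 - rcos (x i 0 - y j i 0))) * (c M ^- n.+1 * W j x))).
  apply: ler_sum => j _; rewrite normcM normc_real ger0_norm; last first.
    by rewrite mulr_ge0// invr_ge0 ltW.
  by rewrite ler_wpM2r// mulr_ge0// invr_ge0 ltW.
under eq_bigr do rewrite mulrDl.
rewrite big_split/= -mulr_sumr -mulr_sumr sumW mulVf ?gt_eqF// mulr1.
rewrite (_ : \sum_j _ = K * c M ^- n.+1 * \sum_i \sum_j W j x * (1 - rcos (x i 0 - y j i 0))); last first.
  rewrite exchange_big/= mulr_sumr; apply: eq_bigr => j _.
  by rewrite -[in RHS]mulr_sumr; ring.
under eq_bigr do rewrite sumW1.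
rewrite sumr_const card_ord -[_ *+ n.+1]mulr_natr.
have hm : K * n.+1%:R / e < m.+1%:R by exact: truncnS_gt.
rewrite (_ : K * _ * _ = K * n.+1%:R / (2 * m.+1%:R)); last first.
  have m0 : m.+1%:R != 0 :> R by rewrite pnatr_eq0.
  have cn0 : c M ^+ n.+1 != 0 by rewrite gt_eqF.
  by move: (m.+1%:R) (c M ^+ n.+1) (n.+1%:R : R) m0 cn0 => u v w u0 v0; field; rewrite v0 u0.
rewrite [leRHS](splitr e) lerD2l ler_pdivrMr; last by rewrite mulr_gt0.
by rewrite mulrA divfK ?pnatr_eq0// [e * _]mulrC -ler_pdivrMr// ltW.
Qed.

End trigonometric_approximation.

Section linear_combinations.
Context {R : realType} {V : Type}.
Local Notation C := R[i].

(** Indices may repeat, which keeps sums and multiples simple; [combination_uniq] merges the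
    repetitions at the end. *)
Definition combination (I : Type) (e : I -> V -> C) (f : V -> C) :=
  exists s : seq (I * C), forall x, f x = \sum_(t <- s) t.2 * e t.1 x.

Lemma combination0 I (e : I -> V -> C) : combination e (fun=> 0).
Proof. by exists [::] => x; rewrite big_nil. Qed.

Lemma combinationD I (e : I -> V -> C) f g : combination e f -> combination e g ->
  combination e (fun x => f x + g x).
Proof. by move=> [s fs] [t gt]; exists (s ++ t) => x; rewrite big_cat fs gt. Qed.

Lemma combinationZ I (e : I -> V -> C) c f : combination e f ->
  combination e (fun x => c * f x).
Proof.
move=> [s fs]; exists [seq (t.1, c * t.2) | t <- s] => x.
by rewrite big_map fs mulr_sumr; apply: eq_bigr => t _ /=; rewrite mulrA.
Qed.

Lemma combination_sum I (e : I -> V -> C) J (s : seq J) (F : J -> V -> C) :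
  (forall j, combination e (F j)) -> combination e (fun x => \sum_(j <- s) F j x).
Proof.
move=> HF; elim: s => [|i s IH].
  by under eq_fun do rewrite big_nil; exact: combination0.
by under eq_fun do rewrite big_cons; exact: combinationD.
Qed.

Lemma combination_mem I (e : I -> V -> C) i : combination e (e i).
Proof. by exists [:: (i, 1)] => x; rewrite big_seq1 mul1r. Qed.

End linear_combinations.

(** * Telescoping projections over the scales *)

Section completeness.
Context {R : realType} {n : nat}.
Local Notation C := R[i].
Local Notation V := 'cV[R]_n.+1.
Local Notation Z := 'cV[int]_n.+1.
Local Notation zvec := (@zvec R n.+1).
Local Notation mu := (@lebesgue_cV R n.+1).

Variables (A : 'M[R]_n.+1) (G : set V) (th : V -> R) (r : nat) (Gl : 'I_r -> V -> C).
Hypothesis A_unit : A \in unitmx.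
Let B := A^T.
Let Bi := invmx B.
Hypothesis ZG : int_lattice `<=` G.
Hypothesis ZG1 : int_lattice `<=` [set x | G (B^T *m x)].
Hypothesis th_bsupp : bsupp th.
Hypothesis th_sum : forall x, psum (dualZ G) (fun y => th y ^+ 2) x = 1.
Hypothesis th_one : exists2 d, 0 < d & forall x, `|x| <= d -> th x = 1.
Hypothesis contraction : forall b d : R, 0 < d ->
  exists J : nat, forall j (x : V), (J <= j)%N -> `|x| <= b -> `|Bi ^+ j *m x| <= d.
Hypothesis Gl_test : forall l, testfun (Gl l).
Hypothesis Gl_kernel : forall x k, \sum_l Gl l x * conjc (Gl l (x + zvec k)) =
  (th (Bi *m x) * th (Bi *m (x + zvec k)))%:C%C * (`[< dual_lattice G (Bi *m zvec k) >])%:R -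
  (th x * th (x + zvec k))%:C%C * (`[< dual_lattice G (zvec k) >])%:R.

Let B_unit : B \in unitmx. Proof. by rewrite unitmx_tr. Qed.
Let BKi (x : V) : Bi *m (B *m x) = x. Proof. by rewrite mulmxA mulVmx// mul1mx. Qed.
Let BiK (x : V) : B *m (Bi *m x) = x. Proof. by rewrite mulmxA mulmxV// mul1mx. Qed.

Let th_unique y l : th y = 1 -> dualZ G l -> l != 0 -> th (y + zvec l) = 0.
Proof.
move=> ty Sl l0; apply: (psum_sqr_unique th_bsupp th_sum _ Sl) => //.
by move=> z _; rewrite zvec0 dot0l.
Qed.

(** On the Fourier side, the orthogonal projection onto the closed span of the [G]-translates of the
    function with transform [th], that is onto products of [th] with multipliers periodic under the
    dual lattice. *)
Definition lowpass (F : V -> C) (x : V) : C :=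
  (th x)%:C%C * psum (dualZ G) (fun y => (th y)%:C%C * F y) x.

Let dual_B_int (y : V) : dual_lattice G y -> int_lattice (B *m y).
Proof. exact: dual_mulmx_int. Qed.

(** [psum] only takes functions of x + k; the floor of y - x recovers k, so that kernels depending
    on k can be written. *)
Let lowpass_kernel (F : V -> C) (x : V) (u : V -> R) (S : set Z) (x0 : R) : bsupp F ->
  psum setT (fun y => (x0 * u y)%:C%C * (`[< S (\col_i Num.floor ((y - x) i 0)) >])%:R * F y) x =
  x0%:C%C * psum S (fun y => (u y)%:C%C * F y) x.
Proof.
move=> [t Ht]; rewrite -psumZ; last by exists t => y /Ht ->; rewrite mulr0.
rewrite /psum [RHS]fsbig_mkcond; apply: eq_fsbigr => k _; rewrite /patch.
have -> : \col_i Num.floor ((x + zvec k - x) i 0) = k.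
  by apply/colP => i; rewrite mxE addrC addKr mxE intrKfloor.
rewrite -[`[< _ >]]/(k \in S); case: ifP => _; rewrite ?mulr0 ?mul0r//.
by rewrite mulr1 rmorphM/= mulrA.
Qed.

(** The identity [Gl_kernel] summed against [F]: the components on the generators make up the
    difference of two consecutive projections. *)
Lemma highpass_eq (F : V -> C) x : testfun F ->
  \sum_l Gl l x * psum setT (fun y => conjc (Gl l y) * F y) x =
  lowpass (fun y => F (B *m y)) (Bi *m x) - lowpass F x.
Proof.
move=> tF; have bF := tF.2.
have bG l : bsupp (fun y => conjc (Gl l y) * F y).
  by case: bF => t Ht; exists t => y /Ht ->; rewrite mulr0.
transitivity (psum setT (fun y => \sum_l Gl l x * (conjc (Gl l y) * F y)) x).
  rewrite psum_sum => [|l]; last by case: (bG l) => t Ht; exists t => y /Ht ->; rewrite mulr0.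
  by apply: eq_bigr => l _; rewrite psumZ.
have tau_eq : lowpass (fun y => F (B *m y)) (Bi *m x) =
   (th (Bi *m x))%:C%C * psum [set k | dual_lattice G (Bi *m zvec k)] (fun y => (th (Bi *m y))%:C%C * F y) x.
  rewrite /lowpass; congr (_ * _); rewrite [RHS](psum_mulmx (S := dualZ G) _ _ B_unit).
  - by apply: eq_fsbigr => l _; rewrite -/Bi BKi.
  - move=> l Sl; have /int_latticeP[k kE] := dual_B_int Sl.
    by exists k => //=; rewrite -kE BKi.
  - move=> k Dk; have /int_latticeP[l lE] := dual_int ZG Dk.
    by exists l; rewrite -?lE// /dualZ/= -lE.
rewrite tau_eq /lowpass -!lowpass_kernel//.
have bu (c : V -> C) : bsupp (fun y => c y * F y).
  by case: bF => t Ht; exists t => y /Ht ->; rewrite mulr0.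
rewrite -[X in _ - X]mul1r -mulNr -psumZ//.
rewrite -psumD; last 2 first.
- exact: bu.
- have [t Ht] := bu (fun y => ((th x * th y)%:C)%C * (`[< dualZ G (\col_i Num.floor ((y - x) i 0)) >])%:R).
  by exists t => y /Ht ->; rewrite mulr0.
apply: eq_fsbigr => k _.
have kE : \col_i Num.floor ((x + zvec k - x) i 0) = k.
  by apply/colP => i; rewrite mxE addrC addKr mxE intrKfloor.
rewrite kE mulN1r -mulrBl -Gl_kernel mulr_suml.
by apply: eq_bigr => l _; rewrite mulrA.
Qed.

Let Q (j : int) : 'M[R]_n.+1 := (A ^ j)^T.

Let uA : A \is a GRing.unit. Proof. exact: A_unit. Qed.

Let Q_unit j : Q j \in unitmx.
Proof. by rewrite /Q unitmx_tr; exact: unitrXz. Qed.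

Let QS j : Q (j + 1) = Q j *m B.
Proof.
by rewrite /Q /B -trmx_mul; congr (_^T); rewrite addrC exprzDr.
Qed.

Let trX (M : 'M[R]_n.+1) m : (M ^+ m)^T = M^T ^+ m.
Proof.
elim: m => [|m IH]; first by rewrite !expr0 trmx1.
by rewrite exprS exprSr -[_ * _]/(_ *m _) trmx_mul IH.
Qed.

Let Q_pos (m : nat) : invmx (Q m) = Bi ^+ m.
Proof. by rewrite /Q -exprnP trX -[invmx _]/((B ^+ m)^-1) -exprVn. Qed.

Let Q_neg (m : nat) : Q (- m%:Z) = Bi ^+ m.
Proof. by rewrite /Q -exprnN -exprVn trX -[A^-1]/(invmx A) trmx_inv. Qed.

Let projection (F : V -> C) (j : int) (x : V) : C :=
  lowpass (fun y => F (Q j *m y)) (invmx (Q j) *m x).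

Let projection_step F j x : testfun F ->
  projection F (j + 1) x - projection F j x =
  \sum_l Gl l (invmx (Q j) *m x) *
    psum setT (fun y => conjc (Gl l y) * F (Q j *m y)) (invmx (Q j) *m x).
Proof.
move=> tF; rewrite highpass_eq; last exact: testfun_mulmx.
rewrite /projection; congr (_ - _); rewrite QS.
have -> : (fun y => F (Q j *m B *m y)) = (fun y => F (Q j *m (B *m y))).
  by apply/funext => y; rewrite mulmxA.
by rewrite mulmxA -[_ *m invmx (Q j)]/(B^-1 * (Q j)^-1) -invrM//; exact: Q_unit.
Qed.

(** At a fine scale the rescaled support of [F] lies in the ball where [th] is 1 and no other
    translate interferes, so the projection is exactly [F]. *)
Let projection_top (F : V -> C) : bsupp F -> exists J : nat, forall m, (J <= m)%N -> projection F m = F.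
Proof.
move=> [b Hb]; have [d d0 Hd] := th_one; have [J HJ] := contraction b d0.
exists J => m Jm; apply/funext => x; rewrite /projection Q_pos.
set y := _ *m x; have yx : Q m *m y = x by rewrite /y -Q_pos mulmxA mulmxV ?mul1mx// Q_unit.
have supp z : F (Q m *m z) != 0 -> th z = 1.
  move=> Fz; apply: Hd; have <- : Bi ^+ m *m (Q m *m z) = z.
    by rewrite -Q_pos mulmxA mulVmx ?mul1mx// Q_unit.
  by apply: HJ => //; rewrite leNgt; apply: contra Fz => /Hb ->.
rewrite /lowpass; have [ty|ty] := eqVneq (th y) 0.
  rewrite ty mul0r; apply/eqP; rewrite eq_sym -yx; apply: contraT => /supp h.
  by move: ty; rewrite h => /eqP; rewrite oner_eq0.
rewrite psum_single.
- have [F0|Fn] := eqVneq (F (Q m *m y)) 0; first by rewrite F0 !mulr0 -yx F0.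
  by rewrite (supp _ Fn) rmorph1 !mul1r yx.
- by move=> z _; rewrite zvec0 dot0l.
move=> k Sk k0; have [->|Fn] := eqVneq (F (Q m *m (y + zvec k))) 0; first by rewrite mulr0.
exfalso; move/eqP: ty; apply.
have := @th_unique (y + zvec k) (- k) (supp _ Fn); rewrite zvecN addrK; apply.
  by move=> z Gz; rewrite zvecN dotNl rpredN; exact: Sk.
by rewrite oppr_eq0.
Qed.

(** At a coarse scale the support of [th] is carried into the ball where [F] vanishes. *)
Let projection_bottom (F : V -> C) : (exists2 d, 0 < d & forall x, `|x| <= d -> F x = 0) ->
  exists J : nat, forall m, (J <= m)%N -> projection F (- m%:Z) = fun=> 0.
Proof.
move=> [d d0 Hd]; have [b Hb] := th_bsupp; have [J HJ] := contraction b d0.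
exists J => m Jm; apply/funext => x; rewrite /projection /lowpass Q_neg.
rewrite (_ : psum _ _ _ = 0) ?mulr0//; apply: fsbig1 => k _; set y := _ + _.
have [->|ty] := eqVneq (th y) 0; first by rewrite mul0r.
rewrite Hd ?mulr0//; apply: HJ => //.
by rewrite leNgt; apply: contra ty => /Hb ->.
Qed.

Let e (i : int * Z * 'I_r) : V -> C := wave (Q i.1.1) (Gl i.2) i.1.2.

(** Telescoping writes [F] as a finite sum of generators with smooth periodic coefficients.
    Replacing each coefficient by a trigonometric polynomial produces a finite sum of waves and
    costs at most d H(x) at each point. *)
Lemma wave_combination_approx (F : V -> C) (eps : R) : testfun F ->
  (exists2 d, 0 < d & forall x, `|x| <= d -> F x = 0) -> 0 < eps ->
  exists2 f, combination e f & \int[mu]_x normc (F x - f x) ^+ 2 <= eps.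
Proof.
move=> tF F0 eps0; have [J1 HJ1] := projection_top tF.2; have [J2 HJ2] := projection_bottom F0.
pose J := maxn J1 J2.
pose jj (i : nat) : int := i%:Z - J%:Z.
pose M (i : nat) (l : 'I_r) := psum setT (fun y => conjc (Gl l y) * F (Q (jj i) *m y)).
have tM i l : testfun (fun y => conjc (Gl l y) * F (Q (jj i) *m y)).
  apply: testfunMr; first exact: testfun_conj.
  by apply: csmooth_mulmx; exact: tF.1.
have sM i l : csmooth (M i l) by exact: csmooth_psum.
have pM i l : zperiodic (M i l) by move=> x h; exact: psum_shift.
have FE x : F x = \sum_(i < J + J) \sum_l Gl l (invmx (Q (jj i)) *m x) * M i l (invmx (Q (jj i)) *m x).
  transitivity (\sum_(0 <= i < J + J) (projection F (jj i.+1) x - projection F (jj i) x)).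
    rewrite telescope_sumr// /jj PoszD addrK sub0r HJ2 ?leq_maxr// subr0.
    by rewrite HJ1// leq_maxl.
  rewrite big_mkord; apply: eq_bigr => i _; rewrite -projection_step//.
  by rewrite (_ : jj i.+1 = jj i + 1)// /jj -addn1 PoszD addrAC.
pose H x := \sum_(i < J + J) \sum_l normc (Gl l (invmx (Q (jj i)) *m x)).
have mH : measurable_fun setT H.
  apply: measurable_sum => i; apply: measurable_sum => l; apply: measurable_normc.
  apply: csmooth_measurable; apply: csmooth_mulmx; exact: (Gl_test l).1.
have tGQ i l : testfun (fun x => Gl l (invmx (Q i) *m x)).
  by apply: testfun_mulmx => //; rewrite unitmx_inv.
have [K HK] : exists K, forall x, H x <= K.
  have /choice[b Hb] (il : 'I_(J + J) * 'I_r) : exists b, forall x, normc (Gl il.2 (invmx (Q (jj il.1)) *m x)) <= b.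
    by have [b _ Hb] := testfun_bounded (tGQ (jj il.1) il.2); exists b.
  exists (\sum_(i < J + J) \sum_l b (i, l)) => x.
  by apply: ler_sum => i _; apply: ler_sum => l _; exact: (Hb (i, l)).
have H0 x : 0 <= H x by apply: sumr_ge0 => i _; apply: sumr_ge0 => l _; exact: normc_ge0.
have bH : bsupp H.
  have bs I (s : seq I) (f : I -> V -> R) : (forall i, bsupp (f i)) -> bsupp (fun x => \sum_(i <- s) f i x).
    move=> bf; elim: s => [|i s IH]; first by exists 0 => x _; rewrite big_nil.
    by under eq_fun do rewrite big_cons; exact: bsuppD.
  apply: (bs _ _ _) => i; apply: (bs _ _ _) => l; have [b Hb] := (tGQ (jj i) l).2.
  by exists b => x /Hb ->; rewrite normc0.
have iH2 : mu.-integrable setT (EFin \o (fun x => H x ^+ 2)).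
  have [b Hb] := bH; apply: (@integrable_bounded_support _ _ (fun x => H x ^+ 2) b (K ^+ 2)).
  - exact: measurable_funX.
  - by move=> x; rewrite ger0_norm ?sqr_ge0// lerXn2r ?nnegrE// (le_trans (H0 x)).
  - by move=> x /Hb ->; rewrite expr0n.
pose I := \int[mu]_x (H x ^+ 2).
have I0 : 0 <= I by apply: Rintegral_ge0 => x _; exact: sqr_ge0.
(* With d <= 1 one has d^2 I <= d (I + 1) <= eps. *)
pose d := Num.min 1 (eps / (I + 1)).
have d0 : 0 < d by rewrite lt_min ltr01 divr_gt0// ltr_wpDl.
have dI : d ^+ 2 * I <= eps.
  have d1 : d <= 1 by rewrite ge_min lexx.
  have d2 : d * (I + 1) <= eps by rewrite -ler_pdivlMr ?ltr_wpDl// ge_min lexx orbT.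
  apply: le_trans d2; rewrite expr2 -mulrA ler_pM2l// ler_wpDr//.
  by rewrite ler_piMl.
have /choice[p Hp] (il : nat * 'I_r) : exists p, trig_poly p /\
    forall x, normc (M il.1 il.2 x - p x) <= d.
  by have [p tp Hp] := trig_poly_dense (sM il.1 il.2) (pM il.1 il.2) d0; exists p.
pose f x := \sum_(i < J + J) \sum_l Gl l (invmx (Q (jj i)) *m x) * p (nat_of_ord i, l) (invmx (Q (jj i)) *m x).
exists f.
  rewrite /f; apply: combination_sum => i; apply: combination_sum => l.
  have [[s Hs] _] := Hp (nat_of_ord i, l).
  rewrite (_ : (fun x => _) = fun x => \sum_(t <- s) (t.2 * (Num.sqrt `|\det (Q (jj i))|)%:C%C) * e (jj i, t.1, l) x).
    by apply: combination_sum => t; apply: combinationZ; exact: combination_mem.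
  apply/funext => x; rewrite Hs mulr_sumr; apply: eq_bigr => t _; rewrite /e /wave/=.
  have c0 : Num.sqrt `|\det (Q (jj i))| != 0.
    by rewrite gt_eqF// sqrtr_gt0 normr_gt0 -unitfE -unitmxE.
  rewrite -[in RHS]mulrA [in RHS](mulrA _%:C%C) -rmorphM/= divff// rmorph1 mul1r.
  by rewrite mulrCA.
have le_dH x : normc (F x - f x) <= d * H x.
  rewrite FE /f -sumrB; apply: le_trans (normc_sum _ _) _; rewrite mulr_sumr.
  apply: ler_sum => i _; rewrite -sumrB; apply: le_trans (normc_sum _ _) _; rewrite mulr_sumr.
  apply: ler_sum => l _; rewrite -mulrBr normcM mulrC ler_wpM2r ?normc_ge0//.
  exact: (Hp (nat_of_ord i, l)).2.
have mf : cmeasurable (fun x => F x - f x).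
  apply: cmeasurableD; first exact: csmooth_measurable tF.1.
  apply: cmeasurableN; apply: cmeasurable_sum => i; apply: cmeasurable_sum => l.
  have [[s Hs] _] := Hp (nat_of_ord i, l).
  apply: cmeasurableM; first exact: csmooth_measurable (tGQ _ _).1.
  apply: csmooth_measurable; apply: csmooth_mulmx.
  rewrite (_ : p _ = fun x => \sum_(t <- s) t.2 * char t.1 x); last exact/funext.
  by apply: csmooth_sum => t; apply: csmoothM; [exact: csmooth_cst|exact: csmooth_char].
have le2 x : `|normc (F x - f x) ^+ 2| <= d ^+ 2 * H x ^+ 2.
  rewrite ger0_norm ?sqr_ge0// -exprMn lerXn2r ?nnegrE ?normc_ge0//.
  by rewrite mulr_ge0// ltW.
have mf2 : measurable_fun setT (fun x => normc (F x - f x) ^+ 2).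
  by apply: measurable_funX; exact: measurable_normc.
have i2 : mu.-integrable setT (EFin \o (fun x => d ^+ 2 * H x ^+ 2)).
  have := integrableZl measurableT (d ^+ 2) iH2.
  by under eq_fun do rewrite -EFinM.
apply: le_trans (ler_norm _) _; apply: le_trans (normr_Rintegral_le mf2 le2 i2) _.
by rewrite RintegralZl.
Qed.

End completeness.

(** * Density in L^2 *)

Import HBNNSimple.

Lemma hexp0_le1 {R : realType} (t : R) : hexp 0 t <= 1.
Proof.
rewrite /hexp; case: ifPn => // t0; rewrite expr0 mul1r -[leRHS]expR0 ler_expR.
by rewrite oppr_le0 invr_ge0 ltW.
Qed.

Lemma hexp0_cvg1 {R : realType} (u : nat -> R) :
  (\forall m \near \oo, m.+1%:R <= 2 * u m) -> hexp 0 (u m) @[m --> \oo] --> (1 : R).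
Proof.
move=> Hu; have lb : expR (- (2 * m.+1%:R^-1)) @[m --> \oo] --> (1 : R).
  rewrite -[X in _ --> X]expR0; apply: continuous_cvg; first exact: continuous_expR.
  rewrite -[X in _ --> X]oppr0; apply: cvgN; rewrite -[X in _ --> X](mulr0 2).
  by apply: cvgMr; exact: cvg_harmonic.
suff H : \forall m \near \oo, expR (- (2 * m.+1%:R^-1)) <= hexp 0 (u m) <= 1.
  exact: (squeeze_cvgr H lb (cvg_cst _)).
apply: filterS Hu => m mu; rewrite hexp0_le1 andbT /hexp.
have m0 : 0 < m.+1%:R :> R by [].
have u0 : 0 < u m by lra.
rewrite u0 expr0 mul1r ler_expR lerN2 -[leRHS]invrK lef_pV2 ?posrE//.
by rewrite invfM invrK; lra.
Qed.

Section square_norm.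
Context {R : realType} {n : nat}.
Local Notation C := R[i].
Local Notation V := 'cV[R]_n.
Local Notation mu := (@lebesgue_cV R n).
Implicit Types f g h : V -> C.

(** The square of the L^2 norm as an extended real; [nsqD] stands in for the triangle inequality and
    avoids square roots. *)
Definition nsq f : \bar R := (\int[mu]_x (normc (f x) ^+ 2)%:E)%E.

Lemma measurable_normc_sqr f : cmeasurable f -> measurable_fun setT (fun x => normc (f x) ^+ 2).
Proof. by move=> mf; apply: measurable_funX; exact: measurable_normc. Qed.

Lemma nsqE f (g : V -> R) : cmeasurable f -> (forall x, normc (f x) ^+ 2 <= g x) ->
  mu.-integrable setT (EFin \o g) -> nsq f = (\int[mu]_x (normc (f x) ^+ 2))%:E.
Proof.
move=> mf fg ig; rewrite /nsq /Rintegral fineK//; apply: integrable_fin_num => //.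
apply: (@integrable_le _ _ _ mu (fun x => normc (f x) ^+ 2) g) => //.
  exact: measurable_normc_sqr.
by move=> x; rewrite ger0_norm ?sqr_ge0.
Qed.

Lemma nsqD f g : cmeasurable f -> cmeasurable g ->
  (nsq (fun x => f x + g x)%R <= 2%:E * nsq f + 2%:E * nsq g)%E.
Proof.
move=> mf mg.
have mE h : cmeasurable h -> measurable_fun setT (fun x => (normc (h x) ^+ 2)%:E).
  by move=> mh; apply/measurable_EFinP; exact: measurable_normc_sqr.
rewrite /nsq -!ge0_integralZl//; try (exact: mE); try by move=> x _; rewrite lee_fin sqr_ge0.
rewrite -ge0_integralD//; try by move=> x _; rewrite mule_ge0// lee_fin sqr_ge0.
- apply: ge0_le_integral => //.
  + by move=> x _; rewrite lee_fin sqr_ge0.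
  + by apply: mE; exact: cmeasurableD.
  + by apply: emeasurable_funD; apply: emeasurable_funM => //; exact: mE.
  move=> x _; rewrite -!EFinM -EFinD lee_fin.
  have h1 := le_normcD (f x) (g x); have h2 := normc_ge0 (f x + g x).
  move: h1 h2; move: (normc _) (normc (f x)) (normc (g x)) => u v w h1 h2.
  have h3 : u ^+ 2 <= (v + w) ^+ 2 by rewrite lerXn2r ?nnegrE// (le_trans h2).
  have := sqr_ge0 (v - w); rewrite !expr2 in h3 *; nra.
- by apply: emeasurable_funM => //; exact: mE.
- by apply: emeasurable_funM => //; exact: mE.
Qed.

Lemma nsqZ (c : C) f : cmeasurable f -> nsq (fun x => c * f x) = ((normc c ^+ 2)%:E * nsq f)%E.
Proof.
move=> mf; rewrite /nsq -ge0_integralZl//.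
- by apply: eq_integral => x _; rewrite normcM exprMn EFinM.
- by apply/measurable_EFinP; exact: measurable_normc_sqr.
- by move=> x _; rewrite lee_fin sqr_ge0.
- by rewrite lee_fin sqr_ge0.
Qed.

Lemma nsq_dominated_cvg (f_ : nat -> V -> C) f (g : V -> R) :
  (forall m, cmeasurable (f_ m)) -> cmeasurable f ->
  (forall x, ccvg (f_ ^~ x) (f x)) ->
  (forall m x, normc (f_ m x) <= g x) -> (forall x, normc (f x) <= g x) ->
  mu.-integrable setT (EFin \o (fun x => g x ^+ 2)) ->
  forall e : R, 0 < e -> exists m, (nsq (fun x => f x - f_ m x)%R <= e%:E)%E.
Proof.
move=> mf_ mf cf f_g fg ig e e0.
have mD m : cmeasurable (fun x => f x - f_ m x).
  by apply: cmeasurableD => //; exact: cmeasurableN.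
have ig4 : mu.-integrable setT (EFin \o (fun x => 4 * g x ^+ 2)).
  have := integrableZl measurableT 4 ig; by under eq_fun do rewrite -EFinM.
have le4 m x : normc (f x - f_ m x) ^+ 2 <= 4 * g x ^+ 2.
  have g0 : 0 <= g x by apply: le_trans (fg x); exact: normc_ge0.
  have h : normc (f x - f_ m x) <= 2 * g x.
    apply: le_trans (le_normcD _ _) _; rewrite normcN mulr_natl mulr2n lerD//.
  rewrite (_ : 4 * g x ^+ 2 = (2 * g x) ^+ 2); last by ring.
  by rewrite lerXn2r ?nnegrE ?normc_ge0// mulr_ge0.
have cv0 : (\int[mu]_x (normc (f x - f_ m x) ^+ 2)) @[m --> \oo] --> \int[mu]_x (0 : R).
  apply: (Rintegral_dominated_cvg (g := fun x => 4 * g x ^+ 2)) => //.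
  - by move=> m; exact: measurable_normc_sqr.
  - move=> x; under eq_fun do rewrite normc_sqr.
    have [c1 c2] := cf x.
    have d0 (u : nat -> R) l : u m @[m --> \oo] --> l -> (l - u m) ^+ 2 @[m --> \oo] --> (0 : R).
      move=> ul; under eq_fun do rewrite expr2; rewrite -(mulr0 (0:R)) -{1 2}(subrr l).
      by apply: cvgM; apply: cvgB => //; exact: cvg_cst.
    under eq_fun do rewrite cReD cImD cReN cImN.
    by have := cvgD (d0 _ _ c1) (d0 _ _ c2); rewrite addr0; exact.
  - by move=> m x; rewrite ger0_norm ?sqr_ge0.
rewrite /Rintegral integral0 /= in cv0.
have /cvgr0Pnorm_le/(_ _ e0) := cv0.
case=> m _ /(_ m (leqnn m)); rewrite /= => h; exists m.
rewrite (nsqE (mD m) (le4 m) ig4) lee_fin; exact: le_trans (ler_norm _) h.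
Qed.

Section density.
Variable P : (V -> C) -> Prop.
Hypothesis PD : forall f g, P f -> P g -> P (fun x => f x + g x).
Hypothesis PZ : forall c f, P f -> P (fun x => c * f x).
Hypothesis Plim : forall f, cmeasurable f ->
  (forall e : R, 0 < e -> exists2 g, P g & (nsq (fun x => f x - g x)%R <= e%:E)%E) -> P f.
Hypothesis Ptest : forall f, testfun f -> P f.

Let Pdct (f_ : nat -> V -> C) f (g : V -> R) :
  (forall m, cmeasurable (f_ m)) -> cmeasurable f ->
  (forall x, ccvg (f_ ^~ x) (f x)) ->
  (forall m x, normc (f_ m x) <= g x) -> (forall x, normc (f x) <= g x) ->
  mu.-integrable setT (EFin \o (fun x => g x ^+ 2)) ->
  (forall m, P (f_ m)) -> P f.
Proof.
move=> mf_ mf cf f_g fg ig Pf; apply: Plim => // e e0.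
have [m Hm] := nsq_dominated_cvg mf_ mf cf f_g fg ig e0.
by exists (f_ m).
Qed.

Let Psum I (s : seq I) (F : I -> V -> C) : (forall i, P (F i)) ->
  P (fun x => \sum_(i <- s) F i x).
Proof.
move=> PF; elim: s => [|i s IH].
  by under eq_fun do rewrite big_nil; apply: Ptest; exact: testfun0.
by under eq_fun do rewrite big_cons; exact: PD.
Qed.

Let ind (E : set V) (x : V) : C := (\1_E x)%:C%C.

(** A smooth approximation of the indicator of c >= 0. The added m + 1 brings the limit at c = 0 to
    1, so that closed boxes are reached exactly. *)
Let soft (c : R) (m : nat) : R := hexp 0 (m.+1%:R ^+ 2 * c + m.+1%:R).

Let soft_cvg c : soft c m @[m --> \oo] --> ((0 <= c)%R%:R : R).
Proof.
have [c0|c0] := leP 0 c.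
  apply: hexp0_cvg1; near=> m.
  have h : m.+1%:R <= m.+1%:R ^+ 2 * c + m.+1%:R :> R by rewrite lerDr mulr_ge0.
  by have := ler0n R m.+1; lra.
have : \forall m \near \oo, soft c m = 0.
  near=> m; rewrite /soft hexp_eq0//.
  have h : (- c)^-1 <= m.+1%:R.
    near: m; exists (Num.truncn (- c)^-1) => // m /= mm.
    by rewrite ltW// (lt_le_trans (truncnS_gt _))// ler_nat ltnS.
  have : 1 <= m.+1%:R * - c by rewrite -ler_pdivrMr ?oppr_gt0// mul1r.
  by have := ler0n R m.+1; rewrite expr2; move: (m.+1%:R : R) => u; nra.
by move=> H; apply: cvg_near_cst; apply: filterS H => m ->.
Unshelve. all: by end_near.
Qed.

Let Pbox (a b : V) : P (ind (cbox a b)).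
Proof.
pose f_ (m : nat) (x : V) : R := \prod_i (soft (x i 0 - a i 0) m * soft (b i 0 - x i 0) m).
pose r := `|a| + `|b| + 1.
have sne c m : soft c m != 0 -> -1 < c.
  apply: contraNT; rewrite -leNgt => c1; apply/eqP/hexp_eq0.
  have : 1 <= m.+1%:R :> R by rewrite ler1n.
  by rewrite expr2; move: (m.+1%:R : R) => u; nra.
have supp m x : f_ m x != 0 -> `|x| <= r.
  move=> /prodf_neq0 H; apply: cV_norm_leP; first by rewrite !addr_ge0.
  move=> i; have := H i isT; rewrite mulf_eq0 negb_or => /andP[/sne h1 /sne h2].
  have := cV_norm_le a i; have := cV_norm_le b i; rewrite !ler_norml /r => /andP[h3 h4] /andP[h5 h6].
  have h7 := normr_ge0 a; have h8 := normr_ge0 b; apply/andP; split; lra.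
have bx x : cbox a b x -> `|x| <= r.
  move=> H; apply: cV_norm_leP; first by rewrite !addr_ge0.
  move=> i; have /andP[h1 h2] := H i.
  have := cV_norm_le a i; have := cV_norm_le b i; rewrite !ler_norml /r => /andP[h3 h4] /andP[h5 h6].
  have h7 := normr_ge0 a; have h8 := normr_ge0 b; apply/andP; split; lra.
pose g (x : V) : R := (`|x| <= r)%R%:R.
have mball : measurable_fun setT g.
  rewrite (_ : g = \1_[set x : V | `|x| <= r]).
    apply: measurable_indic; rewrite (_ : [set x | _] = cbox (const_mx (- r)) (const_mx r)).
      exact: measurable_cbox.
    apply/seteqP; split=> x /=; first exact: ball_le_cbox.
    move=> H; apply: cV_norm_leP; first by rewrite !addr_ge0.
    by move=> i; have := H i; rewrite !mxE -ler_norml.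
  by apply/funext => x; rewrite indicE mem_setE.
have tf m : testfun (fun x => (f_ m x)%:C%C).
  split; last by exists r => x xr; apply/eqP; rewrite eq_complex/= eqxx andbT; apply/negPn/negP => /supp; rewrite leNgt xr.
  apply: csmooth_real => k; apply: Ck_prod => i; apply: CkM; apply: (Ck_comp (Cinf_hexp 0 k)).
    apply: CkD; last exact: Ck_cst.
    apply: CkM; first exact: Ck_cst.
    by apply: CkB; [exact: Cinf_coord|exact: Ck_cst].
  apply: CkD; last exact: Ck_cst.
  apply: CkM; first exact: Ck_cst.
  by apply: CkB; [exact: Ck_cst|exact: Cinf_coord].
have f1 m x : 0 <= f_ m x <= 1.
  apply/andP; split; first by apply: prodr_ge0 => i _; rewrite mulr_ge0// hexp_ge0.
  by apply: prodr_ile1 => i _; rewrite mulr_ge0 ?hexp_ge0//= mulr_ile1 ?hexp_ge0 ?hexp0_le1.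
apply: (@Pdct (fun m x => (f_ m x)%:C%C) _ g).
- by move=> m; exact: csmooth_measurable (tf m).1.
- by apply: cmeasurable_real; apply: measurable_indic; exact: measurable_cbox.
- move=> x; apply: ccvg_real.
  have -> : \1_(cbox a b) x = \prod_i ((0 <= x i 0 - a i 0)%R%:R * (0 <= b i 0 - x i 0)%R%:R) :> R.
    rewrite indicE; have [H|H] := pselect (cbox a b x).
      rewrite mem_set// big1// => i _; have /andP[h1 h2] := H i.
      by rewrite !subr_ge0 h1 h2 mulr1.
    rewrite memNset//; have [i Hi] : exists i, ~ (a i 0 <= x i 0 <= b i 0) by apply/existsNP.
    rewrite (bigD1 i)//= !subr_ge0; move/negP: Hi; rewrite negb_and => /orP[/negbTE ->|/negbTE ->].
      by rewrite mul0r mul0r.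
    by rewrite mulr0 mul0r.
  rewrite /f_; elim: (index_enum _) => [|i s IH].
    by under eq_fun do rewrite big_nil; rewrite big_nil; exact: cvg_cst.
  under eq_fun do rewrite big_cons; rewrite big_cons; apply: cvgM => //.
  by apply: cvgM; exact: soft_cvg.
- move=> m x; rewrite normc_real /g; have /andP[h0 h1] := f1 m x.
  have [|xr] := leP `|x| r; first by rewrite ger0_norm.
  by rewrite (_ : f_ m x = 0) ?normr0//; apply/eqP/negPn/negP => /supp; rewrite leNgt xr.
- move=> x; rewrite normc_real indicE /g; have [H|H] := pselect (cbox a b x).
    by rewrite mem_set// (bx _ H) normr1.
  by rewrite memNset// normr0.
- apply: (@integrable_bounded_support _ _ (fun x => g x ^+ 2) r 1).
  + exact: measurable_funX.
  + by move=> x; rewrite /g; case: (_ <= r); rewrite ?expr1n ?normr1// expr0n normr0.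
  + by move=> x xr; rewrite /g leNgt xr expr0n.
- by move=> m; exact: Ptest.
Qed.

Let Q (M : nat) : set V := cbox (const_mx (- M%:R)) (const_mx M%:R).

Let mQ M : measurable (Q M). Proof. exact: measurable_cbox. Qed.

Let Q_int M : mu.-integrable setT (EFin \o (fun x => (\1_(Q M) x : R) ^+ 2)).
Proof.
apply: (@integrable_bounded_support _ _ (fun x => \1_(Q M) x ^+ 2) M%:R 1).
- by apply: measurable_funX; exact: measurable_indic.
- by move=> x; rewrite indicE; case: (_ \in _); rewrite ?expr1n ?normr1// expr0n normr0.
- move=> x xM; rewrite indicE memNset ?expr0n// => H; move: xM; rewrite ltNge => /negP; apply.
  by apply: cV_norm_leP => // i; have := H i; rewrite !mxE -ler_norml.
Qed.

Let ind_le (E : set V) M x : normc (ind (E `&` Q M) x) <= \1_(Q M) x.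
Proof.
by rewrite normc_real ger0_norm// !indicE in_setI ler_nat; case: (x \in E).
Qed.

(** Dynkin induction on [E], with the cube [Q M] kept fixed so that complements remain of finite
    measure. *)
Let Pset M (E : set V) : measurable E -> P (ind (E `&` Q M)).
Proof.
rewrite cV_measurableE; move: E.
apply: (@dynkin_induction _ _ (@cboxes R n) (fun E => P (ind (E `&` Q M)))).
- exact: cV_measurableE.
- exact: setI_closed_cboxes.
- by rewrite setTI; exact: Pbox.
- by move=> _ [a [b ->]]; rewrite /Q cboxI; exact: Pbox.
- move=> E mE PE.
  rewrite (_ : ind _ = fun x => ind (Q M) x + (-1) * ind (E `&` Q M) x).
    by apply: PD; [exact: Pbox|exact: PZ].
  apply/funext => x; rewrite /ind !indicE !in_setI in_setC.
  by case: (x \in E); case: (x \in Q M); rewrite /= ?mulN1r ?subrr ?subr0 ?rmorph0 ?rmorph1 ?oppr0 ?addr0 ?subrr.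
- move=> F mF tF PF.
  pose U m := \big[setU/set0]_(k < m) F k.
  have mU m : measurable (U m) by apply: bigsetU_measurable.
  apply: (@Pdct (fun m => ind (U m `&` Q M)) _ (\1_(Q M))).
  + by move=> m; apply: cmeasurable_real; apply: measurable_indic; exact: measurableI.
  + apply: cmeasurable_real; apply: measurable_indic; apply: measurableI => //.
    exact: bigcupT_measurable.
  + move=> x; apply: ccvg_real; apply: cvg_near_cst.
    have [[k _ Fk]|nF] := pselect ((\bigcup_k F k) x).
      exists k.+1 => // m /= km; rewrite !indicE !in_setI; congr (_ && _)%:R.
      by rewrite !mem_set//; [exists k|rewrite /U -bigcup_mkord; exists k].
    near=> m; rewrite !indicE !in_setI; congr (_ && _)%:R.
    by rewrite !memNset//; rewrite /U -bigcup_mkord => -[k _ Fk]; apply: nF; exists k.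
  + by move=> m x; exact: ind_le.
  + by move=> x; exact: ind_le.
  + exact: Q_int.
  + elim=> [|m IH].
      rewrite /U big_ord0 set0I (_ : ind set0 = fun=> 0); first by apply: Ptest; exact: testfun0.
      by apply/funext => x; rewrite /ind indicE in_set0.
    rewrite (_ : ind _ = fun x => ind (U m `&` Q M) x + ind (F m `&` Q M) x); first exact: PD.
    apply/funext => x; rewrite /ind !indicE !in_setI {1}/U big_ord_recr/= -/(U m) in_setU.
    have [Um|] := boolP (x \in U m); have [Fm|] := boolP (x \in F m); case: (x \in Q M);
      rewrite /= ?rmorph0 ?rmorph1 ?addr0 ?add0r//.
    exfalso; move: Um Fm; rewrite !inE /U -bigcup_mkord => -[k /= km Fk] Fm.
    have := tF k m Logic.I Logic.I (ex_intro _ x (conj Fk Fm)) => km'.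
    by rewrite km' ltnn in km.
Unshelve. all: by end_near.
Qed.

Let Psimple (g : {nnsfun V >-> R}) M : P (fun x => (g x * \1_(Q M) x)%:C%C).
Proof.
set s := finmap.enum_fset (fset_set (g @` setT)).
rewrite (_ : (fun x => _) = fun x => \sum_(y <- s) y%:C%C * ind (g @^-1` [set y] `&` Q M) x).
  apply: Psum => y; apply: PZ; apply: Pset.
  exact: measurable_funPTI.
apply/funext => x; rewrite fimfunE fsbig_finite//= mulr_suml rmorph_sum/=.
apply: eq_bigr => y _; rewrite -rmorphM/=; congr (_%:C)%C.
by rewrite -mulrA !indicE in_setI -mulnb natrM.
Qed.

Let Pnonneg (f : V -> R) : measurable_fun setT f -> (forall x, 0 <= f x) ->
  mu.-integrable setT (EFin \o (fun x => f x ^+ 2)) -> P (fun x => (f x)%:C%C).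
Proof.
move=> mf f0 if2.
have mEf : measurable_fun setT (EFin \o f) by exact/measurable_EFinP.
pose g := nnsfun_approx measurableT mEf.
have gf m x : g m x <= f x.
  rewrite /g nnsfun_approxE -lee_fin; apply: (le_approx (f := EFin \o f)) => //.
  by move=> y _; rewrite /= lee_fin.
have le m x : normc ((g m x * \1_(Q m) x)%:C%C) <= f x.
  rewrite normc_real ger0_norm ?mulr_ge0//.
  by apply: le_trans (gf m x); rewrite indicE; case: (_ \in _); rewrite ?mulr1 ?mulr0.
apply: (@Pdct (fun m x => (g m x * \1_(Q m) x)%:C%C) _ f) => //.
- by move=> m; apply: cmeasurable_real; apply: measurable_funM => //.
- move=> x; apply: ccvg_real; rewrite -[X in _ --> X]mulr1; apply: cvgM.
    have h : EFin \o g ^~ x @ \oo --> (f x)%:E.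
      by apply: (@cvg_nnsfun_approx _ _ _ setT measurableT _ mEf) => // y _; rewrite /= lee_fin.
    by move/fine_cvgP : h => [_].
  apply: cvg_near_cst; exists (Num.truncn `|x|).+1 => // m /= xm.
  rewrite indicE mem_set// => i; rewrite !mxE -ler_norml.
  apply: le_trans (cV_norm_le x i) _; apply: le_trans (ltW (truncnS_gt _)) _.
  by rewrite ler_nat.
- by move=> x; rewrite normc_real ger0_norm.
Qed.

(** A monotone class argument: test functions yield indicators of boxes, hence of bounded Borel
    sets, hence simple functions, and truncated simple approximations yield nonnegative functions; a
    general [f] splits into four such parts. *)
Lemma L2_induction f : cmeasurable f -> (nsq f < +oo)%E -> P f.
Proof.
move=> mf nf; have [m1 m2] := mf.
have i2 : mu.-integrable setT (EFin \o (fun x => normc (f x) ^+ 2)).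
  apply/integrableP; split; first by apply/measurable_EFinP; exact: measurable_normc_sqr.
  by under eq_integral => x _ do rewrite /= ger0_norm ?sqr_ge0//.
have H (h : V -> R) : measurable_fun setT h -> (forall x, `|h x| <= normc (f x)) ->
    P (fun x => (h x)%:C%C).
  move=> mh hf.
  have K (k : V -> R) : measurable_fun setT k -> (forall x, `|k x| <= normc (f x)) ->
      P (fun x => (Num.max (k x) 0)%:C%C).
    move=> mk kf.
    have mk' : measurable_fun setT (fun x => Num.max (k x) 0) by exact: measurable_maxr.
    have k0 x : 0 <= Num.max (k x) 0 by rewrite le_max lexx orbT.
    apply: Pnonneg => //.
    apply: (@integrable_le _ _ _ mu (fun x => Num.max (k x) 0 ^+ 2) (fun x => normc (f x) ^+ 2)) => //.
      exact: measurable_funX.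
    move=> x; rewrite ger0_norm ?sqr_ge0// lerXn2r ?nnegrE ?normc_ge0//.
    by rewrite ge_max normc_ge0 andbT (le_trans (ler_norm _)).
  rewrite (_ : (fun x => _) = fun x => (Num.max (h x) 0)%:C%C + (-1) * (Num.max (- h x) 0)%:C%C).
    apply: PD; first exact: K.
    by apply: PZ; apply: K; [exact: measurable_funN|move=> x; rewrite normrN].
  apply/funext => x; rewrite mulN1r -rmorphN -rmorphD/=; congr (_%:C)%C.
  have [h0|h0] := leP 0 (h x).
    have h1 : - h x <= 0 by rewrite oppr_le0.
    by rewrite (max_idPr h1) subr0.
  have h1 : 0 <= - h x by rewrite oppr_ge0 ltW.
  by rewrite (max_idPl h1) opprK add0r.
rewrite (_ : f = fun x => (complex.Re (f x))%:C%C + Complex 0 1 * (complex.Im (f x))%:C%C).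
  apply: PD; first by apply: H => // x; exact: normc_Re.
  by apply: PZ; apply: H => // x; exact: normc_Im.
apply/funext => x; apply: complex_ext; rewrite !(cReD, cImD, cReM, cImM)/=; ring.
Qed.

End density.
End square_norm.

(** * Plancherel's identity and cutoffs in frequency *)

Section plancherel.
Context {R : realType} {n : nat}.
Local Notation C := R[i].
Local Notation V := 'cV[R]_n.+1.
Local Notation mu := (@lebesgue_cV R n.+1).

Lemma nsq_bounded (f : V -> C) (M : R) : cintegrable mu f -> (forall x, normc (f x) <= M) ->
  mu.-integrable setT (EFin \o (fun x => normc (f x) ^+ 2)) /\
  nsq f = (complex.Re (cint mu (fun x => f x * conjc (f x))))%:E.
Proof.
move=> fi fM; have mf := cintegrable_meas fi.
have i2 : mu.-integrable setT (EFin \o (fun x => normc (f x) ^+ 2)).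
  apply: (@integrable_le _ _ _ mu (fun x => normc (f x) ^+ 2) (fun x => M * normc (f x))).
  - exact: measurable_normc_sqr.
  - move=> x; rewrite ger0_norm ?sqr_ge0// expr2.
    by apply: ler_wpM2r; [exact: normc_ge0|exact: fM].
  - have := integrableZl measurableT M (cintegrable_normc fi).
    by under eq_fun do rewrite -EFinM.
split=> //; rewrite (nsqE mf (fun x => lexx _) i2) /cint/=; congr (_%:E).
by apply: eq_Rintegral => x _; rewrite normc_mulconj.
Qed.

Lemma ifourier_fourier (f : V -> C) : testfun f -> ifourier (fourier f) = f.
Proof.
move=> tf; rewrite -[RHS](fourier_ifourier tf); apply/funext => x.
rewrite /ifourier !fourierE -[RHS]cint_opp.
  by congr cint; apply/funext => y; rewrite opprK dotNl dotNr.
apply: cmeasurableM; last exact: cmeasurable_phase.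
exact: (cintegrable_meas (cintegrable_ifourier tf)).
Qed.

(** Inversion is a hypothesis because the lemma is applied to the difference of a test function and
    an inverse transform of one, which need not be a test function, nor have one as its
    transform. *)
Lemma plancherel (f : V -> C) (M : R) : cintegrable mu f -> cintegrable mu (fourier f) ->
  (forall x, normc (f x) <= M) -> ifourier (fourier f) = f -> nsq f = nsq (fourier f).
Proof.
move=> fi Ffi fM fK; have [K _ HK] := fourier_bound fi.
rewrite (nsq_bounded fi fM).2 (nsq_bounded Ffi HK).2; congr (complex.Re _)%:E.
rewrite -(fourier_multiplication fi (cintegrable_conj Ffi)); congr cint; apply/funext => x.
by rewrite -[in X in _ * X]fK {1}/ifourier fourier_conj// /ifourier opprK.
Qed.

Lemma fourierD (f g : V -> C) : cintegrable mu f -> cintegrable mu g ->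
  fourier (fun x => f x + g x) = (fun x => fourier f x + fourier g x).
Proof.
move=> fi gi; apply/funext => x; rewrite !fourierE -cintD; try exact: cintegrable_phase.
by congr cint; apply/funext => y; rewrite mulrDl.
Qed.

Lemma fourierZ (c : C) (f : V -> C) : cintegrable mu f ->
  fourier (fun x => c * f x) = (fun x => c * fourier f x).
Proof.
move=> fi; apply/funext => x; rewrite !fourierE -cintZ; last exact: cintegrable_phase.
by congr cint; apply/funext => y; rewrite mulrA.
Qed.

Lemma fourier_sumZ I (s : seq (I * C)) (F : I -> V -> C) : (forall i, cintegrable mu (F i)) ->
  fourier (fun x => \sum_(t <- s) t.2 * F t.1 x) = (fun x => \sum_(t <- s) t.2 * fourier (F t.1) x).
Proof.
move=> Fi; elim: s => [|i s IH].
  apply/funext => x; rewrite big_nil fourierE -[RHS](cint0 mu).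
  by congr cint; apply/funext => y; rewrite big_nil mul0r.
under eq_fun do rewrite big_cons; rewrite fourierD.
- by apply/funext => x; rewrite fourierZ// big_cons IH.
- exact: cintegrableZ.
- by apply: cintegrable_sum => t; exact: cintegrableZ.
Qed.

Lemma plancherel_sub (f G : V -> C) : testfun f -> testfun G ->
  nsq (fun x => f x - ifourier G x)%R = nsq (fun x => fourier f x - G x)%R.
Proof.
move=> tf tG; have fi := testfun_integrable tf; have Gi := testfun_integrable tG.
have E : (fun x => f x - ifourier G x) = (fun x => f x + (-1) * ifourier G x).
  by apply/funext => x; rewrite mulN1r.
have iGi := cintegrable_ifourier tG.
have FE : fourier (fun x => f x + (-1) * ifourier G x) = (fun x => fourier f x + (-1) * G x).
  by rewrite fourierD//; [rewrite fourierZ// fourier_ifourier|exact: cintegrableZ].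
have Ffi := cintegrable_fourier tf.
have [M1 _ HM1] := testfun_bounded tf; have [M2 _ HM2] := fourier_bound Gi.
rewrite E (@plancherel _ (M1 + M2)) ?FE.
- by congr (nsq _); apply/funext => x; rewrite mulN1r.
- by apply: cintegrableD => //; exact: cintegrableZ.
- by apply: cintegrableD => //; exact: cintegrableZ.
- move=> x; apply: le_trans (le_normcD _ _) _; rewrite normcM normcN normc1 mul1r.
  by apply: lerD => //; exact: HM2 (- x).
- apply/funext => x; rewrite {1}/ifourier fourierD//; last exact: cintegrableZ.
  by rewrite fourierZ// -/(ifourier (fourier f) x) ifourier_fourier.
Qed.

(** A smooth cutoff vanishing near 0 and outside a ball. Approximation by waves asks for functions
    that vanish near the origin, a null set that can be given up. *)
Definition annulus (m : nat) (x : V) : R :=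
  hexp 0 (m.+1%:R ^+ 2 * dot x x - 1) * hexp 0 (m.+1%:R - dot x x).

Lemma dot_ge (x : V) : `|x| ^+ 2 <= dot x x.
Proof.
have d0 : 0 <= dot x x by apply: sumr_ge0 => i _; rewrite -expr2 sqr_ge0.
rewrite -[leRHS]sqr_sqrtr// lerXn2r ?nnegrE ?sqrtr_ge0//.
apply: cV_norm_leP; first exact: sqrtr_ge0.
move=> i; rewrite -sqrtr_sqr ler_wsqrtr// /dot (bigD1 i)//= -expr2 lerDl.
by apply: sumr_ge0 => j _; rewrite -expr2 sqr_ge0.
Qed.

Lemma annulus_bound m x : 0 <= annulus m x <= 1.
Proof. by rewrite mulr_ge0 ?hexp_ge0//= mulr_ile1 ?hexp_ge0 ?hexp0_le1. Qed.

Lemma testfun_annulus m (f : V -> C) : csmooth f -> testfun (fun x => (annulus m x)%:C%C * f x).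
Proof.
move=> sf; split.
  apply: csmoothM => //; apply: csmooth_real => k; apply: CkM; apply: (Ck_comp (Cinf_hexp 0 k)).
    apply: CkB; last exact: Ck_cst.
    apply: CkM; first exact: Ck_cst.
    by apply: Ck_sum => i; apply: CkM; exact: Cinf_coord.
  apply: CkB; first exact: Ck_cst.
  by apply: Ck_sum => i; apply: CkM; exact: Cinf_coord.
exists m.+1%:R => x xm; suff h : m.+1%:R - dot x x <= 0 by rewrite /annulus [hexp 0 (m.+1%:R - _)]hexp_eq0// mulr0 mul0r.
have := dot_ge x; have : 1 <= m.+1%:R :> R by rewrite ler1n.
by move: xm; move: (m.+1%:R : R) `|x| (dot x x) => u v w; rewrite expr2; nra.
Qed.

Lemma annulus_near0 m : exists2 d, 0 < d & forall x, `|x| <= d -> annulus m x = 0.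
Proof.
have m0 : 0 < m.+1%:R :> R by [].
have N0 : 0 < n.+1%:R :> R by [].
exists (m.+1%:R * n.+1%:R)^-1; first by rewrite invr_gt0 mulr_gt0.
move=> x xd; rewrite /annulus hexp_eq0 ?mul0r//.
have dx : dot x x <= n.+1%:R * (`|x| * `|x|) by apply: le_trans (dot_le x x); exact: ler_norm.
have h : m.+1%:R * n.+1%:R * `|x| <= 1.
  by move: xd; rewrite -[_^-1]mul1r ler_pdivlMr ?mulr_gt0// mulrC.
have N1 : 1 <= n.+1%:R :> R by rewrite ler1n.
have x0 := normr_ge0 x; have h2 : 0 <= m.+1%:R * `|x| by rewrite mulr_ge0.
have h3 : m.+1%:R ^+ 2 * dot x x <= m.+1%:R ^+ 2 * (n.+1%:R * (`|x| * `|x|)).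
  by rewrite ler_wpM2l// sqr_ge0.
move: h h2 h3 N1; rewrite subr_le0 expr2; move: (m.+1%:R : R) (n.+1%:R : R) `|x| => a b c h h2 h3 N1.
apply: le_trans h3 _; have -> : a * a * (b * (c * c)) = (a * b * c) * (a * c) by ring.
have : a * c <= 1 by nra.
nra.
Qed.

Lemma annulus_cvg x : annulus m x @[m --> \oo] --> ((x != 0)%:R : R).
Proof.
have [->|x0] := eqVneq x 0.
  apply: cvg_near_cst; near=> m.
  by rewrite /annulus dot0l mulr0 hexp_eq0 ?mul0r// sub0r oppr_le0.
have d0 : 0 < dot x x by apply: lt_le_trans (dot_ge x); rewrite exprn_gt0// normr_gt0.
rewrite -[X in _ --> X](mulr1 1); apply: cvgM; apply: hexp0_cvg1; near=> m.
  have h : 2 / dot x x <= m.+1%:R.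
    near: m; exists (Num.truncn (2 / dot x x)) => // m /= mm.
    by rewrite ltW// (lt_le_trans (truncnS_gt _))// ler_nat ltnS.
  have : 1 <= m.+1%:R :> R by rewrite ler1n.
  move: h; rewrite ler_pdivrMr// expr2; move: (m.+1%:R : R) (dot x x) d0 => a b; nra.
have h : 2 * dot x x <= m.+1%:R.
  near: m; exists (Num.truncn (2 * dot x x)) => // m /= mm.
  by rewrite ltW// (lt_le_trans (truncnS_gt _))// ler_nat ltnS.
by lra.
Unshelve. all: by end_near.
Qed.

Lemma negligible_point : mu.-negligible [set 0 : V].
Proof.
exists (cbox 0 0); split; first exact: measurable_cbox.
  have := @lebesgue_cV_box R n.+1 0 0 (fun i => lexx _); rewrite /cbox => ->.
  by rewrite (bigD1 ord0)//= subrr mul0r.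
by move=> x -> i; rewrite lexx.
Qed.

Lemma annulus_approx (f : V -> C) (M : R) : cintegrable mu f -> (forall x, normc (f x) <= M) ->
  forall e : R, 0 < e -> exists m, (nsq (fun x => f x - (annulus m x)%:C%C * f x)%R <= e%:E)%E.
Proof.
move=> fi fM e e0; have mf := cintegrable_meas fi.
(* Every cutoff is 0 at the origin, so the pointwise limit is [f] with its value there erased, equal
   to [f] almost everywhere. *)
pose f0 x := (x != 0)%:R%:C%C * f x.
have mann m : cmeasurable (fun x => (annulus m x)%:C%C * f x).
  apply: cmeasurableM => //.
  have := (testfun_annulus m (csmooth_cst (1 : C))).1.
  by under eq_fun do rewrite mulr1; exact: csmooth_measurable.
have mf0 : cmeasurable f0.
  apply: cmeasurableM => //; apply: cmeasurable_real.
  rewrite (_ : (fun x => _) = \1_(~` cbox 0 0)).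
    by apply: measurable_indic; apply: measurableC; exact: measurable_cbox.
  apply/funext => x; rewrite indicE in_setC; congr (~~ _)%:R.
  apply/eqP/idP => [->|]; first by rewrite mem_set// => i; rewrite lexx.
  rewrite inE => H; apply/colP => i; have /andP[h1 h2] := H i.
  by apply/eqP; rewrite eq_le h1 h2.
have [m Hm] : exists m, (nsq (fun x => f0 x - (annulus m x)%:C%C * f x)%R <= e%:E)%E.
  apply: (@nsq_dominated_cvg _ _ (fun m x => (annulus m x)%:C%C * f x) f0 (fun x => normc (f x))) => //.
  - move=> x; apply: ccvgM; last exact: ccvg_cst.
    by apply: ccvg_real; exact: annulus_cvg.
  - move=> m x; have /andP[h0 h1] := annulus_bound m x.
    by rewrite normcM normc_real ger0_norm// ler_piMl ?normc_ge0.
  - move=> x; rewrite normcM normc_real normr_nat.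
    by case: (x != 0); rewrite ?mul1r ?mul0r ?normc_ge0.
  - exact: (nsq_bounded fi fM).1.
exists m; apply: le_trans Hm; rewrite le_eqVlt; apply/orP; left; apply/eqP.
apply: ge0_ae_eq_integral => //.
- by apply/measurable_EFinP; apply: measurable_normc_sqr; apply: cmeasurableD => //; exact: cmeasurableN.
- by apply/measurable_EFinP; apply: measurable_normc_sqr; apply: cmeasurableD => //; exact: cmeasurableN.
- by move=> x _; rewrite lee_fin sqr_ge0.
- by move=> x _; rewrite lee_fin sqr_ge0.
- have := negligible_point; apply: negligibleS => x /= H.
  apply: contrapT => x0; apply: H => _; rewrite /f0.
  by have /eqP -> : x <> 0 by []; rewrite rmorph1 mul1r.
Qed.

End plancherel.

(** * Density of combinations of waves in L^2 *)

Section density.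
Context {R : realType} {n : nat}.
Local Notation C := R[i].
Local Notation V := 'cV[R]_n.+1.
Local Notation mu := (@lebesgue_cV R n.+1).
Variables (I : Type) (e : I -> V -> C).
Hypothesis e_test : forall i, testfun (e i).
Hypothesis e_approx : forall F eps, testfun F ->
  (exists2 d, 0 < d & forall x, `|x| <= d -> F x = 0) -> 0 < eps ->
  exists2 f, combination e f & \int[mu]_x normc (F x - f x) ^+ 2 <= eps.

Lemma cmeasurable_combination (u : I -> V -> C) g : (forall i, cmeasurable (u i)) ->
  combination u g -> cmeasurable g.
Proof.
move=> mu_ [s gE]; rewrite (_ : g = fun x => \sum_(t <- s) t.2 * u t.1 x); last exact/funext.
by apply: cmeasurable_sum => t; apply: cmeasurableM => //; exact: cmeasurable_cst.
Qed.

(** Approximability, the property [P], is closed under L^2 limits, so test functions are decisive: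
    their transforms are cut off, approximated by waves and brought back by Plancherel. *)
Lemma fourier_side_density f : cmeasurable f -> (nsq f < +oo)%E ->
  forall eps : R, 0 < eps ->
  exists2 g, combination (fun i => ifourier (e i)) g & (nsq (fun x => f x - g x)%R <= eps%:E)%E.
Proof.
pose P f := cmeasurable f /\ forall eps : R, 0 < eps ->
  exists2 g, combination (fun i => ifourier (e i)) g & (nsq (fun x => f x - g x)%R <= eps%:E)%E.
have mcomb g : combination (fun i => ifourier (e i)) g -> cmeasurable g.
  apply: cmeasurable_combination => i.
  exact: (cintegrable_meas (cintegrable_ifourier (e_test i))).
(* Quarters rather than halves, because of the factor 2 in [nsqD]. *)
have two (a b : \bar R) (eps : R) : (a <= (eps / 4)%:E -> b <= (eps / 4)%:E ->
    2%:E * a + 2%:E * b <= eps%:E)%E.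
  move=> h1 h2; rewrite (_ : eps = 2 * (eps / 4) + 2 * (eps / 4)); last by field.
  by rewrite (EFinD (2 * (eps / 4))) (EFinM 2 (eps / 4)); apply: leeD; apply: lee_wpmul2l.
move=> mf nf; suff [] : P f by [].
move: f mf nf; apply: L2_induction.
- move=> f g [mf Hf] [mg Hg]; split; first exact: cmeasurableD.
  move=> eps e0; have e4 : 0 < eps / 4 by rewrite divr_gt0.
  have [f' cf' Hf'] := Hf _ e4; have [g' cg' Hg'] := Hg _ e4.
  exists (fun x => f' x + g' x); first exact: combinationD.
  rewrite (_ : (fun x => _) = fun x => (f x - f' x) + (g x - g' x)).
    apply: le_trans (nsqD _ _) _; last exact: two.
      by apply: cmeasurableD => //; apply: cmeasurableN; exact: mcomb.
    by apply: cmeasurableD => //; apply: cmeasurableN; exact: mcomb.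
  by apply/funext => x; rewrite opprD addrACA.
- move=> c f [mf Hf]; split; first by apply: cmeasurableM => //; exact: cmeasurable_cst.
  move=> eps e0; have d0 : 0 < normc c ^+ 2 + 1 by rewrite ltr_wpDl ?sqr_ge0.
  have [f' cf' Hf'] := Hf _ (divr_gt0 e0 d0).
  exists (fun x => c * f' x); first exact: combinationZ.
  rewrite (_ : (fun x => _) = fun x => c * (f x - f' x)).
    rewrite nsqZ; last by apply: cmeasurableD => //; apply: cmeasurableN; exact: mcomb.
    apply: (@le_trans _ _ ((normc c ^+ 2)%:E * (eps / (normc c ^+ 2 + 1))%:E)%E).
      by apply: lee_wpmul2l => //; rewrite lee_fin sqr_ge0.
    rewrite -EFinM lee_fin mulrA ler_pdivrMr//; have := sqr_ge0 (normc c).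
    by move: (normc c ^+ 2) => u; nra.
  by apply/funext => x; rewrite mulrBr.
- move=> f mf H; split=> // eps e0; have e4 : 0 < eps / 4 by rewrite divr_gt0.
  have [g [mg Hg] fg] := H _ e4; have [g' cg' Hg'] := Hg _ e4.
  exists g' => //; rewrite (_ : (fun x => _) = fun x => (f x - g x) + (g x - g' x)).
    apply: le_trans (nsqD _ _) _; last exact: two.
      by apply: cmeasurableD => //; exact: cmeasurableN.
    by apply: cmeasurableD => //; apply: cmeasurableN; exact: mcomb.
  by apply/funext => x; rewrite addrA subrK.
- move=> f tf; split; first exact: csmooth_measurable tf.1.
  move=> eps e0; have e4 : 0 < eps / 4 by rewrite divr_gt0.
  have [M _ HM] := fourier_bound (testfun_integrable tf).
  have [m Hm] := annulus_approx (cintegrable_fourier tf) HM e4.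
  have tF := testfun_annulus m (csmooth_fourier tf).
  have [d d0 Hd] := @annulus_near0 R n m.
  have [|G cG HG] := e_approx tF _ e4.
    by exists d => // x xd; rewrite (Hd _ xd) rmorph0 mul0r.
  have tG : testfun G.
    case: cG => s Hs; rewrite (_ : G = fun x => \sum_(t <- s) t.2 * e t.1 x); last exact/funext.
    by apply: testfun_sum => t; apply: testfunMl => //; exact: csmooth_cst.
  exists (ifourier G).
    case: cG => s Hs; exists s => x; rewrite /ifourier.
    rewrite (_ : G = fun x => \sum_(t <- s) t.2 * e t.1 x); last exact/funext.
    by rewrite fourier_sumZ// => i; exact: testfun_integrable.
  rewrite plancherel_sub//.
  rewrite (_ : (fun x => _) = fun x => (fourier f x - (annulus m x)%:C%C * fourier f x) +
    ((annulus m x)%:C%C * fourier f x - G x)); last by apply/funext => x; rewrite addrA subrK.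
  have mF := csmooth_measurable tF.1; have mG := csmooth_measurable tG.1.
  apply: le_trans (nsqD _ _) _.
    by apply: cmeasurableD; [exact: cmeasurable_fourier|exact: cmeasurableN].
    by apply: cmeasurableD => //; exact: cmeasurableN.
  apply: two => //; have tFG := testfunB tF tG; have [K K0 HK] := testfun_bounded tFG.
  have [i2 _] := nsq_bounded (testfun_integrable tFG) HK.
  by rewrite (nsqE (csmooth_measurable tFG.1) (fun x => lexx _) i2) lee_fin.
Qed.

End density.

Section L2_norm.
Context {R : realType} {n : nat}.
Local Notation C := R[i].
Local Notation V := 'cV[R]_n.
Implicit Types f : V -> C.

Lemma L2norm_sqr f : (L2norm f `^ 2)%E = nsq f.
Proof.
rewrite /L2norm poweR_Lnorm//; apply: eq_integral => x _.
by rewrite abse_EFin poweR_EFin ger0_norm ?normc_ge0// powR_mulrn ?normc_ge0.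
Qed.

Lemma L2norm_ge0 f : (0 <= L2norm f)%E. Proof. exact: Lnorm_ge0. Qed.

Lemma L2norm_lty f : (L2norm f < +oo)%E = (nsq f < +oo)%E.
Proof.
rewrite -L2norm_sqr; have := L2norm_ge0 f; case: (L2norm f) => [r| |]// r0.
  by rewrite poweR_EFin !ltry.
by rewrite poweRyr// ltxx.
Qed.

Lemma L2norm_lt f (eps : R) : 0 < eps -> (nsq f <= (eps ^+ 2 / 2)%:E)%E -> (L2norm f < eps%:E)%E.
Proof.
move=> e0; rewrite -L2norm_sqr; have := L2norm_ge0 f; case: (L2norm f) => [r| |]//; last first.
  by rewrite poweRyr// leye_eq.
rewrite poweR_EFin !lee_fin lte_fin => r0; rewrite powR_mulrn//; apply: contraTT; rewrite -!leNgt -ltNge => er.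
apply: (@lt_le_trans _ _ (eps ^+ 2)); last by rewrite lerXn2r ?nnegrE// ltW.
by rewrite ltr_pdivrMr// ltr_pMr ?exprn_gt0// ltr1n.
Qed.

End L2_norm.

Section representatives.
Context {R : realType} {n : nat}.
Local Notation V := 'cV[R]_n.

(** The quotient is a set of cosets known by its cardinality only; a bijection with [I_m] and choice
    give indexed representatives. *)
Lemma quotient_representatives (G H : set V) (m : nat) : H 0 ->
  (forall x y, H x -> H y -> H (x - y)) -> (quotient G H #= `I_m)%card ->
  exists g : 'I_m -> V, [/\ forall i, G (g i),
    forall x, G x -> exists i, H (x - g i) & forall i j, H (g i - g j) -> i = j].
Proof.
move=> H0 HB; rewrite card_eq_sym => /card_set_bijP[f [f1 f2 f3]].
have /choice[g Hg] (i : 'I_m) : exists g, G g /\ sumset [set g] H = f i.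
  by have [g Gg gE] := f1 i (ltn_ord i); exists g.
have HN x : H x -> H (- x) by move=> Hx; rewrite -sub0r; exact: HB.
have HD x y : H x -> H y -> H (x + y) by move=> Hx Hy; rewrite -[y]opprK; apply: HB => //; exact: HN.
exists g; split=> [i|x Gx|i j Hij]; first exact: (Hg i).1.
  have [i im iE] := f3 (sumset [set x] H) (ex_intro2 _ _ x Gx erefl).
  exists (Ordinal im); have : sumset [set x] H x by exists x => //; exists 0 => //; rewrite addr0.
  rewrite -iE -[f i]/(f (Ordinal im)) -(Hg _).2 => -[_ -> [h Hh <-]].
  by rewrite addrC addKr.
apply/val_inj/f2; rewrite ?inE ?ltn_ord//= -(Hg i).2 -(Hg j).2.
have D u v h : u + h = v + ((u - v) + h) :> V by rewrite addrA [v + _]addrC subrK.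
apply/seteqP; split=> [_ [_ -> [h Hh <-]]|_ [_ -> [h Hh <-]]].
  by exists (g j) => //; exists ((g i - g j) + h); [exact: HD|rewrite -D].
exists (g i) => //; exists ((g j - g i) + h); last by rewrite -D.
by apply: HD => //; rewrite -opprB; exact: HN.
Qed.

(** A singular matrix would have the eigenvalue 0, of modulus below 1. *)
Lemma expansive_unitmx (A : 'M[R]_n) : expansive A -> A \in unitmx.
Proof.
move=> eA; rewrite -(map_unitmx (real_complex R)) -row_free_unit -kermx_eq0.
apply: contraT => h; have := eA 0; rewrite normc0 ltr10 => /(_ _); apply.
by rewrite /eigenvalue /eigenspace raddf0 subr0.
Qed.

End representatives.

Section wavelets.
Context {R : realType} {n : nat}.
Local Notation C := R[i].
Local Notation V := 'cV[R]_n.+1.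
Lemma L2_ifourier (G : V -> C) : testfun G -> L2 (ifourier G).
Proof.
move=> tG; have iG := cintegrable_ifourier tG; have [m1 m2] := cintegrable_meas iG.
have [M _ HM] := fourier_bound (testfun_integrable tG); split=> //.
by rewrite L2norm_lty (nsq_bounded iG (fun x => HM (- x))).2 ltry.
Qed.

Lemma ifourier_schwartz (G : V -> C) : testfun G -> schwartz (ifourier G).
Proof.
move=> tG; have tG' : testfun (fun x => G ((- 1%:M) *m x)).
  by apply: testfun_mulmx => //; rewrite -scaleN1r unitmxZ ?unitrN1// unitmx1.
rewrite (_ : ifourier G = fourier (fun x => G ((- 1%:M) *m x))); first exact: fourier_schwartz.
apply/funext => x; rewrite /ifourier !fourierE -[LHS]cint_opp.
  by congr cint; apply/funext => y; rewrite mulNmx mul1mx dotNr dotNl opprK.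
by apply: cmeasurableM; [exact: csmooth_measurable tG.1|exact: cmeasurable_phase].
Qed.

Lemma testfun_compactly_supported (G : V -> C) : testfun G -> compactly_supported G.
Proof.
move=> [_ [r Gr]]; apply: (@subclosed_compact _ _ [set x : V | `|x| <= r]).
- exact: closed_closure.
- exact: cV_cball_compact.
- have /closure_id cE : closed [set x : V | `|x| <= r].
    by apply: compact_closed; [exact: norm_hausdorff|exact: cV_cball_compact].
  rewrite cE; apply: closureS => x /= Gx.
  by rewrite leNgt; apply/negP => /Gr xr; rewrite xr eqxx in Gx.
Qed.

(** Density in [orthonormal_basis] is stated with one coefficient per index. *)
Lemma combination_uniq (I : eqType) (e : I -> V -> C) f : combination e f ->
  exists (s : seq I) (c : I -> C), forall x, f x = \sum_(i <- s) c i * e i x.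
Proof.
move=> [s fs]; exists (undup [seq t.1 | t <- s]), (fun i => \sum_(t <- s | t.1 == i) t.2) => x.
under eq_bigr do rewrite mulr_suml; rewrite fs (exchange_big_dep predT)//=.
apply: eq_big_seq => t ts; rewrite -big_filter (_ : [seq _ <- _ | _] = [:: t.1]) ?big_seq1//.
rewrite (eq_filter (a2 := pred1 t.1)); last by move=> i /=; rewrite eq_sym.
by rewrite filter_pred1_uniq ?undup_uniq// mem_undup map_f.
Qed.

End wavelets.

Theorem theorem6p5 (R : realType) (n : nat) (A0 : 'M[rat]_n.+1) (p q : nat) :
  let A : 'M[R]_n.+1 := map_mx ratr A0 in
  let Zn : set 'cV[R]_n.+1 := int_lattice in
  let Gamma := sumset (mx_image A Zn) Zn in
  strictly_expansive A Gamma ->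
  (quotient Gamma (mx_image A Zn) #= `I_p)%card ->
  (quotient Gamma Zn #= `I_q)%card ->
  (n.+1 <= 2 * (p - q))%N ->
  exists psi : 'I_(p - q) -> 'cV[R]_n.+1 -> R[i],
    orthonormal_wavelet A psi /\
    forall l, [/\ schwartz (psi l), smooth (fourier (psi l))
                & compactly_supported (fourier (psi l))].
Proof.
move=> A Zn G [eA [K [cK tileK KB]]] qp qq nr.
have uA := expansive_unitmx eA; have uB : A^T \in unitmx by rewrite unitmx_tr.
have Z0 : Zn 0 by move=> i; rewrite mxE.
have ZB x y : Zn x -> Zn y -> Zn (x - y) by move=> Zx Zy i; rewrite !mxE rpredB.
have AZ0 : mx_image A Zn 0 by exists 0 => //; rewrite mulmx0.
have AZB x y : mx_image A Zn x -> mx_image A Zn y -> mx_image A Zn (x - y).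
  by move=> [u Zu <-] [v Zv <-]; exists (u - v); [exact: ZB|rewrite mulmxBr].
have GB x y : G x -> G y -> G (x - y).
  move=> [u Au [v Zv <-]] [u' Au' [v' Zv' <-]]; exists (u - u'); first exact: AZB.
  by exists (v - v'); [exact: ZB|rewrite opprD addrACA].
have ZG : Zn `<=` G by move=> x Zx; exists 0 => //; exists x => //; rewrite add0r.
have ZG1 : Zn `<=` [set x | G ((A^T)^T *m x)].
  by move=> x Zx /=; rewrite trmxK; exists (A *m x); [exists x|exists 0 => //; rewrite addr0].
have [g [Gg g_surj g_inj]] := quotient_representatives Z0 ZB qq.
have [b [Gb b_surj b_inj]] := quotient_representatives AZ0 AZB qp.
(* A^-1 carries representatives of Gamma modulo A Z^n to representatives of A^-1 Gamma modulo
   Z^n. *)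
pose a i := invmx A *m b i.
have Aa i : A *m a i = b i by rewrite mulmxA mulmxV// mul1mx.
have Ga i : [set x | G ((A^T)^T *m x)] (a i) by rewrite /= trmxK Aa.
have a_surj x : [set x | G ((A^T)^T *m x)] x -> exists i, Zn (x - a i).
  rewrite /= trmxK => /b_surj[i [z Zz zE]]; exists i.
  suff -> : x - a i = z by [].
  by rewrite -[LHS]mul1mx -(mulVmx uA) -mulmxA mulmxBr Aa -zE mulmxA mulVmx// mul1mx.
have a_inj i j : Zn (a i - a j) -> i = j.
  by move=> Zij; apply: b_inj; exists (a i - a j) => //; rewrite mulmxBr !Aa.
have D0 : dual_lattice G 0 by move=> x _; rewrite dot0l.
have DB x y : dual_lattice G x -> dual_lattice G y -> dual_lattice G (x - y).
  by move=> Dx Dy z Gz; rewrite dotBl rpredB ?Dx ?Dy.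
have DZ : dual_lattice G `<=` Zn by move=> x; exact: dual_int.
have [th [th_smooth th_bsupp th_sum th_step th_one]] := tile_partition D0 DB DZ uB cK tileK KB.
have contraction := tile_contraction DZ uB cK tileK KB.
(* The dimension is positive, so [nr] forces p > q and the truncated subtraction is a genuine
   one. *)
have qrp : (q + (p - q))%N = p by rewrite subnKC// ltnW// -subn_gt0; move: nr; case: (p - q)%N.
have [Gl [Gl_test Gl_kernel Gl_gram Gl_perp Gl_factor]] := generators_exist uB GB ZG ZG1
  Ga a_surj a_inj Gg g_surj g_inj th_smooth th_bsupp th_sum th_step qrp nr.
exists (fun l => ifourier (Gl l)); split; last first.
  move=> l; rewrite fourier_ifourier//; split; first exact: ifourier_schwartz.
    exact: csmooth_smooth (Gl_test l).1.
  exact: testfun_compactly_supported.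
split=> [l|]; first exact: L2_ifourier.
pose e (i : int * 'cV[int]_n.+1 * 'I_(p - q)) := wave (A ^ i.1.1)^T (Gl i.2) i.1.2.
have uAj j : A ^ j \in unitmx by exact: unitrXz.
have e_test i : testfun (e i) by apply: testfun_wave => //; rewrite unitmx_tr.
rewrite (_ : (fun jkl => _) = fun i => ifourier (e i)); last first.
  by apply/funext => -[[j k] l]; rewrite -[map_mx _ _]/(zvec k) dilate_translate_ifourier.
split=> [i|[[j k] l] [[j' k'] l']|f [m1 m2 Lf] eps e0]; first exact: L2_ifourier.
  rewrite parseval// (wave_orthonormal uB ZG1 th_smooth th_bsupp th_sum th_step Gl_test
    Gl_kernel Gl_gram Gl_perp Gl_factor j j' k k' l l' erefl).
  by rewrite !xpair_eqE.
have e2 : 0 < eps ^+ 2 / 2 by rewrite divr_gt0// exprn_gt0.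
have approx := wave_combination_approx uA ZG ZG1 th_bsupp th_sum th_one contraction Gl_test Gl_kernel.
rewrite L2norm_lty in Lf.
have [h /combination_uniq[s [c hE]] fh] := fourier_side_density e_test approx (conj m1 m2) Lf e2.
exists s, c; apply: L2norm_lt => //.
by under [X in nsq X]eq_fun do rewrite -hE.
Qed.
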